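(* Let $T\in\mathcal{KC}(X)$ and assume that the operators $T_\ell$, $\ell=0,1,2,3$, have real spectrum, where one of the $T_\ell$ is the zero operator. Let $\rho_S(T)\cap\mathbb{R}\neq\emptyset$, suppose that $\alpha\in\rho_S(T)\cap\mathbb{R}$ and set $A:=(T-\alpha\mathcal{I})^{-1}$. (Linearity) If $f,g\in\mathcal{SH}_L(\overline\sigma_S(T))$ and $a\in\mathbb{H}$, then $$(\tilde f a+\tilde g)(T)=\tilde f(T)a+\tilde g(T).$$ Similarly, if $f,g\in\mathcal{SH}_R(\overline\sigma_S(T))$ and $a\in\mathbb{H}$, then $$(a\tilde f+\tilde g)(T)=a\tilde f(T)+\tilde g(T).$$ (Product rule) If $f\in\mathcal{N}(\overline\sigma_S(T))$ and $g\in\mathcal{SH}_L(\overline\sigma_S(T))$, or $f\in\mathcal{SH}_R(\overline\sigma_S(T))$ and $g\in\mathcal{N}(\overline\sigma_S(T))$, then $$\mathcal{D}(fg)(T)=f(T)(\mathcal{D}g)(T)+(\mathcal{D}f)(T)g(T)+(A\bar A)^{-1}(\mathcal{D}f)(T)\,\underline{A}\,(\mathcal{D}g)(T),$$ where $\underline{A}:=A_1e_1+A_2e_2+A_3e_3$.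
   Context: $\mathbb{H}$ denotes the quaternions $q=q_0+q_1e_1+q_2e_2+q_3e_3$ with the usual relations ($e_i^2=-1$, $e_1e_2=-e_2e_1=e_3$, cyclically); $\mathbb{S}$ is the sphere of purely imaginary unit quaternions; for $J\in\mathbb{S}$, $\mathbb{C}_J=\{u+Jv:u,v\in\mathbb{R}\}$ and $ds_J=ds(-J)$. A set $U\subset\mathbb{H}$ is axially symmetric if $u+Iv\in U$ implies $u+Jv\in U$ for all $J\in\mathbb{S}$. A slice Cauchy domain is an axially symmetric open set $U$ such that, for every $J\in\mathbb{S}$, $U\cap\mathbb{C}_J$ is a Cauchy domain in $\mathbb{C}_J$, i.e. its boundary is a finite union of non-intersecting piecewise $C^1$ Jordan curves. Functions. A function $f$ on an axially symmetric open set is left (resp. right) slice hyperholomorphic if $f(u+Jv)=\alpha(u,v)+J\beta(u,v)$ (resp. $\alpha(u,v)+\beta(u,v)J$) with $\mathbb{H}$-valued $\alpha,\beta$ satisfying $\alpha(u,-v)=\alpha(u,v)$, $\beta(u,-v)=-\beta(u,v)$ and $\partial_u\alpha-\partial_v\beta=0$, $\partial_v\alpha+\partial_u\beta=0$; it is intrinsic if $\alpha,\beta$ are real-valued. $\mathcal{D}=\partial_{q_0}+\sum_{i=1}^3e_i\partial_{q_i}$ is the Cauchy–Fueter operator, and $f\mathcal{D}=\partial_{q_0}f+\sum_i(\partial_{q_i}f)e_i$. Operators. $X=X_{\mathbb{R}}\otimes\mathbb{H}$ is a two-sided quaternionic Banach module, $\mathcal{B}(X)$ the bounded right linear operators, $\mathcal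 I$ the identity, $(aB)v=a(Bv)$, $(Ba)v=B(av)$ for $a\in\mathbb{H}$. $\mathcal{KC}(X)$ is the set of closed right linear operators $T=T_0+e_1T_1+e_2T_2+e_3T_3$, $\mathrm{dom}(T)=\bigcap_\ell\mathrm{dom}(T_\ell)$, where $T_0,\dots,T_3$ are closed linear operators with $T_\ell T_k=T_kT_\ell$ on $\mathrm{dom}(T_\ell T_k)\cap\mathrm{dom}(T_kT_\ell)$; the $T_\ell$ contain no imaginary units (they commute with multiplication by $e_1,e_2,e_3$). The conjugate is $\bar T=T_0-e_1T_1-e_2T_2-e_3T_3$. Similarly the bounded operator $A=A_0+e_1A_1+e_2A_2+e_3A_3$ has commuting components and conjugate $\bar A=A_0-e_1A_1-e_2A_2-e_3A_3$. $\mathcal{Q}_{c,s}(T)=s^2\mathcal{I}-2sT_0+T\bar T$ on $\mathrm{dom}(T\bar T)$; $\rho_S(T)=\{s\in\mathbb{H}:\mathcal{Q}_{c,s}(T)^{-1}\in\mathcal{B}(X)\}$, $\sigma_S(T)=\mathbb{H}\setminus\rho_S(T)$, $\overline\sigma_S(T)=\sigma_S(T)\cup\{\infty\}$. The same definitions are used for bounded $A$. $\mathcal{SH}_L(\overline\sigma_S(T))$ (resp. $\mathcal{SH}_R(\overline\sigma_S(T))$, $\mathcal{N}(\overline\sigma_S(T))$) is the set of left (resp. right, intrinsic) slice hyperholomorphic $f$ with $\sigma_S(T)\subset\mathrm{dom}(f)$, $\mathbb{H}\setminus B_r(0)\subset\mathrm{dom}(f)$ for some $r>0$, and such that $f(\infty)=\lim_{q\to\infty}f(q)$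 exists. $\mathcal{SH}_L(\sigma_S(A))$, $\mathcal{SH}_R(\sigma_S(A))$ are the left, right slice hyperholomorphic functions with $\sigma_S(A)\subset\mathrm{dom}$. Bounded calculi. Let $A$ be bounded with commuting components, $V$ any bounded slice Cauchy domain with $\sigma_S(A)\subset V$, $\overline V\subset\mathrm{dom}(\phi)$, and $J\in\mathbb{S}$ arbitrary. For $\phi\in\mathcal{SH}_L(\sigma_S(A))$: $\phi(A)=\frac1{2\pi}\int_{\partial(V\cap\mathbb{C}_J)}S_L^{-1}(p,A)\,dp_J\,\phi(p)$ with $S_L^{-1}(p,A)=(p\mathcal{I}-\bar A)\mathcal{Q}_{c,p}(A)^{-1}$ ($S$-functional calculus), and the operator associated with $\tilde\psi=\mathcal{D}\phi$ is $\tilde\psi(A)=(\mathcal{D}\phi)(A)=-\frac1\pi\int_{\partial(V\cap\mathbb{C}_J)}\mathcal{Q}_{c,p}(A)^{-1}dp_J\,\phi(p)$ (harmonic functional calculus). For $\phi\in\mathcal{SH}_R(\sigma_S(A))$: $\phi(A)=\frac1{2\pi}\int_{\partial(V\cap\mathbb{C}_J)}\phi(p)\,dp_J\,S_R^{-1}(p,A)$ with $S_R^{-1}(p,A)=\mathcal{Q}_{c,p}(A)^{-1}(p\mathcal{I}-\bar A)$, and for $\tilde\psi=\phi\mathcal{D}$, $\tilde\psi(A)=-\frac1\pi\int_{\partial(V\cap\mathbb{C}_J)}\phi(p)\,dp_J\,\mathcal{Q}_{c,p}(A)^{-1}$. Unbounded calculi. For $\alpha\in\rho_S(T)\cap\mathbb{R}$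 let $\phi_\alpha(s)=(s-\alpha)^{-1}$, $\phi_\alpha(\alpha)=\infty$, $\phi_\alpha(\infty)=0$, $A=(T-\alpha\mathcal{I})^{-1}$. For $f$ in $\mathcal{SH}_L(\overline\sigma_S(T))$ or $\mathcal{SH}_R(\overline\sigma_S(T))$ put $\phi=f\circ\phi_\alpha^{-1}$. Then $f(T):=\phi(A)$ ($S$-functional calculus). The harmonic functional calculus is $\tilde f(T):=(A\bar A)\tilde\psi(A)$, where in the left case $\tilde f=\mathcal{D}f$, $\tilde\psi=\mathcal{D}\phi$, and in the right case $\tilde f=f\mathcal{D}$, $\tilde\psi=\phi\mathcal{D}$. One writes $(\mathcal{D}f)(T)$ for $\tilde f(T)$ and $\mathcal{D}(fg)(T)$ for the operator associated in this way with the product $fg$; when the product lies in $\mathcal{SH}_R(\overline\sigma_S(T))$ (second case of the product rule), the right version of the calculus is used for the right slice hyperholomorphic functions. $(\tilde fa+\tilde g)(T)$ denotes the operator associated with $fa+g$, and $(a\tilde f+\tilde g)(T)$ the one associated with $af+g$. *)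

(* Defs.v *)
(* Stdlib reals with Coquelicot. *)
From Stdlib Require Import Reals List ClassicalEpsilon.
From Coquelicot Require Import Coquelicot.
Open Scope R_scope.

(** * The quaternionic module [E (x) H] over a real normed space [E] *)

(* The element v0 + v1 e1 + v2 e2 + v3 e3 is the nested tuple of its
   components; the product norm is sqrt (|v0|^2 + |v1|^2 + |v2|^2 + |v3|^2). *)
Definition hmod (E : NormedModule R_AbsRing) : NormedModule R_AbsRing :=
  prod_NormedModule R_AbsRing E
    (prod_NormedModule R_AbsRing E (prod_NormedModule R_AbsRing E E)).

Definition mkh {E : NormedModule R_AbsRing} (x0 x1 x2 x3 : E) : hmod E :=
  (x0, (x1, (x2, x3))).

Inductive idx : Set := I0 | I1 | I2 | I3.

Definition coord {E : NormedModule R_AbsRing} (l : idx) (v : hmod E) : E :=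
  match l with
  | I0 => fst v
  | I1 => fst (snd v)
  | I2 => fst (snd (snd v))
  | I3 => snd (snd (snd v))
  end.

Definition quat : NormedModule R_AbsRing := hmod R_NormedModule.

Definition qc (l : idx) (a : quat) : R := coord l a.

Definition ofR (x : R) : quat := mkh (E := R_NormedModule) x 0 0 0.

Definition unit_of (l : idx) : quat :=
  match l with
  | I0 => mkh (E := R_NormedModule) 1 0 0 0
  | I1 => mkh (E := R_NormedModule) 0 1 0 0
  | I2 => mkh (E := R_NormedModule) 0 0 1 0
  | I3 => mkh (E := R_NormedModule) 0 0 0 1
  end.

Definition is_real (a : quat) : Prop := a = ofR (qc I0 a).

Definition lin4 {E : NormedModule R_AbsRing} (a b c d : R) (x y z w : E) : E :=
  plus (plus (scal a x) (scal b y)) (plus (scal c z) (scal d w)).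

(* a v *)
Definition lmul {E : NormedModule R_AbsRing} (a : quat) (v : hmod E) : hmod E :=
  let a0 := qc I0 a in let a1 := qc I1 a in
  let a2 := qc I2 a in let a3 := qc I3 a in
  let v0 := coord I0 v in let v1 := coord I1 v in
  let v2 := coord I2 v in let v3 := coord I3 v in
  mkh (lin4 a0 (- a1) (- a2) (- a3) v0 v1 v2 v3)
      (lin4 a1 a0 (- a3) a2 v0 v1 v2 v3)
      (lin4 a2 a3 a0 (- a1) v0 v1 v2 v3)
      (lin4 a3 (- a2) a1 a0 v0 v1 v2 v3).

(* v a *)
Definition rmul {E : NormedModule R_AbsRing} (v : hmod E) (a : quat) : hmod E :=
  let a0 := qc I0 a in let a1 := qc I1 a in
  let a2 := qc I2 a in let a3 := qc I3 a in
  let v0 := coord I0 v in let v1 := coord I1 v in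
  let v2 := coord I2 v in let v3 := coord I3 v in
  mkh (lin4 a0 (- a1) (- a2) (- a3) v0 v1 v2 v3)
      (lin4 a1 a0 a3 (- a2) v0 v1 v2 v3)
      (lin4 a2 (- a3) a0 a1 v0 v1 v2 v3)
      (lin4 a3 a2 (- a1) a0 v0 v1 v2 v3).

Definition qmul (a b : quat) : quat := lmul (E := R_NormedModule) a b.

Definition qconj (a : quat) : quat :=
  mkh (E := R_NormedModule) (qc I0 a) (- qc I1 a) (- qc I2 a) (- qc I3 a).

Definition qinv (a : quat) : quat := scal (/ (norm a) ^ 2) (qconj a).

Definition imag_unit (J : quat) : Prop :=
  qc I0 J = 0 /\ (qc I1 J) ^ 2 + (qc I2 J) ^ 2 + (qc I3 J) ^ 2 = 1.

(* u + J v *)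
Definition slice_pt (J : quat) (u v : R) : quat := plus (ofR u) (scal v J).

(** * Partially defined operators *)

(* [act P] is only meaningful on [dom P]. *)
Record pop (E : Type) : Type := mkpop { dom : E -> Prop; act : E -> E }.
Arguments mkpop {E}. Arguments dom {E}. Arguments act {E}.

Definition peq {E : Type} (P Q : pop E) : Prop :=
  (forall v, dom P v <-> dom Q v) /\ (forall v, dom P v -> act P v = act Q v).

Definition tot {E : Type} (B : E -> E) : pop E := mkpop (fun _ => True) B.

Definition pcomp {E : Type} (P Q : pop E) : pop E :=
  mkpop (fun v => dom Q v /\ dom P (act Q v)) (fun v => act P (act Q v)).

Definition padd {E : NormedModule R_AbsRing} (P Q : pop E) : pop E :=
  mkpop (fun v => dom P v /\ dom Q v) (fun v => plus (act P v) (act Q v)).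

Definition popp {E : NormedModule R_AbsRing} (P : pop E) : pop E :=
  mkpop (dom P) (fun v => opp (act P v)).

(* The inverse is defined at the points having exactly one preimage, so it is
   everywhere defined iff P is a bijection of dom P onto the whole space. *)
Definition pinv {E : NormedModule R_AbsRing} (P : pop E) : pop E :=
  mkpop (fun w => exists! v, dom P v /\ act P v = w)
        (fun w => epsilon (inhabits zero) (fun v => dom P v /\ act P v = w)).

Definition closed_op {E : NormedModule R_AbsRing} (P : pop E) : Prop :=
  closed (fun z : E * E => dom P (fst z) /\ act P (fst z) = snd z).

Definition linear_op {E : NormedModule R_AbsRing} (P : pop E) : Prop :=
  dom P zero /\
  (forall v w, dom P v -> dom P w ->
     dom P (plus v w) /\ act P (plus v w) = plus (act P v) (act P w)) /\
  (forall (c : R) v, dom P v ->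
     dom P (scal c v) /\ act P (scal c v) = scal c (act P v)).

Definition zero_op {E : NormedModule R_AbsRing} (P : pop E) : Prop :=
  forall v, dom P v /\ act P v = zero.

Definition right_linear {E : NormedModule R_AbsRing} (P : pop (hmod E)) : Prop :=
  dom P zero /\
  (forall v w, dom P v -> dom P w ->
     dom P (plus v w) /\ act P (plus v w) = plus (act P v) (act P w)) /\
  (forall (a : quat) v, dom P v ->
     dom P (rmul v a) /\ act P (rmul v a) = rmul (act P v) a).

(* P belongs to B(X). *)
Definition in_B {E : NormedModule R_AbsRing} (P : pop (hmod E)) : Prop :=
  (forall v, dom P v) /\ right_linear P /\
  exists M : R, forall v, norm (act P v) <= M * norm v.

(* The extension of an operator of E to E (x) H commuting with e1, e2, e3. *)
Definition lift {E : NormedModule R_AbsRing} (P : pop E) : pop (hmod E) :=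
  mkpop (fun v => forall l, dom P (coord l v))
        (fun v => mkh (act P (coord I0 v)) (act P (coord I1 v))
                      (act P (coord I2 v)) (act P (coord I3 v))).

(* T_0 + e1 T_1 + e2 T_2 + e3 T_3 *)
Definition quatop {E : NormedModule R_AbsRing} (T : idx -> pop E) : pop (hmod E) :=
  mkpop (fun v => forall l, dom (lift (T l)) v)
        (fun v => plus (plus (act (lift (T I0)) v)
                             (lmul (unit_of I1) (act (lift (T I1)) v)))
                       (plus (lmul (unit_of I2) (act (lift (T I2)) v))
                             (lmul (unit_of I3) (act (lift (T I3)) v)))).

Definition conj_comp {E : NormedModule R_AbsRing} (T : idx -> pop E) : idx -> pop E :=
  fun l => match l with I0 => T I0 | _ => popp (T l) end.

Definition KC {E : NormedModule R_AbsRing} (T : idx -> pop E) : Prop :=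
  (forall l, linear_op (T l) /\ closed_op (T l)) /\
  (forall l k v, dom (pcomp (T l) (T k)) v -> dom (pcomp (T k) (T l)) v ->
     act (T l) (act (T k) v) = act (T k) (act (T l) v)) /\
  right_linear (quatop T) /\ closed_op (quatop T).

(* s^2 I - 2 s T_0 + T Tbar on dom (T Tbar) *)
Definition Qc {E : NormedModule R_AbsRing} (T : idx -> pop E) (s : quat) : pop (hmod E) :=
  let TTbar := pcomp (quatop T) (quatop (conj_comp T)) in
  mkpop (dom TTbar)
        (fun v => plus (minus (lmul (qmul s s) v)
                              (scal 2 (lmul s (act (lift (T I0)) v))))
                       (act TTbar v)).

Definition rhoS {E : NormedModule R_AbsRing} (T : idx -> pop E) (s : quat) : Prop :=
  in_B (pinv (Qc T s)).

Definition sigmaS {E : NormedModule R_AbsRing} (T : idx -> pop E) (s : quat) : Prop :=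
  ~ rhoS T s.

(* Left multiplication by lambda in C_J makes E (x) H a complex space on which
   the lift of P is C_J-linear; its spectrum there is independent of J, and all
   J are treated at once by letting lambda range over the quaternions. *)
Definition spectrum {E : NormedModule R_AbsRing} (P : pop E) (lam : quat) : Prop :=
  ~ in_B (pinv (padd (tot (lmul lam)) (popp (lift P)))).

Definition real_spectrum {E : NormedModule R_AbsRing} (P : pop E) : Prop :=
  forall lam, spectrum P lam -> is_real lam.

(* (T - alpha I)^{-1} *)
Definition resolvent {E : NormedModule R_AbsRing} (T : idx -> pop E) (alpha : R)
    : pop (hmod E) :=
  pinv (padd (quatop T) (tot (fun v => opp (scal alpha v)))).

(** ** Components of an everywhere defined right linear operator *)

(* A (x + 0 e1 + 0 e2 + 0 e3) = A_0 x + e1 A_1 x + e2 A_2 x + e3 A_3 x. *)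
Definition comp {E : NormedModule R_AbsRing} (A : hmod E -> hmod E) (l : idx) : pop E :=
  tot (fun x => coord l (A (mkh x zero zero zero))).

Definition commuting_components {E : NormedModule R_AbsRing} (A : hmod E -> hmod E) : Prop :=
  forall l k x, act (comp A l) (act (comp A k) x) = act (comp A k) (act (comp A l) x).

Definition bar {E : NormedModule R_AbsRing} (A : hmod E -> hmod E) : hmod E -> hmod E :=
  act (quatop (conj_comp (comp A))).

(* A_1 e1 + A_2 e2 + A_3 e3 *)
Definition underl {E : NormedModule R_AbsRing} (A : hmod E -> hmod E) (v : hmod E) : hmod E :=
  plus (act (lift (comp A I1)) (lmul (unit_of I1) v))
       (plus (act (lift (comp A I2)) (lmul (unit_of I2) v))
             (act (lift (comp A I3)) (lmul (unit_of I3) v))).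

Definition Qcinv {E : NormedModule R_AbsRing} (A : hmod E -> hmod E) (p : quat)
    : hmod E -> hmod E :=
  act (pinv (Qc (comp A) p)).

Definition SLinv {E : NormedModule R_AbsRing} (p : quat) (A : hmod E -> hmod E)
    (v : hmod E) : hmod E :=
  minus (lmul p (Qcinv A p v)) (bar A (Qcinv A p v)).

Definition SRinv {E : NormedModule R_AbsRing} (p : quat) (A : hmod E -> hmod E)
    (v : hmod E) : hmod E :=
  Qcinv A p (minus (lmul p v) (bar A v)).

(** * Slice hyperholomorphic functions *)

Definition axially_symmetric (U : quat -> Prop) : Prop :=
  forall u v I J, imag_unit I -> imag_unit J ->
    U (slice_pt I u v) -> U (slice_pt J u v).

(* A quaternion-valued function with its domain. *)
Record hfun : Type := mkhfun { hdom : quat -> Prop; hval : quat -> quat }.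

(* (alpha, beta) is a C^1 solution, on {(u, v) | u + J v in U}, of the even-odd
   conditions and of the Cauchy-Riemann equations. *)
Definition stem (U : quat -> Prop) (alpha beta : R -> R -> quat) : Prop :=
  exists au av bu bv : R -> R -> quat,
  forall (u v : R) (J : quat), imag_unit J -> U (slice_pt J u v) ->
    alpha u (- v) = alpha u v /\ beta u (- v) = opp (beta u v) /\
    is_derive (fun x => alpha x v) u (au u v) /\
    is_derive (fun y => alpha u y) v (av u v) /\
    is_derive (fun x => beta x v) u (bu u v) /\
    is_derive (fun y => beta u y) v (bv u v) /\
    continuous (fun z : R * R => au (fst z) (snd z)) (u, v) /\
    continuous (fun z : R * R => av (fst z) (snd z)) (u, v) /\
    continuous (fun z : R * R => bu (fst z) (snd z)) (u, v) /\
    continuous (fun z : R * R => bv (fst z) (snd z)) (u, v) /\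
    minus (au u v) (bv u v) = zero /\
    plus (av u v) (bu u v) = zero.

Definition slice_dom (U : quat -> Prop) : Prop := open U /\ axially_symmetric U.

Definition left_sh (f : hfun) : Prop :=
  slice_dom (hdom f) /\
  exists alpha beta, stem (hdom f) alpha beta /\
    forall u v J, imag_unit J -> hdom f (slice_pt J u v) ->
      hval f (slice_pt J u v) = plus (alpha u v) (qmul J (beta u v)).

Definition right_sh (f : hfun) : Prop :=
  slice_dom (hdom f) /\
  exists alpha beta, stem (hdom f) alpha beta /\
    forall u v J, imag_unit J -> hdom f (slice_pt J u v) ->
      hval f (slice_pt J u v) = plus (alpha u v) (qmul (beta u v) J).

Definition intrinsic_sh (f : hfun) : Prop :=
  slice_dom (hdom f) /\
  exists alpha beta, stem (hdom f) alpha beta /\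
    forall u v J, imag_unit J -> hdom f (slice_pt J u v) ->
      is_real (alpha u v) /\ is_real (beta u v) /\
      hval f (slice_pt J u v) = plus (alpha u v) (qmul J (beta u v)).

Definition lim_infty (f : hfun) (l : quat) : Prop :=
  forall eps : posreal, exists M : R, forall q,
    M < norm q -> hdom f q /\ norm (minus (hval f q) l) < eps.

Definition dom_ext {E : NormedModule R_AbsRing} (T : idx -> pop E) (f : hfun) : Prop :=
  (forall s, sigmaS T s -> hdom f s) /\
  (exists r : R, 0 < r /\ forall q, r <= norm q -> hdom f q) /\
  (exists l, lim_infty f l).

(* SH_L, SH_R and N of the extended S-spectrum of T *)
Definition SHL {E : NormedModule R_AbsRing} (T : idx -> pop E) (f : hfun) : Prop :=
  left_sh f /\ dom_ext T f.
Definition SHR {E : NormedModule R_AbsRing} (T : idx -> pop E) (f : hfun) : Prop :=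
  right_sh f /\ dom_ext T f.
Definition SHN {E : NormedModule R_AbsRing} (T : idx -> pop E) (f : hfun) : Prop :=
  intrinsic_sh f /\ dom_ext T f.

Definition fadd (f g : hfun) : hfun :=
  mkhfun (fun q => hdom f q /\ hdom g q) (fun q => plus (hval f q) (hval g q)).
Definition fmul (f g : hfun) : hfun :=
  mkhfun (fun q => hdom f q /\ hdom g q) (fun q => qmul (hval f q) (hval g q)).
Definition frscal (f : hfun) (a : quat) : hfun :=
  mkhfun (hdom f) (fun q => qmul (hval f q) a).
Definition flscal (a : quat) (f : hfun) : hfun :=
  mkhfun (hdom f) (fun q => qmul a (hval f q)).

Definition val_infty (f : hfun) : quat :=
  epsilon (inhabits zero) (lim_infty f).

(* f o phi_alpha^{-1}, where phi_alpha^{-1} p = p^{-1} + alpha for p <> 0 and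
   phi_alpha^{-1} 0 = oo. *)
Definition transform (alpha : R) (f : hfun) : hfun :=
  mkhfun (fun p => p = zero \/ hdom f (plus (qinv p) (ofR alpha)))
         (fun p => if excluded_middle_informative (p = zero) then val_infty f
                   else hval f (plus (qinv p) (ofR alpha))).

(** * Slice Cauchy domains and contour integrals *)

Definition cl {E : UniformSpace} (D : E -> Prop) (z : E) : Prop :=
  forall eps : posreal, exists y, ball z eps y /\ D y.

Definition bdry {E : UniformSpace} (D : E -> Prop) (z : E) : Prop :=
  cl D z /\ cl (fun y => ~ D y) z.

(* The plane C_J is identified with R * R by u + J v <-> (u, v). *)
Definition trace (U : quat -> Prop) (J : quat) (z : R * R) : Prop :=
  U (slice_pt J (fst z) (snd z)).

Definition C1 (h : R -> R * R) : Prop :=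
  exists h' : R -> R * R, forall t, is_derive h t (h' t) /\ continuous h' t.

Definition piecewise_C1 (g : R -> R * R) : Prop :=
  exists (n : nat) (t : nat -> R), t O = 0 /\ t n = 1 /\
    forall i, (i < n)%nat -> t i < t (S i) /\
      exists h, C1 h /\ forall x, t i <= x <= t (S i) -> g x = h x.

(* Curves are parametrized by [0, 1]. *)
Definition jordan_curve (g : R -> R * R) : Prop :=
  piecewise_C1 g /\ g 0 = g 1 /\
  forall s t, 0 <= s < 1 -> 0 <= t < 1 -> g s = g t -> s = t.

Definition cauchy_boundary (G : list (R -> R * R)) (D : R * R -> Prop) : Prop :=
  List.Forall jordan_curve G /\
  ForallOrdPairs (fun g h => forall s t, 0 <= s <= 1 -> 0 <= t <= 1 -> g s <> h t) G /\
  forall z, bdry D z <-> exists g t, In g G /\ 0 <= t <= 1 /\ g t = z.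

Definition slice_cauchy_domain (U : quat -> Prop) : Prop :=
  slice_dom U /\
  forall J, imag_unit J -> exists G, cauchy_boundary G (trace U J).

Definition dx (g : R -> R * R) (t : R) : R := Derive (fun x => fst (g x)) t.
Definition dy (g : R -> R * R) (t : R) : R := Derive (fun x => snd (g x)) t.

(* (1 / (2 pi i)) times the integral of dz / (z - w) along the closed curve g. *)
Definition winding (g : R -> R * R) (w : R * R) : R :=
  / (2 * PI) *
  RInt (fun t => ((fst (g t) - fst w) * dy g t - (snd (g t) - snd w) * dx g t) /
                 ((fst (g t) - fst w) ^ 2 + (snd (g t) - snd w) ^ 2)) 0 1.

Definition total_winding (G : list (R -> R * R)) (w : R * R) : R :=
  fold_right Rplus 0 (map (fun g => winding g w) G).

(* The usual orientation of the boundary of a bounded domain. *)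
Definition positively_oriented (G : list (R -> R * R)) (D : R * R -> Prop) : Prop :=
  (forall w, D w -> total_winding G w = 1) /\
  (forall w, ~ cl D w -> total_winding G w = 0).

Record contour : Type :=
  mkcontour { cV : quat -> Prop; cJ : quat; cG : list (R -> R * R) }.

(* cG parametrizes the boundary of V cap C_J, for a bounded slice Cauchy domain V
   with sigma_S(A) contained in V and the closure of V contained in dom phi. *)
Definition admissible {E : NormedModule R_AbsRing} (A : hmod E -> hmod E) (phi : hfun)
    (K : contour) : Prop :=
  slice_cauchy_domain (cV K) /\
  (exists M : R, forall q, cV K q -> norm q <= M) /\
  (forall s, sigmaS (comp A) s -> cV K s) /\
  (forall q, cl (cV K) q -> hdom phi q) /\
  imag_unit (cJ K) /\
  cauchy_boundary (cG K) (trace (cV K) (cJ K)) /\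
  positively_oriented (cG K) (trace (cV K) (cJ K)).

Definition hRInt {E : CompleteNormedModule R_AbsRing} (F : R -> hmod E) (a b : R) : hmod E :=
  mkh (RInt (fun t => coord I0 (F t)) a b) (RInt (fun t => coord I1 (F t)) a b)
      (RInt (fun t => coord I2 (F t)) a b) (RInt (fun t => coord I3 (F t)) a b).

(* The integral of F p dp_J, where F p is applied to dp_J = dp (-J). *)
Definition cint {E : CompleteNormedModule R_AbsRing} (K : contour)
    (F : quat -> quat -> hmod E) : hmod E :=
  fold_right plus zero
    (map (fun g : R -> R * R =>
            hRInt (fun t => F (slice_pt (cJ K) (fst (g t)) (snd (g t)))
                              (qmul (slice_pt (cJ K) (dx g t) (dy g t)) (opp (cJ K)))) 0 1)
         (cG K)).

(** * Functional calculi of a bounded operator A *)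

(* The operator-valued integrals are evaluated at a vector v. *)

Definition S_L {E : CompleteNormedModule R_AbsRing} (K : contour) (A : hmod E -> hmod E)
    (phi : hfun) (v : hmod E) : hmod E :=
  scal (/ (2 * PI)) (cint K (fun p dpJ => SLinv p A (lmul dpJ (lmul (hval phi p) v)))).

Definition S_R {E : CompleteNormedModule R_AbsRing} (K : contour) (A : hmod E -> hmod E)
    (phi : hfun) (v : hmod E) : hmod E :=
  scal (/ (2 * PI)) (cint K (fun p dpJ => lmul (hval phi p) (lmul dpJ (SRinv p A v)))).

(* (D phi)(A) *)
Definition harm_L {E : CompleteNormedModule R_AbsRing} (K : contour) (A : hmod E -> hmod E)
    (phi : hfun) (v : hmod E) : hmod E :=
  scal (- / PI) (cint K (fun p dpJ => Qcinv A p (lmul dpJ (lmul (hval phi p) v)))).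

(* (phi D)(A) *)
Definition harm_R {E : CompleteNormedModule R_AbsRing} (K : contour) (A : hmod E -> hmod E)
    (phi : hfun) (v : hmod E) : hmod E :=
  scal (- / PI) (cint K (fun p dpJ => lmul (hval phi p) (lmul dpJ (Qcinv A p v)))).

(** * Functional calculi of the unbounded operator T *)

(* "B is f(T)" and "B is the operator attached to the Cauchy-Fueter derivative of
   f", obtained from some admissible V and J. *)

Definition is_S_L {E : CompleteNormedModule R_AbsRing} (T : idx -> pop E) (alpha : R)
    (f : hfun) (B : hmod E -> hmod E) : Prop :=
  let A := act (resolvent T alpha) in let phi := transform alpha f in
  exists K, admissible A phi K /\ forall v, B v = S_L K A phi v.

Definition is_S_R {E : CompleteNormedModule R_AbsRing} (T : idx -> pop E) (alpha : R)
    (f : hfun) (B : hmod E -> hmod E) : Prop :=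
  let A := act (resolvent T alpha) in let phi := transform alpha f in
  exists K, admissible A phi K /\ forall v, B v = S_R K A phi v.

Definition is_harm_L {E : CompleteNormedModule R_AbsRing} (T : idx -> pop E) (alpha : R)
    (f : hfun) (B : hmod E -> hmod E) : Prop :=
  let A := act (resolvent T alpha) in let phi := transform alpha f in
  exists K, admissible A phi K /\ forall v, B v = A (bar A (harm_L K A phi v)).

Definition is_harm_R {E : CompleteNormedModule R_AbsRing} (T : idx -> pop E) (alpha : R)
    (f : hfun) (B : hmod E -> hmod E) : Prop :=
  let A := act (resolvent T alpha) in let phi := transform alpha f in
  exists K, admissible A phi K /\ forall v, B v = A (bar A (harm_R K A phi v)).

(* f(T) (Dg)(T) + (Df)(T) g(T) + (A Abar)^{-1} (Df)(T) underl(A) (Dg)(T), with its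
   natural domain; F, G, DF, DG stand for f(T), g(T), (Df)(T), (Dg)(T). *)
Definition product_rhs {E : NormedModule R_AbsRing} (A F G DF DG : hmod E -> hmod E)
    : pop (hmod E) :=
  padd (padd (tot (fun v => F (DG v))) (tot (fun v => DF (G v))))
       (pcomp (pinv (tot (fun v => A (bar A v))))
              (tot (fun v => DF (underl A (DG v))))).

(* Main.v *)
Require Import Defs.
From Stdlib Require Import ssreflect ZArith Reals List Lra Lia Psatz ClassicalEpsilon FunctionalExtensionality.
From Coquelicot Require Import Coquelicot.
Open Scope R_scope.
Open Scope general_if_scope.

(** The idea of the proof.

    Let W be the module X_R (x) H. The components A_k of A commute with one another
    and with left multiplication by quaternions, and so does
    N = A Abar = A_0^2 + A_1^2 + A_2^2 + A_3^2 ([nrm_eq]). The inverse of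
    p^2 - 2 p A_0 + N at p = u + J v is therefore the inverse of the same quadratic
    pencil in the complex variable u + i v, for the complex structure that J defines
    on W. To treat all J at once one works on the complexification of W, where
    R(z) denotes the inverse of z^2 - 2 z A_0 + N, and maps it to W by
    a + i b |-> a + J b ([Qcinv_embJ]).

    A left slice function is a sum of s_l e_l with intrinsic s_l, that is, with
    functions s_l of a complex variable that commute with conjugation
    ([left_decomposition]). So the calculi of the left functions are built from the
    operators
      b_s = (1 / (2 pi i)) times the integral of s(z) R(z) dz,
    which map W to W ([Phi_beta]) because conjugation preserves s and the contour:
    the harmonic calculus is -2 times the sum of b_(s_l) e_l, and the S-calculus is
    the sum of (b_(z s_l) - Abar b_(s_l)) e_l ([harm_L_beta], [S_L_beta]). The right
    case is symmetric. Linearity is then evident, provided that b_s does not depend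
    on the contour. The product rule is algebra ([product_core]): it follows from
      b_(s t) = b_(z s) b_t + b_s b_(z t) - 2 A_0 b_s b_t        ([beta_mult])
    and from Abar = A_0 - underl A. The inverse of N in the statement makes sense
    because A is injective, being an inverse, and hence so is N ([nrm_inj]).

    Both facts about b_s, independence of the contour ([Phi_indep]) and the product
    identity ([Phi_mult]), concern cycles that are only known through their winding
    numbers. The two sides of each identity are linear in s and continuous for uniform
    convergence on the closure of the enclosed domain. By Runge's theorem ([runge],
    [cfun_eq_approx]) it suffices to take for s a Cauchy kernel 1 / (zeta - z) with
    zeta outside. There the resolvent identity reduces everything to two moments, the
    integral of R being 0 and that of z R being 2 pi i ([cyc_res_0], [cyc_res_1]),
    which are found on a large square.

    The function f enters through f(1 / z + alpha), whose value at z = 0 is the limit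
    of f at infinity. Of this point only continuity is used, and Goursat's theorem,
    Cauchy's formula and Runge's theorem are proved for functions which need not be
    differentiable there. *)

(** * Complex Banach spaces *)

Section ProdComplete.
Context (U V : CompleteNormedModule R_AbsRing).

Definition prod_lim (F : (U * V -> Prop) -> Prop) : U * V :=
  (lim (fun P => F (fun x => P (fst x))), lim (fun P => F (fun x => P (snd x)))).

Lemma prod_lim_cauchy (F : (prod_UniformSpace U V -> Prop) -> Prop) :
  ProperFilter F -> Hierarchy.cauchy F -> forall eps : posreal, F (ball (prod_lim F : prod_UniformSpace U V) eps).
Proof.
intros HF Hc eps.
assert (P1 : ProperFilter (fun P : U -> Prop => F (fun x => P (fst x)))).
{ exact (filtermap_proper_filter (U * V) U (fun x => fst x) F HF). }
assert (P2 : ProperFilter (fun P : V -> Prop => F (fun x => P (snd x)))).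
{ exact (filtermap_proper_filter (U * V) V (fun x => snd x) F HF). }
assert (C1 := complete_cauchy _ P1). assert (C2 := complete_cauchy _ P2).
assert (H1 : F (fun x => ball (fst (prod_lim F)) eps (fst x))).
{ apply C1. intros e. destruct (Hc e) as [x Hx]. exists (fst x).
  revert Hx. apply filter_imp. intros y Hy. apply Hy. }
assert (H2 : F (fun x => ball (snd (prod_lim F)) eps (snd x))).
{ apply C2. intros e. destruct (Hc e) as [x Hx]. exists (snd x).
  revert Hx. apply filter_imp. intros y Hy. apply Hy. }
generalize (filter_and _ _ H1 H2). apply filter_imp.
intros y [Ha Hb]. split; assumption.
Qed.

Lemma prod_lim_close (F1 F2 : (prod_UniformSpace U V -> Prop) -> Prop) :
  filter_le F1 F2 -> filter_le F2 F1 -> close (prod_lim F1 : prod_UniformSpace U V) (prod_lim F2).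
Proof.
intros H1 H2 eps. split.
- refine (close_lim _ _ _ _ eps); intros P HP; [apply H1 | apply H2]; exact HP.
- refine (close_lim _ _ _ _ eps); intros P HP; [apply H1 | apply H2]; exact HP.
Qed.

(** The completeness structure is put on top of the normed structure of the
    product, so that [hmodC E] below is convertible to [hmod E]. *)
Definition prodC : CompleteNormedModule R_AbsRing :=
  CompleteNormedModule.Pack R_AbsRing (U * V)
    (CompleteNormedModule.Class R_AbsRing (U * V)
       (NormedModule.class R_AbsRing (prod_NormedModule R_AbsRing U V))
       (CompleteSpace.Mixin (prod_UniformSpace U V) prod_lim prod_lim_cauchy prod_lim_close))
    (U * V).
End ProdComplete.

Definition hmodC (E : CompleteNormedModule R_AbsRing) : CompleteNormedModule R_AbsRing :=
  prodC E (prodC E (prodC E E)).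

(** Complex Banach spaces, as real ones with a multiplication by i. Only the real
    norm is kept: multiplication by a complex number c is bounded by 2 |c|, which
    is enough for every estimate below. *)
Record cspace : Type := CSpace {
  csp :> CompleteNormedModule R_AbsRing;
  ci : csp -> csp;
  ci_plus : forall x y, ci (plus x y) = plus (ci x) (ci y);
  ci_scal : forall (r : R) x, ci (scal r x) = scal r (ci x);
  ci_ci : forall x, ci (ci x) = opp x;
  ci_norm : forall x, norm (ci x) <= norm x }.
Arguments ci {c}.

Definition cmul {Y : cspace} (c : C) (y : Y) : Y :=
  plus (scal (fst c) y) (scal (snd c) (ci y)).

(** * Deciding linear identities *)

Lemma plus4 {Y : CompleteNormedModule R_AbsRing} (a b c d : Y) :
  plus (plus a b) (plus c d) = plus (plus a c) (plus b d).
Proof.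
rewrite -plus_assoc (plus_assoc b) (plus_comm b) -plus_assoc plus_assoc.
reflexivity.
Qed.

Lemma ntri {Y : CompleteNormedModule R_AbsRing} (x y : Y) : norm (plus x y) <= norm x + norm y.
Proof. exact (norm_triangle (V := Y) x y). Qed.
Lemma nscal {Y : CompleteNormedModule R_AbsRing} (r : R) (x : Y) : norm (scal r x) <= Rabs r * norm x.
Proof. exact (norm_scal (V := Y) r x). Qed.
Lemma nopp {Y : CompleteNormedModule R_AbsRing} (x : Y) : norm (opp x) = norm x.
Proof. exact (norm_opp (V := Y) x). Qed.
Lemma nzero {Y : CompleteNormedModule R_AbsRing} : norm (zero : Y) = 0.
Proof. exact (norm_zero (V := Y)). Qed.
Lemma nge0 {Y : CompleteNormedModule R_AbsRing} (x : Y) : 0 <= norm x.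
Proof. exact (norm_ge_0 (V := Y) x). Qed.

Section Cmul.
Context {Y : cspace}.
Implicit Types (c d : C) (x y : Y).

Lemma cmul_plus_r c x y : cmul c (plus x y) = plus (cmul c x) (cmul c y).
Proof. unfold cmul. rewrite ci_plus !scal_distr_l. apply plus4. Qed.

Lemma cmul_plus_l c d y : cmul (Cplus c d) y = plus (cmul c y) (cmul d y).
Proof.
unfold cmul; simpl.
rewrite (scal_distr_r (fst c) (fst d) y : scal (fst c + fst d) y = _).
rewrite (scal_distr_r (snd c) (snd d) (ci y) : scal (snd c + snd d) _ = _).
apply plus4.
Qed.

Lemma cmul_cmul c d y : cmul c (cmul d y) = cmul (Cmult c d) y.
Proof.
unfold cmul; simpl.
rewrite ci_plus !ci_scal ci_ci !scal_distr_l !scal_assoc.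
rewrite scal_opp_r -(scal_opp_l _ y).
rewrite (scal_distr_r (fst c * fst d) (- (snd c * snd d)) y : scal (fst c * fst d - snd c * snd d) y = _).
rewrite (scal_distr_r (fst c * snd d) (snd c * fst d) (ci y) : scal (fst c * snd d + snd c * fst d) _ = _).
rewrite plus4. rewrite plus4. rewrite (plus_comm (scal (mult (snd c) (fst d)) _)). rewrite plus4. reflexivity.
Qed.

Lemma cmul_RtoC (r : R) y : cmul (RtoC r) y = scal r y.
Proof. unfold cmul; simpl. rewrite (scal_zero_l (ci y) : scal 0 (ci y) = _). apply plus_zero_r. Qed.

Lemma cmul_one y : cmul (RtoC 1) y = y.
Proof. rewrite cmul_RtoC. apply (scal_one y). Qed.

Lemma cmul_zero y : cmul (RtoC 0) y = zero.
Proof. rewrite cmul_RtoC. apply (scal_zero_l y). Qed.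

Lemma cmul_zero_r c : cmul c (zero : Y) = zero.
Proof. rewrite -(cmul_zero zero) cmul_cmul. f_equal. ring. Qed.

Lemma cmul_m1 y : cmul (RtoC (-1)) y = opp y.
Proof. rewrite cmul_RtoC. apply (scal_opp_one y). Qed.

Lemma cmul_Ci y : cmul Ci y = ci y.
Proof.
unfold cmul; simpl. rewrite (scal_zero_l y : scal 0 y = _) plus_zero_l.
apply (scal_one (ci y)).
Qed.

Lemma norm_cmul c y : norm (cmul c y) <= 2 * Cmod c * norm y.
Proof.
unfold cmul. eapply Rle_trans; [apply ntri|].
eapply Rle_trans; [apply Rplus_le_compat; apply nscal|].
assert (H1 := Rmax_Cmod c). assert (Ha := Rmax_l (Rabs (fst c)) (Rabs (snd c))).
assert (Hb := Rmax_r (Rabs (fst c)) (Rabs (snd c))).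
assert (H := ci_norm Y y). assert (H0 := nge0 y). assert (H2 := nge0 (ci y)).
assert (Rabs (fst c) * norm y <= Cmod c * norm y) by (apply Rmult_le_compat_r; lra).
assert (Rabs (snd c) * norm (ci y) <= Cmod c * norm y).
{ apply Rmult_le_compat; try lra. apply Rabs_pos. }
lra.
Qed.
End Cmul.

(** Identities between linear combinations over C are decided by reification:
    both sides are expanded over a list of atoms and their coefficients are
    compared with [ring]. *)
Inductive vexp : Type :=
| VAtom (n : nat) | VZero | VPlus (a b : vexp) | VOpp (a : vexp)
| VScal (r : R) (a : vexp) | VCi (a : vexp) | VMul (c : C) (a : vexp).

Fixpoint veval {Y : cspace} (env : list Y) (e : vexp) : Y :=
  match e with
  | VAtom n => nth n env zero
  | VZero => zero
  | VPlus a b => plus (veval env a) (veval env b)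
  | VOpp a => opp (veval env a)
  | VScal r a => scal r (veval env a)
  | VCi a => ci (veval env a)
  | VMul c a => cmul c (veval env a)
  end.

Fixpoint vcoef (n : nat) (e : vexp) : C :=
  match e with
  | VAtom m => if Nat.eqb n m then RtoC 1 else RtoC 0
  | VZero => RtoC 0
  | VPlus a b => Cplus (vcoef n a) (vcoef n b)
  | VOpp a => Cmult (RtoC (-1)) (vcoef n a)
  | VScal r a => Cmult (RtoC r) (vcoef n a)
  | VCi a => Cmult Ci (vcoef n a)
  | VMul c a => Cmult c (vcoef n a)
  end.

Fixpoint vsum {Y : cspace} (env : list Y) (f : nat -> C) : Y :=
  match env with
  | nil => zero
  | y :: env' => plus (cmul (f O) y) (vsum env' (fun n => f (S n)))
  end.

Lemma vsum_ext {Y : cspace} (env : list Y) f g :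
  (forall n, (n < length env)%nat -> f n = g n) -> vsum env f = vsum env g.
Proof.
revert f g; induction env as [|y env IH]; intros f g H; simpl; [reflexivity|].
rewrite (H O ltac:(simpl; lia)). f_equal. apply IH. intros n Hn. apply H. simpl; lia.
Qed.

Lemma vsum_plus {Y : cspace} (env : list Y) f g :
  vsum env (fun n => Cplus (f n) (g n)) = plus (vsum env f) (vsum env g).
Proof.
revert f g; induction env as [|y env IH]; intros f g; simpl.
- rewrite plus_zero_l. reflexivity.
- rewrite (IH (fun n => f (S n)) (fun n => g (S n))) cmul_plus_l. apply plus4.
Qed.

Lemma vsum_mul {Y : cspace} (env : list Y) c f :
  vsum env (fun n => Cmult c (f n)) = cmul c (vsum env f).
Proof.
revert f; induction env as [|y env IH]; intros f; simpl.
- rewrite cmul_zero_r. reflexivity.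
- rewrite (IH (fun n => f (S n))) -cmul_cmul cmul_plus_r. reflexivity.
Qed.

Lemma vsum_zero {Y : cspace} (env : list Y) : vsum env (fun _ => RtoC 0) = zero.
Proof.
induction env as [|y env IH]; simpl; [reflexivity|].
rewrite IH cmul_zero. apply plus_zero_l.
Qed.

Lemma vsum_atom {Y : cspace} (env : list Y) n :
  vsum env (fun m => if Nat.eqb m n then RtoC 1 else RtoC 0) = nth n env zero.
Proof.
revert n; induction env as [|y env IH]; intros [|n]; simpl; try reflexivity.
- rewrite vsum_zero cmul_one. apply plus_zero_r.
- rewrite cmul_zero IH. apply plus_zero_l.
Qed.

Lemma veval_vsum {Y : cspace} (env : list Y) e :
  veval env e = vsum env (fun n => vcoef n e).
Proof.
induction e; simpl.
- symmetry. apply vsum_atom.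
- symmetry. apply vsum_zero.
- rewrite vsum_plus IHe1 IHe2. reflexivity.
- rewrite vsum_mul IHe cmul_m1. reflexivity.
- rewrite vsum_mul IHe cmul_RtoC. reflexivity.
- rewrite vsum_mul IHe cmul_Ci. reflexivity.
- rewrite vsum_mul IHe. reflexivity.
Qed.

Lemma veval_eq {Y : cspace} (env : list Y) e1 e2 :
  List.Forall (fun n => vcoef n e1 = vcoef n e2) (List.seq 0 (length env)) ->
  veval env e1 = veval env e2.
Proof.
intros H. rewrite !veval_vsum. apply vsum_ext. intros n Hn.
apply (proj1 (List.Forall_forall _ _) H n). apply in_seq. lia.
Qed.

Ltac v_lookup x env :=
  match env with
  | nil => constr:(@None nat)
  | x :: _ => constr:(Some O)
  | _ :: ?env' => match v_lookup x env' with
                  | Some ?n => constr:(Some (S n))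
                  | None => constr:(@None nat)
                  end
  end.

Ltac v_atoms Y env e :=
  lazymatch e with
  | plus ?a ?b => let env1 := v_atoms Y env a in v_atoms Y env1 b
  | minus ?a ?b => let env1 := v_atoms Y env a in v_atoms Y env1 b
  | opp ?a => v_atoms Y env a
  | scal _ ?a => v_atoms Y env a
  | cmul _ ?a => v_atoms Y env a
  | ci ?a => v_atoms Y env a
  | zero => env
  | _ => lazymatch v_lookup e env with
         | Some _ => env
         | None => constr:((e : csp Y) :: env)
         end
  end.

Ltac v_reify env e :=
  lazymatch e with
  | plus ?a ?b => let a' := v_reify env a in let b' := v_reify env b in constr:(VPlus a' b')
  | minus ?a ?b => let a' := v_reify env a in let b' := v_reify env b in
                   constr:(VPlus a' (VOpp b'))
  | opp ?a => let a' := v_reify env a in constr:(VOpp a')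
  | scal ?r ?a => let a' := v_reify env a in constr:(VScal r a')
  | cmul ?r ?a => let a' := v_reify env a in constr:(VMul r a')
  | ci ?a => let a' := v_reify env a in constr:(VCi a')
  | zero => constr:(VZero)
  | _ => lazymatch v_lookup e env with
         | Some ?n => constr:(VAtom n)
         end
  end.

Ltac vec_coefs Y :=
  lazymatch goal with
  | |- ?a = ?b =>
    let env := v_atoms Y (@nil (csp Y)) a in
    let env := v_atoms Y env b in
    let a' := v_reify env a in let b' := v_reify env b in
    let H := constr:(fun H => @veval_eq Y env a' b' H) in
    refine (H _); cbn [length List.seq]; repeat (apply Forall_cons); try apply List.Forall_nil;
    cbn [vcoef Nat.eqb]
  end.

Ltac vec Y := vec_coefs Y; ring.

Ltac norm_as Y t :=
  lazymatch goal with |- context [norm ?a] =>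
    let H := fresh in assert (H : a = t) by (vec Y); rewrite H; clear H end.

Lemma nminus_diag {Y : cspace} (x : Y) : norm (minus x x) = 0.
Proof. replace (minus x x) with (zero : Y) by vec Y. apply nzero. Qed.

(** * Continuity and complex differentiability *)

Definition cont {Y : cspace} (h : R * R -> Y) (z : R * R) : Prop :=
  forall eps, 0 < eps -> exists d, 0 < d /\
  forall w, Cmod (Cminus w z) < d -> norm (minus (h w) (h z)) < eps.

Definition ccont (s : R * R -> R * R) (z : R * R) : Prop :=
  forall eps, 0 < eps -> exists d, 0 < d /\
  forall w, Cmod (Cminus w z) < d -> Cmod (Cminus (s w) (s z)) < eps.

(** Caratheodory's form of complex differentiability: the difference quotient
    extends to a function continuous at z. *)
Definition cdiff {Y : cspace} (h : R * R -> Y) (z : R * R) : Prop :=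
  exists q : R * R -> Y, cont q z /\
  forall w, minus (h w) (h z) = cmul (Cminus w z) (q w).

Definition ccdiff (s : R * R -> R * R) (z : R * R) : Prop :=
  exists q : R * R -> R * R, ccont q z /\
  forall w, Cminus (s w) (s z) = Cmult (Cminus w z) (q w).

Lemma Cmod_m0 (z : C) : Cmod (Cminus z z) = 0.
Proof. replace (Cminus z z) with (RtoC 0) by ring. apply Cmod_0. Qed.

Lemma Cmod_bound_Re (x y : R) : Rabs x <= Cmod (x, y).
Proof. apply Rle_trans with (2 := Rmax_Cmod (x, y)), Rmax_l. Qed.

Lemma Cmod_bound_Im (x y : R) : Rabs y <= Cmod (x, y).
Proof. apply Rle_trans with (2 := Rmax_Cmod (x, y)), Rmax_r. Qed.

Lemma Cmod_le_sum (x y : R) : Cmod (x, y) <= Rabs x + Rabs y.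
Proof.
replace (x, y) with (Cplus (RtoC x) (Cmult Ci (RtoC y)))
  by (apply injective_projections; simpl; ring).
eapply Rle_trans; [apply Cmod_triangle|]. rewrite Cmod_mult !Cmod_R.
assert (Cmod Ci = 1).
{ unfold Cmod, Ci; simpl. replace (0 * (0 * 1) + 1 * (1 * 1)) with 1 by ring. apply sqrt_1. }
rewrite H. lra.
Qed.

Lemma Cmod_minus_sym (z w : C) : Cmod (Cminus z w) = Cmod (Cminus w z).
Proof. rewrite <- Cmod_opp. f_equal. ring. Qed.

Lemma Cmod_tri_sub (z w : C) : Cmod z - Cmod w <= Cmod (Cminus z w).
Proof.
assert (H := Cmod_triangle (Cminus z w) w).
replace (Cplus (Cminus z w) w) with z in H by ring. lra.
Qed.

Lemma Cminus_neq (z w : C) : z <> w -> Cminus z w <> RtoC 0.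
Proof. intros H E. apply H. replace z with (Cplus (Cminus z w) w) by ring. rewrite E. ring. Qed.

Section Cont.
Context {Y : cspace}.
Implicit Types (h k : R * R -> Y) (s t : R * R -> R * R) (z w : R * R).

Lemma cont_ext_loc h k z (d : R) : 0 < d ->
  (forall w, Cmod (Cminus w z) < d -> h w = k w) -> cont h z -> cont k z.
Proof.
intros Hd E H eps He. destruct (H eps He) as [e [He1 He2]].
exists (Rmin d e). split; [apply Rmin_pos; assumption|]. intros w Hw.
rewrite <- E, <- E.
- apply He2. eapply Rlt_le_trans; [apply Hw|apply Rmin_r].
- rewrite Cmod_m0. assumption.
- eapply Rlt_le_trans; [apply Hw|apply Rmin_l].
Qed.

Lemma cont_const (y : Y) z : cont (fun _ => y) z.
Proof.
intros eps He. exists 1. split; [lra|]. intros w _.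
replace (minus y y) with (zero : Y) by (symmetry; apply (minus_eq_zero (G := Y))).
rewrite nzero. assumption.
Qed.

Lemma cont_plus h k z : cont h z -> cont k z -> cont (fun w => plus (h w) (k w)) z.
Proof.
intros H K eps He. destruct (H (eps / 2)) as [d [Hd1 Hd2]]; [lra|].
destruct (K (eps / 2)) as [e [He1 He2]]; [lra|].
exists (Rmin d e). split; [apply Rmin_pos; assumption|]. intros w Hw.
assert (Ha := Hd2 w (Rlt_le_trans _ _ _ Hw (Rmin_l _ _))).
assert (Hb := He2 w (Rlt_le_trans _ _ _ Hw (Rmin_r _ _))).
replace (minus (plus (h w) (k w)) (plus (h z) (k z)))
  with (plus (minus (h w) (h z)) (minus (k w) (k z))) by vec Y.
eapply Rle_lt_trans; [apply ntri|]. lra.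
Qed.

Lemma cont_lip h z (L : R) (d : R) : 0 < d ->
  (forall w, Cmod (Cminus w z) < d -> norm (minus (h w) (h z)) <= L * Cmod (Cminus w z)) -> cont h z.
Proof.
intros Hd H eps He.
assert (0 < Rabs L + 1) by (assert (H0 := Rabs_pos L); lra).
assert (0 < eps / (Rabs L + 1)) by (apply Rdiv_lt_0_compat; lra).
exists (Rmin d (eps / (Rabs L + 1))). split; [apply Rmin_pos; assumption|]. intros w Hw.
eapply Rle_lt_trans; [apply H, (Rlt_le_trans _ _ _ Hw (Rmin_l _ _))|].
assert (Hb := Rlt_le_trans _ _ _ Hw (Rmin_r _ _)).
apply Rle_lt_trans with ((Rabs L + 1) * Cmod (Cminus w z)).
- apply Rmult_le_compat_r; [apply Cmod_ge_0|]. assert (H2 := Rle_abs L). lra.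
- apply (Rmult_lt_compat_l (Rabs L + 1)) in Hb; [|lra].
  replace ((Rabs L + 1) * (eps / (Rabs L + 1))) with eps in Hb by (field; lra). lra.
Qed.

Lemma cont_cmul s h z : ccont s z -> cont h z -> cont (fun w => cmul (s w) (h w)) z.
Proof.
intros S H eps He.
set (A := Cmod (s z) + 1). set (B := norm (h z) + 1).
assert (HA : 0 < A) by (unfold A; assert (H0 := Cmod_ge_0 (s z)); lra).
assert (HB : 0 < B) by (unfold B; assert (H0 := nge0 (h z)); lra).
destruct (H (Rmin 1 (eps / (4 * A)))) as [d [Hd1 Hd2]].
{ apply Rmin_pos; [lra|]. apply Rdiv_lt_0_compat; lra. }
destruct (S (eps / (4 * B))) as [e [He1 He2]]; [apply Rdiv_lt_0_compat; lra|].
exists (Rmin d e). split; [apply Rmin_pos; assumption|]. intros w Hw.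
assert (Ha := Hd2 w (Rlt_le_trans _ _ _ Hw (Rmin_l _ _))).
assert (Hb := He2 w (Rlt_le_trans _ _ _ Hw (Rmin_r _ _))).
assert (Ha1 := Rlt_le_trans _ _ _ Ha (Rmin_l _ _)).
assert (Ha2 := Rlt_le_trans _ _ _ Ha (Rmin_r _ _)).
replace (minus (cmul (s w) (h w)) (cmul (s z) (h z)))
  with (plus (cmul (Cminus (s w) (s z)) (h w)) (cmul (s z) (minus (h w) (h z)))) by vec Y.
eapply Rle_lt_trans; [apply ntri|].
eapply Rle_lt_trans; [apply Rplus_le_compat; apply norm_cmul|].
assert (Hw2 : norm (h w) <= B).
{ unfold B. replace (h w) with (plus (minus (h w) (h z)) (h z)) by vec Y.
  eapply Rle_trans; [apply ntri|]. lra. }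
assert (E1 : 2 * Cmod (Cminus (s w) (s z)) * norm (h w) <= eps / 2).
{ replace (eps / 2) with (2 * (eps / (4 * B)) * B) by (field; lra).
  apply Rmult_le_compat; try lra; [|apply nge0].
  assert (H1 := Cmod_ge_0 (Cminus (s w) (s z))). lra. }
assert (E2 : 2 * Cmod (s z) * norm (minus (h w) (h z)) < eps / 2).
{ apply Rle_lt_trans with (2 * Cmod (s z) * (eps / (4 * A))).
  - apply Rmult_le_compat_l; [|lra]. assert (H1 := Cmod_ge_0 (s z)). lra.
  - replace (eps / 2) with (2 * A * (eps / (4 * A))) by (field; lra).
    apply Rmult_lt_compat_r; [apply Rdiv_lt_0_compat; lra|]. unfold A. lra. }
lra.
Qed.

Lemma cdiff_cont h z : cdiff h z -> cont h z.
Proof.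
intros [q [Hq E]].
apply (cont_ext_loc (fun w => plus (h z) (cmul (Cminus w z) (q w))) h z 1); [lra| |].
- intros w _. rewrite -E. vec Y.
- apply cont_plus; [apply cont_const|]. apply cont_cmul; [|exact Hq].
  intros eps He. exists eps. split; [exact He|]. intros w Hw.
  replace (Cminus (Cminus w z) (Cminus z z)) with (Cminus w z) by ring. exact Hw.
Qed.

(** The quotient need only be given near z, since elsewhere it is determined by h. *)
Lemma cdiff_loc h q z (d : R) : 0 < d -> cont q z ->
  (forall w, Cmod (Cminus w z) < d -> minus (h w) (h z) = cmul (Cminus w z) (q w)) -> cdiff h z.
Proof.
intros Hd Hq E.
exists (fun w => if Rlt_dec (Cmod (Cminus w z)) d then q w
                 else cmul (Cinv (Cminus w z)) (minus (h w) (h z))).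
split.
- apply (cont_ext_loc q _ z d Hd); [|exact Hq].
  intros w Hw. destruct (Rlt_dec _ _); [reflexivity|contradiction].
- intros w. destruct (Rlt_dec _ _) as [H|H]; [apply E, H|].
  rewrite cmul_cmul Cinv_r; [rewrite cmul_one; reflexivity|].
  intros E0. apply H. rewrite E0 Cmod_0. exact Hd.
Qed.

Lemma cdiff_ext_loc h k z (d : R) : 0 < d ->
  (forall w, Cmod (Cminus w z) < d -> h w = k w) -> cdiff h z -> cdiff k z.
Proof.
intros Hd E [q [Hq H]]. apply (cdiff_loc k q z d Hd Hq).
intros w Hw. rewrite <- H, <- E, <- E; [reflexivity| |exact Hw].
rewrite Cmod_m0. exact Hd.
Qed.

Lemma cdiff_const (y : Y) z : cdiff (fun _ => y) z.
Proof. exists (fun _ => zero). split; [apply cont_const|]. intros w. vec Y. Qed.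

Lemma cdiff_plus h k z : cdiff h z -> cdiff k z -> cdiff (fun w => plus (h w) (k w)) z.
Proof.
intros [q [Hq E]] [r [Hr F]]. exists (fun w => plus (q w) (r w)). split.
- apply cont_plus; assumption.
- intros w. rewrite cmul_plus_r -E -F. vec Y.
Qed.

Lemma cdiff_cmul s h z : ccdiff s z -> cdiff h z -> cdiff (fun w => cmul (s w) (h w)) z.
Proof.
intros [q [Hq E]] H. assert (Hc := cdiff_cont h z H). destruct H as [r [Hr F]].
exists (fun w => plus (cmul (q w) (h w)) (cmul (s z) (r w))). split.
- apply cont_plus; apply cont_cmul; try assumption.
  intros eps He. exists 1. split; [lra|]. intros w _. rewrite Cmod_m0. exact He.
- intros w. 
  transitivity (plus (cmul (Cminus (s w) (s z)) (h w)) (cmul (s z) (minus (h w) (h z)))); [vec Y|].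
  rewrite E F. vec Y.
Qed.

End Cont.

Lemma ccont_id z : ccont (fun w => w) z.
Proof. intros eps He. exists eps. split; [exact He|]. intros w Hw; exact Hw. Qed.

Lemma ccont_inv (a z : C) : z <> a -> ccont (fun w => Cinv (Cminus w a)) z.
Proof.
intros H eps He. assert (H0 := Cminus_neq _ _ H).
set (m := Cmod (Cminus z a)). assert (Hm : 0 < m) by (apply Cmod_gt_0; exact H0).
exists (Rmin (m / 2) (eps * m * m / 2)). split.
{ apply Rmin_pos; [lra|]. apply Rdiv_lt_0_compat; [|lra].
  apply Rmult_lt_0_compat; [apply Rmult_lt_0_compat|]; assumption. }
intros w Hw.
assert (Ha := Rlt_le_trans _ _ _ Hw (Rmin_l _ _)).
assert (Hb := Rlt_le_trans _ _ _ Hw (Rmin_r _ _)).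
assert (Hwa : m / 2 < Cmod (Cminus w a)).
{ assert (T := Cmod_tri_sub (Cminus z a) (Cminus w a)).
  replace (Cminus (Cminus z a) (Cminus w a)) with (Cminus z w) in T by ring.
  rewrite Cmod_minus_sym in Ha. unfold m in *. lra. }
assert (Hn : Cminus w a <> RtoC 0) by (apply Cmod_gt_0; lra).
replace (Cminus (Cinv (Cminus w a)) (Cinv (Cminus z a)))
  with (Cdiv (Cminus z w) (Cmult (Cminus w a) (Cminus z a))) by (field; split; assumption).
rewrite Cmod_div; [|apply Cmult_neq_0; assumption]. rewrite Cmod_mult Cmod_minus_sym. fold m.
apply Rmult_lt_reg_r with (Cmod (Cminus w a) * m); [apply Rmult_lt_0_compat; lra|].
replace (Cmod (Cminus w z) / (Cmod (Cminus w a) * m) * (Cmod (Cminus w a) * m))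
  with (Cmod (Cminus w z)) by (field; split; lra).
apply Rlt_trans with (eps * m * m / 2); [exact Hb|].
replace (eps * m * m / 2) with (eps * (m / 2 * m)) by field.
apply Rmult_lt_compat_l; [exact He|]. apply Rmult_lt_compat_r; lra.
Qed.

Lemma ccdiff_inv (a z : C) : z <> a -> ccdiff (fun w => Cinv (Cminus w a)) z.
Proof.
intros H. assert (H0 := Cminus_neq _ _ H).
exists (fun w => if excluded_middle_informative (w = a) then
      Cdiv (Cminus (Cinv (Cminus w a)) (Cinv (Cminus z a))) (Cminus w z)
    else Cmult (Copp (Cinv (Cminus z a))) (Cinv (Cminus w a))).
split.
- intros eps He.
  assert (Hc : 0 < Cmod (Cminus z a)) by (apply Cmod_gt_0; exact H0).
  destruct (ccont_inv a z H (eps * Cmod (Cminus z a))) as [d [Hd1 Hd2]].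
  { apply Rmult_lt_0_compat; assumption. }
  exists (Rmin d (Cmod (Cminus z a))). split; [apply Rmin_pos; assumption|].
  intros w Hw. assert (Ha := Hd2 w (Rlt_le_trans _ _ _ Hw (Rmin_l _ _))).
  assert (Hb := Rlt_le_trans _ _ _ Hw (Rmin_r _ _)).
  destruct (excluded_middle_informative _) as [E|E].
  { subst w. rewrite Cmod_minus_sym in Hb. lra. }
  destruct (excluded_middle_informative _); [contradiction|].
  replace (Cminus _ _) with (Cmult (Copp (Cinv (Cminus z a)))
     (Cminus (Cinv (Cminus w a)) (Cinv (Cminus z a)))) by ring.
  rewrite Cmod_mult Cmod_opp Cmod_inv; [|exact H0].
  apply Rmult_lt_reg_l with (Cmod (Cminus z a)); [exact Hc|].
  rewrite -Rmult_assoc Rinv_r; [|lra]. lra.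
- intros w. destruct (excluded_middle_informative _) as [E|E].
  + assert (H1 : Cminus w z <> RtoC 0) by (apply Cminus_neq; congruence).
    unfold Cdiv. rewrite Cmult_assoc (Cmult_comm (Cminus w z)) -Cmult_assoc Cinv_r; [ring|exact H1].
  + assert (Cminus w a <> RtoC 0) by (apply Cminus_neq; assumption). field. split; assumption.
Qed.

(** * Integrals over rectangles *)

Lemma cont_continuous {Y : cspace} (u : R -> Y) (x : R) :
  (forall eps, 0 < eps -> exists d, 0 < d /\
     forall x', Rabs (x' - x) < d -> norm (minus (u x') (u x)) < eps) ->
  continuous u x.
Proof.
intros H. apply filterlim_locally. intros eps.
destruct (H eps (cond_pos eps)) as [d [Hd1 Hd2]].
exists (mkposreal d Hd1). intros x' Hx'. apply (norm_compat1 (V := Y)). apply Hd2. exact Hx'.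
Qed.

Lemma Cmod_hdist (x x' y : R) : Cmod (Cminus (x', y) (x, y)) = Rabs (x' - x).
Proof.
rewrite -Cmod_R. f_equal. apply injective_projections; simpl; ring.
Qed.

Lemma Cmod_vdist (x y y' : R) : Cmod (Cminus (x, y') (x, y)) = Rabs (y' - y).
Proof.
rewrite -Cmod_R -(Cmod_opp (RtoC _)). unfold Cmod. f_equal. simpl. ring.
Qed.

Lemma cont_hline {Y : cspace} (h : R * R -> Y) (x y : R) :
  cont h (x, y) -> continuous (fun x' => h (x', y)) x.
Proof.
intros H. apply cont_continuous. intros eps He. destruct (H eps He) as [d [Hd1 Hd2]].
exists d. split; [exact Hd1|]. intros x' Hx'. apply Hd2.
eapply Rle_lt_trans; [right; apply Cmod_hdist|exact Hx'].
Qed.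

Lemma cont_vline {Y : cspace} (h : R * R -> Y) (x y : R) :
  cont h (x, y) -> continuous (fun y' => h (x, y')) y.
Proof.
intros H. apply cont_continuous. intros eps He. destruct (H eps He) as [d [Hd1 Hd2]].
exists d. split; [exact Hd1|]. intros y' Hy'. apply Hd2.
eapply Rle_lt_trans; [right; apply Cmod_vdist|exact Hy'].
Qed.

Section Rect.
Context {Y : cspace}.
Implicit Types (h k : R * R -> Y) (a b c d : R).

Definition hseg h a b y : Y := RInt (fun x => h (x, y)) a b.
Definition vseg h x c d : Y := ci (RInt (fun y => h (x, y)) c d).

(** The integral of h(z) dz along the boundary of [a, b] x [c, d]. *)
Definition rect h a b c d : Y :=
  minus (plus (hseg h a b c) (vseg h b c d)) (plus (hseg h a b d) (vseg h a c d)).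

Definition contR h a b c d := forall x y, a <= x <= b -> c <= y <= d -> cont h (x, y).

Lemma ex_hseg h a b y : a <= b -> (forall x, a <= x <= b -> cont h (x, y)) ->
  ex_RInt (fun x => h (x, y)) a b.
Proof.
intros Hab H. apply (ex_RInt_continuous (V := Y)). intros x Hx.
rewrite Rmin_left in Hx; [|exact Hab]. rewrite Rmax_right in Hx; [|exact Hab].
apply cont_hline, H, Hx.
Qed.

Lemma ex_vseg h x c d : c <= d -> (forall y, c <= y <= d -> cont h (x, y)) ->
  ex_RInt (fun y => h (x, y)) c d.
Proof.
intros Hab H. apply (ex_RInt_continuous (V := Y)). intros y Hy.
rewrite Rmin_left in Hy; [|exact Hab]. rewrite Rmax_right in Hy; [|exact Hab].
apply cont_vline, H, Hy.
Qed.

Lemma hseg_split h a m b y : a <= m <= b -> (forall x, a <= x <= b -> cont h (x, y)) ->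
  hseg h a b y = plus (hseg h a m y) (hseg h m b y).
Proof.
intros Hm H. unfold hseg. symmetry. apply (RInt_Chasles (V := Y)); apply ex_hseg; try lra;
  intros x Hx; apply H; lra.
Qed.

Lemma vseg_split h x c m d : c <= m <= d -> (forall y, c <= y <= d -> cont h (x, y)) ->
  vseg h x c d = plus (vseg h x c m) (vseg h x m d).
Proof.
intros Hm H. unfold vseg. rewrite -ci_plus. f_equal. symmetry. apply (RInt_Chasles (V := Y)); apply ex_vseg; try lra;
  intros y Hy; apply H; lra.
Qed.

Lemma rect_split_x h a m b c d : a <= m <= b -> c <= d -> contR h a b c d ->
  rect h a b c d = plus (rect h a m c d) (rect h m b c d).
Proof.
intros Hm Hc H. unfold rect. rewrite !(hseg_split h a m b); try exact Hm; try (intros x Hx; apply H; lra).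
vec Y.
Qed.

Lemma rect_split_y h a b c m d : a <= b -> c <= m <= d -> contR h a b c d ->
  rect h a b c d = plus (rect h a b c m) (rect h a b m d).
Proof.
intros Hm Hc H. unfold rect. rewrite !(vseg_split h _ c m d); try exact Hc; try (intros x Hx; apply H; lra).
vec Y.
Qed.

Lemma rect_deg_x h a c d : rect h a a c d = zero.
Proof. unfold rect, hseg. rewrite !(RInt_point (V := Y)). vec Y. Qed.

Lemma rect_deg_y h a b c : rect h a b c c = zero.
Proof. unfold rect, vseg. rewrite !(RInt_point (V := Y)). vec Y. Qed.

Lemma hseg_bound h a b y M : a <= b -> (forall x, a <= x <= b -> cont h (x, y)) ->
  (forall x, a <= x <= b -> norm (h (x, y)) <= M) -> norm (hseg h a b y) <= (b - a) * M.
Proof.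
intros Hab H HM. apply (norm_RInt_le_const (V := Y) (fun x => h (x, y)) a b); [exact Hab|exact HM|].
apply (RInt_correct (V := Y)), ex_hseg; assumption.
Qed.

Lemma vseg_bound h x c d M : c <= d -> (forall y, c <= y <= d -> cont h (x, y)) ->
  (forall y, c <= y <= d -> norm (h (x, y)) <= M) -> norm (vseg h x c d) <= (d - c) * M.
Proof.
intros Hab H HM. unfold vseg. eapply Rle_trans; [apply ci_norm|].
apply (norm_RInt_le_const (V := Y) (fun y => h (x, y)) c d); [exact Hab|exact HM|].
apply (RInt_correct (V := Y)), ex_vseg; assumption.
Qed.

Lemma nminus (x y : Y) : norm (minus x y) <= norm x + norm y.
Proof. unfold minus. eapply Rle_trans; [apply ntri|]. rewrite nopp. lra. Qed.

Definition onbd a b c d x y := a <= x <= b /\ c <= y <= d /\ (x = a \/ x = b \/ y = c \/ y = d).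

Lemma rect_bound h a b c d M : a <= b -> c <= d ->
  (forall x y, onbd a b c d x y -> cont h (x, y) /\ norm (h (x, y)) <= M) ->
  norm (rect h a b c d) <= 2 * M * ((b - a) + (d - c)).
Proof.
intros Hab Hcd H. unfold rect. eapply Rle_trans; [apply nminus|].
eapply Rle_trans; [apply Rplus_le_compat; apply ntri|].
assert (norm (hseg h a b c) <= (b - a) * M)
  by (apply hseg_bound; try lra; intros x Hx; apply H; unfold onbd; lra).
assert (norm (hseg h a b d) <= (b - a) * M)
  by (apply hseg_bound; try lra; intros x Hx; apply H; unfold onbd; lra).
assert (norm (vseg h b c d) <= (d - c) * M)
  by (apply vseg_bound; try lra; intros x Hx; apply H; unfold onbd; lra).
assert (norm (vseg h a c d) <= (d - c) * M)
  by (apply vseg_bound; try lra; intros x Hx; apply H; unfold onbd; lra).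
lra.
Qed.

Lemma hseg_ext h k a b y : a <= b ->
  (forall x, a <= x <= b -> h (x, y) = k (x, y)) -> hseg h a b y = hseg k a b y.
Proof.
intros Hab H. apply (RInt_ext (V := Y)). rewrite Rmin_left; [|exact Hab].
rewrite Rmax_right; [|exact Hab]. intros x Hx. apply H; lra.
Qed.

Lemma vseg_ext h k x c d : c <= d ->
  (forall y, c <= y <= d -> h (x, y) = k (x, y)) -> vseg h x c d = vseg k x c d.
Proof.
intros Hab H. unfold vseg. apply f_equal, (RInt_ext (V := Y)). rewrite Rmin_left; [|exact Hab].
rewrite Rmax_right; [|exact Hab]. intros y Hy. apply H; lra.
Qed.

Lemma rect_ext h k a b c d : a <= b -> c <= d ->
  (forall x y, onbd a b c d x y -> h (x, y) = k (x, y)) -> rect h a b c d = rect k a b c d.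
Proof.
intros Hab Hcd H. unfold rect.
rewrite (hseg_ext h k a b c Hab); [|intros; apply H; unfold onbd; lra].
rewrite (hseg_ext h k a b d Hab); [|intros; apply H; unfold onbd; lra].
rewrite (vseg_ext h k a c d Hcd); [|intros; apply H; unfold onbd; lra].
rewrite (vseg_ext h k b c d Hcd); [|intros; apply H; unfold onbd; lra].
reflexivity.
Qed.

Lemma rect_plus h k a b c d : a <= b -> c <= d ->
  (forall x y, onbd a b c d x y -> cont h (x, y) /\ cont k (x, y)) ->
  rect (fun z => plus (h z) (k z)) a b c d = plus (rect h a b c d) (rect k a b c d).
Proof.
intros Hab Hcd H. unfold rect, hseg, vseg.
rewrite !(RInt_plus (V := Y));
  try (apply ex_hseg; [exact Hab|]; intros x Hx; apply H; unfold onbd; lra);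
  try (apply ex_vseg; [exact Hcd|]; intros x Hx; apply H; unfold onbd; lra).
rewrite !ci_plus. vec Y.
Qed.

End Rect.

(** * Bisection and Goursat's theorem *)

Section Bisect.
Variables (P : R -> R -> R -> R -> Prop) (a0 b0 c0 d0 : R).
Hypothesis quarter : forall a b c d, a0 <= a -> a <= b -> b <= b0 -> c0 <= c -> c <= d -> d <= d0 ->
  P a ((a + b) / 2) c ((c + d) / 2) -> P ((a + b) / 2) b c ((c + d) / 2) ->
  P a ((a + b) / 2) ((c + d) / 2) d -> P ((a + b) / 2) b ((c + d) / 2) d -> P a b c d.
Hypothesis local : forall x y, a0 <= x <= b0 -> c0 <= y <= d0 -> exists e, 0 < e /\
  forall a b c d, a0 <= a -> a <= x <= b -> b <= b0 -> c0 <= c -> c <= y <= d -> d <= d0 ->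
  b - a < e -> d - c < e -> P a b c d.
Hypotheses (H0 : a0 <= b0) (H1 : c0 <= d0).

Let inR (r : (R * R) * (R * R)) :=
  a0 <= fst (fst r) /\ fst (fst r) <= snd (fst r) /\ snd (fst r) <= b0 /\
  c0 <= fst (snd r) /\ fst (snd r) <= snd (snd r) /\ snd (snd r) <= d0.
Let bad (r : (R * R) * (R * R)) := inR r /\ ~ P (fst (fst r)) (snd (fst r)) (fst (snd r)) (snd (snd r)).
Let half (r r' : (R * R) * (R * R)) :=
  fst (fst r) <= fst (fst r') /\ snd (fst r') <= snd (fst r) /\
  fst (snd r) <= fst (snd r') /\ snd (snd r') <= snd (snd r) /\
  snd (fst r') - fst (fst r') = (snd (fst r) - fst (fst r)) / 2 /\
  snd (snd r') - fst (snd r') = (snd (snd r) - fst (snd r)) / 2.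

Lemma bisect_step r : bad r -> exists r', bad r' /\ half r r'.
Proof.
destruct r as [[a b] [c d]]. intros [[I1 [I2 [I3 [I4 [I5 I6]]]]] N]. simpl in *.
destruct (classic (P a ((a + b) / 2) c ((c + d) / 2))) as [E1|E1];
  [|exists ((a, (a + b) / 2), (c, (c + d) / 2)); unfold bad, half, inR; simpl; repeat split; try lra; assumption].
destruct (classic (P ((a + b) / 2) b c ((c + d) / 2))) as [E2|E2];
  [|exists (((a + b) / 2, b), (c, (c + d) / 2)); unfold bad, half, inR; simpl; repeat split; try lra; assumption].
destruct (classic (P a ((a + b) / 2) ((c + d) / 2) d)) as [E3|E3];
  [|exists ((a, (a + b) / 2), ((c + d) / 2, d)); unfold bad, half, inR; simpl; repeat split; try lra; assumption].
destruct (classic (P ((a + b) / 2) b ((c + d) / 2) d)) as [E4|E4];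
  [|exists (((a + b) / 2, b), ((c + d) / 2, d)); unfold bad, half, inR; simpl; repeat split; try lra; assumption].
exfalso. apply N, quarter; assumption.
Qed.

Lemma nested_point (u v : nat -> R) : (forall n, u n <= u (S n)) -> (forall n, v (S n) <= v n) ->
  (forall n, u n <= v n) -> exists x, forall n, u n <= x <= v n.
Proof.
intros Hu Hv Huv.
assert (Mu : forall n k, u n <= u (n + k)%nat).
{ intros n k. induction k as [|k IH]; [rewrite Nat.add_0_r; lra|].
  rewrite Nat.add_succ_r. eapply Rle_trans; [exact IH|apply Hu]. }
assert (Mv : forall n k, v (n + k)%nat <= v n).
{ intros n k. induction k as [|k IH]; [rewrite Nat.add_0_r; lra|].
  rewrite Nat.add_succ_r. eapply Rle_trans; [apply Hv|exact IH]. }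
assert (B : forall n m, u n <= v m).
{ intros n m. eapply Rle_trans; [apply (Mu n m)|]. eapply Rle_trans; [apply Huv|].
  rewrite Nat.add_comm. apply Mv. }
destruct (completeness (fun x => exists n, x = u n)) as [x [Hx1 Hx2]].
- exists (v O). intros x [n ->]. apply B.
- exists (u O), O. reflexivity.
- exists x. intros n. split.
  + apply Hx1. exists n. reflexivity.
  + apply Hx2. intros y [m ->]. apply B.
Qed.

(** A property of rectangles that passes from the four quarters to the whole and
    holds for all small rectangles around each point holds globally: a failure
    would propagate to nested rectangles shrinking to a point. Besides Goursat's
    argument this serves for covering arguments, also on intervals, taken as
    rectangles of height 0. *)
Lemma bisection : P a0 b0 c0 d0.
Proof.
apply NNPP. intros N.
assert (B0 : bad ((a0, b0), (c0, d0))) by (unfold bad, inR; simpl; repeat split; try lra; assumption).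
set (next := fun r : {r | bad r} =>
  let (r', H) := constructive_indefinite_description _ (bisect_step (proj1_sig r) (proj2_sig r)) in
  exist bad r' (proj1 H)).
assert (Hnext : forall r, half (proj1_sig r) (proj1_sig (next r))).
{ intros r. unfold next. destruct (constructive_indefinite_description _ _) as [r' [Ha Hb]]. exact Hb. }
set (s := fix s (n : nat) := match n with O => exist bad _ B0 | S n => next (s n) end).
set (a := fun n => fst (fst (proj1_sig (s n)))). set (b := fun n => snd (fst (proj1_sig (s n)))).
set (c := fun n => fst (snd (proj1_sig (s n)))). set (d := fun n => snd (snd (proj1_sig (s n)))).
assert (Hs : forall n, a n <= a (S n) /\ b (S n) <= b n /\ c n <= c (S n) /\ d (S n) <= d n /\
  b (S n) - a (S n) = (b n - a n) / 2 /\ d (S n) - c (S n) = (d n - c n) / 2).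
{ intros n. exact (Hnext (s n)). }
assert (Hb : forall n, bad ((a n, b n), (c n, d n))).
{ intros n. assert (H := proj2_sig (s n)). unfold a, b, c, d.
  destruct (proj1_sig (s n)) as [[? ?] [? ?]]. exact H. }
destruct (nested_point a b) as [x Hx]; try (intros n; destruct (Hs n); tauto).
{ intros n. destruct (Hb n) as [Hn _]. unfold inR in Hn. simpl in Hn. tauto. }
destruct (nested_point c d) as [y Hy]; try (intros n; destruct (Hs n); tauto).
{ intros n. destruct (Hb n) as [Hn _]. unfold inR in Hn. simpl in Hn. tauto. }
assert (Hx0 := Hx O). assert (Hy0 := Hy O). simpl in Hx0, Hy0.
destruct (local x y) as [e [He1 He2]]; [exact Hx0|exact Hy0|].
assert (Hw : forall n, b n - a n = (b0 - a0) * (/ 2) ^ n /\ d n - c n = (d0 - c0) * (/ 2) ^ n).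
{ induction n as [|n [IH1 IH2]]; [simpl; unfold a, b, c, d; simpl; lra|].
  destruct (Hs n) as [_ [_ [_ [_ [S1 S2]]]]]. rewrite S1 S2 IH1 IH2. simpl. lra. }
set (L := (b0 - a0) + (d0 - c0) + 1).
destruct (pow_lt_1_zero (/ 2)) with (y := e / L) as [n Hn].
{ rewrite Rabs_right; lra. }
{ apply Rdiv_lt_0_compat; [exact He1|unfold L; lra]. }
specialize (Hn n (le_n n)). rewrite Rabs_right in Hn; [|apply Rle_ge, pow_le; lra].
assert (Hp : 0 < (/ 2) ^ n) by (apply pow_lt; lra).
assert (HL : L * (/ 2) ^ n < e).
{ apply (Rmult_lt_compat_l L) in Hn; [|unfold L; lra].
  replace (L * (e / L)) with e in Hn by (field; unfold L; lra). exact Hn. }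
destruct (Hb n) as [[I1 [I2 [I3 [I4 [I5 I6]]]]] NP]. simpl in *.
destruct (Hw n) as [W1 W2].
apply NP, He2; try assumption; try apply Hx; try apply Hy.
- rewrite W1. eapply Rle_lt_trans; [|exact HL]. apply Rmult_le_compat_r; unfold L; lra.
- rewrite W2. eapply Rle_lt_trans; [|exact HL]. apply Rmult_le_compat_r; unfold L; lra.
Qed.
End Bisect.

Section Goursat.
Context {Y : cspace}.
Implicit Types (h k : R * R -> Y) (a b c d : R).

Lemma is_derive_scal_const (f : R -> R) (f' x : R) (y : Y) :
  is_derive f x f' -> is_derive (fun t => scal (f t) y) x (scal f' y).
Proof. intros H. apply (is_derive_scal_l (V := Y) f x f' y H). Qed.

Lemma continuous_scal_const (f : R -> R) (x : R) (y : Y) :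
  continuous f x -> continuous (fun t => scal (f t) y : Y) x.
Proof.
intros H. apply (continuous_comp f (fun r => scal r y) x H).
apply (filterlim_scal_l (V := Y)).
Qed.

Lemma RInt_scal_const (f F : R -> R) (y : Y) (p q : R) :
  (forall x, Rmin p q <= x <= Rmax p q -> is_derive F x (f x)) ->
  (forall x, Rmin p q <= x <= Rmax p q -> continuous f x) ->
  is_RInt (fun x => scal (f x) y) p q (scal (F q - F p) y).
Proof.
intros HF Hf.
replace (scal (F q - F p) y) with (minus (scal (F q) y) (scal (F p) y)).
- apply (is_RInt_derive (V := Y) (fun x => scal (F x) y)).
  + intros x Hx. apply is_derive_scal_const, HF, Hx.
  + intros x Hx. apply continuous_scal_const, Hf, Hx.
- symmetry. vec_coefs Y; rewrite RtoC_minus. ring.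
Qed.

Lemma RInt_two (f F g G : R -> R) (y z : Y) (p q : R) :
  (forall x, Rmin p q <= x <= Rmax p q -> is_derive F x (f x)) ->
  (forall x, Rmin p q <= x <= Rmax p q -> continuous f x) ->
  (forall x, Rmin p q <= x <= Rmax p q -> is_derive G x (g x)) ->
  (forall x, Rmin p q <= x <= Rmax p q -> continuous g x) ->
  RInt (fun x => plus (scal (f x) y) (scal (g x) z)) p q
  = plus (scal (F q - F p) y) (scal (G q - G p) z).
Proof.
intros HF Hf HG Hg. apply (is_RInt_unique (V := Y)), (is_RInt_plus (V := Y)); apply RInt_scal_const; assumption.
Qed.

Lemma rect_const (y : Y) a b c d : rect (fun _ => y) a b c d = zero.
Proof. unfold rect, hseg, vseg. rewrite !(RInt_const (V := Y)). vec Y. Qed.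

Lemma rect_linear (w : C) (l : Y) a b c d : rect (fun z => cmul (Cminus z w) l) a b c d = zero.
Proof.
assert (D1 : forall t x, is_derive (fun x => (x - t) ^ 2 / 2) x (x - t)).
{ intros t x. auto_derive; [trivial|field]. }
assert (D2 : forall t x, is_derive (fun x => t * x) x t).
{ intros t x. auto_derive; [trivial|ring]. }
assert (C1 : forall t x, continuous (fun x => x - t) x).
{ intros t x. apply (ex_derive_continuous (fun x => x - t)). auto_derive. trivial. }
assert (C2 : forall t x : R, continuous (fun _ : R => t) x) by (intros; apply continuous_const).
assert (HS : forall y p q, hseg (fun z => cmul (Cminus z w) l) p q y =
   plus (scal ((q - fst w) ^ 2 / 2 - (p - fst w) ^ 2 / 2) l) (scal ((y - snd w) * q - (y - snd w) * p) (ci l))).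
{ intros y p q. unfold hseg.
  apply (RInt_two (fun x => x - fst w) (fun x => (x - fst w) ^ 2 / 2) (fun _ => y - snd w) (fun x => (y - snd w) * x)); auto. }
assert (VS : forall x p q, vseg (fun z => cmul (Cminus z w) l) x p q =
   ci (plus (scal ((x - fst w) * q - (x - fst w) * p) l) (scal ((q - snd w) ^ 2 / 2 - (p - snd w) ^ 2 / 2) (ci l)))).
{ intros x p q. unfold vseg. f_equal.
  apply (RInt_two (fun _ => x - fst w) (fun y => (x - fst w) * y) (fun y => y - snd w) (fun y => (y - snd w) ^ 2 / 2)); auto. }
unfold rect. rewrite !HS !VS. vec_coefs Y;
rewrite /RtoC /Ci /Cmult /Cplus /=. apply injective_projections; simpl; field.
Qed.

(** h differs from an affine function, whose integral vanishes, by (w - z)(q w - q z). *)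
Lemma rect_cauchy_est h a b c d (x y e : R) (q : R * R -> Y) :
  a <= x <= b -> c <= y <= d -> contR h a b c d ->
  (forall w, minus (h w) (h (x, y)) = cmul (Cminus w (x, y)) (q w)) ->
  (forall w, onbd a b c d (fst w) (snd w) -> norm (minus (q w) (q (x, y))) <= e) ->
  norm (rect h a b c d) <= 4 * e * ((b - a) + (d - c)) ^ 2.
Proof.
intros Hx Hy Hh Hq He.
set (g := fun w => minus (h w) (plus (h (x, y)) (cmul (Cminus w (x, y)) (q (x, y))))).
assert (Hg : forall w, g w = cmul (Cminus w (x, y)) (minus (q w) (q (x, y)))).
{ intros w. unfold g.
  transitivity (minus (minus (h w) (h (x, y))) (cmul (Cminus w (x, y)) (q (x, y)))); [vec Y|].
  rewrite Hq. vec Y. }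
assert (La : forall u v, cont (fun w => cmul (Cminus w (x, y)) (q (x, y))) (u, v)).
{ intros u v. apply cont_cmul; [|apply cont_const].
  intros eps Heps. exists eps. split; [exact Heps|]. intros w Hw.
  replace (Cminus _ _) with (Cminus w (u, v)) by ring. exact Hw. }
assert (Cg : forall u v, onbd a b c d u v -> cont g (u, v)).
{ intros u v Huv. unfold g, minus. apply cont_plus; [apply Hh; unfold onbd in Huv; lra|].
  apply (cont_ext_loc (fun w => cmul (RtoC (-1)) (plus (h (x, y)) (cmul (Cminus w (x, y)) (q (x, y))))) _ _ 1); [lra| |].
  - intros w _. vec Y.
  - apply cont_cmul; [|apply cont_plus; [apply cont_const|apply La]].
    intros eps Heps. exists 1. split; [lra|]. intros w _. rewrite Cmod_m0. exact Heps. }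
replace (rect h a b c d) with (rect g a b c d).
- eapply Rle_trans.
  + apply (rect_bound g a b c d (2 * ((b - a) + (d - c)) * e)); try lra.
    intros u v Huv. split; [apply Cg, Huv|]. rewrite Hg.
    eapply Rle_trans; [apply norm_cmul|].
    assert (He' := He (u, v) Huv).
    apply Rmult_le_compat; [|apply nge0| |exact He'].
    * assert (H1 := Cmod_ge_0 (Cminus (u, v) (x, y))). lra.
    * apply Rmult_le_compat_l; [lra|]. eapply Rle_trans; [apply Cmod_le_sum|].
      unfold onbd in Huv. simpl.
      apply Rplus_le_compat; apply Rabs_le; lra.
  + right. ring.
- assert (E : rect h a b c d = plus (rect g a b c d)
     (plus (rect (fun _ => h (x, y)) a b c d) (rect (fun w => cmul (Cminus w (x, y)) (q (x, y))) a b c d))).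
  { rewrite -!rect_plus; try lra.
    - apply rect_ext; try lra. intros u v _. unfold g. vec Y.
    - intros u v Huv. split; [apply Cg, Huv|apply cont_plus; [apply cont_const|apply La]].
    - intros u v Huv. split; [apply cont_const|apply La]. }
  rewrite E rect_const rect_linear. vec Y.
Qed.

Definition cdiffR h a b c d := forall x y, a <= x <= b -> c <= y <= d -> cdiff h (x, y).

Lemma norm_eq0 (y : Y) : (forall eps, 0 < eps -> norm y <= eps) -> y = zero.
Proof.
intros H. apply (norm_eq_zero (V := Y)). apply Rle_antisym; [|apply nge0].
apply le_epsilon. intros eps He. rewrite Rplus_0_l. apply H, He.
Qed.

(** Goursat's argument: the bound eps * (half perimeter)^2 is inherited from the
    quarters and holds for small rectangles by differentiability. *)
Lemma goursat h a b c d : a <= b -> c <= d -> cdiffR h a b c d -> rect h a b c d = zero.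
Proof.
intros Hab Hcd Hh.
assert (Hc : contR h a b c d) by (intros x y Hx Hy; apply cdiff_cont, Hh; assumption).
apply norm_eq0. intros eps He.
set (S := ((b - a) + (d - c)) ^ 2 + 1). assert (HS : 0 < S) by (unfold S; nra).
apply Rle_trans with (eps / S * ((b - a) + (d - c)) ^ 2).
2:{ apply Rmult_le_reg_r with S; [exact HS|].
    replace (eps / S * (b - a + (d - c)) ^ 2 * S) with (eps * (b - a + (d - c)) ^ 2) by (field; lra).
    apply Rmult_le_compat_l; unfold S; lra. }
apply (bisection (fun a b c d => norm (rect h a b c d) <= eps / S * ((b - a) + (d - c)) ^ 2) a b c d);
  [| |exact Hab|exact Hcd].
- intros a' b' c' d' A1 A2 A3 A4 A5 A6 Q1 Q2 Q3 Q4.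
  set (m := (a' + b') / 2) in *. set (n := (c' + d') / 2) in *.
  rewrite (rect_split_x h a' m b' c' d'); try (unfold m; lra); [|intros x y Hx Hy; apply Hc; lra].
  rewrite (rect_split_y h a' m c' n d'); try (unfold m, n; lra);
    [|intros x y Hx Hy; apply Hc; unfold m in *; lra].
  rewrite (rect_split_y h m b' c' n d'); try (unfold m, n; lra);
    [|intros x y Hx Hy; apply Hc; unfold m in *; lra].
  eapply Rle_trans; [apply ntri|].
  eapply Rle_trans; [apply Rplus_le_compat; apply ntri|].
  replace ((b' - a' + (d' - c')) ^ 2) with (4 * (m - a' + (n - c')) ^ 2) by (unfold m, n; field).
  replace (b' - m) with (m - a') in Q2 by (unfold m; field).
  replace (d' - n) with (n - c') in Q3 by (unfold n; field).
  replace (b' - m) with (m - a') in Q4 by (unfold m; field).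
  replace (d' - n) with (n - c') in Q4 by (unfold n; field). lra.
- intros x y Hx Hy. destruct (Hh x y Hx Hy) as [q [Hq E]].
  assert (He4 : 0 < eps / S / 4) by (apply Rdiv_lt_0_compat; [apply Rdiv_lt_0_compat|]; lra).
  destruct (Hq (eps / S / 4) He4) as [e [He1 He2]].
  exists (e / 2). split; [lra|].
  intros a' b' c' d' A1 A2 A3 A4 A5 A6 W1 W2.
  replace (eps / S) with (4 * (eps / S / 4)) by (field; lra).
  apply (rect_cauchy_est h a' b' c' d' x y (eps / S / 4) q); try assumption.
  + intros u v Hu Hv. apply Hc; lra.
  + intros w Hw. left. apply He2. destruct w as [u v]. unfold onbd in Hw; simpl in Hw.
    eapply Rle_lt_trans; [apply Cmod_le_sum|]. simpl.
    assert (Rabs (u + - x) < e / 2) by (apply Rabs_lt_between; lra).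
    assert (Rabs (v + - y) < e / 2) by (apply Rabs_lt_between; lra). lra.
Qed.
End Goursat.

(** * Cauchy's formula for rectangles *)

Section CauchyRect.
Context {Y : cspace}.
Implicit Types (h k : R * R -> Y) (a b c d : R).

Lemma cont_bounded h a b c d : a <= b -> c <= d -> contR h a b c d ->
  exists M, 0 <= M /\ forall x y, a <= x <= b -> c <= y <= d -> norm (h (x, y)) <= M.
Proof.
intros Hab Hcd Hc.
apply (bisection (fun a b c d => exists M, 0 <= M /\ forall x y, a <= x <= b -> c <= y <= d -> norm (h (x, y)) <= M) a b c d); try assumption.
- intros a' b' c' d' A1 A2 A3 A4 A5 A6 [M1 [P1 Q1]] [M2 [P2 Q2]] [M3 [P3 Q3]] [M4 [P4 Q4]].
  exists (M1 + M2 + M3 + M4). split; [lra|]. intros x y Hx Hy.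
  destruct (Rle_dec x ((a' + b') / 2)); destruct (Rle_dec y ((c' + d') / 2)).
  + assert (norm (h (x, y)) <= M1) by (apply Q1; lra). lra.
  + assert (norm (h (x, y)) <= M3) by (apply Q3; lra). lra.
  + assert (norm (h (x, y)) <= M2) by (apply Q2; lra). lra.
  + assert (norm (h (x, y)) <= M4) by (apply Q4; lra). lra.
- intros x y Hx Hy. destruct (Hc x y Hx Hy 1) as [e [He1 He2]]; [lra|].
  exists (e / 2). split; [lra|]. intros a' b' c' d' A1 A2 A3 A4 A5 A6 W1 W2.
  exists (norm (h (x, y)) + 1). split; [assert (H := nge0 (h (x, y))); lra|].
  intros u v Hu Hv.
  assert (H : norm (minus (h (u, v)) (h (x, y))) < 1).
  { apply He2. eapply Rle_lt_trans; [apply Cmod_le_sum|]. simpl.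
    assert (Rabs (u + - x) < e / 2) by (apply Rabs_lt_between; lra).
    assert (Rabs (v + - y) < e / 2) by (apply Rabs_lt_between; lra). lra. }
  replace (h (u, v)) with (plus (minus (h (u, v)) (h (x, y))) (h (x, y))) by vec Y.
  eapply Rle_trans; [apply ntri|]. lra.
Qed.

(** Continuity at p suffices: the rectangles away from p contribute nothing, and
    the remaining one around p can be taken with arbitrarily small perimeter. *)
Lemma rect_except h a b c d (p : R * R) : a <= b -> c <= d -> contR h a b c d ->
  (forall a' b' c' d', a <= a' -> a' <= b' -> b' <= b -> c <= c' -> c' <= d' -> d' <= d ->
    ~ (a' <= fst p <= b' /\ c' <= snd p <= d') -> rect h a' b' c' d' = zero) ->
  rect h a b c d = zero.
Proof.
intros Hab Hcd Hc H0. destruct p as [px py]. simpl in H0.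
destruct (classic (a <= px <= b /\ c <= py <= d)) as [[Hpx Hpy]|Np]; [|apply H0; lra].
destruct (cont_bounded h a b c d Hab Hcd Hc) as [M [HM HB]].
apply norm_eq0. intros eps He.
set (t := eps / (8 * (M + 1))). assert (Ht : 0 < t) by (apply Rdiv_lt_0_compat; lra).
set (a' := Rmax a (px - t)). set (b' := Rmin b (px + t)).
set (c' := Rmax c (py - t)). set (d' := Rmin d (py + t)).
assert (Ha' : a <= a' /\ px - t <= a' <= px /\ (a' = a \/ a' < px)).
{ unfold a', Rmax. destruct (Rle_dec a (px - t)); lra. }
assert (Hb' : b' <= b /\ px <= b' <= px + t /\ (b' = b \/ px < b')).
{ unfold b', Rmin. destruct (Rle_dec b (px + t)); lra. }
assert (Hc' : c <= c' /\ py - t <= c' <= py /\ (c' = c \/ c' < py)).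
{ unfold c', Rmax. destruct (Rle_dec c (py - t)); lra. }
assert (Hd' : d' <= d /\ py <= d' <= py + t /\ (d' = d \/ py < d')).
{ unfold d', Rmin. destruct (Rle_dec d (py + t)); lra. }
assert (S : forall u1 u2 v1 v2, a <= u1 -> u1 <= u2 -> u2 <= b -> c <= v1 -> v1 <= v2 -> v2 <= d ->
  contR h u1 u2 v1 v2) by (intros u1 u2 v1 v2 ? ? ? ? ? ? x y Hx Hy; apply Hc; lra).
rewrite (rect_split_x h a a' b); [|lra|lra|apply S; lra].
rewrite (rect_split_x h a' b' b); [|lra|lra|apply S; lra].
rewrite (rect_split_y h a' b' c c' d); [|lra|lra|apply S; lra].
rewrite (rect_split_y h a' b' c' d' d); [|lra|lra|apply S; lra].
assert (E1 : rect h a a' c d = zero).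
{ destruct Ha' as [? [? [->|?]]]; [apply rect_deg_x|apply H0; lra]. }
assert (E2 : rect h b' b c d = zero).
{ destruct Hb' as [? [? [->|?]]]; [apply rect_deg_x|apply H0; lra]. }
assert (E3 : rect h a' b' c c' = zero).
{ destruct Hc' as [? [? [->|?]]]; [apply rect_deg_y|apply H0; lra]. }
assert (E4 : rect h a' b' d' d = zero).
{ destruct Hd' as [? [? [->|?]]]; [apply rect_deg_y|apply H0; lra]. }
rewrite E1 E2 E3 E4.
replace (plus zero _) with (rect h a' b' c' d') by vec Y.
eapply Rle_trans.
- apply (rect_bound h a' b' c' d' M); try lra.
  intros x y Hxy. unfold onbd in Hxy. split; [apply Hc; lra|apply HB; lra].
- apply Rle_trans with (2 * M * (4 * t)).
  + apply Rmult_le_compat_l; lra.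
  + unfold t. apply Rmult_le_reg_r with (M + 1); [lra|].
    replace (2 * M * (4 * (eps / (8 * (M + 1)))) * (M + 1)) with (M * eps) by (field; lra). nra.
Qed.

(** Differentiability may fail at 0, the point that corresponds to infinity under
    the change of variable q = 1 / z + alpha. *)
Definition cdiffR0 h a b c d :=
  contR h a b c d /\ forall x y, a <= x <= b -> c <= y <= d -> (x, y) <> (0, 0) -> cdiff h (x, y).

Lemma goursat0 h a b c d : a <= b -> c <= d -> cdiffR0 h a b c d -> rect h a b c d = zero.
Proof.
intros Hab Hcd [Hc Hh]. apply (rect_except h a b c d (0, 0) Hab Hcd Hc).
intros a' b' c' d' ? ? ? ? ? ? N. apply goursat; try assumption.
intros x y Hx Hy. apply Hh; try lra. intros E. injection E. intros -> ->. apply N. simpl. lra.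
Qed.

(** The primitives on the sides are explicit, a logarithm and an arc tangent; the
    logarithms cancel and the arc tangents add up to 2 pi by
    atan x + atan (1 / x) = pi / 2. *)
Lemma rect_cinv (wx wy : R) (y : Y) a b c d : a < wx < b -> c < wy < d ->
  rect (fun z => cmul (Cinv (Cminus z (wx, wy))) y) a b c d = scal (2 * PI) (ci y).
Proof.
intros Hx Hy.
set (L := fun u v => ln (u ^ 2 + v ^ 2) / 2).
assert (P : forall u v : R, u <> 0 \/ v <> 0 -> 0 < u ^ 2 + v ^ 2).
{ intros u v [H|H]; [assert (0 < u ^ 2) by (apply pow2_gt_0; exact H)|assert (0 < v ^ 2) by (apply pow2_gt_0; exact H)];
  assert (Ha := pow2_ge_0 u); assert (Hb := pow2_ge_0 v); lra. }
assert (HS : forall yy p q, p <= q -> yy <> wy -> hseg (fun z => cmul (Cinv (Cminus z (wx, wy))) y) p q yy =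
  plus (scal (L (q - wx) (yy - wy) - L (p - wx) (yy - wy)) y)
       (scal (- atan ((q - wx) / (yy - wy)) - - atan ((p - wx) / (yy - wy))) (ci y))).
{ intros yy p q Hpq Hyy. set (v := yy - wy). assert (Hv : v <> 0) by (unfold v; lra). unfold hseg.
  apply (RInt_two (fun x => (x - wx) / ((x - wx) ^ 2 + v ^ 2)) (fun x => L (x - wx) v)
                  (fun x => - v / ((x - wx) ^ 2 + v ^ 2)) (fun x => - atan ((x - wx) / v))).
  - intros x _. assert (H := P (x - wx) v (or_intror Hv)). unfold L. auto_derive.
    + simpl in H. lra.
    + simpl. field. simpl in H. nra.
  - intros x _. assert (H := P (x - wx) v (or_intror Hv)).
    apply (ex_derive_continuous (fun x => (x - wx) / ((x - wx) ^ 2 + v ^ 2))). auto_derive. simpl in H. lra.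
  - intros x _. assert (H := P (x - wx) v (or_intror Hv)). auto_derive; [trivial|].
    field. repeat split; try exact Hv; simpl in H; nra.
  - intros x _. assert (H := P (x - wx) v (or_intror Hv)).
    apply (ex_derive_continuous (fun x => - v / ((x - wx) ^ 2 + v ^ 2))). auto_derive. simpl in H. lra. }
assert (VS : forall xx p q, p <= q -> xx <> wx -> vseg (fun z => cmul (Cinv (Cminus z (wx, wy))) y) xx p q =
  ci (plus (scal (atan ((q - wy) / (xx - wx)) - atan ((p - wy) / (xx - wx))) y)
       (scal (- L (xx - wx) (q - wy) - - L (xx - wx) (p - wy)) (ci y)))).
{ intros xx p q Hpq Hxx. set (u := xx - wx). assert (Hu : u <> 0) by (unfold u; lra). unfold vseg. f_equal.
  apply (RInt_two (fun t => u / (u ^ 2 + (t - wy) ^ 2)) (fun t => atan ((t - wy) / u))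
                  (fun t => - (t - wy) / (u ^ 2 + (t - wy) ^ 2)) (fun t => - L u (t - wy))).
  - intros t _. assert (H := P u (t - wy) (or_introl Hu)). auto_derive; [trivial|].
    field. repeat split; try exact Hu; simpl in H; nra.
  - intros t _. assert (H := P u (t - wy) (or_introl Hu)).
    apply (ex_derive_continuous (fun t => u / (u ^ 2 + (t - wy) ^ 2))). auto_derive. simpl in H. lra.
  - intros t _. assert (H := P u (t - wy) (or_introl Hu)). unfold L. auto_derive.
    + simpl in H. lra.
    + simpl. field. simpl in H. nra.
  - intros t _. assert (H := P u (t - wy) (or_introl Hu)).
    apply (ex_derive_continuous (fun t => - (t - wy) / (u ^ 2 + (t - wy) ^ 2))). auto_derive. simpl in H. lra. }
assert (AI : forall s t, 0 < s -> 0 < t -> atan (s / t) = PI / 2 - atan (t / s)).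
{ intros s t Hs Ht. replace (s / t) with (/ (t / s)) by (field; lra). apply atan_inv.
  apply Rdiv_lt_0_compat; assumption. }
unfold rect. rewrite !HS; try lra. rewrite !VS; try lra.
set (l := wx - a). set (r := b - wx). set (n := wy - c). set (s := d - wy).
assert (0 < l) by (unfold l; lra). assert (0 < r) by (unfold r; lra).
assert (0 < n) by (unfold n; lra). assert (0 < s) by (unfold s; lra).
replace (a - wx) with (- l) by (unfold l; ring). replace (c - wy) with (- n) by (unfold n; ring).
replace (- l / - n) with (l / n) by (field; lra). replace (r / - n) with (- (r / n)) by (field; lra).
replace (- l / s) with (- (l / s)) by (field; lra).
replace (- n / - l) with (n / l) by (field; lra). replace (s / - l) with (- (s / l)) by (field; lra).
replace (- n / r) with (- (n / r)) by (field; lra).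
rewrite !atan_opp (AI l n) // (AI r n) // (AI l s) // (AI r s) //.
assert (EL : forall u v u' v', u ^ 2 = u' ^ 2 -> v ^ 2 = v' ^ 2 -> L u v = L u' v').
{ intros u v u' v' E1 E2. unfold L. rewrite E1 E2. reflexivity. }
rewrite (EL (- l) (- n) l n); [|ring|ring]. rewrite (EL (- l) s l s); [|ring|ring].
rewrite (EL r (- n) r n); [|ring|ring].
vec_coefs Y; rewrite /RtoC /Ci /Cmult /Cplus /=; apply injective_projections; simpl; field.
Qed.

(** The difference quotient of h at w is continuous at w and differentiable
    elsewhere, so its integral vanishes; the rest is the constant h w. *)
Lemma cauchy_rect h a b c d (w : R * R) : a < fst w < b -> c < snd w < d -> cdiffR0 h a b c d ->
  w <> (0, 0) -> rect (fun z => cmul (Cinv (Cminus z w)) (h z)) a b c d = scal (2 * PI) (ci (h w)).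
Proof.
intros Hx Hy [Hc Hh] Hw. destruct w as [wx wy]. simpl in Hx, Hy.
destruct (Hh wx wy) as [q [Hq E]]; [lra|lra|exact Hw|].
assert (Eq : forall z, z <> (wx, wy) -> q z = cmul (Cinv (Cminus z (wx, wy))) (minus (h z) (h (wx, wy)))).
{ intros z Hz. rewrite E cmul_cmul Cinv_l; [rewrite cmul_one; reflexivity|apply Cminus_neq, Hz]. }
assert (Hloc : forall z, z <> (wx, wy) -> exists e, 0 < e /\ forall z', Cmod (Cminus z' z) < e -> z' <> (wx, wy)).
{ intros z Hz. exists (Cmod (Cminus z (wx, wy))). split; [apply Cmod_gt_0, Cminus_neq, Hz|].
  intros z' Hz' ->. rewrite Cmod_minus_sym in Hz'. lra. }
assert (Cm : forall z, cont h z -> cont (fun z => minus (h z) (h (wx, wy))) z).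
{ intros z Hz. apply (cont_plus h (fun _ => opp (h (wx, wy)))); [exact Hz|apply cont_const]. }
assert (Dm : forall z, cdiff h z -> cdiff (fun z => minus (h z) (h (wx, wy))) z).
{ intros z Hz. apply (cdiff_plus h (fun _ => opp (h (wx, wy)))); [exact Hz|apply cdiff_const]. }
assert (Cq : contR q a b c d).
{ intros x y Hx' Hy'. destruct (classic ((x, y) = (wx, wy))) as [->|N]; [exact Hq|].
  destruct (Hloc _ N) as [e [He1 He2]].
  apply (cont_ext_loc (fun z => cmul (Cinv (Cminus z (wx, wy))) (minus (h z) (h (wx, wy)))) q (x, y) e He1).
  - intros z Hz. symmetry. apply Eq, He2, Hz.
  - apply cont_cmul; [apply ccont_inv, N|apply Cm, Hc; assumption]. }
assert (Dq : forall x y, a <= x <= b -> c <= y <= d -> (x, y) <> (0, 0) -> (x, y) <> (wx, wy) -> cdiff q (x, y)).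
{ intros x y Hx' Hy' N0 N. destruct (Hloc _ N) as [e [He1 He2]].
  apply (cdiff_ext_loc (fun z => cmul (Cinv (Cminus z (wx, wy))) (minus (h z) (h (wx, wy)))) q (x, y) e He1).
  - intros z Hz. symmetry. apply Eq, He2, Hz.
  - apply cdiff_cmul; [apply ccdiff_inv, N|apply Dm, Hh; assumption]. }
assert (Zq : rect q a b c d = zero).
{ apply (rect_except q a b c d (wx, wy)); try lra; [exact Cq|].
  intros a' b' c' d' ? ? ? ? ? ? N. apply goursat0; try assumption. split.
  - intros x y ? ?. apply Cq; lra.
  - intros x y ? ? ?. apply Dq; try lra; try assumption. intros E'. injection E'. intros -> ->.
    apply N. simpl. lra. }
assert (Nb : forall x y, onbd a b c d x y -> (x, y) <> (wx, wy)).
{ intros x y Hb E'. injection E'. intros -> ->. unfold onbd in Hb. lra. }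
transitivity (plus (rect q a b c d) (rect (fun z => cmul (Cinv (Cminus z (wx, wy))) (h (wx, wy))) a b c d)).
- rewrite -rect_plus; try lra.
  + apply rect_ext; try lra. intros x y Hb. rewrite (Eq _ (Nb x y Hb)). vec Y.
  + intros x y Hb. split; [apply Cq; unfold onbd in Hb; lra|].
    apply cont_cmul; [apply ccont_inv, (Nb x y Hb)|apply cont_const].
- rewrite Zq rect_cinv; try assumption. vec Y.
Qed.

Lemma cauchy_rect_out h a b c d (w : R * R) : a <= b -> c <= d ->
  ~ (a <= fst w <= b /\ c <= snd w <= d) -> cdiffR0 h a b c d ->
  rect (fun z => cmul (Cinv (Cminus z w)) (h z)) a b c d = zero.
Proof.
intros Hab Hcd N [Hc Hh].
assert (Nw : forall x y, a <= x <= b -> c <= y <= d -> (x, y) <> w).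
{ intros x y Hx Hy <-. apply N. simpl. lra. }
apply goursat0; try assumption. split.
- intros x y Hx Hy. apply cont_cmul; [apply ccont_inv, Nw; assumption|apply Hc; assumption].
- intros x y Hx Hy N0. apply cdiff_cmul; [apply ccdiff_inv, Nw; assumption|apply Hh; assumption].
Qed.
End CauchyRect.

(** * Rational approximation *)

Section Approx.
Context {Y : cspace}.
Implicit Types (h u : R * R -> Y) (K : R * R -> Prop) (l : list ((R * R) * Y)).

Definition rat l (w : R * R) : Y :=
  fold_right (fun p acc => plus (cmul (Cinv (Cminus (fst p) w)) (snd p)) acc) zero l.

Definition poles_off K l := List.Forall (fun p : (R * R) * Y => ~ K (fst p)) l.

Definition approx K u := forall eps, 0 < eps -> exists l, poles_off K l /\
  forall w, K w -> norm (minus (u w) (rat l w)) <= eps.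

Lemma rat_app l1 l2 w : rat (l1 ++ l2) w = plus (rat l1 w) (rat l2 w).
Proof.
induction l1 as [|p l1 IH]; simpl; [vec Y|]. rewrite IH. vec Y.
Qed.

Lemma rat_map c l w : rat (map (fun p => (fst p, cmul c (snd p))) l) w = cmul c (rat l w).
Proof. induction l as [|[z y] l IH]; simpl; [vec Y|]. rewrite IH. vec Y. Qed.

Lemma rat_cont l w : (forall p, In p l -> fst p <> w) -> cont (rat l) w.
Proof.
induction l as [|p l IH]; intros H.
- apply (cont_const zero).
- apply cont_plus.
  + apply cont_cmul; [|apply cont_const].
    assert (Hp : w <> fst p) by (intros E; apply (H p); [left; reflexivity|congruence]).
    intros eps He. destruct (ccont_inv (fst p) w Hp eps He) as [d [Hd1 Hd2]].
    exists d. split; [exact Hd1|]. intros z Hz.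
    assert (A : forall u v : C, Cinv (Cminus u v) = Copp (Cinv (Cminus v u))).
    { intros u v. destruct (classic (Cminus v u = RtoC 0)) as [E|E].
      - replace (Cminus u v) with (Copp (Cminus v u)) by ring. rewrite E.
        apply injective_projections; simpl; unfold Rdiv; ring.
      - field. split; [exact E|]. intros E'. apply E.
        replace (Cminus v u) with (Copp (Cminus u v)) by ring. rewrite E'. ring. }
    rewrite (A (fst p) z) (A (fst p) w).
    replace (Cminus _ _) with (Copp (Cminus (Cinv (Cminus z (fst p))) (Cinv (Cminus w (fst p))))) by ring.
    rewrite Cmod_opp. apply Hd2, Hz.
  + apply IH. intros p' Hp'. apply H. right. exact Hp'.
Qed.

Lemma approx_ext K u v : (forall w, K w -> u w = v w) -> approx K u -> approx K v.
Proof.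
intros E H eps He. destruct (H eps He) as [l [Hl1 Hl2]]. exists l. split; [exact Hl1|].
intros w Hw. rewrite -E; [apply Hl2|]; exact Hw.
Qed.

Lemma approx_zero K : approx K (fun _ => zero).
Proof.
intros eps He. exists nil. split; [constructor|]. intros w _.
eapply Rle_trans; [right; apply (nminus_diag (zero : Y))|lra].
Qed.

Lemma approx_plus K u v : approx K u -> approx K v -> approx K (fun w => plus (u w) (v w)).
Proof.
intros Hu Hv eps He. destruct (Hu (eps / 2)) as [l1 [A1 B1]]; [lra|].
destruct (Hv (eps / 2)) as [l2 [A2 B2]]; [lra|]. exists (l1 ++ l2). split.
- apply Forall_app. split; assumption.
- intros w Hw. rewrite rat_app.
  norm_as Y (plus (minus (u w) (rat l1 w)) (minus (v w) (rat l2 w))).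
  eapply Rle_trans; [apply ntri|]. assert (H1 := B1 w Hw). assert (H2 := B2 w Hw). lra.
Qed.

Lemma approx_cmul K c u : approx K u -> approx K (fun w => cmul c (u w)).
Proof.
intros Hu eps He. assert (Hc := Cmod_ge_0 c).
destruct (Hu (eps / (2 * Cmod c + 1))) as [l [A1 B1]]; [apply Rdiv_lt_0_compat; lra|].
exists (map (fun p => (fst p, cmul c (snd p))) l). split.
- unfold poles_off. apply List.Forall_forall. intros p Hp. apply in_map_iff in Hp.
  destruct Hp as [p' [<- Hp']]. simpl. exact (proj1 (List.Forall_forall _ _) A1 p' Hp').
- intros w Hw. rewrite rat_map.
  norm_as Y (cmul c (minus (u w) (rat l w))).
  eapply Rle_trans; [apply norm_cmul|]. assert (H := B1 w Hw).
  apply Rle_trans with ((2 * Cmod c + 1) * (eps / (2 * Cmod c + 1))); [|right; field; lra].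
  apply Rmult_le_compat; try lra. apply nge0.
Qed.

(** Closedness, in the form that bounds Cauchy kernels on K. *)
Definition pclosed K := forall z, ~ K z -> exists d, 0 < d /\ forall w, K w -> d <= Cmod (Cminus z w).

(** Riemann sums of the integral are combinations of Cauchy kernels, and they
    converge uniformly in w because the path keeps a distance from K. The path is
    parametrized by arc length, as the sides of squares are. *)
Lemma approx_path K h (p : R -> R * R) (a b : R) : pclosed K -> a <= b ->
  (forall s t, Cmod (Cminus (p s) (p t)) = Rabs (s - t)) ->
  (forall t, a <= t <= b -> ~ K (p t) /\ cont h (p t)) ->
  approx K (fun w => RInt (fun t => cmul (Cinv (Cminus (p t) w)) (h (p t))) a b).
Proof.
intros HK Hab Hp H eps He.
set (e := eps / (b - a + 1)). assert (Hepos : 0 < e) by (apply Rdiv_lt_0_compat; lra).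
set (F := fun w t => cmul (Cinv (Cminus (p t) w)) (h (p t)) : Y).
assert (Fc : forall w t, K w -> a <= t <= b -> continuous (F w) t).
{ intros w t Hw Ht. apply cont_continuous. intros x Hx.
  assert (C1 : cont (fun z => cmul (Cinv (Cminus z w)) (h z)) (p t)).
  { apply cont_cmul; [|apply H, Ht]. apply ccont_inv. intros E. apply (proj1 (H t Ht)).
    rewrite E. exact Hw. }
  destruct (C1 x Hx) as [d [Hd1 Hd2]]. exists d. split; [exact Hd1|]. intros t' Ht'.
  apply Hd2. rewrite Hp. exact Ht'. }
assert (Fi : forall w s t, K w -> a <= s -> s <= t -> t <= b -> ex_RInt (F w) s t).
{ intros w s t Hw H1 H2 H3. apply (ex_RInt_continuous (V := Y)). intros x Hx.
  rewrite Rmin_left in Hx; [|exact H2]. rewrite Rmax_right in Hx; [|exact H2]. apply Fc; [exact Hw|lra]. }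
assert (B : exists l, poles_off K l /\ forall w, K w -> norm (minus (RInt (F w) a b) (rat l w)) <= e * (b - a)).
{ apply (bisection (fun a b _ _ => exists l, poles_off K l /\ forall w, K w -> norm (minus (RInt (F w) a b) (rat l w)) <= e * (b - a)) a b 0 0); try lra.
  - intros a' b' c' d' A1 A2 A3 _ _ _ [l1 [P1 Q1]] [l2 [P2 Q2]] _ _.
    exists (l1 ++ l2). split; [apply Forall_app; split; assumption|].
    intros w Hw. rewrite rat_app. set (m := (a' + b') / 2) in *.
    rewrite -(RInt_Chasles (V := Y) (F w) a' m b'); try (apply Fi; [exact Hw| | |]; unfold m; lra).
    norm_as Y (plus (minus (RInt (F w) a' m) (rat l1 w)) (minus (RInt (F w) m b') (rat l2 w))).
    eapply Rle_trans; [apply ntri|]. assert (H1 := Q1 w Hw). assert (H2 := Q2 w Hw). lra.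
  - intros t y0 Ht _. destruct (H t Ht) as [Nt Ct]. destruct (HK _ Nt) as [d0 [Hd0 HK0]].
    set (N := norm (h (p t)) + 1). assert (HN : 1 <= N) by (unfold N; assert (H0 := nge0 (h (p t))); lra).
    destruct (Ct (Rmin 1 (e * d0 / 4))) as [d1 [Hd1 Hc1]].
    { apply Rmin_pos; [lra|]. apply Rdiv_lt_0_compat; [apply Rmult_lt_0_compat; assumption|lra]. }
    set (d2 := e * d0 * d0 / (8 * N)).
    assert (Hd2 : 0 < d2) by (apply Rdiv_lt_0_compat; [apply Rmult_lt_0_compat; [apply Rmult_lt_0_compat; assumption|assumption]|lra]).
    (* d1 makes the variation of h cost e / 2, d2 that of the kernel. *)
    exists (Rmin d1 (Rmin (d0 / 2) d2)). split; [repeat apply Rmin_pos; lra|].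
    intros a' b' c' d' A1 A2 A3 _ _ _ W _.
    exists ((p t, scal (b' - a') (h (p t))) :: nil). split.
    { constructor; [exact Nt|constructor]. }
    intros w Hw.
    assert (E : minus (RInt (F w) a' b') (rat ((p t, scal (b' - a') (h (p t))) :: nil) w)
       = RInt (fun s => minus (F w s) (F w t)) a' b').
    { rewrite (RInt_minus (V := Y)); [|apply Fi; [exact Hw| | |]; lra|apply (ex_RInt_const (V := Y))].
      rewrite (RInt_const (V := Y)). unfold rat, F; simpl. vec Y. }
    rewrite E. replace (e * (b' - a')) with ((b' - a') * e) by ring.
    apply (norm_RInt_le_const (V := Y) (fun s => minus (F w s) (F w t)) a' b'); [lra| |].
    2:{ apply (RInt_correct (V := Y)), (ex_RInt_minus (V := Y));
        [apply Fi; [exact Hw| | |]; lra|apply (ex_RInt_const (V := Y))]. }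
    intros s Hs. unfold F.
    assert (Hst : Cmod (Cminus (p s) (p t)) < Rmin d1 (Rmin (d0 / 2) d2)).
    { rewrite Hp. eapply Rle_lt_trans; [|exact W]. apply Rabs_le. lra. }
    assert (S1 := Rlt_le_trans _ _ _ Hst (Rmin_l _ _)).
    assert (S2 := Rlt_le_trans _ _ _ (Rlt_le_trans _ _ _ Hst (Rmin_r _ _)) (Rmin_l _ _)).
    assert (S3 := Rlt_le_trans _ _ _ (Rlt_le_trans _ _ _ Hst (Rmin_r _ _)) (Rmin_r _ _)).
    assert (Hh := Hc1 _ S1).
    assert (Hh1 := Rlt_le_trans _ _ _ Hh (Rmin_l _ _)).
    assert (Hh2 := Rlt_le_trans _ _ _ Hh (Rmin_r _ _)).
    assert (K1 := HK0 w Hw).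
    assert (K2 : d0 / 2 <= Cmod (Cminus (p s) w)).
    { assert (T := Cmod_tri_sub (Cminus (p t) w) (Cminus (p s) w)).
      replace (Cminus (Cminus (p t) w) (Cminus (p s) w)) with (Cminus (p t) (p s)) in T by ring.
      rewrite (Cmod_minus_sym (p t) (p s)) in T. lra. }
    assert (N1 : Cminus (p t) w <> RtoC 0) by (apply Cmod_gt_0; lra).
    assert (N2 : Cminus (p s) w <> RtoC 0) by (apply Cmod_gt_0; lra).
    norm_as Y (plus (cmul (Cminus (Cinv (Cminus (p s) w)) (Cinv (Cminus (p t) w))) (h (p s)))
       (cmul (Cinv (Cminus (p t) w)) (minus (h (p s)) (h (p t))))).
    eapply Rle_trans; [apply ntri|].
    eapply Rle_trans; [apply Rplus_le_compat; apply norm_cmul|].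
    assert (HhN : norm (h (p s)) <= N).
    { unfold N. replace (h (p s)) with (plus (minus (h (p s)) (h (p t))) (h (p t))) by vec Y.
      eapply Rle_trans; [apply ntri|]. lra. }
    replace (Cminus (Cinv (Cminus (p s) w)) (Cinv (Cminus (p t) w)))
      with (Cdiv (Cminus (p t) (p s)) (Cmult (Cminus (p s) w) (Cminus (p t) w))) by (field; split; assumption).
    rewrite Cmod_div; [|apply Cmult_neq_0; assumption]. rewrite Cmod_mult Cmod_inv; [|exact N1].
    rewrite (Cmod_minus_sym (p t) (p s)).
    set (x := Cmod (Cminus (p s) (p t))) in *. set (m := Cmod (Cminus (p t) w)) in *.
    set (m' := Cmod (Cminus (p s) w)) in *.
    assert (Hx0 : 0 <= x) by apply Cmod_ge_0.
    assert (T1 : x / (m' * m) <= d2 / (d0 / 2 * d0)).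
    { unfold Rdiv. apply Rmult_le_compat; [exact Hx0| |lra|].
      - left. apply Rinv_0_lt_compat, Rmult_lt_0_compat; lra.
      - apply Rinv_le_contravar; [apply Rmult_lt_0_compat; lra|]. apply Rmult_le_compat; lra. }
    assert (T2 : / m <= / d0) by (apply Rinv_le_contravar; lra).
    assert (U1 : 2 * (x / (m' * m)) * norm (h (p s)) <= e / 2).
    { replace (e / 2) with (2 * (d2 / (d0 / 2 * d0)) * N) by (unfold d2; field; lra).
      apply Rmult_le_compat; [| |lra|exact HhN]; [|apply nge0].
      assert (0 <= x / (m' * m)); [|lra]. apply Rmult_le_pos; [exact Hx0|].
      left. apply Rinv_0_lt_compat, Rmult_lt_0_compat; lra. }
    assert (U2 : 2 * / m * norm (minus (h (p s)) (h (p t))) <= e / 2).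
    { replace (e / 2) with (2 * / d0 * (e * d0 / 4)) by (field; lra).
      apply Rmult_le_compat; [| |lra|lra]; [|apply nge0].
      assert (0 < / m) by (apply Rinv_0_lt_compat; lra). lra. }
    lra. }
destruct B as [l [P Q]]. exists l. split; [exact P|]. intros w Hw.
eapply Rle_trans; [apply (Q w Hw)|]. unfold e.
apply Rmult_le_reg_r with (b - a + 1); [lra|].
replace (eps / (b - a + 1) * (b - a) * (b - a + 1)) with (eps * (b - a)) by (field; lra). nra.
Qed.

Lemma approx_hseg K h a b y : pclosed K -> a <= b ->
  (forall x, a <= x <= b -> ~ K (x, y) /\ cont h (x, y)) ->
  approx K (fun w => hseg (fun z => cmul (Cinv (Cminus z w)) (h z)) a b y).
Proof.
intros HK Hab H. apply (approx_path K h (fun x => (x, y)) a b HK Hab); [|exact H].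
intros s t. apply Cmod_hdist.
Qed.

Lemma approx_vseg K h x c d : pclosed K -> c <= d ->
  (forall y, c <= y <= d -> ~ K (x, y) /\ cont h (x, y)) ->
  approx K (fun w => vseg (fun z => cmul (Cinv (Cminus z w)) (h z)) x c d).
Proof.
intros HK Hab H.
apply (approx_ext K (fun w => cmul Ci (RInt (fun y => cmul (Cinv (Cminus (x, y) w)) (h (x, y))) c d))).
- intros w _. apply cmul_Ci.
- apply approx_cmul. apply (approx_path K h (fun y => (x, y)) c d HK Hab); [|exact H].
  intros s t. apply Cmod_vdist.
Qed.
End Approx.

(** * Finite sums and summation by parts *)

Section Gsum.
Context {Y : cspace}.

Fixpoint gsum (n : nat) (f : nat -> Y) : Y :=
  match n with O => zero | S m => plus (gsum m f) (f m) end.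

Lemma gsum_ext n f g : (forall i, (i < n)%nat -> f i = g i) -> gsum n f = gsum n g.
Proof.
induction n as [|n IH]; intros H; simpl; [reflexivity|].
rewrite IH; [|intros; apply H; lia]. rewrite H; [reflexivity|lia].
Qed.

Lemma gsum_plus n f g : gsum n (fun i => plus (f i) (g i)) = plus (gsum n f) (gsum n g).
Proof. induction n as [|n IH]; simpl; [vec Y|]. rewrite IH. vec Y. Qed.

Lemma gsum_zero n : gsum n (fun _ => zero) = zero.
Proof. induction n as [|n IH]; simpl; [reflexivity|]. rewrite IH. vec Y. Qed.

Lemma gsum_exchange n m (f : nat -> nat -> Y) :
  gsum n (fun i => gsum m (f i)) = gsum m (fun j => gsum n (fun i => f i j)).
Proof.
induction n as [|n IH]; simpl; [rewrite gsum_zero; reflexivity|].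
rewrite IH -gsum_plus. reflexivity.
Qed.

Lemma gsum_single n f k : (k < n)%nat -> (forall i, (i < n)%nat -> i <> k -> f i = zero) -> gsum n f = f k.
Proof.
induction n as [|n IH]; intros Hk H; [lia|]. simpl.
destruct (Nat.eq_dec k n) as [->|N].
- rewrite (gsum_ext n f (fun _ => zero)); [|intros; apply H; lia]. rewrite gsum_zero. vec Y.
- rewrite IH; [|lia|intros; apply H; lia]. rewrite (H n); [|lia|lia]. vec Y.
Qed.

Lemma gsum_abel n (x : nat -> R) (v : nat -> Y) : x O = 0 -> x n = 0 ->
  gsum n (fun i => scal (x i) (minus (v (S i)) (v i))) = gsum n (fun i => scal (x i - x (S i)) (v (S i))).
Proof.
intros H0 Hn.
assert (A : forall m, plus (gsum m (fun i => scal (x i) (minus (v (S i)) (v i)))) (scal (x O) (v O))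
   = plus (gsum m (fun i => scal (x i - x (S i)) (v (S i)))) (scal (x m) (v m))).
{ induction m as [|m IH]; simpl; [reflexivity|].
  transitivity (plus (plus (gsum m (fun i => scal (x i) (minus (v (S i)) (v i)))) (scal (x O) (v O)))
     (scal (x m) (minus (v (S m)) (v m)))); [vec Y|].
  rewrite IH. vec_coefs Y; rewrite ?RtoC_minus; ring. }
assert (E := A n). rewrite H0 Hn in E.
transitivity (plus (gsum n (fun i => scal (x i) (minus (v (S i)) (v i)))) (scal 0 (v O))); [vec Y|].
rewrite E. vec Y.
Qed.

Lemma approx_gsum K n (u : nat -> R * R -> Y) :
  (forall i, (i < n)%nat -> approx K (u i)) -> approx K (fun w => gsum n (fun i => u i w)).
Proof.
induction n as [|n IH]; intros H; simpl; [apply approx_zero|].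
apply approx_plus; [apply IH; intros; apply H; lia|apply H; lia].
Qed.
End Gsum.

Lemma grid_floor (o s x : R) (n : nat) : o <= x < o + s * INR n ->
  exists i, (i < n)%nat /\ o + s * INR i <= x < o + s * INR (S i).
Proof.
induction n as [|n IH]; intros H; [simpl in H; lra|].
destruct (Rlt_dec x (o + s * INR n)) as [H1|H1].
- destruct IH as [i [Hi1 Hi2]]; [lra|]. exists i. split; [lia|exact Hi2].
- exists n. split; [lia|]. lra.
Qed.

Lemma Cmod_box_lt (x y u v s : R) : Rabs (x - u) <= s -> Rabs (y - v) <= s ->
  Cmod (Cminus (x, y) (u, v)) <= 2 * s.
Proof.
intros H1 H2. eapply Rle_trans; [apply Cmod_le_sum|]. simpl. unfold Rminus in *. lra.
Qed.

(** * Runge's theorem *)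

Section Runge.
Context {Y : cspace}.
Variables (Om : R * R -> Prop) (h : R * R -> Y).
Hypothesis h_cont : forall z, Om z -> cont h z.
Hypothesis h_diff : forall z, Om z -> z <> (0, 0) -> cdiff h z.
Variables (K : R * R -> Prop) (B : R) (s : R).
Hypothesis s_pos : 0 < s.
Hypothesis B_pos : 0 <= B.
Hypothesis K_box : forall z, K z -> Rabs (fst z) <= B /\ Rabs (snd z) <= B.
Hypothesis K_closed : pclosed K.
Hypothesis K_Om : forall z w, K z -> Cmod (Cminus z w) <= 2 * s -> Om w.

(* A grid of n * n squares of side s with corner (o, o), covering the box of K
   with a margin; [meets i j] says that square (i, j) meets K. *)
Let o := - B - 2 * s.
Let n := Z.to_nat (up ((2 * B + 4 * s) / s)).
Let X (i : nat) := o + s * INR i.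
Let meets (i j : nat) := exists z, K z /\ X i <= fst z <= X (S i) /\ X j <= snd z <= X (S j).
Let chi (i j : nat) : R := if excluded_middle_informative (meets i j) then 1 else 0.

Let F (w z : R * R) : Y := cmul (Cinv (Cminus z w)) (h z).
Let H (w : R * R) (i j : nat) := hseg (F w) (X i) (X (S i)) (X j).
Let V (w : R * R) (i j : nat) := vseg (F w) (X i) (X j) (X (S j)).

Lemma X_S i : X (S i) = X i + s.
Proof. unfold X. rewrite S_INR. ring. Qed.

Lemma X_n : B + s < X n.
Proof.
unfold X, o, n. set (q := (2 * B + 4 * s) / s).
assert (Hq : 0 < q) by (apply Rdiv_lt_0_compat; lra).
destruct (archimed q) as [A _].
assert (Hz : (0 <= up q)%Z) by (apply le_IZR; simpl; lra).
rewrite INR_IZR_INZ Z2Nat.id; [|exact Hz].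
apply (Rmult_lt_compat_l s) in A; [|exact s_pos].
replace (s * q) with (2 * B + 4 * s) in A by (unfold q; field; lra). lra.
Qed.

Lemma X_0 : X 0 = - B - 2 * s.
Proof. unfold X, o. simpl. ring. Qed.

Lemma chi_meets i j : meets i j -> chi i j = 1.
Proof. intros Hm. unfold chi. destruct (excluded_middle_informative _); [reflexivity|contradiction]. Qed.

Lemma chi_not i j : ~ meets i j -> chi i j = 0.
Proof. intros Hm. unfold chi. destruct (excluded_middle_informative _); [contradiction|reflexivity]. Qed.

Lemma box_abs x : Rabs x <= B -> - B <= x <= B.
Proof. intros Hx. apply Rabs_le_between in Hx. exact Hx. Qed.

(** The margin: the summation by parts has no boundary terms. *)
Lemma chi_outer i j : i = O \/ i = n \/ j = O \/ j = n -> chi i j = 0.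
Proof.
intros Hij. apply chi_not. intros [z [Hz [Hx Hy]]].
destruct (K_box z Hz) as [Bx By]. apply box_abs in Bx. apply box_abs in By.
rewrite !X_S in Hx, Hy. assert (X0 := X_0). assert (Xn := X_n).
destruct Hij as [E|[E|[E|E]]]; rewrite E in Hx, Hy; lra.
Qed.

Lemma square_Om i j x y : meets i j -> X i <= x <= X (S i) -> X j <= y <= X (S j) -> Om (x, y).
Proof.
intros [[u v] [Hz [Hx Hy]]] Hx' Hy'. simpl in *. rewrite !X_S in Hx, Hy, Hx', Hy'.
apply (K_Om (u, v)); [exact Hz|]. apply Cmod_box_lt; apply Rabs_le; lra.
Qed.

Lemma rect_HV w i j : rect (F w) (X i) (X (S i)) (X j) (X (S j)) =
  plus (minus (H w i j) (H w i (S j))) (minus (V w (S i) j) (V w i j)).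
Proof. unfold rect, H, V. vec Y. Qed.

(* The Cauchy integral over all squares meeting K. *)
Let U (w : R * R) : Y :=
  gsum n (fun i => gsum n (fun j => scal (chi i j) (rect (F w) (X i) (X (S i)) (X j) (X (S j))))).

Lemma cdiffR0_square i j : meets i j -> cdiffR0 h (X i) (X (S i)) (X j) (X (S j)).
Proof.
intros Hm. split; intros x y Hx Hy; [apply h_cont|intros N; apply h_diff; [|exact N]];
  apply (square_Om i j); assumption.
Qed.

(** Cauchy's formula in the square of w, Cauchy's theorem in the others. *)
Lemma U_inside w i j : (i < n)%nat -> (j < n)%nat -> meets i j ->
  X i < fst w < X (S i) -> X j < snd w < X (S j) -> w <> (0, 0) -> U w = scal (2 * PI) (ci (h w)).
Proof.
intros Hi Hj Hm Hx Hy N. unfold U.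
assert (XS : forall k, X k <= X (S k)) by (intros k; rewrite X_S; lra).
assert (Disj : forall k k' t, X k < t < X (S k) -> X k' <= t <= X (S k') -> k = k').
{ intros k k' t H1 H2. unfold X in H1, H2. 
  assert (INR k < INR (S k')) by (apply Rmult_lt_reg_l with s; lra).
  assert (INR k' < INR (S k)) by (apply Rmult_lt_reg_l with s; lra).
  apply INR_lt in H0. apply INR_lt in H3. lia. }
assert (Z : forall i' j', (i' <> i \/ j' <> j) ->
   scal (chi i' j') (rect (F w) (X i') (X (S i')) (X j') (X (S j'))) = (zero : Y)).
{ intros i' j' Hne. destruct (classic (meets i' j')) as [M|M].
  - unfold F. rewrite cauchy_rect_out; try apply XS.
    + vec Y.
    + intros [H1 H2]. destruct Hne as [Hne|Hne]; apply Hne; symmetry; eapply Disj; eassumption.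
    + apply cdiffR0_square, M.
  - rewrite (chi_not _ _ M). vec Y. }
rewrite (gsum_single n _ i Hi).
- rewrite (gsum_single n _ j Hj).
  + rewrite (chi_meets _ _ Hm). unfold F. rewrite cauchy_rect; try assumption.
    * vec Y.
    * apply cdiffR0_square, Hm.
  + intros j' _ Hj'. apply Z. right. exact Hj'.
- intros i' _ Hi'. rewrite (gsum_ext n _ (fun _ => zero)); [apply gsum_zero|].
  intros j' _. apply Z. left. exact Hi'.
Qed.

Lemma approx_scal (c : R) (u : R * R -> Y) : approx K u -> approx K (fun w => scal c (u w)).
Proof.
intros A. apply (approx_ext K (fun w => cmul (RtoC c) (u w))); [|apply approx_cmul, A].
intros w _. apply cmul_RtoC.
Qed.

(** Summation by parts turns U into a sum over the segments of the grid, with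
    the difference of the two adjacent squares as coefficient. A segment with a
    nonzero coefficient borders a square not meeting K, hence avoids K. *)
Lemma approx_H i j : approx K (fun w => scal (chi i j - chi i (S j)) (H w i (S j))).
Proof.
destruct (classic (meets i j <-> meets i (S j))) as [E|E].
- apply (approx_ext K (fun _ => zero)); [|apply approx_zero]. intros w _.
  replace (chi i j - chi i (S j)) with 0; [vec Y|].
  destruct (classic (meets i j)) as [M|M]; [rewrite !chi_meets; try ring; tauto|rewrite !chi_not; try ring; tauto].
- apply approx_scal. apply approx_hseg; [exact K_closed|rewrite X_S; lra|].
  intros x Hx. split.
  + intros Kx. apply E. split; intros _; exists (x, X (S j)); (split; [exact Kx|]); simpl;
    rewrite ?X_S in Hx |- *; lra.
  + apply h_cont. destruct (classic (meets i j)) as [M|M].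
    * apply (square_Om i j); [exact M|exact Hx|rewrite X_S; lra].
    * apply (square_Om i (S j)); [tauto|exact Hx|rewrite !X_S; lra].
Qed.

Lemma approx_V i j : approx K (fun w => scal (chi i j - chi (S i) j) (V w (S i) j)).
Proof.
destruct (classic (meets i j <-> meets (S i) j)) as [E|E].
- apply (approx_ext K (fun _ => zero)); [|apply approx_zero]. intros w _.
  replace (chi i j - chi (S i) j) with 0; [vec Y|].
  destruct (classic (meets i j)) as [M|M]; [rewrite !chi_meets; try ring; tauto|rewrite !chi_not; try ring; tauto].
- apply approx_scal. apply approx_vseg; [exact K_closed|rewrite X_S; lra|].
  intros y Hy. split.
  + intros Ky. apply E. split; intros _; exists (X (S i), y); (split; [exact Ky|]); simpl;
    rewrite ?X_S in Hy |- *; lra.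
  + apply h_cont. destruct (classic (meets i j)) as [M|M].
    * apply (square_Om i j); [exact M|rewrite X_S; lra|exact Hy].
    * apply (square_Om (S i) j); [tauto|rewrite !X_S; lra|exact Hy].
Qed.

Lemma approx_U : approx K U.
Proof.
apply (approx_ext K (fun w => plus
   (cmul (RtoC (-1)) (gsum n (fun i => gsum n (fun j => scal (chi i j - chi i (S j)) (H w i (S j))))))
   (gsum n (fun j => gsum n (fun i => scal (chi i j - chi (S i) j) (V w (S i) j)))))).
- intros w _. unfold U. symmetry.
  rewrite (gsum_ext n _ (fun i => plus
     (gsum n (fun j => cmul (RtoC (-1)) (scal (chi i j) (minus (H w i (S j)) (H w i j)))))
     (gsum n (fun j => scal (chi i j) (minus (V w (S i) j) (V w i j)))))).
  + rewrite gsum_plus. f_equal.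
    * assert (A : forall m f, gsum m (fun k => cmul (RtoC (-1)) (f k)) = cmul (RtoC (-1)) (gsum m f : Y)).
      { intros m f. induction m as [|m IH]; simpl; [vec Y|]. rewrite IH. vec Y. }
      rewrite -A. apply gsum_ext. intros i _. rewrite A.
      f_equal. apply gsum_abel; apply chi_outer; auto.
    * rewrite gsum_exchange. apply gsum_ext. intros j _.
      apply (gsum_abel n (fun i => chi i j) (fun i => V w i j)); apply chi_outer; auto.
  + intros i _. rewrite -gsum_plus. apply gsum_ext. intros j _. rewrite rect_HV. vec Y.
- apply approx_plus.
  + apply approx_cmul, approx_gsum. intros i _. apply approx_gsum. intros j _. apply approx_H.
  + apply approx_gsum. intros j _. apply approx_gsum. intros i _. apply approx_V.
Qed.

(** Points on the grid lines, where Cauchy's formula is not available, are moved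
    into the interior of a square; x' <> 0 keeps the new point away from 0. *)
Lemma nudge x eta : 0 < eta -> Rabs x <= B -> exists i x', (i < n)%nat /\
  X i <= x <= X (S i) /\ X i < x' < X (S i) /\ Rabs (x' - x) < eta /\ x' <> 0.
Proof.
intros He Hx. apply box_abs in Hx. assert (X0 := X_0). assert (Xn := X_n).
destruct (grid_floor o s x n) as [i [Hi1 Hi2]]; [split; [unfold o; lra|fold (X n); lra]|].
fold (X i) in Hi2. fold (X (S i)) in Hi2.
set (m := Rmin eta (X (S i) - x)).
assert (Hm : 0 < m) by (apply Rmin_pos; lra).
assert (M1 : m <= eta) by apply Rmin_l. assert (M2 : m <= X (S i) - x) by apply Rmin_r.
destruct (Req_dec (x + m / 2) 0) as [E|E].
- exists i, (x + m / 3). repeat split; try lra; try assumption. apply Rabs_lt_between. lra.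
- exists i, (x + m / 2). repeat split; try lra; try assumption. apply Rabs_lt_between. lra.
Qed.

(** At points moved off the grid U agrees with 2 pi i h, and both h and the
    approximating rational functions are continuous. *)
Lemma approx_interior (K0 : R * R -> Prop) (e : R) : 0 < e ->
  (forall z w, K0 z -> Cmod (Cminus w z) < e -> K w) -> approx K0 (fun w => scal (2 * PI) (ci (h w))).
Proof.
intros He HK0 eps Heps.
destruct (approx_U (eps / 2)) as [l [P Q]]; [lra|]. exists l.
assert (KK : forall z, K0 z -> K z).
{ intros z Hz. apply (HK0 z z Hz). rewrite Cmod_m0. exact He. }
split.
{ unfold poles_off. apply List.Forall_forall. intros p Hp Hz.
  exact (proj1 (List.Forall_forall _ _) P p Hp (KK _ Hz)). }
intros w Hw.
assert (C1 : cont (fun w => minus (scal (2 * PI) (ci (h w))) (rat l w)) w).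
{ apply (cont_ext_loc (fun w => plus (cmul (Cmult (RtoC (2 * PI)) Ci) (h w)) (cmul (RtoC (-1)) (rat l w))) _ w 1); [lra| |].
  - intros z _. vec Y.
  - assert (CC : forall (c : C) z, ccont (fun _ => c) z).
    { intros c z x Hx. exists 1. split; [lra|]. intros t _. rewrite Cmod_m0. exact Hx. }
    apply cont_plus; (apply cont_cmul; [apply CC|]).
    + apply h_cont. apply (K_Om w w (KK w Hw)). rewrite Cmod_m0. lra.
    + apply rat_cont. intros p Hp E. apply (proj1 (List.Forall_forall _ _) P p Hp).
      rewrite E. apply KK, Hw. }
destruct (C1 (eps / 2)) as [d [Hd1 Hd2]]; [lra|].
set (eta := Rmin d e / 4). assert (Heta : 0 < eta) by (unfold eta; assert (0 < Rmin d e) by (apply Rmin_pos; lra); lra).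
assert (E1 : 4 * eta <= d) by (unfold eta; assert (T := Rmin_l d e); lra).
assert (E2 : 4 * eta <= e) by (unfold eta; assert (T := Rmin_r d e); lra).
destruct (K_box w (KK w Hw)) as [Bx By]. destruct w as [wx wy]. simpl in Bx, By.
destruct (nudge wx eta Heta Bx) as [i [x' [Hi [Ix [Ix' [Dx Nx]]]]]].
destruct (nudge wy eta Heta By) as [j [y' [Hj [Iy [Iy' [Dy Ny]]]]]].
assert (Dw : Cmod (Cminus (x', y') (wx, wy)) <= 2 * eta) by (apply Cmod_box_lt; lra).
assert (M : meets i j) by (exists (wx, wy); split; [apply KK, Hw|split; assumption]).
assert (Kw' : K (x', y')) by (apply (HK0 (wx, wy)); [exact Hw|lra]).
assert (Q' := Q _ Kw'). rewrite (U_inside (x', y') i j) in Q'; try assumption.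
2:{ intros E. injection E. intros _ E'. contradiction. }
assert (D' := Hd2 (x', y') ltac:(lra)).
set (f := fun w => minus (scal (2 * PI) (ci (h w))) (rat l w)) in *.
change (norm (f (x', y')) <= eps / 2) in Q'.
change (norm (minus (f (x', y')) (f (wx, wy))) < eps / 2) in D'.
change (norm (f (wx, wy)) <= eps).
norm_as Y (minus (f (x', y')) (minus (f (x', y')) (f (wx, wy)))).
eapply Rle_trans; [apply nminus|]. lra.
Qed.
End Runge.

(** Runge's theorem, for functions with values in Y that may fail to be
    differentiable at 0. The grid is applied to a slightly larger closed set K',
    so that K lies in its interior. *)
Theorem runge {Y : cspace} (Om K : R * R -> Prop) (h : R * R -> Y) (M delta : R) :
  (forall z, Om z -> cont h z) -> (forall z, Om z -> z <> (0, 0) -> cdiff h z) ->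
  (forall z, K z -> Cmod z <= M) -> 0 < delta ->
  (forall z w, K z -> Cmod (Cminus w z) < delta -> Om w) -> approx K h.
Proof.
intros Hc Hd HM Hdelta HOm.
set (K' := fun z : R * R => Rabs (fst z) <= Rabs M + delta /\ Rabs (snd z) <= Rabs M + delta /\
   forall w, ~ Om w -> delta / 2 <= Cmod (Cminus w z)).
assert (HM0 := Rabs_pos M). assert (HM1 := Rle_abs M).
assert (A : approx K (fun w => scal (2 * PI) (ci (h w)))).
{ apply (approx_interior Om h Hc Hd K' (Rabs M + delta) (delta / 8)) with (e := delta / 2); try lra.
  - intros z Hz. split; apply Hz.
  - intros z Hz.
    assert (HH : Rabs M + delta < Rabs (fst z) \/ Rabs M + delta < Rabs (snd z) \/
       exists w, ~ Om w /\ Cmod (Cminus w z) < delta / 2).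
    { apply NNPP. intros N. apply Hz. split; [|split].
      - apply Rnot_lt_le. tauto.
      - apply Rnot_lt_le. tauto.
      - intros w Hw. apply Rnot_lt_le. intros L. apply N. right. right. exists w. tauto. }
    assert (RS : forall u v : R, Rabs u - Rabs v <= Rabs (u - v)) by (intros; apply Rabs_triang_inv).
    destruct HH as [HH|[HH|[w0 [Nw Lw]]]].
    + exists (Rabs (fst z) - (Rabs M + delta)). split; [lra|]. intros w [Hw _].
      assert (T := Cmod_bound_Re (fst z - fst w) (snd z - snd w)).
      change (Cmod (Cminus z w)) with (Cmod (fst z - fst w, snd z - snd w)).
      assert (T2 := RS (fst z) (fst w)). lra.
    + exists (Rabs (snd z) - (Rabs M + delta)). split; [lra|]. intros w [_ [Hw _]].
      assert (T := Cmod_bound_Im (fst z - fst w) (snd z - snd w)).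
      change (Cmod (Cminus z w)) with (Cmod (fst z - fst w, snd z - snd w)).
      assert (T2 := RS (snd z) (snd w)). lra.
    + exists (delta / 2 - Cmod (Cminus w0 z)). split; [lra|]. intros w [_ [_ Hw]].
      assert (T := Cmod_tri_sub (Cminus w0 w) (Cminus w0 z)). assert (T2 := Hw w0 Nw).
      replace (Cminus (Cminus w0 w) (Cminus w0 z)) with (Cminus z w) in T by ring. lra.
  - intros z w [_ [_ Hz]] Hw. apply NNPP. intros N. assert (T := Hz w N).
    rewrite Cmod_minus_sym in T. lra.
  - intros z w Hz Hw. assert (Mz := HM z Hz).
    assert (T1 := Cmod_tri_sub w z). destruct w as [wx wy].
    assert (T2 := Cmod_bound_Re wx wy). assert (T3 := Cmod_bound_Im wx wy).
    split; [simpl; lra|]. split; [simpl; lra|].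
    intros v Nv. apply Rnot_lt_le. intros L. apply Nv, (HOm z); [exact Hz|].
    assert (T := Cmod_triangle (Cminus v (wx, wy)) (Cminus (wx, wy) z)).
    replace (Cplus (Cminus v (wx, wy)) (Cminus (wx, wy) z)) with (Cminus v z) in T by ring. lra. }
apply (approx_ext K (fun w => cmul (Cinv (Cmult (RtoC (2 * PI)) Ci)) (scal (2 * PI) (ci (h w))))).
- intros w _.
  assert (N : Cmult (RtoC (2 * PI)) Ci <> RtoC 0).
  { apply Cmult_neq_0; intros E; apply (f_equal fst) in E as E1; apply (f_equal snd) in E as E2; simpl in E1, E2;
    assert (P := PI_RGT_0); lra. }
  transitivity (cmul (Cmult (Cinv (Cmult (RtoC (2 * PI)) Ci)) (Cmult (RtoC (2 * PI)) Ci)) (h w)); [vec Y|].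
  rewrite Cinv_l; [apply cmul_one|exact N].
- apply approx_cmul, A.
Qed.

(** * Contour integrals *)

Lemma prod_ci_norm (W : CompleteNormedModule R_AbsRing) (x : prodC W W) :
  norm ((opp (snd x), fst x) : prodC W W) <= norm x.
Proof.
destruct x as [a b]. right. change (prod_norm (opp b, a) = prod_norm (a, b)).
unfold prod_norm; simpl. f_equal. 
replace (norm (opp b)) with (norm b) by (symmetry; apply nopp). ring.
Qed.

(** The complexification of W. *)
Definition prodCS (W : CompleteNormedModule R_AbsRing) : cspace.
Proof.
refine (CSpace (prodC W W) (fun x => (opp (snd x), fst x)) _ _ _ (prod_ci_norm W)).
- intros [a b] [a' b']. apply injective_projections; [apply (opp_plus (G := W))|reflexivity].
- intros r [a b]. apply injective_projections; [symmetry; apply (scal_opp_r (V := W))|reflexivity].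
- intros [a b]. reflexivity.
Defined.

Definition cC : cspace := prodCS R_CompleteNormedModule.

Lemma norm_cC (z : R * R) : norm (z : cC) = Cmod z.
Proof.
destruct z as [x y]. change (prod_norm ((x, y) : R_NormedModule * R_NormedModule) = Cmod (x, y)).
unfold prod_norm, Cmod; simpl. f_equal.
change (Rabs x * (Rabs x * 1) + Rabs y * (Rabs y * 1) = x * (x * 1) + y * (y * 1)).
rewrite !Rmult_1_r -!Rabs_mult !Rabs_pos_eq; [reflexivity|nra|nra].
Qed.

Lemma cmul_cC (c d : R * R) : cmul (c : C) (d : cC) = Cmult c d.
Proof.
destruct c as [a b], d as [x y].
apply injective_projections; simpl; unfold plus, scal, opp; simpl; unfold mult; simpl; ring.
Qed.

Lemma cont_cC (s : R * R -> R * R) z : cont (Y := cC) s z <-> ccont s z.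
Proof.
split; intros H eps He; destruct (H eps He) as [d [Hd1 Hd2]]; exists d; (split; [exact Hd1|]);
  intros w Hw; assert (T := Hd2 w Hw).
- rewrite -norm_cC. exact T.
- change (norm (Cminus (s w) (s z) : cC) < eps). rewrite norm_cC. exact T.
Qed.

Lemma cdiff_cC (s : R * R -> R * R) z : cdiff (Y := cC) s z <-> ccdiff s z.
Proof.
split; intros [q [Hq E]]; exists q; (split; [apply cont_cC; exact Hq|]); intros w.
- rewrite -cmul_cC. exact (E w).
- rewrite cmul_cC. exact (E w).
Qed.

(** * Bounded linear maps and integrals *)

Definition blin {U V : CompleteNormedModule R_AbsRing} (L : U -> V) : Prop :=
  (forall x y, L (plus x y) = plus (L x) (L y)) /\
  (forall (r : R) x, L (scal r x) = scal r (L x)) /\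
  exists M, 0 <= M /\ forall x, norm (L x) <= M * norm x.

Section Lin.
Context {U V : CompleteNormedModule R_AbsRing} (L : U -> V) (HL : blin L).

Lemma blin_plus x y : L (plus x y) = plus (L x) (L y).
Proof. apply HL. Qed.
Lemma blin_scal (r : R) x : L (scal r x) = scal r (L x).
Proof. apply HL. Qed.
Lemma blin_zero : L zero = zero.
Proof.
replace (zero : U) with (scal 0 (zero : U)) by apply (scal_zero_l (V := U)).
rewrite blin_scal. apply (scal_zero_l (V := V)).
Qed.
Lemma blin_opp x : L (opp x) = opp (L x).
Proof.
replace (opp x) with (scal (-1) x) by apply (scal_opp_one (V := U)).
rewrite blin_scal. apply (scal_opp_one (V := V)).
Qed.
Lemma blin_minus x y : L (minus x y) = minus (L x) (L y).
Proof. unfold minus. rewrite blin_plus blin_opp. reflexivity. Qed.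

Lemma Riemann_sum_lin (f : R -> U) ptd : L (Riemann_sum f ptd) = Riemann_sum (fun t => L (f t)) ptd.
Proof.
apply SF_cons_ind with (s := ptd) => {ptd} [x0 | h ptd IH].
- apply blin_zero.
- rewrite !Riemann_sum_cons blin_plus blin_scal IH. reflexivity.
Qed.

Lemma is_RInt_lin (f : R -> U) a b l : is_RInt f a b l -> is_RInt (fun t => L (f t)) a b (L l).
Proof.
intros H. unfold is_RInt.
apply (filterlim_ext (fun ptd => L (scal (sign (b - a)) (Riemann_sum f ptd)))).
- intros ptd. rewrite blin_scal Riemann_sum_lin. reflexivity.
- apply (filterlim_comp _ _ _ _ L (Riemann_fine a b) (locally l)); [exact H|].
  destruct HL as [_ [_ [M [HM HB]]]].
  apply filterlim_locally. intros eps.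
  assert (He : 0 < eps / (M + 1)) by (apply Rdiv_lt_0_compat; [apply cond_pos|lra]).
  apply (locally_le_locally_norm (V := U)). exists (mkposreal _ He). intros y Hy.
  apply (norm_compat1 (V := V)).
  apply Rle_lt_trans with (norm (L (minus y l))).
  { right. apply f_equal. symmetry. apply blin_minus. }
  eapply Rle_lt_trans; [apply HB|]. unfold ball_norm in Hy. simpl in Hy.
  apply Rle_lt_trans with (M * (eps / (M + 1))).
  + apply Rmult_le_compat_l; [exact HM|]. left. exact Hy.
  + apply Rmult_lt_reg_r with (M + 1); [lra|].
    replace (M * (eps / (M + 1)) * (M + 1)) with (M * eps) by (field; lra).
    assert (P := cond_pos eps). nra.
Qed.

Lemma RInt_lin (f : R -> U) a b : ex_RInt f a b -> RInt (fun t => L (f t)) a b = L (RInt f a b).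
Proof. intros H. apply (is_RInt_unique (V := V)), is_RInt_lin, (RInt_correct (V := U)), H. Qed.

End Lin.

Lemma blin_cmul {Y : cspace} (c : C) : blin (fun y : Y => cmul c y).
Proof.
split; [|split].
- intros x y. vec Y.
- intros r x. vec Y.
- exists (2 * Cmod c). split; [assert (H := Cmod_ge_0 c); lra|]. intros x. apply norm_cmul.
Qed.

Lemma blin_cmul_l {Y : cspace} (y : Y) : blin (fun c : cC => cmul (c : C) y).
Proof.
split; [|split].
- intros x z. apply cmul_plus_l.
- intros r x.
  transitivity (cmul (Cmult (RtoC r) (x : C)) y).
  + f_equal. destruct x as [a b]. apply injective_projections; simpl; unfold scal; simpl; unfold mult; simpl; ring.
  + vec Y.
- exists (2 * norm y). split; [assert (H := nge0 y); lra|]. intros x. rewrite norm_cC.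
  eapply Rle_trans; [apply norm_cmul|]. right. ring.
Qed.

(** * Piecewise C1 curves *)

Lemma subdivision_le (n : nat) (t : nat -> R) : (forall i, (i < n)%nat -> t i < t (S i)) ->
  forall i, (i <= n)%nat -> t O <= t i <= t n.
Proof.
intros H.
assert (Q : forall k i, (i + k <= n)%nat -> t i <= t (i + k)%nat).
{ induction k as [|k IH]; intros i Hk; [rewrite Nat.add_0_r; lra|].
  rewrite Nat.add_succ_r. assert (T1 := H (i + k)%nat ltac:(lia)). assert (T2 := IH i ltac:(lia)). lra. }
intros i Hi. assert (T1 := Q i O Hi). assert (T2 := Q (n - i)%nat i ltac:(lia)).
replace (i + (n - i))%nat with n in T2 by lia. simpl in T1. lra.
Qed.

Section Curve.
Context {Y : cspace}.
Implicit Types (g : R -> R * R) (h k : R * R -> Y).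

Definition cvel g (t : R) : C := (dx g t, dy g t).

(** The integral of h(z) dz along g. *)
Definition gint g h : Y := RInt (fun t => cmul (cvel g t) (h (g t))) 0 1.

Lemma C1_cont (p : R -> R * R) t : Defs.C1 p -> forall eps, 0 < eps -> exists d, 0 < d /\
  forall s, Rabs (s - t) < d -> Cmod (Cminus (p s) (p t)) < eps.
Proof.
intros [p' Hp] eps He. destruct (Hp t) as [Hd _].
assert (Hc : continuous p t).
{ apply (ex_derive_continuous (V := prod_NormedModule R_AbsRing R_NormedModule R_NormedModule)). eexists. exact Hd. }
assert (He2 : 0 < eps / 2) by lra.
destruct (proj1 (filterlim_locally _ _) Hc (mkposreal _ He2)) as [d Hd'].
exists d. split; [apply cond_pos|]. intros s Hs. destruct (Hd' s Hs) as [B1 B2]. simpl in B1, B2.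
change (Rabs (fst (p s) - fst (p t)) < eps / 2) in B1.
change (Rabs (snd (p s) - snd (p t)) < eps / 2) in B2.
eapply Rle_lt_trans; [apply Cmod_le_sum|]. simpl. unfold Rminus in *. lra.
Qed.

Lemma C1_comp_cont (p : R -> R * R) h t : Defs.C1 p -> cont h (p t) -> continuous (fun s => h (p s)) t.
Proof.
intros Hp Hh. apply cont_continuous. intros eps He.
destruct (Hh eps He) as [d [Hd1 Hd2]]. destruct (C1_cont p t Hp d Hd1) as [e [He1 He2]].
exists e. split; [exact He1|]. intros s Hs. apply Hd2, He2, Hs.
Qed.

Lemma C1_components (p p' : R -> R * R) : (forall t, is_derive p t (p' t) /\ continuous p' t) ->
  forall t, is_derive (fun s => fst (p s)) t (fst (p' t)) /\ is_derive (fun s => snd (p s)) t (snd (p' t)) /\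
   continuous (fun s => fst (p' s)) t /\ continuous (fun s => snd (p' s)) t.
Proof.
intros H t. destruct (H t) as [D Ct]. split; [|split; [|split]].
- apply (filterdiff_comp' p fst t (fun y => scal y (p' t)) fst D).
  apply filterdiff_linear, is_linear_fst.
- apply (filterdiff_comp' p snd t (fun y => scal y (p' t)) snd D).
  apply filterdiff_linear, is_linear_snd.
- apply (continuous_comp p' fst); [exact Ct|]. destruct (p' t). apply continuous_fst.
- apply (continuous_comp p' snd); [exact Ct|]. destruct (p' t). apply continuous_snd.
Qed.

(** At the endpoints of the piece g need not be differentiable. *)
Lemma cvel_piece g p p' (a b : R) : (forall t, is_derive p t (p' t) /\ continuous p' t) ->
  (forall x, a <= x <= b -> g x = p x) -> forall t, a < t < b -> cvel g t = p' t.
Proof.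
intros Hp E t Ht. destruct (C1_components p p' Hp t) as [D1 [D2 _]].
assert (L : locally t (fun s => g s = p s)).
{ assert (Hm : 0 < Rmin (t - a) (b - t)) by (apply Rmin_pos; lra).
  exists (mkposreal _ Hm). intros s Hs. apply E.
  change (Rabs (s - t) < Rmin (t - a) (b - t)) in Hs.
  assert (T1 := Rlt_le_trans _ _ _ Hs (Rmin_l _ _)). assert (T2 := Rlt_le_trans _ _ _ Hs (Rmin_r _ _)).
  apply Rabs_lt_between in T1. apply Rabs_lt_between in T2. lra. }
unfold cvel, dx, dy. 
apply injective_projections; simpl; apply is_derive_unique.
- apply (is_derive_ext_loc (fun s => fst (p s))); [|exact D1].
  revert L. apply filter_imp. intros s ->. reflexivity.
- apply (is_derive_ext_loc (fun s => snd (p s))); [|exact D2].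
  revert L. apply filter_imp. intros s ->. reflexivity.
Qed.

Lemma continuous_cmul (c : R -> R * R) (u : R -> Y) t :
  continuous (fun s => fst (c s)) t -> continuous (fun s => snd (c s)) t -> continuous u t ->
  continuous (fun s => cmul (c s) (u s) : Y) t.
Proof.
intros H1 H2 H3. unfold cmul. apply (continuous_plus (V := Y)).
- apply (continuous_scal (V := Y)); assumption.
- apply (continuous_scal (V := Y)); [assumption|].
  apply (continuous_comp u ci); [exact H3|].
  apply filterlim_locally. intros eps.
  apply (locally_le_locally_norm (V := Y)). exists eps. intros y Hy. apply (norm_compat1 (V := Y)).
  unfold ball_norm in Hy.
  assert (E : minus (ci y) (ci (u t)) = ci (minus y (u t))) by vec Y. rewrite E.
  eapply Rle_lt_trans; [apply ci_norm|exact Hy].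
Qed.

(** Integrability is stated together with a bound uniform in h, which makes
    integration along g continuous for uniform convergence. *)
Lemma piece_integrable g (a b : R) : a < b -> (exists p, Defs.C1 p /\ forall x, a <= x <= b -> g x = p x) ->
  exists C, 0 <= C /\ forall h, (forall t, a <= t <= b -> cont h (g t)) ->
    ex_RInt (fun t => cmul (cvel g t) (h (g t))) a b /\
    forall M, (forall t, a <= t <= b -> norm (h (g t)) <= M) ->
    norm (RInt (fun t => cmul (cvel g t) (h (g t))) a b) <= C * M.
Proof.
intros Hab [p [[p' Hp] E]].
assert (HC : exists B, 0 <= B /\ forall t, a <= t <= b -> Cmod (p' t) <= B).
{ destruct (continuity_ab_maj (fun t => Rabs (fst (p' t)) + Rabs (snd (p' t))) a b) as [m [Hm _]]; [lra| |].
  - intros t _. apply continuity_pt_filterlim.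
    destruct (C1_components p p' Hp t) as [_ [_ [C1 C2]]].
    apply (continuous_plus (fun s => Rabs (fst (p' s))) (fun s => Rabs (snd (p' s)))).
    + apply (continuous_comp (fun s => fst (p' s)) Rabs); [exact C1|apply continuous_Rabs].
    + apply (continuous_comp (fun s => snd (p' s)) Rabs); [exact C2|apply continuous_Rabs].
  - exists (Rabs (fst (p' m)) + Rabs (snd (p' m))). split.
    + assert (T1 := Rabs_pos (fst (p' m))). assert (T2 := Rabs_pos (snd (p' m))). lra.
    + intros t Ht. eapply Rle_trans; [|apply (Hm t Ht)]. destruct (p' t). apply Cmod_le_sum. }
destruct HC as [B [HB0 HB]].
exists ((b - a) * (2 * B)). split; [apply Rmult_le_pos; lra|]. intros h Hh.
assert (X : forall t, Rmin a b < t < Rmax a b -> cmul (p' t) (h (p t)) = cmul (cvel g t) (h (g t))).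
{ rewrite Rmin_left; [|lra]. rewrite Rmax_right; [|lra]. intros t Ht.
  rewrite (cvel_piece g p p' a b Hp E t Ht) E; [reflexivity|lra]. }
assert (I : ex_RInt (fun t => cmul (p' t) (h (p t))) a b).
{ apply (ex_RInt_continuous (V := Y)). rewrite Rmin_left; [|lra]. rewrite Rmax_right; [|lra]. intros t Ht.
  destruct (C1_components p p' Hp t) as [_ [_ [C1 C2]]].
  apply (continuous_cmul p' (fun s => h (p s))); [exact C1|exact C2|].
  apply C1_comp_cont; [exists p'; exact Hp|]. rewrite -E; [apply Hh|]; exact Ht. }
split.
- apply (ex_RInt_ext (V := Y) (fun t => cmul (p' t) (h (p t)))); [exact X|exact I].
- intros M HM. rewrite -(RInt_ext (V := Y) (fun t => cmul (p' t) (h (p t))) _ a b X).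
  rewrite Rmult_assoc.
  apply (norm_RInt_le_const (V := Y) (fun t => cmul (p' t) (h (p t))) a b); [lra| |apply (RInt_correct (V := Y)), I].
  intros t Ht. eapply Rle_trans; [apply norm_cmul|].
  rewrite -(E t Ht). assert (T1 := HB t Ht). assert (T2 := HM t Ht).
  apply Rmult_le_compat; [|apply nge0| |exact T2].
  + assert (T := Cmod_ge_0 (p' t)). lra.
  + lra.
Qed.

Lemma curve_integrable g : piecewise_C1 g -> exists C, 0 <= C /\ forall h,
  (forall t, 0 <= t <= 1 -> cont h (g t)) ->
    ex_RInt (fun t => cmul (cvel g t) (h (g t))) 0 1 /\
    forall M, (forall t, 0 <= t <= 1 -> norm (h (g t)) <= M) -> norm (gint g h) <= C * M.
Proof.
intros [n [t [H0 [H1 Hp]]]]. unfold gint.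
assert (Mono := subdivision_le n t (fun i Hi => proj1 (Hp i Hi))).
assert (A : forall i, (i <= n)%nat -> exists C, 0 <= C /\ forall h,
  (forall s, t O <= s <= t i -> cont h (g s)) ->
    ex_RInt (fun t => cmul (cvel g t) (h (g t))) (t O) (t i) /\
    forall M, (forall s, t O <= s <= t i -> norm (h (g s)) <= M) ->
      norm (RInt (fun t => cmul (cvel g t) (h (g t))) (t O) (t i)) <= C * M).
{ induction i as [|i IH]; intros Hi.
  - exists 0. split; [lra|]. intros h _. split; [apply ex_RInt_point|].
    intros M _. rewrite (RInt_point (V := Y)) nzero. lra.
  - destruct (IH ltac:(lia)) as [C1 [P1 Q1]].
    destruct (Hp i) as [Hlt Hpi]; [lia|].
    destruct (piece_integrable g _ _ Hlt Hpi) as [C2 [P2 Q2]].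
    assert (T := Mono i ltac:(lia)).
    exists (C1 + C2). split; [lra|]. intros h Hh.
    destruct (Q1 h) as [I1 B1]; [intros s Hs; apply Hh; lra|].
    destruct (Q2 h) as [I2 B2]; [intros s Hs; apply Hh; lra|].
    split; [apply (ex_RInt_Chasles (V := Y) _ _ (t i)); assumption|].
    intros M HM. rewrite -(RInt_Chasles (V := Y) _ _ (t i)); try assumption.
    eapply Rle_trans; [apply ntri|].
    assert (T1 := B1 M ltac:(intros s Hs; apply HM; lra)).
    assert (T2 := B2 M ltac:(intros s Hs; apply HM; lra)). lra. }
destruct (A n (le_n n)) as [C [P Q]]. exists C. split; [exact P|]. rewrite H0 H1 in Q. exact Q.
Qed.
End Curve.

Lemma curve_bounded {Y : cspace} (g : R -> R * R) (h : R * R -> Y) : piecewise_C1 g ->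
  (forall t, 0 <= t <= 1 -> cont h (g t)) ->
  exists M, 0 <= M /\ forall t, 0 <= t <= 1 -> norm (h (g t)) <= M.
Proof.
intros [n [t [H0 [H1 Hp]]]] Hh.
assert (Ht := subdivision_le n t (fun i Hi => proj1 (Hp i Hi))).
assert (A : forall i, (i <= n)%nat -> exists M, 0 <= M /\ forall s, t O <= s <= t i -> norm (h (g s)) <= M).
{ induction i as [|i IH]; intros Hi.
  - exists (norm (h (g (t O)))). split; [apply nge0|]. intros s Hs. replace s with (t O) by lra. lra.
  - destruct (IH ltac:(lia)) as [M1 [P1 Q1]].
    destruct (Hp i) as [Hlt [p [Hp1 E]]]; [lia|].
    assert (T1 := Ht i ltac:(lia)). assert (T2 := Ht (S i) Hi).
    destruct (bisection (fun a b _ _ => exists M, 0 <= M /\ forall s, a <= s <= b -> norm (h (g s)) <= M) (t i) (t (S i)) 0 0)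
      as [M2 [P2 Q2]]; try lra.
    + intros a b c d _ _ _ _ _ _ [Ma [Pa Qa]] [Mb [Pb Qb]] _ _.
      exists (Ma + Mb). split; [lra|]. intros s Hs. destruct (Rle_dec s ((a + b) / 2)).
      * assert (T := Qa s ltac:(lra)). lra.
      * assert (T := Qb s ltac:(lra)). lra.
    + intros x y Hx _.
      assert (Cx : cont h (p x)) by (rewrite -E; [apply Hh; lra|exact Hx]).
      destruct (Cx 1) as [d [Hd1 Hd2]]; [lra|]. destruct (C1_cont p x Hp1 d Hd1) as [e [He1 He2]].
      exists e. split; [exact He1|]. intros a b c d' A1 A2 A3 _ _ _ W _.
      exists (norm (h (p x)) + 1). split; [assert (T := nge0 (h (p x))); lra|].
      intros s Hs. rewrite E; [|lra].
      assert (T : norm (minus (h (p s)) (h (p x))) < 1) by (apply Hd2, He2; apply Rabs_lt_between; lra).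
      norm_as Y (plus (minus (h (p s)) (h (p x))) (h (p x))).
      eapply Rle_trans; [apply ntri|]. lra.
    + exists (M1 + M2). split; [lra|]. intros s Hs. destruct (Rle_dec s (t i)).
      * assert (T := Q1 s ltac:(lra)). lra.
      * assert (T := Q2 s ltac:(lra)). lra. }
destruct (A n (le_n n)) as [M HM]. rewrite H0 H1 in HM. exists M. exact HM.
Qed.

(** * Continuous functionals on C(K) *)

Definition contK {Y : cspace} (K : R * R -> Prop) (h : R * R -> Y) := forall z, K z -> cont h z.

(** C-linear operators on Y1-valued functions, bounded for the supremum on K. *)
Definition cfun {Y1 Y2 : cspace} (K : R * R -> Prop) (l : (R * R -> Y1) -> Y2) : Prop :=
  (forall h k, contK K h -> contK K k -> l (fun z => plus (h z) (k z)) = plus (l h) (l k)) /\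
  (forall c h, contK K h -> l (fun z => cmul c (h z)) = cmul c (l h)) /\
  exists C, 0 <= C /\ forall h M, contK K h -> 0 <= M -> (forall z, K z -> norm (h z) <= M) -> norm (l h) <= C * M.

Section Cfun.
Context {Y1 Y2 : cspace}.
Implicit Types (K : R * R -> Prop) (h : R * R -> Y1) (l : (R * R -> Y1) -> Y2).

Lemma ccont_const (c : C) z : ccont (fun _ => c) z.
Proof. intros x Hx. exists 1. split; [lra|]. intros t _. rewrite Cmod_m0. exact Hx. Qed.

Lemma contK_cmul K (c : C) h : contK K h -> contK K (fun z => cmul c (h z)).
Proof. intros H z Hz. apply cont_cmul; [apply ccont_const|apply H, Hz]. Qed.

Lemma cfun_close K l h k M (C : R) : cfun K l -> contK K h -> contK K k -> 0 <= M ->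
  (forall h M, contK K h -> 0 <= M -> (forall z, K z -> norm (h z) <= M) -> norm (l h) <= C * M) ->
  (forall z, K z -> norm (minus (h z) (k z)) <= M) -> norm (minus (l h) (l k)) <= C * M.
Proof.
intros [Hp [Hm _]] Hh Hk HM HC HD.
assert (E : minus (l h) (l k) = l (fun z => plus (h z) (cmul (RtoC (-1)) (k z)))).
{ rewrite Hp; [|exact Hh|apply contK_cmul, Hk]. rewrite Hm; [|exact Hk]. vec Y2. }
rewrite E. apply HC; [|exact HM|].
- intros z Hz. apply cont_plus; [apply Hh, Hz|apply (contK_cmul K (RtoC (-1)) k Hk z Hz)].
- intros z Hz. norm_as Y1 (minus (h z) (k z)). apply HD, Hz.
Qed.

Lemma cfun_ext K l h k : cfun K l -> contK K h -> contK K k -> (forall z, K z -> h z = k z) -> l h = l k.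
Proof.
intros Hl Hh Hk E. assert (Hl' := Hl). destruct Hl' as [_ [_ [C [HC HB]]]].
assert (T := cfun_close K l h k 0 C Hl Hh Hk (Rle_refl 0) HB).
assert (Z : minus (l h) (l k) = zero).
{ apply norm_eq0. intros eps He. apply Rle_trans with (C * 0); [|lra]. apply T.
  intros z Hz. rewrite E; [|exact Hz]. rewrite nminus_diag. lra. }
replace (l h) with (plus (minus (l h) (l k)) (l k)) by vec Y2. rewrite Z. vec Y2.
Qed.

Lemma cfun_zero K l : cfun K l -> l (fun _ => zero) = zero.
Proof.
intros [_ [_ [C [HC HB]]]]. apply norm_eq0. intros eps He.
apply Rle_trans with (C * 0); [|lra]. apply HB; [intros z _; apply cont_const|lra|].
intros z _. rewrite nzero. lra.
Qed.

Definition ker {Y : cspace} (zeta : R * R) (y : Y) (w : R * R) : Y := cmul (Cinv (Cminus zeta w)) y.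

Lemma ker_cont {Y : cspace} K zeta (y : Y) : ~ K zeta -> contK K (ker zeta y).
Proof.
intros N z Hz.
apply (cont_ext_loc (fun w => plus (ker zeta y w) zero) _ z 1); [lra| |].
- intros w _. vec Y.
- apply (rat_cont ((zeta, y) :: nil)). intros p [<-|[]]. intros E. apply N. simpl in E. rewrite E. exact Hz.
Qed.

Lemma rat_contK {Y : cspace} K (r : list ((R * R) * Y)) : poles_off K r -> contK K (rat r).
Proof.
intros P z Hz. apply rat_cont. intros p Hp E.
apply (proj1 (List.Forall_forall _ _) P p Hp). rewrite E. exact Hz.
Qed.

(** The principle behind the identities between contour integrals below: by
    Runge's theorem it suffices to check them on Cauchy kernels. *)
Lemma cfun_eq_approx K l1 l2 h : cfun K l1 -> cfun K l2 ->
  (forall zeta y, ~ K zeta -> l1 (ker zeta y) = l2 (ker zeta y)) ->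
  approx K h -> contK K h -> l1 h = l2 h.
Proof.
intros H1 H2 E Ha Hh.
assert (R0 : forall r, poles_off K r -> l1 (rat r) = l2 (rat r)).
{ induction r as [|[z y] r IH]; intros P.
  - change (l1 (fun _ => zero) = l2 (fun _ => zero)). rewrite (cfun_zero K l1) // (cfun_zero K l2) //.
  - inversion P as [|x r' Px Pr Ex]; subst. simpl in Px.
    assert (R1 := ker_cont K z y Px). assert (R2 := rat_contK K r Pr).
    change (l1 (fun w => plus (ker z y w) (rat r w)) = l2 (fun w => plus (ker z y w) (rat r w))).
    rewrite (proj1 H1 _ _ R1 R2) (proj1 H2 _ _ R1 R2) (E z y Px) (IH Pr). reflexivity. }
destruct (proj2 (proj2 H1)) as [C1 [P1 B1]]. destruct (proj2 (proj2 H2)) as [C2 [P2 B2]].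
assert (Z : minus (l1 h) (l2 h) = zero).
{ apply norm_eq0. intros eps He.
  assert (He' : 0 < eps / (C1 + C2 + 1)) by (apply Rdiv_lt_0_compat; lra).
  destruct (Ha _ He') as [r [Pr Br]]. assert (Cr := rat_contK K r Pr).
  assert (T1 := cfun_close K l1 h (rat r) _ C1 H1 Hh Cr (Rlt_le _ _ He') B1 Br).
  assert (T2 := cfun_close K l2 h (rat r) _ C2 H2 Hh Cr (Rlt_le _ _ He') B2 Br).
  assert (Er := R0 r Pr).
  replace (minus (l1 h) (l2 h)) with (minus (minus (l1 h) (l1 (rat r))) (minus (l2 h) (l2 (rat r)))).
  - eapply Rle_trans; [apply nminus|].
    apply Rle_trans with ((C1 + C2) * (eps / (C1 + C2 + 1))); [lra|].
    apply Rmult_le_reg_r with (C1 + C2 + 1); [lra|].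
    replace ((C1 + C2) * (eps / (C1 + C2 + 1)) * (C1 + C2 + 1)) with ((C1 + C2) * eps) by (field; lra). nra.
  - rewrite Er. vec Y2. }
replace (l1 h) with (plus (minus (l1 h) (l2 h)) (l2 h)) by vec Y2. rewrite Z. vec Y2.
Qed.
End Cfun.

(** * Cycles *)

Definition cyc {Y : cspace} (G : list (R -> R * R)) (h : R * R -> Y) : Y :=
  fold_right plus zero (map (fun g => gint g h) G).

Lemma cyc_cons {Y : cspace} g G (h : R * R -> Y) : cyc (g :: G) h = plus (gint g h) (cyc G h).
Proof. reflexivity. Qed.

Definition on_cycle (G : list (R -> R * R)) (K : R * R -> Prop) :=
  forall g, In g G -> piecewise_C1 g /\ forall t, 0 <= t <= 1 -> K (g t).

Lemma on_cycle_cons g G K : on_cycle (g :: G) K ->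
  piecewise_C1 g /\ (forall t, 0 <= t <= 1 -> K (g t)) /\ on_cycle G K.
Proof.
intros H. destruct (H g (or_introl eq_refl)) as [H1 H2]. split; [exact H1|]. split; [exact H2|].
intros g' Hg'. apply H. right. exact Hg'.
Qed.

Lemma cyc_cfun {Y1 Y2 : cspace} (G : list (R -> R * R)) (K : R * R -> Prop) (m : R * R -> Y1 -> Y2) :
  on_cycle G K ->
  (forall h, contK K h -> contK K (fun z => m z (h z))) ->
  (forall z x y, K z -> m z (plus x y) = plus (m z x) (m z y)) ->
  (forall z c x, K z -> m z (cmul c x) = cmul c (m z x)) ->
  (forall g, In g G -> exists B, 0 <= B /\ forall t y, 0 <= t <= 1 -> norm (m (g t) y) <= B * norm y) ->
  cfun K (fun h => cyc G (fun z => m z (h z))).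
Proof.
intros HG Hc Hp Hm HB. induction G as [|g G IH].
- split; [|split].
  + intros h k _ _. unfold cyc; simpl. vec Y2.
  + intros c h _. unfold cyc; simpl. vec Y2.
  + exists 0. split; [lra|]. intros h M _ _ _. unfold cyc; simpl. rewrite nzero. lra.
- destruct (on_cycle_cons g G K HG) as [Hg [Kg HG']].
  destruct (IH HG') as [I1 [I2 [C2 [P2 B2]]]]; [intros g' Hg'; apply HB; right; exact Hg'|].
  destruct (curve_integrable (Y := Y2) g Hg) as [C1 [P1 B1]].
  destruct (HB g (or_introl eq_refl)) as [B [PB BB]].
  assert (EI : forall h, contK K h -> ex_RInt (fun t => cmul (cvel g t) (m (g t) (h (g t)))) 0 1).
  { intros h Hh. apply (B1 (fun z => m z (h z))). intros t Ht. apply (Hc h Hh), Kg, Ht. }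
  assert (X : forall (u v : R -> Y2), (forall t, 0 <= t <= 1 -> u t = v t) -> RInt u 0 1 = RInt v 0 1).
  { intros u v E. apply (RInt_ext (V := Y2)). rewrite Rmin_left; [|lra]. rewrite Rmax_right; [|lra].
    intros t Ht. apply E. lra. }
  split; [|split].
  + intros h k Hh Hk. rewrite !cyc_cons I1 //.
    assert (E : gint g (fun z => m z (plus (h z) (k z))) = plus (gint g (fun z => m z (h z))) (gint g (fun z => m z (k z)))).
    { unfold gint. transitivity (RInt (fun t => plus (cmul (cvel g t) (m (g t) (h (g t)))) (cmul (cvel g t) (m (g t) (k (g t))))) 0 1).
      - apply X. intros t Ht. rewrite Hp; [|apply Kg, Ht]. vec Y2.
      - apply (RInt_plus (V := Y2)); apply EI; assumption. }
    rewrite E. vec Y2.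
  + intros c h Hh. rewrite !cyc_cons I2 //.
    assert (E : gint g (fun z => m z (cmul c (h z))) = cmul c (gint g (fun z => m z (h z)))).
    { unfold gint. rewrite -(RInt_lin (fun y => cmul c y) (blin_cmul c)); [|apply EI, Hh].
      apply X. intros t Ht. rewrite Hm; [|apply Kg, Ht]. vec Y2. }
    rewrite E. vec Y2.
  + exists (C1 * B + C2). split; [assert (0 <= C1 * B) by (apply Rmult_le_pos; assumption); lra|].
    intros h M Hh HM Hb. rewrite cyc_cons. eapply Rle_trans; [apply ntri|].
    assert (T1 := B2 h M Hh HM Hb).
    assert (T2 : norm (gint g (fun z => m z (h z))) <= C1 * (B * M)).
    { apply (B1 (fun z => m z (h z))); [intros t Ht; apply (Hc h Hh), Kg, Ht|].
      intros t Ht. eapply Rle_trans; [apply BB, Ht|]. apply Rmult_le_compat_l; [exact PB|]. apply Hb, Kg, Ht. }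
    lra.
Qed.

Lemma cyc_cfun_id {Y : cspace} (G : list (R -> R * R)) K : on_cycle G K -> cfun K (fun h : R * R -> Y => cyc G h).
Proof.
intros HG. apply (cyc_cfun G K (fun _ y => y) HG); auto.
intros g _. exists 1. split; [lra|]. intros. lra.
Qed.

Lemma cyc_cfun_scalar {Y : cspace} (G : list (R -> R * R)) K (u : R * R -> Y) : on_cycle G K -> contK K u ->
  cfun (Y1 := cC) K (fun s => cyc G (fun z => cmul (s z : C) (u z))).
Proof.
intros HG Hu. apply (cyc_cfun (Y1 := cC) G K (fun z s => cmul (s : C) (u z)) HG).
- intros h Hh z Hz. apply cont_cmul; [apply cont_cC, Hh, Hz|apply Hu, Hz].
- intros z x y _. apply cmul_plus_l.
- intros z c x _. rewrite cmul_cC cmul_cmul. reflexivity.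
- intros g Hg. destruct (HG g Hg) as [Pg Kg].
  destruct (curve_bounded g u Pg) as [M [PM BM]]; [intros t Ht; apply Hu, Kg, Ht|].
  exists (2 * M). split; [lra|]. intros t y Ht. rewrite norm_cC.
  eapply Rle_trans; [apply norm_cmul|]. assert (T := BM t Ht). assert (T2 := Cmod_ge_0 y).
  replace (2 * M * Cmod y) with (2 * Cmod y * M) by ring. apply Rmult_le_compat_l; lra.
Qed.

Lemma rect_cfun {Y : cspace} (a b c d : R) (K : R * R -> Prop) : a <= b -> c <= d ->
  (forall x y, onbd a b c d x y -> K (x, y)) -> cfun K (fun h : R * R -> Y => rect h a b c d).
Proof.
intros Hab Hcd HK. split; [|split].
- intros h k Hh Hk. apply rect_plus; try assumption. intros x y Hxy. split; [apply Hh|apply Hk]; apply HK, Hxy.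
- intros e h Hh. unfold rect, hseg, vseg.
  rewrite !(RInt_lin (fun y => cmul e y) (blin_cmul e));
    try (apply ex_hseg; [exact Hab|]; intros x Hx; apply Hh, HK; unfold onbd; lra);
    try (apply ex_vseg; [exact Hcd|]; intros x Hx; apply Hh, HK; unfold onbd; lra).
  vec Y.
- exists (2 * ((b - a) + (d - c))). split; [lra|]. intros h M Hh HM HB.
  eapply Rle_trans; [apply (rect_bound h a b c d M Hab Hcd)|right; ring].
  intros x y Hxy. split; [apply Hh, HK, Hxy|apply HB, HK, Hxy].
Qed.

(** * Winding numbers *)

Lemma cyc_scalar {Y : cspace} (G : list (R -> R * R)) K (s : R * R -> R * R) (y : Y) :
  on_cycle G K -> contK (Y := cC) K s -> cyc G (fun z => cmul (s z) y) = cmul (cyc (Y := cC) G s : C) y.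
Proof.
intros HG Hs. induction G as [|g G IH].
- unfold cyc; simpl. symmetry. apply cmul_zero.
- destruct (on_cycle_cons g G K HG) as [Hg [Kg HG']].
  rewrite !cyc_cons (IH HG').
  replace (gint g (fun z => cmul (s z) y)) with (cmul (gint (Y := cC) g s : C) y).
  + rewrite -cmul_plus_l. reflexivity.
  + destruct (curve_integrable (Y := cC) g Hg) as [C1 [P1 B1]].
    unfold gint. rewrite -(RInt_lin (fun c : cC => cmul (c : C) y) (blin_cmul_l y)).
    * apply (RInt_ext (V := Y)). intros t _. rewrite cmul_cC cmul_cmul. reflexivity.
    * apply B1. intros t Ht. apply Hs, Kg, Ht.
Qed.

(** The real part of dz / (z - w) is the differential of ln |z - w|, and the curve
    is closed; the imaginary part is the integrand defining the winding number. *)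
Lemma gint_winding (g : R -> R * R) (w : R * R) : piecewise_C1 g -> g 0 = g 1 ->
  (forall t, 0 <= t <= 1 -> g t <> w) ->
  gint (Y := cC) g (fun z => Cinv (Cminus z w)) = (0, 2 * PI * winding g w).
Proof.
intros Hg Hcl Nw.
set (p := fun t => fst (g t) - fst w). set (q := fun t => snd (g t) - snd w).
set (A := fun t => (p t * dx g t + q t * dy g t) / (p t ^ 2 + q t ^ 2)).
set (B := fun t => (p t * dy g t - q t * dx g t) / (p t ^ 2 + q t ^ 2)).
assert (Pos : forall t, 0 <= t <= 1 -> 0 < p t ^ 2 + q t ^ 2).
{ intros t Ht. assert (N := Nw t Ht). assert (H1 := pow2_ge_0 (p t)). assert (H2 := pow2_ge_0 (q t)).
  destruct (Req_dec (p t) 0) as [E1|E1]; [destruct (Req_dec (q t) 0) as [E2|E2]|].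
  - exfalso. apply N. unfold p in E1. unfold q in E2. apply injective_projections; lra.
  - assert (0 < q t ^ 2) by (apply pow2_gt_0; exact E2). lra.
  - assert (0 < p t ^ 2) by (apply pow2_gt_0; exact E1). lra. }
assert (EX : ex_RInt (V := prodC R_CompleteNormedModule R_CompleteNormedModule)
   (fun t => cmul (Y := cC) (cvel g t) (Cinv (Cminus (g t) w))) 0 1).
{ destruct (curve_integrable (Y := cC) g Hg) as [C1 [P1 B1]].
  apply (B1 (fun z => Cinv (Cminus z w))). intros t Ht. apply cont_cC, ccont_inv, Nw, Ht. }
assert (Efst : forall t, 0 <= t <= 1 -> cmul (Y := cC) (cvel g t) (Cinv (Cminus (g t) w)) = (A t, B t)).
{ intros t Ht. rewrite cmul_cC. assert (P := Pos t Ht). unfold A, B, p, q in *. unfold cvel.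
  apply injective_projections; simpl; field; intros E; simpl in P; lra. }
destruct EX as [[la lb] HL].
assert (HA : is_RInt A 0 1 la).
{ apply (is_RInt_ext (fun t => fst (cmul (Y := cC) (cvel g t) (Cinv (Cminus (g t) w))))).
  - rewrite Rmin_left; [|lra]. rewrite Rmax_right; [|lra]. intros t Ht. rewrite Efst; [reflexivity|lra].
  - apply (is_RInt_fct_extend_fst _ 0 1 (la, lb) HL). }
assert (HB : is_RInt B 0 1 lb).
{ apply (is_RInt_ext (fun t => snd (cmul (Y := cC) (cvel g t) (Cinv (Cminus (g t) w))))).
  - rewrite Rmin_left; [|lra]. rewrite Rmax_right; [|lra]. intros t Ht. rewrite Efst; [reflexivity|lra].
  - apply (is_RInt_fct_extend_snd _ 0 1 (la, lb) HL). }
unfold gint. rewrite (is_RInt_unique (V := prodC R_CompleteNormedModule R_CompleteNormedModule) _ 0 1 _ HL).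
apply injective_projections; simpl.
- set (L := fun t => ln (p t ^ 2 + q t ^ 2) / 2).
  destruct Hg as [n [t [H0 [H1 Hp]]]].
  assert (Ht := subdivision_le n t (fun i Hi => proj1 (Hp i Hi))).
  assert (sm : forall a b c : R, c = a * b -> scal a b = c) by (intros a b c ->; reflexivity).
  assert (fe : forall a b c d m : R, 0 < m -> (2 * a * b + 2 * c * d) * / (2 * m) = (a * b + c * d) / m).
  { intros a b c d m Hm. field. lra. }
  assert (Q : forall i, (i <= n)%nat -> is_RInt A (t O) (t i) (L (t i) - L (t O))).
  { induction i as [|i IH]; intros Hi.
    - rewrite Rminus_diag. apply (is_RInt_point (V := R_NormedModule)).
    - destruct (Hp i) as [Hlt [r [[r' Hr] E]]]; [lia|].
      assert (T1 := Ht i ltac:(lia)). assert (T2 := Ht (S i) Hi).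
      assert (EP : plus (L (t i) - L (t O)) (L (t (S i)) - L (t i)) = L (t (S i)) - L (t O)).
      { change ((L (t i) - L (t O)) + (L (t (S i)) - L (t i)) = L (t (S i)) - L (t O)). ring. }
      rewrite -EP.
      apply (is_RInt_Chasles (V := R_NormedModule) A (t O) (t i)); [apply IH; lia|].
      set (N := fun s => (fst (r s) - fst w) ^ 2 + (snd (r s) - snd w) ^ 2).
      assert (EL : forall s, t i <= s <= t (S i) -> L s = ln (N s) / 2).
      { intros s Hs. unfold L, N, p, q. rewrite (E s Hs). reflexivity. }
      assert (PN : forall s, t i <= s <= t (S i) -> 0 < N s).
      { intros s Hs. unfold N. rewrite -(E s Hs). apply Pos. lra. }
      rewrite (EL (t (S i))); [|lra]. rewrite (EL (t i)); [|lra].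
      apply (is_RInt_ext (fun s => ((fst (r s) - fst w) * fst (r' s) + (snd (r s) - snd w) * snd (r' s)) / N s)).
      + rewrite Rmin_left; [|lra]. rewrite Rmax_right; [|lra]. intros s Hs.
        assert (V := cvel_piece g r r' _ _ Hr E s Hs). unfold A, N, p, q.
        rewrite (E s ltac:(lra)). apply (f_equal fst) in V as V1. apply (f_equal snd) in V as V2.
        simpl in V1, V2. rewrite V1 V2. reflexivity.
      + apply (is_RInt_derive (V := R_CompleteNormedModule) (fun s => ln (N s) / 2)).
        * rewrite Rmin_left; [|lra]. rewrite Rmax_right; [|lra]. intros s Hs.
          destruct (C1_components r r' Hr s) as [D1 [D2 _]].
          assert (P := PN s Hs).
          assert (DN : is_derive N s (2 * (fst (r s) - fst w) * fst (r' s) + 2 * (snd (r s) - snd w) * snd (r' s))).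
          { unfold N. 
            assert (X1 : is_derive (fun s => (fst (r s) - fst w) ^ 2) s (2 * (fst (r s) - fst w) * fst (r' s))).
            { apply (is_derive_ext (fun s => (fun x => (x - fst w) ^ 2) (fst (r s)))); [reflexivity|].
              rewrite -(sm (fst (r' s)) (2 * (fst (r s) - fst w)) (2 * (fst (r s) - fst w) * fst (r' s)) ltac:(ring)).
              apply (is_derive_comp (fun x => (x - fst w) ^ 2) (fun s => fst (r s))); [|exact D1].
              auto_derive; [trivial|ring]. }
            assert (X2 : is_derive (fun s => (snd (r s) - snd w) ^ 2) s (2 * (snd (r s) - snd w) * snd (r' s))).
            { apply (is_derive_ext (fun s => (fun x => (x - snd w) ^ 2) (snd (r s)))); [reflexivity|].
              rewrite -(sm (snd (r' s)) (2 * (snd (r s) - snd w)) (2 * (snd (r s) - snd w) * snd (r' s)) ltac:(ring)).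
              apply (is_derive_comp (fun x => (x - snd w) ^ 2) (fun s => snd (r s))); [|exact D2].
              auto_derive; [trivial|ring]. }
            apply (is_derive_plus (fun s => (fst (r s) - fst w) ^ 2) _ s _ _ X1 X2). }
          apply (is_derive_ext (fun s => (fun x => ln x / 2) (N s))); [reflexivity|].
          replace (((fst (r s) - fst w) * fst (r' s) + (snd (r s) - snd w) * snd (r' s)) / N s)
            with (scal (2 * (fst (r s) - fst w) * fst (r' s) + 2 * (snd (r s) - snd w) * snd (r' s)) (/ (2 * N s)))
            by (apply sm; symmetry; apply fe; exact P).
          apply (is_derive_comp (fun x => ln x / 2) N); [|exact DN].
          auto_derive; [exact P|field; lra].
        * rewrite Rmin_left; [|lra]. rewrite Rmax_right; [|lra]. intros s Hs.
          destruct (C1_components r r' Hr s) as [D1 [D2 [K1 K2]]].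
          assert (P := PN s Hs).
          assert (c1 : continuous (fun s => fst (r s) - fst w) s).
          { apply (continuous_minus (fun s => fst (r s)) (fun _ => fst w)); [|apply continuous_const].
            apply (ex_derive_continuous (fun s => fst (r s))). eexists; exact D1. }
          assert (c2 : continuous (fun s => snd (r s) - snd w) s).
          { apply (continuous_minus (fun s => snd (r s)) (fun _ => snd w)); [|apply continuous_const].
            apply (ex_derive_continuous (fun s => snd (r s))). eexists; exact D2. }
          assert (cN : continuous N s).
          { assert (EN : forall x, (fst (r x) - fst w) * (fst (r x) - fst w) + (snd (r x) - snd w) * (snd (r x) - snd w) = N x)
              by (intros x; unfold N; ring).
            apply (continuous_ext (fun s => (fst (r s) - fst w) * (fst (r s) - fst w) + (snd (r s) - snd w) * (snd (r s) - snd w))).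
            - exact EN.
            - apply (continuous_plus (fun s => (fst (r s) - fst w) * (fst (r s) - fst w)) (fun s => (snd (r s) - snd w) * (snd (r s) - snd w)));
              apply (continuous_mult (K := R_AbsRing)); assumption. }
          apply (continuous_mult (K := R_AbsRing)).
          -- apply (continuous_plus (fun s => (fst (r s) - fst w) * fst (r' s)) (fun s => (snd (r s) - snd w) * snd (r' s)));
             apply (continuous_mult (K := R_AbsRing)); assumption.
          -- apply (continuous_comp N (fun x => / x)); [exact cN|].
             apply (ex_derive_continuous (fun x => / x)). auto_derive. lra. }
  assert (T := Q n (le_n n)). rewrite H0 H1 in T.
  assert (E01 : L 1 - L 0 = 0) by (unfold L, p, q; rewrite Hcl; ring). rewrite E01 in T.
  rewrite -(is_RInt_unique (V := R_CompleteNormedModule) _ _ _ _ HA).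
  apply (is_RInt_unique (V := R_CompleteNormedModule)). exact T.
- unfold winding. fold p q.
  assert (EB : RInt B 0 1 = lb) by (apply (is_RInt_unique (V := R_CompleteNormedModule)); exact HB).
  change (lb = 2 * PI * (/ (2 * PI) * RInt B 0 1)). rewrite EB.
  assert (FE : forall x : R, x = 2 * PI * (/ (2 * PI) * x)) by (intros x; assert (P := PI_RGT_0); field; lra).
  apply FE.
Qed.

Definition closed_cycle (G : list (R -> R * R)) := forall g, In g G -> g 0 = g 1.

Lemma cyc_winding (G : list (R -> R * R)) K (w : R * R) : on_cycle G K -> closed_cycle G -> ~ K w ->
  cyc (Y := cC) G (fun z => Cinv (Cminus z w)) = (0, 2 * PI * total_winding G w).
Proof.
intros HG Hcl N. induction G as [|g G IH].
- apply injective_projections; simpl; [reflexivity|unfold total_winding; simpl; unfold zero; simpl; ring].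
- destruct (on_cycle_cons g G K HG) as [Hg [Kg HG']].
  rewrite cyc_cons (IH HG'); [|intros g' Hg'; apply Hcl; right; exact Hg'].
  rewrite gint_winding; try assumption.
  + apply injective_projections; unfold total_winding; simpl; unfold plus; simpl; ring.
  + apply Hcl. left. reflexivity.
  + intros t Ht E. apply N. rewrite -E. apply Kg, Ht.
Qed.

(** * The quadratic resolvent *)

Definition clin {Y : cspace} (L : Y -> Y) : Prop :=
  (forall x y, L (plus x y) = plus (L x) (L y)) /\
  (forall (c : C) x, L (cmul c x) = cmul c (L x)) /\
  exists M, 0 <= M /\ forall x, norm (L x) <= M * norm x.

Section Resolvent.
Context {Y : cspace} (A N : Y -> Y).
Hypotheses (HA : clin A) (HN : clin N) (AN : forall y, A (N y) = N (A y)).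

Lemma clin_plus {L : Y -> Y} : clin L -> forall x y, L (plus x y) = plus (L x) (L y).
Proof. intros H. apply H. Qed.
Lemma clin_cmul {L : Y -> Y} : clin L -> forall c x, L (cmul c x) = cmul c (L x).
Proof. intros H. apply H. Qed.
Lemma clin_opp {L : Y -> Y} : clin L -> forall x, L (opp x) = opp (L x).
Proof. intros H x. rewrite -!cmul_m1. apply H. Qed.
Lemma clin_minus {L : Y -> Y} : clin L -> forall x y, L (minus x y) = minus (L x) (L y).
Proof. intros H x y. unfold minus. rewrite (clin_plus H) (clin_opp H). reflexivity. Qed.
Lemma clin_zero {L : Y -> Y} : clin L -> L zero = zero.
Proof. intros H. rewrite -(cmul_zero zero) (clin_cmul H). vec Y. Qed.

Definition Qz (z : C) (y : Y) : Y :=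
  plus (minus (cmul (Cmult z z) y) (cmul (Cmult (RtoC 2) z) (A y))) (N y).

Lemma Qz_plus z x y : Qz z (plus x y) = plus (Qz z x) (Qz z y).
Proof. unfold Qz. rewrite (clin_plus HA) (clin_plus HN). vec Y. Qed.
Lemma Qz_cmul z c x : Qz z (cmul c x) = cmul c (Qz z x).
Proof. unfold Qz. rewrite (clin_cmul HA) (clin_cmul HN). vec Y. Qed.
Lemma Qz_minus z x y : Qz z (minus x y) = minus (Qz z x) (Qz z y).
Proof. unfold Qz. rewrite (clin_minus HA) (clin_minus HN). vec Y. Qed.

Definition is_inv (z : C) (S : Y -> Y) : Prop :=
  (forall y, Qz z (S y) = y) /\ (forall y, S (Qz z y) = y) /\
  exists M, 0 <= M /\ forall y, norm (S y) <= M * norm y.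

Definition Rho (z : R * R) : Prop := exists S, is_inv z S.
(** The inverse of the pencil, meaningful on the resolvent set. *)
Definition Rs (z : R * R) : Y -> Y := epsilon (inhabits (fun y => y)) (is_inv z).

Lemma Rs_inv z : Rho z -> is_inv z (Rs z).
Proof. intros H. unfold Rs. apply epsilon_spec. exact H. Qed.

Lemma QR z y : Rho z -> Qz z (Rs z y) = y.
Proof. intros H. apply (Rs_inv z H). Qed.
Lemma RQ z y : Rho z -> Rs z (Qz z y) = y.
Proof. intros H. apply (Rs_inv z H). Qed.

Lemma Rs_plus z x y : Rho z -> Rs z (plus x y) = plus (Rs z x) (Rs z y).
Proof. intros H. rewrite -{1}(QR z x H) -{1}(QR z y H) -Qz_plus RQ //. Qed.
Lemma Rs_cmul z c x : Rho z -> Rs z (cmul c x) = cmul c (Rs z x).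
Proof. intros H. rewrite -{1}(QR z x H) -Qz_cmul RQ //. Qed.
Lemma Rs_clin z : Rho z -> clin (Rs z).
Proof.
intros H. split; [|split].
- intros x y. apply Rs_plus, H.
- intros c x. apply Rs_cmul, H.
- apply (Rs_inv z H).
Qed.

Lemma Rs_comm z (L : Y -> Y) y : Rho z -> (forall x, L (Qz z x) = Qz z (L x)) -> Rs z (L y) = L (Rs z y).
Proof. intros H E. rewrite -{1}(QR z y H) E RQ //. Qed.

Lemma A_Qz z x : A (Qz z x) = Qz z (A x).
Proof. unfold Qz. rewrite (clin_plus HA) (clin_minus HA) !(clin_cmul HA) AN. reflexivity. Qed.

Lemma Rs_A z y : Rho z -> Rs z (A y) = A (Rs z y).
Proof. intros H. apply Rs_comm; [exact H|apply A_Qz]. Qed.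

Lemma Qz_diff z w y : minus (Qz z y) (Qz w y)
  = cmul (Cminus z w) (minus (cmul (Cplus z w) y) (cmul (RtoC 2) (A y))).
Proof. unfold Qz. vec Y. Qed.

(** The first resolvent identity for a quadratic pencil. *)
Lemma Rs_diff z w y : Rho z -> Rho w -> minus (Rs w y) (Rs z y)
  = cmul (Cminus z w) (Rs z (minus (cmul (Cplus z w) (Rs w y)) (cmul (RtoC 2) (A (Rs w y))))).
Proof.
intros Hz Hw. rewrite -(Rs_cmul z) // -Qz_diff (QR w) // (clin_minus (Rs_clin z Hz)) RQ //.
Qed.

Lemma Rs_bound z : Rho z -> exists M, 0 <= M /\ forall y, norm (Rs z y) <= M * norm y.
Proof. intros H. apply (Rs_inv z H). Qed.

(** * The resolvent set is open *)

Lemma geometric_limit (u : nat -> Y) (M : R) : 0 <= M ->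
  (forall n, norm (minus (u (S n)) (u n)) <= M * (/ 2) ^ n) ->
  exists y, forall eps, 0 < eps -> exists n0, forall n, (n0 <= n)%nat -> norm (minus (u n) y) < eps.
Proof.
intros HM H.
assert (E : ex_series (V := Y) (fun n => minus (u (S n)) (u n))).
{ apply (ex_series_le (V := Y) _ (fun n => M * (/ 2) ^ n)); [exact H|].
  apply (ex_series_scal (K := R_AbsRing) (V := R_NormedModule) M (fun n => (/ 2) ^ n)).
  apply ex_series_geom. rewrite Rabs_right; lra. }
destruct E as [l Hl]. exists (plus (u O) l).
assert (Sum : forall n, sum_n (fun n => minus (u (S n)) (u n)) n = minus (u (S n)) (u O)).
{ induction n as [|n IH]; [apply sum_O|]. rewrite sum_Sn IH. vec Y. }
intros eps He.
assert (Hf := proj1 (filterlim_locally_ball_norm (U := Y) _ _) Hl (mkposreal eps He)).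
destruct Hf as [n0 Hn0]. exists (S n0). intros [|n] Hn; [lia|].
assert (T := Hn0 n ltac:(lia)). unfold ball_norm in T. simpl in T. rewrite Sum in T.
norm_as Y (minus (minus (u (S n)) (u O)) l). exact T.
Qed.

(** The contraction principle, used to invert perturbations of an invertible map. *)
Lemma affine_fixpoint (T : Y -> Y) (b : Y) : (forall x y, T (minus x y) = minus (T x) (T y)) ->
  (forall y, norm (T y) <= / 2 * norm y) -> exists y, y = minus b (T y).
Proof.
intros HT HB.
set (u := fix u n := match n with O => b | S n => minus b (T (u n)) end).
assert (D : forall n, norm (minus (u (S n)) (u n)) <= norm (T b) * (/ 2) ^ n).
{ induction n as [|n IH].
  - simpl. rewrite Rmult_1_r. norm_as Y (opp (T b)). rewrite nopp. lra.
  - change (u (S (S n))) with (minus b (T (u (S n)))). change (u (S n)) with (minus b (T (u n))) at 2.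
    norm_as Y (opp (minus (T (u (S n))) (T (u n)))). rewrite nopp -HT.
    eapply Rle_trans; [apply HB|]. change ((/ 2) ^ S n) with (/ 2 * (/ 2) ^ n). lra. }
destruct (geometric_limit u (norm (T b)) (nge0 _) D) as [y Hy]. exists y.
assert (Z : minus y (minus b (T y)) = zero).
{ apply norm_eq0. intros eps He. destruct (Hy (eps / 2)) as [n0 Hn0]; [lra|].
  assert (T1 := Hn0 n0 ltac:(lia)). assert (T2 := Hn0 (S n0) ltac:(lia)).
  change (u (S n0)) with (minus b (T (u n0))) in T2.
  norm_as Y (minus (opp (minus (minus b (T (u n0))) y)) (minus (T (u n0)) (T y))).
  eapply Rle_trans; [apply nminus|]. rewrite nopp -HT.
  assert (T3 := HB (minus (u n0) y)). assert (T4 := nge0 (minus (u n0) y)). lra. }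
transitivity (plus (minus y (minus b (T y))) (minus b (T y))); [vec Y|]. rewrite Z. vec Y.
Qed.

Lemma Qz_perturb (z : C) : exists k, 0 < k /\ forall w y, Cmod (Cminus w z) < 1 ->
  norm (minus (Qz w y) (Qz z y)) <= k * Cmod (Cminus w z) * norm y.
Proof.
destruct (proj2 (proj2 HA)) as [a [Ha1 Ha2]].
assert (Hz := Cmod_ge_0 z).
exists (2 * (2 * (2 * Cmod z + 1) + 2 * 2 * a)). split; [nra|]. intros w y Hw.
rewrite Qz_diff. eapply Rle_trans; [apply norm_cmul|].
replace (2 * (2 * (2 * Cmod z + 1) + 2 * 2 * a) * Cmod (Cminus w z) * norm y)
  with (2 * Cmod (Cminus w z) * ((2 * (2 * Cmod z + 1) + 2 * 2 * a) * norm y)) by ring.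
apply Rmult_le_compat_l; [assert (H := Cmod_ge_0 (Cminus w z)); lra|].
eapply Rle_trans; [apply nminus|].
eapply Rle_trans; [apply Rplus_le_compat; apply norm_cmul|].
rewrite (Cmod_R 2) Rabs_right; [|lra].
assert (B1 : Cmod (Cplus w z) <= 2 * Cmod z + 1).
{ replace (Cplus w z) with (Cplus (Cminus w z) (Cplus z z)) by ring.
  eapply Rle_trans; [apply Cmod_triangle|].
  assert (T := Cmod_triangle z z). lra. }
assert (B2 := Ha2 y). assert (Hy := nge0 y).
assert (2 * Cmod (Cplus w z) * norm y <= 2 * (2 * Cmod z + 1) * norm y)
  by (apply Rmult_le_compat_r; lra).
lra.
Qed.

(** For w near z, Qz w y = x is the fixed point equation
    y = Rs z x - Rs z ((Qz w - Qz z) y) of a contraction. *)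
Lemma Rho_open z : Rho z -> exists d M, 0 < d /\ 0 <= M /\ forall w, Cmod (Cminus w z) < d ->
  Rho w /\ forall y, norm (Rs w y) <= M * norm y.
Proof.
intros Hz. destruct (Qz_perturb z) as [k [Hk Hp]]. destruct (Rs_bound z Hz) as [M [HM HB]].
set (d := Rmin 1 (/ (2 * k * (M + 1)))).
assert (Hkm : 0 < 2 * k * (M + 1)) by (apply Rmult_lt_0_compat; lra).
assert (Hd : 0 < d) by (apply Rmin_pos; [lra|apply Rinv_0_lt_compat; exact Hkm]).
assert (W : forall w y, Cmod (Cminus w z) < d -> norm (Rs z (minus (Qz w y) (Qz z y))) <= / 2 * norm y).
{ intros w y Hw. eapply Rle_trans; [apply HB|].
  assert (H1 := Rlt_le_trans _ _ _ Hw (Rmin_l _ _)). assert (H2 := Rlt_le_trans _ _ _ Hw (Rmin_r _ _)).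
  assert (H3 := Hp w y H1). assert (H4 := Cmod_ge_0 (Cminus w z)). assert (Hy := nge0 y).
  apply Rle_trans with (M * (k * Cmod (Cminus w z) * norm y)); [apply Rmult_le_compat_l; assumption|].
  rewrite -Rmult_assoc. apply Rmult_le_compat_r; [exact Hy|].
  apply Rle_trans with ((M + 1) * (k * / (2 * k * (M + 1)))).
  - apply Rmult_le_compat; try lra; [apply Rmult_le_pos; lra|]. apply Rmult_le_compat_l; lra.
  - right. field. lra. }
assert (Low : forall w y, Cmod (Cminus w z) < d -> norm y <= 2 * M * norm (Qz w y)).
{ intros w y Hw. assert (H1 := W w y Hw).
  assert (H2 : norm y <= norm (Rs z (Qz w y)) + / 2 * norm y).
  { rewrite -{1}(RQ z y Hz).
    assert (E : Rs z (Qz z y) = minus (Rs z (Qz w y)) (Rs z (minus (Qz w y) (Qz z y)))).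
    { rewrite (clin_minus (Rs_clin z Hz)). vec Y. }
    rewrite E. eapply Rle_trans; [apply nminus|]. lra. }
  assert (H3 := HB (Qz w y)). lra. }
exists d, (2 * M). split; [exact Hd|]. split; [lra|]. intros w Hw.
assert (Sol : forall x, exists y, Qz w y = x).
{ intros x. destruct (affine_fixpoint (fun y => Rs z (minus (Qz w y) (Qz z y))) (Rs z x)) as [y Hy].
  - intros u v. rewrite !Qz_minus -(clin_minus (Rs_clin z Hz)). f_equal. vec Y.
  - intros y. apply W, Hw.
  - exists y. rewrite -(clin_minus (Rs_clin z Hz)) in Hy.
    apply (f_equal (Qz z)) in Hy. rewrite (QR z) // in Hy.
    transitivity (plus (Qz z y) (minus (Qz w y) (Qz z y))); [vec Y|]. rewrite {1}Hy. vec Y. }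
assert (HR : Rho w).
{ exists (fun x => epsilon (inhabits zero) (fun y => Qz w y = x)).
  assert (E : forall x, Qz w (epsilon (inhabits zero) (fun y => Qz w y = x)) = x).
  { intros x. apply (epsilon_spec (inhabits zero) (fun y => Qz w y = x)), Sol. }
  split; [exact E|]. split.
  - intros y. set (y' := epsilon _ _). assert (E' : Qz w y' = Qz w y) by apply E.
    assert (Z : minus y' y = zero).
    { apply norm_eq0. intros eps He. eapply Rle_trans; [apply (Low w _ Hw)|].
      rewrite Qz_minus E' nminus_diag. lra. }
    transitivity (plus (minus y' y) y); [vec Y|]. rewrite Z. vec Y.
  - exists (2 * M). split; [lra|]. intros y. rewrite -{2}(E y). apply Low, Hw. }
split; [exact HR|]. intros y. rewrite -{2}(QR w y HR). apply Low, Hw.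
Qed.

Lemma Rs_cont z y : Rho z -> cont (fun w => Rs w y) z.
Proof.
intros Hz. destruct (Rho_open z Hz) as [d [M [Hd [HM HR]]]].
destruct (proj2 (proj2 HA)) as [a [Ha1 Ha2]].
apply (cont_lip _ z (2 * (M * (2 * (2 * Cmod z + d) * norm (Rs z y) + 2 * 2 * (a * norm (Rs z y))))) d Hd).
intros w Hw. destruct (HR w Hw) as [Hw1 Hw2].
assert (E := Rs_diff w z y Hw1 Hz).
norm_as Y (opp (minus (Rs z y) (Rs w y))). rewrite nopp E.
eapply Rle_trans; [apply norm_cmul|].
set (Q := 2 * (2 * Cmod z + d) * norm (Rs z y) + 2 * 2 * (a * norm (Rs z y))).
replace (2 * (M * Q) * Cmod (Cminus w z)) with (2 * Cmod (Cminus w z) * (M * Q)) by ring.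
apply Rmult_le_compat_l; [assert (H := Cmod_ge_0 (Cminus w z)); lra|].
eapply Rle_trans; [apply Hw2|]. apply Rmult_le_compat_l; [exact HM|].
eapply Rle_trans; [apply nminus|]. eapply Rle_trans; [apply Rplus_le_compat; apply norm_cmul|].
rewrite (Cmod_R 2) Rabs_right; [|lra]. unfold Q.
assert (B1 : Cmod (Cplus w z) <= 2 * Cmod z + d).
{ replace (Cplus w z) with (Cplus (Cminus w z) (Cplus z z)) by ring.
  eapply Rle_trans; [apply Cmod_triangle|]. assert (T := Cmod_triangle z z). lra. }
apply Rplus_le_compat.
- apply Rmult_le_compat_r; [apply nge0|lra].
- apply Rmult_le_compat_l; [lra|]. apply Ha2.
Qed.

Lemma Rs_cdiff z y : Rho z -> cdiff (fun w => Rs w y) z.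
Proof.
intros Hz. destruct (Rho_open z Hz) as [d [M [Hd [HM HR]]]].
apply (cdiff_loc _ (fun w => plus (cmul (Copp (Cplus w z)) (Rs w (Rs z y))) (cmul (RtoC 2) (Rs w (A (Rs z y))))) z d Hd).
- apply cont_plus; (apply cont_cmul; [|apply Rs_cont, Hz]).
  + intros eps He. exists eps. split; [exact He|]. intros w Hw.
    replace (Cminus _ _) with (Copp (Cminus w z)) by ring. rewrite Cmod_opp. exact Hw.
  + apply ccont_const.
- intros w Hw. destruct (HR w Hw) as [Hw1 _].
  transitivity (opp (minus (Rs z y) (Rs w y))); [vec Y|].
  rewrite (Rs_diff w z y Hw1 Hz) (clin_minus (Rs_clin w Hw1)) !(Rs_cmul w) //. vec Y.
Qed.

(** * Behaviour of the resolvent at infinity *)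

Lemma norm_cmul_low (c : C) (y : Y) : c <> RtoC 0 -> Cmod c * norm y <= 2 * norm (cmul c y).
Proof.
intros Hc. assert (Hp : 0 < Cmod c) by (apply Cmod_gt_0; exact Hc).
assert (E : y = cmul (Cinv c) (cmul c y)).
{ rewrite cmul_cmul Cinv_l; [symmetry; apply cmul_one|exact Hc]. }
assert (T := norm_cmul (Cinv c) (cmul c y)). rewrite -E Cmod_inv in T; [|exact Hc].
apply (Rmult_le_compat_l (Cmod c)) in T; [|lra].
replace (Cmod c * (2 * / Cmod c * norm (cmul c y))) with (2 * norm (cmul c y)) in T by (field; lra). exact T.
Qed.

Lemma Rs_decay : exists r, 0 < r /\ forall z y, r <= Cmod z -> Rho z -> Cmod z ^ 2 * norm (Rs z y) <= 4 * norm y.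
Proof.
destruct (proj2 (proj2 HA)) as [a [Ha1 Ha2]]. destruct (proj2 (proj2 HN)) as [b [Hb1 Hb2]].
exists (16 * a + 4 * b + 4). split; [lra|]. intros z y Hz HR.
rewrite -{2}(QR z y HR). set (x := Rs z y). assert (Hx := nge0 x).
assert (Nz : z <> RtoC 0) by (apply Cmod_gt_0; lra).
assert (L := norm_cmul_low (Cmult z z) x ltac:(apply Cmult_neq_0; exact Nz)). rewrite Cmod_mult in L.
assert (E : cmul (Cmult z z) x = plus (Qz z x) (minus (cmul (Cmult (RtoC 2) z) (A x)) (N x))) by (unfold Qz; vec Y).
rewrite E in L.
assert (T1 := ntri (Qz z x) (minus (cmul (Cmult (RtoC 2) z) (A x)) (N x))).
assert (T2 := nminus (cmul (Cmult (RtoC 2) z) (A x)) (N x)).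
assert (T3 := norm_cmul (Cmult (RtoC 2) z) (A x)). rewrite Cmod_mult (Cmod_R 2) Rabs_right in T3; [|lra].
assert (T4 := Ha2 x). assert (T5 := Hb2 x).
set (m := Cmod z) in *. set (n := norm x) in *.
assert (T6 : 4 * m * norm (A x) <= 4 * m * (a * n)) by (apply Rmult_le_compat_l; lra).
assert (T7 : n * m * (16 * a + 4 * b + 4) <= n * m * m) by (apply Rmult_le_compat_l; [apply Rmult_le_pos; lra|lra]).
assert (T8 : n * 1 <= n * m) by (apply Rmult_le_compat_l; lra).
nra.
Qed.
End Resolvent.

(** * Cycles and holomorphic functions *)

Definition clo (D : R * R -> Prop) (z : R * R) : Prop :=
  forall e, 0 < e -> exists w, Cmod (Cminus w z) < e /\ D w.

Definition copen (D : R * R -> Prop) : Prop :=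
  forall z, D z -> exists e, 0 < e /\ forall w, Cmod (Cminus w z) < e -> D w.

Lemma clo_incl D z : D z -> clo D z.
Proof. intros H e He. exists z. split; [rewrite Cmod_m0; exact He|exact H]. Qed.

Lemma clo_out D z : ~ clo D z -> exists d, 0 < d /\ forall w, clo D w -> d <= Cmod (Cminus z w).
Proof.
intros H. assert (T : exists e, 0 < e /\ forall w, Cmod (Cminus w z) < e -> ~ D w).
{ apply NNPP. intros X. apply H. intros e He. apply NNPP. intros Y. apply X. exists e. split; [exact He|].
  intros w Hw Dw. apply Y. exists w. split; assumption. }
destruct T as [e [He T]]. exists (e / 2). split; [lra|]. intros w Hw. apply Rnot_lt_le. intros L.
destruct (Hw (e / 2)) as [v [Hv Dv]]; [lra|]. apply (T v); [|exact Dv].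
assert (Tr := Cmod_triangle (Cminus v w) (Cminus w z)).
replace (Cplus (Cminus v w) (Cminus w z)) with (Cminus v z) in Tr by ring.
rewrite (Cmod_minus_sym w z) in Tr. lra.
Qed.

Lemma clo_bound D M : (forall z, D z -> Cmod z <= M) -> forall z, clo D z -> Cmod z <= M.
Proof.
intros H z Hz. apply Rnot_lt_le. intros L. destruct (Hz (Cmod z - M)) as [w [Hw Dw]]; [lra|].
assert (T := H w Dw). assert (T2 := Cmod_tri_sub z w). rewrite Cmod_minus_sym in T2. lra.
Qed.

Lemma lebesgue_number (K Om : R * R -> Prop) (M : R) : copen Om -> pclosed K ->
  (forall z, K z -> Cmod z <= M) -> (forall z, K z -> Om z) ->
  exists d, 0 < d /\ forall z w, K z -> Cmod (Cminus w z) < d -> Om w.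
Proof.
intros HO HK HM HKO. set (m := Rabs M). assert (Hm : 0 <= m) by apply Rabs_pos.
assert (B : exists d, 0 < d /\ forall z w, K z -> - m <= fst z <= m /\ - m <= snd z <= m -> Cmod (Cminus w z) < d -> Om w).
{ apply (bisection (fun a b c d => exists e, 0 < e /\ forall z w, K z -> a <= fst z <= b /\ c <= snd z <= d ->
    Cmod (Cminus w z) < e -> Om w) (- m) m (- m) m); try lra.
  - intros a b c d _ _ _ _ _ _ [e1 [P1 Q1]] [e2 [P2 Q2]] [e3 [P3 Q3]] [e4 [P4 Q4]].
    exists (Rmin (Rmin e1 e2) (Rmin e3 e4)). split; [repeat apply Rmin_pos; assumption|].
    intros z w Kz [Hx Hy] Hw.
    assert (W12 := Rlt_le_trans _ _ _ Hw (Rmin_l _ _)). assert (W34 := Rlt_le_trans _ _ _ Hw (Rmin_r _ _)).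
    assert (W1 := Rlt_le_trans _ _ _ W12 (Rmin_l _ _)). assert (W2 := Rlt_le_trans _ _ _ W12 (Rmin_r _ _)).
    assert (W3 := Rlt_le_trans _ _ _ W34 (Rmin_l _ _)). assert (W4 := Rlt_le_trans _ _ _ W34 (Rmin_r _ _)).
    destruct (Rle_dec (fst z) ((a + b) / 2)); destruct (Rle_dec (snd z) ((c + d) / 2)).
    + apply (Q1 z); try assumption; lra.
    + apply (Q3 z); try assumption; lra.
    + apply (Q2 z); try assumption; lra.
    + apply (Q4 z); try assumption; lra.
  - intros x y _ _. destruct (classic (K (x, y))) as [Kxy|Nxy].
    + destruct (HO _ (HKO _ Kxy)) as [e [He1 He2]]. exists (e / 4). split; [lra|].
      intros a b c d _ Hx _ _ Hy _ W1 W2. exists (e / 2). split; [lra|]. intros [zx zy] w _ [Hzx Hzy] Hw.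
      simpl in Hzx, Hzy. apply He2.
      assert (T := Cmod_triangle (Cminus w (zx, zy)) (Cminus (zx, zy) (x, y))).
      replace (Cplus (Cminus w (zx, zy)) (Cminus (zx, zy) (x, y))) with (Cminus w (x, y)) in T by ring.
      assert (T2 : Cmod (Cminus (zx, zy) (x, y)) <= 2 * (e / 4)) by (apply Cmod_box_lt; apply Rabs_le; lra). lra.
    + destruct (HK _ Nxy) as [e [He1 He2]]. exists (e / 4). split; [lra|].
      intros a b c d _ Hx _ _ Hy _ W1 W2. exists 1. split; [lra|]. intros [zx zy] w Kz [Hzx Hzy] _.
      simpl in Hzx, Hzy. exfalso. assert (T := He2 _ Kz).
      assert (T2 : Cmod (Cminus (x, y) (zx, zy)) <= 2 * (e / 4)) by (apply Cmod_box_lt; apply Rabs_le; lra). lra. }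
destruct B as [d [Hd1 Hd2]]. exists d. split; [exact Hd1|]. intros z w Kz. apply Hd2; [exact Kz|].
assert (T := HM z Kz). assert (T0 := Rle_abs M). destruct z as [x y].
assert (T1 := Cmod_bound_Re x y). assert (T2 := Cmod_bound_Im x y). simpl. 
assert (T3 := Rabs_le_between x m). assert (T4 := Rabs_le_between y m). unfold m in *.
split; [apply T3|apply T4]; lra.
Qed.

(** The point 0 will stand for infinity, where of a slice function only the limit
    is known. *)
Definition holo {Y : cspace} (Om : R * R -> Prop) (h : R * R -> Y) : Prop :=
  (forall z, Om z -> cont h z) /\ forall z, Om z -> z <> (0, 0) -> cdiff h z.

Lemma holo_approx {Y : cspace} (Om K : R * R -> Prop) (h : R * R -> Y) (M : R) : holo Om h -> copen Om ->
  pclosed K -> (forall z, K z -> Cmod z <= M) -> (forall z, K z -> Om z) -> approx K h.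
Proof.
intros [H1 H2] HO HK HM HKO. destruct (lebesgue_number K Om M HO HK HM HKO) as [d [Hd1 Hd2]].
apply (runge Om K h M d); assumption.
Qed.

(** What Cauchy's theorem uses of a positively oriented boundary of D. *)
Definition bounds (G : list (R -> R * R)) (D : R * R -> Prop) : Prop :=
  (forall g, In g G -> piecewise_C1 g /\ g 0 = g 1 /\ forall t, 0 <= t <= 1 -> clo D (g t) /\ ~ D (g t)) /\
  (exists M, forall z, D z -> Cmod z <= M) /\ copen D /\
  (forall w, D w -> total_winding G w = 1) /\ (forall w, ~ clo D w -> total_winding G w = 0).

Definition c2pi : C := Cmult (RtoC (2 * PI)) Ci.

(** * The moments of the resolvent *)

Section Calculus.
Context {Y : cspace} (A N : Y -> Y).
Hypotheses (HA : clin A) (HN : clin N) (AN : forall y, A (N y) = N (A y)).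
Let Rh := Rho A N.
Let Rz := Rs A N.
Variables (G : list (R -> R * R)) (D : R * R -> Prop).
Hypothesis HG : bounds G D.
Hypothesis HD : forall z, ~ D z -> Rh z.

Lemma bounds_on K : (forall z, clo D z -> ~ D z -> K z) -> on_cycle G K.
Proof.
intros HK g Hg. destruct (proj1 HG g Hg) as [P [_ Q]]. split; [exact P|].
intros t Ht. apply HK; apply (Q t Ht).
Qed.

Lemma bounds_closed : closed_cycle G.
Proof. intros g Hg. apply (proj1 HG g Hg). Qed.

Let Gam (z : R * R) := clo D z /\ ~ D z.

Lemma on_Gam : on_cycle G Gam.
Proof. apply bounds_on. intros z H1 H2. split; assumption. Qed.

Lemma Rh_open : copen Rh.
Proof.
intros z Hz. destruct (Rho_open A N HA HN z Hz) as [d [M [Hd [_ H]]]]. exists d. split; [exact Hd|].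
intros w Hw. apply H, Hw.
Qed.

Lemma Cinv_sym (u v : C) : Cinv (Cminus u v) = Copp (Cinv (Cminus v u)).
Proof.
destruct (classic (Cminus v u = RtoC 0)) as [E|E].
- replace (Cminus u v) with (Copp (Cminus v u)) by ring. rewrite E.
  apply injective_projections; simpl; unfold Rdiv; ring.
- field. split; [exact E|]. intros E'. apply E.
  replace (Cminus v u) with (Copp (Cminus u v)) by ring. rewrite E'. ring.
Qed.

Lemma contK_inv K w : ~ K w -> contK (Y := cC) K (fun z => Cinv (Cminus z w)).
Proof. intros H z Hz. apply cont_cC, ccont_inv. intros E. apply H. rewrite -E. exact Hz. Qed.

Lemma cyc_ker {Z : cspace} K w (y : Z) : on_cycle G K -> ~ K w ->
  cyc G (ker w y) = cmul (Copp (Cmult c2pi (RtoC (total_winding G w)))) y.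
Proof.
intros HK Nw.
transitivity (cyc G (fun z => cmul (Cinv (Cminus z w)) (opp y))).
- apply (cfun_ext K (fun h => cyc G h)); [apply cyc_cfun_id, HK|apply ker_cont, Nw| |].
  + intros z Hz. apply cont_cmul; [apply cont_cC, (contK_inv K w Nw z Hz)|apply cont_const].
  + intros z _. unfold ker. rewrite Cinv_sym. vec Z.
- rewrite (cyc_scalar G K _ (opp y) HK (contK_inv K w Nw)).
  rewrite (cyc_winding G K w HK bounds_closed Nw).
  assert (E : ((0, 2 * PI * total_winding G w) : C) = Cmult c2pi (RtoC (total_winding G w)))
    by (apply injective_projections; simpl; ring).
  rewrite E. vec Z.
Qed.

(** Outside D the resolvent is holomorphic, and G has the same winding numbers as a
    large square: Cauchy's theorem in its homology form, obtained from Runge's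
    theorem on the closed set K between D and the square. *)
Lemma cyc_box (h : R * R -> Y) (M r : R) : (forall z, D z -> Cmod z <= M) -> M < r -> 0 < r ->
  holo Rh h -> cyc G h = rect h (- r) r (- r) r.
Proof.
intros HM Hr Hr0 Hh.
assert (HMc := clo_bound D M HM).
set (K := fun z : R * R => - r <= fst z <= r /\ - r <= snd z <= r /\ ~ D z).
assert (Bx : forall z, Cmod z <= M -> - r < fst z < r /\ - r < snd z < r).
{ intros [x y] Hz. assert (T1 := Cmod_bound_Re x y). assert (T2 := Cmod_bound_Im x y). simpl.
  split; apply Rabs_lt_between; lra. }
assert (OK : on_cycle G K).
{ apply bounds_on. intros z H1 H2. assert (T := Bx z (HMc z H1)). unfold K. repeat split; try lra; try exact H2. }
assert (Kcl : pclosed K).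
{ intros [x y] Nz. destruct (classic (D (x, y))) as [Dz|Nd].
  - destruct HG as [_ [_ [Op _]]]. destruct (Op _ Dz) as [e [He1 He2]]. exists e. split; [exact He1|].
    intros w [_ [_ Hw]]. apply Rnot_lt_le. intros L. apply Hw, He2. rewrite Cmod_minus_sym. exact L.
  - assert (HH : r < Rabs x \/ r < Rabs y).
    { apply NNPP. intros NN. apply Nz. unfold K; simpl.
      assert (Ax : Rabs x <= r) by (apply Rnot_lt_le; tauto). assert (Ay : Rabs y <= r) by (apply Rnot_lt_le; tauto).
      apply Rabs_le_between in Ax. apply Rabs_le_between in Ay. repeat split; try exact Nd; lra. }
    destruct HH as [L|L].
    + exists (Rabs x - r). split; [lra|]. intros [u v] [Hu _]. simpl in Hu.
      assert (T := Cmod_bound_Re (x - u) (y - v)).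
      change (Cmod (Cminus (x, y) (u, v))) with (Cmod (x - u, y - v)).
      assert (T2 := Rabs_triang_inv x u). assert (Rabs u <= r) by (apply Rabs_le; lra). lra.
    + exists (Rabs y - r). split; [lra|]. intros [u v] [_ [Hu _]]. simpl in Hu.
      assert (T := Cmod_bound_Im (x - u) (y - v)).
      change (Cmod (Cminus (x, y) (u, v))) with (Cmod (x - u, y - v)).
      assert (T2 := Rabs_triang_inv y v). assert (Rabs v <= r) by (apply Rabs_le; lra). lra. }
assert (KRh : forall z, K z -> Rh z) by (intros z [_ [_ Hz]]; apply HD, Hz).
assert (Ap : approx K h).
{ apply (holo_approx Rh K h (2 * r) Hh Rh_open Kcl); [|exact KRh].
  intros [x y] [Hx [Hy _]]. simpl in Hx, Hy. eapply Rle_trans; [apply Cmod_le_sum|].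
  assert (Rabs x <= r) by (apply Rabs_le; lra). assert (Rabs y <= r) by (apply Rabs_le; lra). lra. }
assert (Kb : forall x y, onbd (- r) r (- r) r x y -> K (x, y)).
{ intros x y Hxy. unfold onbd in Hxy. unfold K; simpl. split; [lra|]. split; [lra|].
  intros Dz. assert (T := Bx _ (HM _ Dz)). simpl in T. lra. }
apply (cfun_eq_approx K (fun h => cyc G h) (fun h => rect h (- r) r (- r) r)).
- apply cyc_cfun_id, OK.
- apply rect_cfun; [lra|lra|exact Kb].
- intros w y Nw. rewrite (cyc_ker K w y OK Nw).
  assert (E : rect (ker w y) (- r) r (- r) r = rect (fun z => cmul (Cinv (Cminus z w)) (opp y)) (- r) r (- r) r).
  { apply rect_ext; try lra. intros u v _. unfold ker. rewrite Cinv_sym. vec Y. }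
  rewrite E. destruct (classic (D w)) as [Dw|Ndw].
  + destruct HG as [_ [_ [_ [W1 _]]]]. rewrite (W1 w Dw). destruct w as [wx wy].
    assert (T := Bx _ (HM _ Dw)). simpl in T. rewrite rect_cinv; [unfold c2pi; vec Y|lra|lra].
  + assert (Nc : ~ clo D w).
    { intros Cw. assert (T := Bx w (HMc w Cw)). apply Nw. unfold K. repeat split; try lra. exact Ndw. }
    destruct HG as [_ [_ [_ [_ W0]]]]. rewrite (W0 w Nc).
    rewrite cauchy_rect_out; try lra.
    * vec Y.
    * intros [T1 T2]. apply Nw. unfold K. repeat split; try lra. exact Ndw.
    * split; [intros u v _ _; apply cont_const|intros u v _ _ _; apply cdiff_const].
- exact Ap.
- intros z Hz. apply Hh, KRh, Hz.
Qed.

Lemma holo_Rz y : holo Rh (fun w => Rz w y).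
Proof.
split; intros z Hz.
- apply Rs_cont; assumption.
- intros _. apply Rs_cdiff; assumption.
Qed.

Lemma ccdiff_id z : ccdiff (fun w => w) z.
Proof. exists (fun _ => RtoC 1). split; [apply ccont_const|]. intros w. ring. Qed.

Lemma holo_cmul {Z : cspace} Om (s : R * R -> R * R) (h : R * R -> Z) : holo (Y := cC) Om s -> holo Om h ->
  holo Om (fun z => cmul (s z) (h z)).
Proof.
intros [S1 S2] [H1 H2]. split.
- intros z Hz. apply cont_cmul; [apply cont_cC, S1, Hz|apply H1, Hz].
- intros z Hz N0. apply cdiff_cmul; [apply cdiff_cC, S2; assumption|apply H2; assumption].
Qed.

Lemma holo_id Om : holo (Y := cC) Om (fun z => z).
Proof. split; intros z _; [apply cont_cC, ccont_id|intros _; apply cdiff_cC, ccdiff_id]. Qed.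

Lemma box_limit (h : R * R -> Y) (x : Y) (C r0 : R) : 0 < r0 -> 0 <= C ->
  (forall z, r0 <= Cmod z -> cont h z /\ Cmod z ^ 2 * norm (h z) <= C) ->
  (forall r, r0 <= r -> x = rect h (- r) r (- r) r) -> x = zero.
Proof.
intros Hr0 HC Hh Hx. apply norm_eq0. intros eps He.
set (r := Rmax r0 (8 * C / eps)). assert (R1 : r0 <= r) by apply Rmax_l.
assert (R2 : 8 * C / eps <= r) by apply Rmax_r.
rewrite (Hx r R1).
assert (Hrp : 0 < r) by lra.
eapply Rle_trans.
- apply (rect_bound h _ _ _ _ (C / r ^ 2)); try lra. intros u v Huv. unfold onbd in Huv.
  assert (Hm : r <= Cmod (u, v)).
  { assert (T1 := Cmod_bound_Re u v). assert (T2 := Cmod_bound_Im u v).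
    destruct Huv as [_ [_ [E|[E|[E|E]]]]]; rewrite E in T1, T2 |- *.
    - rewrite Rabs_Ropp Rabs_right in T1; lra.
    - rewrite Rabs_right in T1; lra.
    - rewrite Rabs_Ropp Rabs_right in T2; lra.
    - rewrite (Rabs_right r) in T2; lra. }
  destruct (Hh (u, v)) as [Hc Hb]; [lra|]. split; [exact Hc|].
  assert (Hp : 0 < r ^ 2) by (apply pow_lt; exact Hrp).
  apply Rmult_le_reg_l with (r ^ 2); [exact Hp|].
  replace (r ^ 2 * (C / r ^ 2)) with C by (field; lra).
  eapply Rle_trans; [|exact Hb]. apply Rmult_le_compat_r; [apply nge0|].
  apply pow_incr. lra.
- apply Rle_trans with (8 * C / r).
  + right. field. lra.
  + apply Rmult_le_reg_r with r; [exact Hrp|]. replace (8 * C / r * r) with (8 * C) by (field; lra).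
    apply (Rmult_le_compat_l eps) in R2; [|lra].
    replace (eps * (8 * C / eps)) with (8 * C) in R2 by (field; lra). exact R2.
Qed.

(** The resolvent decays like 1 / z^2, so its integral over large squares tends to 0. *)
Lemma cyc_res_0 y : cyc G (fun w => Rz w y) = zero.
Proof.
destruct (Rs_decay A N HA HN) as [r1 [Hr1 Hdec]]. destruct HG as [_ [[M HM] _]].
set (r0 := Rmax (Rabs M + 1) r1). assert (T1 : Rabs M + 1 <= r0) by apply Rmax_l.
assert (T2 : r1 <= r0) by apply Rmax_r. assert (T3 := Rabs_pos M). assert (T4 := Rle_abs M).
assert (Big : forall z, r0 <= Cmod z -> Rh z).
{ intros z Hz. apply HD. intros Dz. assert (T := HM z Dz). lra. }
apply (box_limit (fun w => Rz w y) _ (4 * norm y) r0); [lra|assert (T := nge0 y); lra| |].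
- intros z Hz. split; [apply (holo_Rz y), Big, Hz|apply Hdec; [lra|apply Big, Hz]].
- intros r Hr. apply (cyc_box _ M); [exact HM|lra|lra|apply holo_Rz].
Qed.

(** z R(z) y - y / z = 2 A R(z) y - N R(z) y / z decays like 1 / z^2. *)
Lemma cyc_res_1 y : cyc G (fun w => cmul (w : C) (Rz w y)) = cmul c2pi y.
Proof.
destruct (Rs_decay A N HA HN) as [r1 [Hr1 Hdec]]. destruct HG as [_ [[M HM] _]].
destruct (proj2 (proj2 HA)) as [a [Ha1 Ha2]]. destruct (proj2 (proj2 HN)) as [b [Hb1 Hb2]].
set (r0 := Rmax (Rabs M + 1) (Rmax r1 1)). assert (T1 : Rabs M + 1 <= r0) by apply Rmax_l.
assert (T2 : Rmax r1 1 <= r0) by apply Rmax_r. assert (T2a := Rmax_l r1 1). assert (T2b := Rmax_r r1 1).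
assert (T3 := Rabs_pos M). assert (T4 := Rle_abs M).
assert (Big : forall z, r0 <= Cmod z -> Rh z).
{ intros z Hz. apply HD. intros Dz. assert (T := HM z Dz). lra. }
(* k z = - y / z *)
set (h := fun z => cmul (z : C) (Rz z y)). set (k := fun z : R * R => cmul (Cinv (Cminus z (0, 0))) (opp y)).
assert (Hn0 : forall z, r0 <= Cmod z -> z <> (0, 0)).
{ intros z Hz E. rewrite E in Hz. assert (E0 : Cmod (0, 0) = 0) by apply Cmod_0. lra. }
assert (Ch : forall z, r0 <= Cmod z -> cont h z).
{ intros z Hz. apply cont_cmul; [apply ccont_id|apply (holo_Rz y), Big, Hz]. }
assert (Ck : forall z, r0 <= Cmod z -> cont k z).
{ intros z Hz. apply cont_cmul; [apply ccont_inv, Hn0, Hz|apply cont_const]. }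
assert (E : minus (cyc G h) (cmul c2pi y) = zero).
{ apply (box_limit (fun z => plus (h z) (k z)) _ (2 * 2 * a * (4 * norm y) + 2 * (b * (4 * norm y))) r0); [lra| | |].
  - assert (T := nge0 y). assert (0 <= a * norm y) by (apply Rmult_le_pos; assumption).
    assert (0 <= b * norm y) by (apply Rmult_le_pos; assumption). lra.
  - intros z Hz. split; [apply cont_plus; [apply Ch|apply Ck]; exact Hz|].
    assert (HR := Big z Hz). assert (Nz : z <> RtoC 0) by (apply Hn0, Hz).
    assert (E : plus (h z) (k z) = minus (cmul (RtoC 2) (A (Rz z y))) (cmul (Cinv z) (N (Rz z y)))).
    { unfold h, k. rewrite -{2}(QR A N z y HR). fold (Rz z y). unfold Qz.
      replace (Cminus z (0, 0)) with (z : C) by (apply injective_projections; simpl; ring).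
      vec_coefs Y; field; exact Nz. }
    rewrite E. assert (Dz := Hdec z y ltac:(lra) HR). fold (Rz z y) in Dz.
    assert (P : 0 <= Cmod z ^ 2) by (apply pow_le; lra).
    apply Rle_trans with (Cmod z ^ 2 * (2 * 2 * (a * norm (Rz z y)) + 2 * (b * norm (Rz z y)))).
    + apply Rmult_le_compat_l; [exact P|]. eapply Rle_trans; [apply nminus|].
      eapply Rle_trans; [apply Rplus_le_compat; apply norm_cmul|].
      rewrite (Cmod_R 2) Rabs_right; [|lra]. rewrite (Cmod_inv z Nz).
      apply Rplus_le_compat; [apply Rmult_le_compat_l; [lra|apply Ha2]|].
      apply Rmult_le_compat; [|apply nge0| |apply Hb2].
      * assert (0 < / Cmod z) by (apply Rinv_0_lt_compat; lra). lra.
      * assert (/ Cmod z <= / 1) by (apply Rinv_le_contravar; lra). rewrite Rinv_1 in H. lra.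
    + replace (Cmod z ^ 2 * (2 * 2 * (a * norm (Rz z y)) + 2 * (b * norm (Rz z y))))
        with ((2 * 2 * a + 2 * b) * (Cmod z ^ 2 * norm (Rz z y))) by ring.
      replace (2 * 2 * a * (4 * norm y) + 2 * (b * (4 * norm y))) with ((2 * 2 * a + 2 * b) * (4 * norm y)) by ring.
      apply Rmult_le_compat_l; lra.
  - intros r Hr. 
    assert (Bd : forall u v, onbd (- r) r (- r) r u v -> r0 <= Cmod (u, v)).
    { intros u v Huv. unfold onbd in Huv.
      assert (T5 := Cmod_bound_Re u v). assert (T6 := Cmod_bound_Im u v).
      destruct Huv as [_ [_ [E|[E|[E|E]]]]]; rewrite E in T5, T6 |- *.
      - rewrite Rabs_Ropp Rabs_right in T5; lra.
      - rewrite Rabs_right in T5; lra.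
      - rewrite Rabs_Ropp Rabs_right in T6; lra.
      - rewrite (Rabs_right r) in T6; lra. }
    rewrite rect_plus; try lra.
    + rewrite -(cyc_box h M r HM); [|lra|lra|apply (holo_cmul Rh (fun z => z) (fun z => Rz z y) (holo_id Rh) (holo_Rz y))].
      unfold k. rewrite rect_cinv; [|lra|lra]. unfold c2pi. vec Y.
    + intros u v Huv. split; [apply Ch|apply Ck]; apply Bd, Huv. }
change (cyc G h = cmul c2pi y).
transitivity (plus (minus (cyc G h) (cmul c2pi y)) (cmul c2pi y)); [vec Y|]. rewrite E. vec Y.
Qed.
End Calculus.

Lemma clin_blin {Y : cspace} (L : Y -> Y) : clin L -> blin L.
Proof.
intros [H1 [H2 H3]]. split; [exact H1|]. split; [|exact H3].
intros r x. rewrite -!cmul_RtoC. apply H2.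
Qed.

Lemma cont_clin {Y : cspace} (L : Y -> Y) (h : R * R -> Y) z : clin L -> cont h z -> cont (fun w => L (h w)) z.
Proof.
intros HL H eps He. assert (HL' := HL). destruct HL' as [_ [_ [M [HM HB]]]].
destruct (H (eps / (M + 1))) as [d [Hd1 Hd2]]; [apply Rdiv_lt_0_compat; lra|].
exists d. split; [exact Hd1|]. intros w Hw. rewrite -(clin_minus HL).
eapply Rle_lt_trans; [apply HB|]. assert (T := Hd2 w Hw).
apply Rle_lt_trans with (M * (eps / (M + 1))); [apply Rmult_le_compat_l; lra|].
apply Rmult_lt_reg_r with (M + 1); [lra|].
replace (M * (eps / (M + 1)) * (M + 1)) with (M * eps) by (field; lra). nra.
Qed.

Lemma cyc_lin {Y : cspace} (G : list (R -> R * R)) K (L : Y -> Y) (h : R * R -> Y) : on_cycle G K -> clin L ->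
  contK K h -> cyc G (fun z => L (h z)) = L (cyc G h).
Proof.
intros HG HL Hh. induction G as [|g G IH].
- symmetry. apply (clin_zero HL).
- destruct (on_cycle_cons g G K HG) as [Hg [Kg HG']]. rewrite !cyc_cons (IH HG') (clin_plus HL). f_equal.
  destruct (curve_integrable (Y := Y) g Hg) as [C1 [P1 B1]].
  unfold gint. rewrite -(RInt_lin L (clin_blin L HL)); [|apply B1; intros t Ht; apply Hh, Kg, Ht].
  apply (RInt_ext (V := Y)). intros t _. symmetry. apply (clin_cmul HL).
Qed.

(** * Integrals against the resolvent *)

Section Product.
Context {Y : cspace} (A N : Y -> Y).
Hypotheses (HA : clin A) (HN : clin N) (AN : forall y, A (N y) = N (A y)).
Let Rh := Rho A N.
Let Rz := Rs A N.
Variables (G : list (R -> R * R)) (D : R * R -> Prop).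
Hypothesis HG : bounds G D.
Hypothesis HD : forall z, ~ D z -> Rh z.
Let Gam (z : R * R) := clo D z /\ ~ D z.
Let OG : on_cycle G Gam := on_Gam G D HG.

Definition Phi (s : R * R -> R * R) (v : Y) : Y := cyc G (fun w => cmul (s w) (Rz w v)).

Lemma Rz_contK v : contK Gam (fun w => Rz w v).
Proof. intros z Hz. apply (holo_Rz A N HA HN v), HD, Hz. Qed.

Lemma Phi_contK s v : contK (Y := cC) Gam s -> contK Gam (fun w => cmul (s w) (Rz w v)).
Proof. intros Hs z Hz. apply cont_cmul; [apply cont_cC, Hs, Hz|apply Rz_contK, Hz]. Qed.

Lemma Phi_cfun K v : (forall z, Gam z -> K z) -> contK K (fun w => Rz w v) -> cfun (Y1 := cC) K (fun s => Phi s v).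
Proof.
intros HK Hc. apply (cyc_cfun_scalar G K (fun w => Rz w v)); [|exact Hc]. intros g Hg. destruct (OG g Hg) as [P Q].
split; [exact P|]. intros t Ht. apply HK, Q, Ht.
Qed.

Lemma Phi_cfunG v : cfun (Y1 := cC) Gam (fun s => Phi s v).
Proof. apply Phi_cfun; [auto|apply Rz_contK]. Qed.

Lemma Phi_comm L s v : clin L -> (forall x, L (A x) = A (L x)) -> (forall x, L (N x) = N (L x)) ->
  contK (Y := cC) Gam s -> Phi s (L v) = L (Phi s v).
Proof.
intros HL LA LN Hs. unfold Phi. rewrite -(cyc_lin G Gam L); [|exact OG|exact HL|apply Phi_contK, Hs].
apply (cfun_ext Gam (fun h => cyc G h)); [apply cyc_cfun_id, OG|apply Phi_contK, Hs| |].
- intros z Hz. apply cont_clin; [exact HL|apply Phi_contK; assumption].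
- intros z Hz. rewrite (clin_cmul HL). f_equal. apply Rs_comm; try assumption.
  + apply HD, Hz.
  + intros x. unfold Qz. rewrite (clin_plus HL) (clin_minus HL) !(clin_cmul HL) LA LN. reflexivity.
Qed.

Lemma Phi_plus s x y : contK (Y := cC) Gam s -> Phi s (plus x y) = plus (Phi s x) (Phi s y).
Proof.
intros Hs. unfold Phi.
rewrite -(proj1 (cyc_cfun_id G Gam OG) _ _ (Phi_contK s x Hs) (Phi_contK s y Hs)).
apply (cfun_ext Gam (fun h => cyc G h)); [apply cyc_cfun_id, OG|apply Phi_contK, Hs| |].
- intros z Hz. apply (cont_plus (fun w => cmul (s w) (Rz w x)) (fun w => cmul (s w) (Rz w y))); apply Phi_contK; assumption.
- intros z Hz. rewrite -cmul_plus_r. apply f_equal. apply Rs_plus; try assumption. apply HD, Hz.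
Qed.

Lemma clin_cmul_l c : clin (fun y : Y => cmul c y).
Proof.
split; [intros; vec Y|]. split; [intros; vec Y|]. exists (2 * Cmod c).
split; [assert (T := Cmod_ge_0 c); lra|intros; apply norm_cmul].
Qed.

Lemma Phi_cmul s c x : contK (Y := cC) Gam s -> Phi s (cmul c x) = cmul c (Phi s x).
Proof.
apply (Phi_comm (fun y => cmul c y) s x (clin_cmul_l c)); intros; symmetry; [apply (clin_cmul HA)|apply (clin_cmul HN)].
Qed.

(** By the resolvent identity (R(w) - R(zeta)) / (zeta - w) is
    R(zeta) ((zeta + w) R(w) - 2 A R(w)), which has no pole at zeta. *)
Lemma cyc_pole (zeta : R * R) (s : R * R -> R * R) (v : Y) : ~ clo D zeta -> contK (Y := cC) Gam s ->
  cyc G (fun w => cmul (Cmult (Cinv (Cminus zeta w)) (s w)) (Rz w v)) =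
  plus (Rz zeta (plus (minus (cmul zeta (Phi s v)) (cmul (RtoC 2) (A (Phi s v)))) (Phi (fun w => Cmult w (s w)) v)))
       (cmul (cyc (Y := cC) G (fun w => Cmult (Cinv (Cminus zeta w)) (s w)) : C) (Rz zeta v)).
Proof.
intros Nz Hs. assert (Rze : Rh zeta) by (apply HD; intros Dz; apply Nz, clo_incl, Dz).
assert (LR := Rs_clin A N HA HN zeta Rze). fold Rz in LR.
assert (Nze : forall z, Gam z -> Cminus zeta z <> RtoC 0).
{ intros z Hz. apply Cminus_neq. intros E. apply Nz. rewrite E. apply Hz. }
assert (Ki : contK (Y := cC) Gam (fun w => Cmult (Cinv (Cminus zeta w)) (s w))).
{ intros z Hz. apply (cont_ext_loc (Y := cC) (fun w => cmul (Copp (Cinv (Cminus w zeta))) (s w : cC)) _ z 1); [lra| |].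
  - intros w _. rewrite cmul_cC (Cinv_sym zeta w). reflexivity.
  - apply cont_cmul; [|apply Hs, Hz]. apply cont_cC.
    apply (cont_ext_loc (Y := cC) (fun w => cmul (RtoC (-1)) (Cinv (Cminus w zeta) : cC)) _ z 1); [lra| |].
    + intros w _. rewrite cmul_cC. assert (T : forall x : C, Cmult (RtoC (-1)) x = Copp x) by (intros; ring). apply T.
    + apply cont_cmul; [apply ccont_const|]. apply cont_cC, ccont_inv. intros E. apply Nz. rewrite -E. apply Hz. }
assert (Kws : contK (Y := cC) Gam (fun w => Cmult w (s w))).
{ intros z Hz. apply (cont_ext_loc (Y := cC) (fun w => cmul (w : C) (s w : cC)) _ z 1); [lra| |].
  - intros w _. apply cmul_cC.
  - apply cont_cmul; [apply ccont_id|apply Hs, Hz]. }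
set (L1 := fun y => Rz zeta (minus (cmul zeta y) (cmul (RtoC 2) (A y)))).
assert (HL1 : clin L1).
{ unfold L1. split; [|split].
  - intros x y. rewrite (clin_plus HA) -(clin_plus LR). f_equal. vec Y.
  - intros c x. rewrite (clin_cmul HA) -(clin_cmul LR). f_equal. vec Y.
  - destruct (proj2 (proj2 LR)) as [M [HM HB]]. destruct (proj2 (proj2 HA)) as [a [Ha Ha2]].
    exists (M * (2 * Cmod zeta + 2 * 2 * a)). assert (T := Cmod_ge_0 zeta).
    split; [apply Rmult_le_pos; lra|]. intros x. eapply Rle_trans; [apply HB|].
    rewrite Rmult_assoc. apply Rmult_le_compat_l; [exact HM|].
    eapply Rle_trans; [apply nminus|]. eapply Rle_trans; [apply Rplus_le_compat; apply norm_cmul|].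
    rewrite (Cmod_R 2) Rabs_right; [|lra]. assert (T2 := Ha2 x). lra. }
assert (E : forall z, Gam z -> cmul (Cmult (Cinv (Cminus zeta z)) (s z)) (Rz z v) =
   plus (plus (L1 (cmul (s z) (Rz z v))) (Rz zeta (cmul (Cmult z (s z)) (Rz z v))))
        (cmul (Cmult (Cinv (Cminus zeta z)) (s z)) (Rz zeta v))).
{ intros z Hz. assert (F := Rs_diff A N HA HN zeta z v Rze (HD z (proj2 Hz))). fold Rz in F.
  set (u := Rz z v) in *. set (u0 := Rz zeta v) in *.
  transitivity (plus (cmul (Cmult (Cinv (Cminus zeta z)) (s z)) (minus u u0)) (cmul (Cmult (Cinv (Cminus zeta z)) (s z)) u0)); [vec Y|].
  apply f_equal2; [|reflexivity]. rewrite F. set (X := minus (cmul (Cplus zeta z) u) (cmul (RtoC 2) (A u))).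
  transitivity (cmul (s z) (Rz zeta X)).
  - rewrite cmul_cmul. apply (f_equal (fun c => cmul c (Rz zeta X))).
    rewrite (Cmult_comm (Cinv _)) -Cmult_assoc Cinv_l; [ring|apply Nze, Hz].
  - rewrite -(clin_cmul LR). unfold L1. rewrite (clin_cmul HA).
    rewrite -(clin_plus LR). apply f_equal. unfold X. vec Y. }
assert (C1 : contK Gam (fun z => L1 (cmul (s z) (Rz z v)))).
{ intros z Hz. apply cont_clin; [exact HL1|apply Phi_contK; assumption]. }
assert (C2 : contK Gam (fun z => Rz zeta (cmul (Cmult z (s z)) (Rz z v)))).
{ intros z Hz. apply cont_clin; [exact LR|apply (Phi_contK (fun z => Cmult z (s z))); assumption]. }
assert (C3 : contK Gam (fun z => cmul (Cmult (Cinv (Cminus zeta z)) (s z)) (Rz zeta v))).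
{ intros z Hz. apply cont_cmul; [apply cont_cC, Ki, Hz|apply cont_const]. }
assert (C12 : contK Gam (fun z => plus (L1 (cmul (s z) (Rz z v))) (Rz zeta (cmul (Cmult z (s z)) (Rz z v))))).
{ intros z Hz. apply cont_plus; [apply C1|apply C2]; exact Hz. }
assert (CI := cyc_cfun_id (Y := Y) G Gam OG).
rewrite (cfun_ext Gam (fun h => cyc G h) _ _ CI (Phi_contK _ v Ki) (fun z Hz => cont_plus _ _ z (C12 z Hz) (C3 z Hz)) E).
rewrite (proj1 CI _ _ C12 C3) (proj1 CI _ _ C1 C2).
rewrite (cyc_lin G Gam L1); [|exact OG|exact HL1|apply Phi_contK, Hs].
rewrite (cyc_lin G Gam (Rz zeta)); [|exact OG|exact LR|apply (Phi_contK (fun z => Cmult z (s z))), Kws].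
rewrite (cyc_scalar G Gam _ (Rz zeta v) OG Ki).
unfold L1. rewrite -(clin_plus LR). unfold Phi. reflexivity.
Qed.
End Product.

(** * Holomorphic scalar functions *)

Lemma cyc_ext {Y : cspace} G (h k : R * R -> Y) : (forall z, h z = k z) -> cyc G h = cyc G k.
Proof. intros E. f_equal. apply functional_extensionality, E. Qed.

Lemma Phi_ext {Y : cspace} (A N : Y -> Y) G s t v : (forall z, s z = t z) -> Phi A N G s v = Phi A N G t v.
Proof. intros E. f_equal. apply functional_extensionality, E. Qed.

Lemma holo_mono {Y : cspace} (Om Om' : R * R -> Prop) (h : R * R -> Y) :
  (forall z, Om' z -> Om z) -> holo Om h -> holo Om' h.
Proof. intros H [H1 H2]. split; intros z Hz; [apply H1, H, Hz|apply H2, H, Hz]. Qed.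

Lemma holo_ext {Y : cspace} Om (h k : R * R -> Y) : (forall z, h z = k z) -> holo Om h -> holo Om k.
Proof. intros E. rewrite (functional_extensionality _ _ E). auto. Qed.

Lemma holo_const {Y : cspace} Om (y : Y) : holo Om (fun _ => y).
Proof. split; intros z _; [apply cont_const|intros _; apply cdiff_const]. Qed.

Lemma holo_mult Om s t : holo (Y := cC) Om s -> holo (Y := cC) Om t -> holo (Y := cC) Om (fun z => Cmult (s z) (t z)).
Proof.
intros Hs Ht. apply (holo_ext (Y := cC) Om (fun z => cmul (s z : C) (t z : cC))).
- intros z. apply cmul_cC.
- apply holo_cmul; assumption.
Qed.

Lemma holo_pole zeta : holo (Y := cC) (fun z => z <> zeta) (fun w => Cinv (Cminus zeta w)).
Proof.
apply (holo_ext (Y := cC) _ (fun w => cmul (RtoC (-1)) (Cinv (Cminus w zeta) : cC))).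
- intros w. rewrite cmul_cC (Cinv_sym zeta w).
  assert (T : forall x : C, Cmult (RtoC (-1)) x = Copp x) by (intros; ring). apply T.
- apply (holo_cmul (Z := cC) _ (fun _ => RtoC (-1))); [apply holo_const|]. split.
  + intros z Hz. apply cont_cC, ccont_inv, Hz.
  + intros z Hz _. apply cdiff_cC, ccdiff_inv, Hz.
Qed.

Lemma pclosed_clo D : pclosed (clo D).
Proof.
intros z Hz. destruct (clo_out D z Hz) as [d [Hd H]]. exists d. split; assumption.
Qed.

Lemma copen_minus Om zeta : copen Om -> copen (fun z => Om z /\ z <> zeta).
Proof.
intros HO z [Hz Nz]. destruct (HO z Hz) as [e [He1 He2]].
assert (P : 0 < Cmod (Cminus z zeta)) by (apply Cmod_gt_0, Cminus_neq, Nz).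
exists (Rmin e (Cmod (Cminus z zeta))). split; [apply Rmin_pos; assumption|]. intros w Hw. split.
- apply He2. eapply Rlt_le_trans; [apply Hw|apply Rmin_l].
- intros E. assert (T := Rlt_le_trans _ _ _ Hw (Rmin_r _ _)). rewrite E in T. rewrite Cmod_minus_sym in T. lra.
Qed.

(** * The calculus of Cauchy kernels *)

Section Product2.
Context {Y : cspace} (A N : Y -> Y).
Hypotheses (HA : clin A) (HN : clin N) (AN : forall y, A (N y) = N (A y)).
Let Rh := Rho A N.
Let Rz := Rs A N.

Section OneCycle.
Variables (G : list (R -> R * R)) (D : R * R -> Prop).
Hypothesis HG : bounds G D.
Hypothesis HD : forall z, ~ D z -> Rh z.
Let Gam (z : R * R) := clo D z /\ ~ D z.

Lemma on_clo : on_cycle G (clo D).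
Proof. apply (bounds_on G D HG). auto. Qed.

Lemma holo_Gam {Z : cspace} Om (h : R * R -> Z) : holo Om h -> (forall z, clo D z -> Om z) -> contK Gam h.
Proof. intros [H _] HO z [Hz _]. apply H, HO, Hz. Qed.

(** Cauchy's theorem: Cauchy kernels with poles off the closure of D have integral 0
    because the winding number vanishes there. *)
Lemma cyc_zero Om (s : R * R -> R * R) : copen Om -> (forall z, clo D z -> Om z) -> holo (Y := cC) Om s ->
  cyc (Y := cC) G s = zero.
Proof.
intros HO HDO Hs. assert (HG' := HG). destruct HG' as [_ [[M HM] [_ [_ W0]]]].
apply (cfun_eq_approx (Y1 := cC) (Y2 := cC) (clo D) (fun h => cyc (Y := cC) G h) (fun _ => zero)).
- apply cyc_cfun_id, on_clo.
- split; [intros; vec cC|]. split; [intros; vec cC|].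
  exists 0. split; [lra|]. intros h m _ _ _. rewrite nzero. lra.
- intros zeta y Nz. rewrite (cyc_ker G D HG (clo D) zeta y on_clo Nz) (W0 zeta Nz).
  vec cC.
- apply (holo_approx (Y := cC) Om (clo D) s M Hs HO (pclosed_clo D) (clo_bound D M HM) HDO).
- intros z Hz. apply Hs, HDO, Hz.
Qed.

Lemma cyc_pole_zero Om zeta (s : R * R -> R * R) : copen Om -> (forall z, clo D z -> Om z) ->
  holo (Y := cC) Om s -> ~ clo D zeta -> cyc (Y := cC) G (fun w => Cmult (Cinv (Cminus zeta w)) (s w)) = zero.
Proof.
intros HO HDO Hs Nz. apply (cyc_zero (fun z => Om z /\ z <> zeta)).
- apply copen_minus, HO.
- intros z Hz. split; [apply HDO, Hz|]. intros E. apply Nz. rewrite -E. exact Hz.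
- apply holo_mult; [apply (holo_mono (fun z => z <> zeta)); [tauto|apply holo_pole]|apply (holo_mono Om); [tauto|exact Hs]].
Qed.

Lemma Phi_pole Om zeta s v : copen Om -> (forall z, clo D z -> Om z) -> holo (Y := cC) Om s -> ~ clo D zeta ->
  Phi A N G (fun w => Cmult (Cinv (Cminus zeta w)) (s w)) v =
  Rz zeta (plus (minus (cmul zeta (Phi A N G s v)) (cmul (RtoC 2) (A (Phi A N G s v))))
                (Phi A N G (fun w => Cmult w (s w)) v)).
Proof.
intros HO HDO Hs Nz. unfold Phi at 1.
rewrite (cyc_pole A N HA HN G D HG HD zeta s v Nz (holo_Gam Om s Hs HDO)).
rewrite (cyc_pole_zero Om zeta s HO HDO Hs Nz). 
fold Rz. set (x := Rz zeta _). set (y := Rz zeta v). assert (T : cmul (zero : cC) y = zero).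
{ change (cmul (RtoC 0) y = zero). apply cmul_zero. }
rewrite T. vec Y.
Qed.

Lemma open_top : copen (fun _ => True).
Proof. intros z _. exists 1. split; [lra|auto]. Qed.

Lemma Phi_one v : Phi A N G (fun _ => RtoC 1) v = zero.
Proof.
unfold Phi. rewrite -(cyc_res_0 A N HA HN G D HG HD v). apply cyc_ext. intros z. apply cmul_one.
Qed.

Lemma Phi_w v : Phi A N G (fun w => Cmult w (RtoC 1)) v = cmul c2pi v.
Proof.
unfold Phi. rewrite -(cyc_res_1 A N HA HN G D HG HD v). apply cyc_ext. intros z.
rewrite Cmult_1_r. reflexivity.
Qed.

(** The case s = 1 of [Phi_pole]: both integrals on the right are moments of the
    resolvent. *)
Lemma Phi_ker zeta v : ~ clo D zeta ->
  Phi A N G (fun w => Cmult (Cinv (Cminus zeta w)) (RtoC 1)) v = cmul c2pi (Rz zeta v).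
Proof.
intros Nz. assert (Rze : Rh zeta) by (apply HD; intros Dz; apply Nz, clo_incl, Dz).
rewrite (Phi_pole (fun _ => True) zeta _ v open_top); [|auto|apply holo_const|exact Nz].
rewrite Phi_one Phi_w (clin_zero HA) -(clin_cmul (Rs_clin A N HA HN zeta Rze)).
unfold Rz. f_equal. vec Y.
Qed.

(** w / (zeta - w) = zeta / (zeta - w) - 1 *)
Lemma Phi_wker zeta v : ~ clo D zeta ->
  Phi A N G (fun w => Cmult w (Cmult (Cinv (Cminus zeta w)) (RtoC 1))) v = cmul c2pi (cmul zeta (Rz zeta v)).
Proof.
intros Nz. assert (Rze : Rh zeta) by (apply HD; intros Dz; apply Nz, clo_incl, Dz).
assert (CI := cyc_cfun_id (Y := Y) G Gam (on_Gam G D HG)).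
assert (Kk : contK (Y := cC) Gam (fun w => Cmult (Cinv (Cminus zeta w)) (RtoC 1))).
{ intros z Hz. apply (holo_mult (fun z => z <> zeta)); [apply holo_pole|apply holo_const|].
  intros E. apply Nz. rewrite -E. apply Hz. }
assert (K1 := Phi_contK A N HA HN D HD _ v Kk).
assert (K0 : contK Gam (fun w => Rz w v)) by (apply (Rz_contK A N HA HN D HD)).
transitivity (cyc G (fun w => plus (cmul zeta (cmul (Cmult (Cinv (Cminus zeta w)) (RtoC 1)) (Rz w v)))
                                   (cmul (RtoC (-1)) (Rz w v)))).
- apply (cfun_ext Gam (fun h => cyc G h) _ _ CI).
  + intros z Hz. apply cont_cmul; [|apply K0, Hz]. apply cont_cC.
    apply (holo_mult (fun z => z <> zeta)); [apply holo_id| |].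
    * apply holo_mult; [apply holo_pole|apply holo_const].
    * intros E. apply Nz. rewrite -E. apply Hz.
  + intros z Hz. apply cont_plus; [apply (contK_cmul Gam zeta _ K1 z Hz)|apply (contK_cmul Gam (RtoC (-1)) _ K0 z Hz)].
  + intros z Hz. fold Rz. assert (Hn : Cminus zeta z <> RtoC 0).
    { apply Cminus_neq. intros E. apply Nz. rewrite E. apply Hz. }
    vec_coefs Y. field. exact Hn.
- rewrite (proj1 CI); [|apply (contK_cmul Gam zeta), K1|apply (contK_cmul Gam), K0].
  rewrite (proj1 (proj2 CI) zeta _ K1) (proj1 (proj2 CI) (RtoC (-1)) _ K0).
  assert (E0 := cyc_res_0 A N HA HN G D HG HD v). fold Rz in E0. rewrite E0.
  assert (E1 := Phi_ker zeta v Nz). unfold Phi in E1. fold Rz in E1. rewrite E1. vec Y.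
Qed.

Lemma ker_cC zeta (y : cC) w : ker zeta y w = Cmult (Cmult (Cinv (Cminus zeta w)) (RtoC 1)) y.
Proof. unfold ker. rewrite cmul_cC Cmult_1_r. reflexivity. Qed.

Lemma Phi_scalar (c : C) s v : contK (Y := cC) Gam s -> Phi A N G (fun w => Cmult (s w) c) v = cmul c (Phi A N G s v).
Proof.
intros Hs. rewrite -(proj1 (proj2 (Phi_cfunG A N HA HN G D HG HD v)) c s Hs).
apply Phi_ext. intros z. rewrite cmul_cC. apply Cmult_comm.
Qed.
End OneCycle.
End Product2.

(** [ring], on an equation in C presented as an equation in the space [cC]. *)
Ltac cring := match goal with |- @eq _ ?a ?b => change (@eq C a b) end; ring.

(** * Independence of the cycle and the product identity *)

Section Product3.
Context {Y : cspace} (A N : Y -> Y).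
Hypotheses (HA : clin A) (HN : clin N) (AN : forall y, A (N y) = N (A y)).
Let Rh := Rho A N.
Let Rz := Rs A N.

Lemma cfun_mono {Z1 Z2 : cspace} (K K' : R * R -> Prop) (l : (R * R -> Z1) -> Z2) :
  (forall z, K z -> K' z) -> cfun K l -> cfun K' l.
Proof.
intros HK [P [Q [C [HC HB]]]].
assert (S : forall h : R * R -> Z1, contK K' h -> contK K h) by (intros h Hh z Hz; apply Hh, HK, Hz).
split; [|split].
- intros h k Hh Hk. apply P; apply S; assumption.
- intros c h Hh. apply Q, S, Hh.
- exists C. split; [exact HC|]. intros h M Hh HM Hb. apply HB; [apply S, Hh|exact HM|].
  intros z Hz. apply Hb, HK, Hz.
Qed.

Lemma Phi_cfunK G D K v : bounds G D -> (forall z, ~ D z -> Rh z) -> (forall z, clo D z -> K z) ->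
  cfun (Y1 := cC) K (fun s => Phi A N G s v).
Proof.
intros HG HD HK. apply (cfun_mono (Z1 := cC) (fun z => clo D z /\ ~ D z)); [intros z [H _]; apply HK, H|].
apply (Phi_cfunG A N HA HN G D HG HD v).
Qed.

Lemma Phi_weight_cfun G D K (t : R * R -> R * R) v : bounds G D -> (forall z, ~ D z -> Rh z) ->
  (forall z, clo D z -> K z) -> contK (Y := cC) (clo D) t ->
  cfun (Y1 := cC) K (fun s => Phi A N G (fun w => Cmult (t w) (s w)) v).
Proof.
intros HG HD HK Ht. set (Gam := fun z => clo D z /\ ~ D z).
apply (cfun_mono (Z1 := cC) Gam); [intros z [H _]; apply HK, H|].
assert (E : (fun s : R * R -> cC => Phi A N G (fun w => Cmult (t w) (s w)) v) =
   (fun s : R * R -> cC => cyc G (fun z => cmul (s z : C) (cmul (t z) (Rz z v))))).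
{ apply functional_extensionality. intros s. apply cyc_ext. intros z. unfold Rz. vec Y. }
rewrite E. apply (cyc_cfun_scalar G Gam (fun z => cmul (t z) (Rz z v))).
- apply (on_Gam G D HG).
- intros z Hz. apply cont_cmul; [apply cont_cC, Ht, Hz|].
  apply (Rz_contK A N HA HN D HD v). exact Hz.
Qed.

Lemma cfun_comp {Z1 Z2 Z3 : cspace} K (l : (R * R -> Z1) -> Z2) (L : Z2 -> Z3) :
  cfun K l -> (forall x y, L (plus x y) = plus (L x) (L y)) -> (forall c x, L (cmul c x) = cmul c (L x)) ->
  (exists M, 0 <= M /\ forall x, norm (L x) <= M * norm x) -> cfun K (fun h => L (l h)).
Proof.
intros [P [Q [C [HC HB]]]] L1 L2 [M [HM HL]]. split; [|split].
- intros h k Hh Hk. rewrite P // L1 //.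
- intros c h Hh. rewrite Q // L2 //.
- exists (M * C). split; [apply Rmult_le_pos; assumption|]. intros h m Hh Hm Hb.
  eapply Rle_trans; [apply HL|]. rewrite Rmult_assoc. apply Rmult_le_compat_l; [exact HM|]. apply HB; assumption.
Qed.

Lemma cfun_plus {Z1 Z2 : cspace} K (l1 l2 : (R * R -> Z1) -> Z2) :
  cfun K l1 -> cfun K l2 -> cfun K (fun h => plus (l1 h) (l2 h)).
Proof.
intros [P1 [Q1 [C1 [HC1 HB1]]]] [P2 [Q2 [C2 [HC2 HB2]]]]. split; [|split].
- intros h k Hh Hk. rewrite P1 // P2 //. vec Z2.
- intros c h Hh. rewrite Q1 // Q2 //. vec Z2.
- exists (C1 + C2). split; [lra|]. intros h m Hh Hm Hb. eapply Rle_trans; [apply ntri|].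
  assert (T1 := HB1 h m Hh Hm Hb). assert (T2 := HB2 h m Hh Hm Hb). lra.
Qed.

Lemma pclosed_union K1 K2 : pclosed K1 -> pclosed K2 -> pclosed (fun z => K1 z \/ K2 z).
Proof.
intros H1 H2 z Hz. destruct (H1 z) as [d1 [P1 Q1]]; [tauto|]. destruct (H2 z) as [d2 [P2 Q2]]; [tauto|].
exists (Rmin d1 d2). split; [apply Rmin_pos; assumption|].
intros w [Hw|Hw]; [eapply Rle_trans; [apply Rmin_l|apply Q1, Hw]|eapply Rle_trans; [apply Rmin_r|apply Q2, Hw]].
Qed.

(** On Cauchy kernels both sides are given by the resolvent at the pole. *)
Theorem Phi_indep G1 D1 G2 D2 Om s v : bounds G1 D1 -> bounds G2 D2 -> (forall z, ~ D1 z -> Rh z) ->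
  (forall z, ~ D2 z -> Rh z) -> copen Om -> (forall z, clo D1 z -> Om z) -> (forall z, clo D2 z -> Om z) ->
  holo (Y := cC) Om s -> Phi A N G1 s v = Phi A N G2 s v.
Proof.
intros B1 B2 R1 R2 HO O1 O2 Hs. set (K := fun z => clo D1 z \/ clo D2 z).
assert (KO : forall z, K z -> Om z) by (intros z [H|H]; [apply O1|apply O2]; exact H).
apply (cfun_eq_approx (Y1 := cC) K (fun s => Phi A N G1 s v) (fun s => Phi A N G2 s v)).
- apply (Phi_cfunK G1 D1); try assumption. intros z Hz. left. exact Hz.
- apply (Phi_cfunK G2 D2); try assumption. intros z Hz. right. exact Hz.
- intros zeta y Nz. assert (N1 : ~ clo D1 zeta) by (intros H; apply Nz; left; exact H).
  assert (N2 : ~ clo D2 zeta) by (intros H; apply Nz; right; exact H).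
  assert (E : forall G D, bounds G D -> (forall z, ~ D z -> Rh z) -> ~ clo D zeta ->
     Phi A N G (ker (Y := cC) zeta y) v = cmul (y : C) (cmul c2pi (Rz zeta v))).
  { intros G D HG HD Nc. rewrite -(Phi_ker A N HA HN G D HG HD zeta v Nc).
    rewrite -(Phi_scalar A N HA HN G D HG HD y (fun w => Cmult (Cinv (Cminus zeta w)) (RtoC 1))).
    - apply Phi_ext. intros z. apply ker_cC.
    - intros z Hz. apply (holo_mult (fun z => z <> zeta)); [apply holo_pole|apply holo_const|].
      intros E. apply Nc. rewrite -E. apply Hz. }
  rewrite (E G1 D1) // (E G2 D2) //.
- destruct B1 as [_ [[M1 HM1] _]]. destruct B2 as [_ [[M2 HM2] _]].
  apply (holo_approx (Y := cC) Om K s (Rmax M1 M2) Hs HO).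
  + apply pclosed_union; apply pclosed_clo.
  + intros z [H|H].
    * eapply Rle_trans; [apply (clo_bound D1 M1 HM1 z H)|apply Rmax_l].
    * eapply Rle_trans; [apply (clo_bound D2 M2 HM2 z H)|apply Rmax_r].
  + exact KO.
- intros z Hz. apply Hs, KO, Hz.
Qed.

(** The calculus of the resolvent of a quadratic pencil is not multiplicative; the
    correction is the source of the product rule of the harmonic functional
    calculus. Both sides are linear and continuous in f, and for a Cauchy kernel f
    with pole zeta both are R(zeta) applied to
    zeta Phi(g) - 2 A Phi(g) + Phi(w g), up to the factor 2 pi i. *)
Theorem Phi_mult G D Om f g v : bounds G D -> (forall z, ~ D z -> Rh z) -> copen Om ->
  (forall z, clo D z -> Om z) -> holo (Y := cC) Om f -> holo (Y := cC) Om g ->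
  cmul c2pi (Phi A N G (fun w => Cmult (f w) (g w)) v) =
  plus (plus (Phi A N G (fun w => Cmult w (f w)) (Phi A N G g v))
             (Phi A N G f (Phi A N G (fun w => Cmult w (g w)) v)))
       (cmul (RtoC (-2)) (A (Phi A N G f (Phi A N G g v)))).
Proof.
intros HG HD HO HDO Hf Hg.
set (b := Phi A N G g v). set (x := Phi A N G (fun w => Cmult w (g w)) v).
set (Gam := fun z => clo D z /\ ~ D z).
assert (CA : forall K l, cfun (Y1 := cC) (Y2 := Y) K l -> cfun (Y1 := cC) K (fun h => cmul (RtoC (-2)) (A (l h)))).
{ intros K l Hl. apply (cfun_comp K l (fun y => cmul (RtoC (-2)) (A y)) Hl).
  - intros u w. rewrite (clin_plus HA). vec Y.
  - intros c u. rewrite (clin_cmul HA). vec Y.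
  - destruct (proj2 (proj2 HA)) as [a [Ha Ha2]]. exists (2 * Cmod (RtoC (-2)) * a).
    assert (T := Cmod_ge_0 (RtoC (-2))). split; [apply Rmult_le_pos; lra|]. intros u.
    eapply Rle_trans; [apply norm_cmul|]. rewrite (Rmult_assoc _ a). apply Rmult_le_compat_l; [lra|apply Ha2]. }
assert (Ck : forall h : R * R -> cC, holo (Y := cC) Om h -> contK (Y := cC) (clo D) h).
{ intros h Hh z Hz. apply Hh, HDO, Hz. }
assert (CkG : forall h : R * R -> cC, contK (Y := cC) (clo D) h -> contK (Y := cC) Gam h).
{ intros h Hh z [Hz _]. apply Hh, Hz. }
assert (idh : holo (Y := cC) Om (fun w => w)) by apply holo_id.
assert (kerh : forall zeta, ~ clo D zeta -> contK (Y := cC) (clo D) (fun w => Cmult (Cinv (Cminus zeta w)) (RtoC 1))).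
{ intros zeta Nz z Hz. apply (holo_mult (fun z => z <> zeta)); [apply holo_pole|apply holo_const|].
  intros E. apply Nz. rewrite -E. exact Hz. }
destruct HG as [HG0 [[M HM] HG1]]. assert (HG : bounds G D) by (split; [exact HG0|split; [exists M; exact HM|exact HG1]]).
apply (cfun_eq_approx (Y1 := cC) (clo D)
  (fun f => cmul c2pi (Phi A N G (fun w => Cmult (f w) (g w)) v))
  (fun f => plus (plus (Phi A N G (fun w => Cmult w (f w)) b) (Phi A N G f x)) (cmul (RtoC (-2)) (A (Phi A N G f b))))).
- apply (cfun_comp (Z1 := cC) (clo D) (fun f : R * R -> cC => Phi A N G (fun w => Cmult (f w) (g w)) v) (fun y => cmul c2pi y)).
  + assert (E : (fun f : R * R -> cC => Phi A N G (fun w => Cmult (f w) (g w)) v) =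
                (fun f : R * R -> cC => Phi A N G (fun w => Cmult (g w) (f w)) v)).
    { apply functional_extensionality. intros s. apply Phi_ext. intros z. apply Cmult_comm. }
    rewrite E. apply (Phi_weight_cfun G D (clo D) g v HG HD (fun z H => H)). apply Ck, Hg.
  + intros u w. vec Y.
  + intros c u. vec Y.
  + exists (2 * Cmod c2pi). split; [assert (T := Cmod_ge_0 c2pi); lra|intros u; apply norm_cmul].
- apply cfun_plus; [apply cfun_plus|].
  + apply (Phi_weight_cfun G D (clo D) (fun w => w) b HG HD (fun z H => H)). apply Ck, idh.
  + apply (Phi_cfunK G D (clo D) x HG HD (fun z H => H)).
  + apply CA, (Phi_cfunK G D (clo D) b HG HD (fun z H => H)).
- intros zeta c Nz. assert (Rze : Rh zeta) by (apply HD; intros Dz; apply Nz, clo_incl, Dz).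
  set (k := fun w => Cmult (Cinv (Cminus zeta w)) (RtoC 1)).
  assert (E1 : Phi A N G (fun w => Cmult (ker (Y := cC) zeta c w) (g w)) v =
     cmul (c : C) (Rz zeta (plus (minus (cmul zeta b) (cmul (RtoC 2) (A b))) x))).
  { unfold b, x, Rz. rewrite -(Phi_pole A N HA HN G D HG HD Om zeta g v HO HDO Hg Nz).
    rewrite -(Phi_scalar A N HA HN G D HG HD c (fun w => Cmult (Cinv (Cminus zeta w)) (g w))).
    - apply Phi_ext. intros z. rewrite ker_cC. cring.
    - intros z [Hz _]. apply (holo_mult (fun z => Om z /\ z <> zeta)).
      + apply (holo_mono (fun z => z <> zeta)); [tauto|apply holo_pole].
      + apply (holo_mono Om); [tauto|exact Hg].
      + split; [apply HDO, Hz|]. intros E. apply Nz. rewrite -E. exact Hz. }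
  assert (E2 : forall u, Phi A N G (ker (Y := cC) zeta c) u = cmul (c : C) (cmul c2pi (Rz zeta u))).
  { intros u. unfold Rz. rewrite -(Phi_ker A N HA HN G D HG HD zeta u Nz).
    rewrite -(Phi_scalar A N HA HN G D HG HD c k); [|apply CkG, (kerh zeta Nz)].
    apply Phi_ext. intros z. apply ker_cC. }
  assert (E3 : Phi A N G (fun w => Cmult w (ker (Y := cC) zeta c w)) b = cmul (c : C) (cmul c2pi (cmul zeta (Rz zeta b)))).
  { unfold Rz. rewrite -(Phi_wker A N HA HN G D HG HD zeta b Nz).
    rewrite -(Phi_scalar A N HA HN G D HG HD c (fun w => Cmult w (k w))).
    - apply Phi_ext. intros z. rewrite ker_cC. unfold k. cring.
    - intros z Hz. apply (holo_mult (fun z => z <> zeta)); [apply holo_id| |].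
      + apply holo_mult; [apply holo_pole|apply holo_const].
      + intros E. apply Nz. rewrite -E. apply Hz. }
  rewrite E1 E3 !E2. assert (LR := Rs_clin A N HA HN zeta Rze). fold Rz in LR.
  rewrite (clin_plus LR) (clin_minus LR) !(clin_cmul LR) !(clin_cmul HA).
  unfold Rz. rewrite (Rs_A A N HA AN zeta b Rze). vec Y.
- apply (holo_approx (Y := cC) Om (clo D) f M Hf HO (pclosed_clo D) (clo_bound D M HM) HDO).
- apply Ck, Hf.
Qed.

(** * Functions symmetric under conjugation *)

(* A conjugation of Y commuting with A and N. *)
Variable cj : Y -> Y.
Hypotheses (cj_plus : forall x y, cj (plus x y) = plus (cj x) (cj y))
  (cj_scal : forall (r : R) x, cj (scal r x) = scal r (cj x))
  (cj_ci : forall x, cj (ci x) = opp (ci (cj x)))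
  (cj_cj : forall x, cj (cj x) = x)
  (cj_norm : forall x, norm (cj x) <= norm x)
  (cj_A : forall x, cj (A x) = A (cj x)) (cj_N : forall x, cj (N x) = N (cj x)).

Lemma cj_cmul c x : cj (cmul c x) = cmul (Cconj c) (cj x).
Proof.
unfold cmul at 1. rewrite cj_plus !cj_scal cj_ci. unfold cmul; simpl.
rewrite (scal_opp_r (V := Y)) -(scal_opp_l (V := Y)). reflexivity.
Qed.

Lemma cj_opp x : cj (opp x) = opp (cj x).
Proof. rewrite -!cmul_m1 cj_cmul. f_equal. apply injective_projections; simpl; ring. Qed.

Lemma Cconj_mult (z w : C) : Cconj (Cmult z w) = Cmult (Cconj z) (Cconj w).
Proof. apply injective_projections; simpl; ring. Qed.

Lemma Cconj_minus (z w : C) : Cconj (Cminus z w) = Cminus (Cconj z) (Cconj w).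
Proof. apply injective_projections; simpl; ring. Qed.

Lemma Cconj_inv (z : C) : Cconj (Cinv z) = Cinv (Cconj z).
Proof.
destruct z as [a b]. unfold Cinv, Cconj; simpl.
replace (- b * (- b * 1)) with (b * (b * 1)) by ring. f_equal. unfold Rdiv. ring.
Qed.

Lemma cj_minus x y : cj (minus x y) = minus (cj x) (cj y).
Proof. unfold minus. rewrite (cj_plus x (opp y)) cj_opp. reflexivity. Qed.

Lemma cj_Qz z x : cj (Qz A N z x) = Qz A N (Cconj z) (cj x).
Proof.
unfold Qz.
rewrite (cj_plus (minus (cmul (Cmult z z) x) (cmul (Cmult (RtoC 2) z) (A x))) (N x)).
rewrite (cj_minus (cmul (Cmult z z) x) (cmul (Cmult (RtoC 2) z) (A x))).
rewrite (cj_cmul (Cmult z z) x) (cj_cmul (Cmult (RtoC 2) z) (A x)) cj_A cj_N !Cconj_mult.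
replace (Cconj (RtoC 2)) with (RtoC 2) by (apply injective_projections; simpl; ring).
reflexivity.
Qed.

Lemma cj_Rs z x : Rh z -> Rh (Cconj z) -> cj (Rs A N z x) = Rs A N (Cconj z) (cj x).
Proof.
intros H1 H2. rewrite -(RQ A N (Cconj z) (cj (Rs A N z x)) H2) -cj_Qz QR //.
Qed.

Lemma Cconj_dist z w : Cmod (Cminus (Cconj z) (Cconj w)) = Cmod (Cminus z w).
Proof.
unfold Cmod. f_equal. simpl. ring.
Qed.

(** Conjugation reverses the orientation of a symmetric contour. Again this is
    checked on Cauchy kernels, whose poles are conjugated. *)
Theorem Phi_sym G D Om s v : bounds G D -> (forall z, ~ D z -> Rh z) -> copen Om ->
  (forall z, clo D z -> Om z) -> (forall z, D z -> D (Cconj z)) -> holo (Y := cC) Om s ->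
  (forall z, Om z -> s (Cconj z) = Cconj (s z)) -> cj v = v ->
  cj (Phi A N G s v) = opp (Phi A N G s v).
Proof.
intros HG HD HO HDO Dsym Hs Ssym Hv.
assert (Csym : forall z, clo D z -> clo D (Cconj z)).
{ intros z Hz e He. destruct (Hz e He) as [w [Hw Dw]]. exists (Cconj w). split; [|apply Dsym, Dw].
  rewrite Cconj_dist. exact Hw. }
assert (CCc : forall z : C, Cconj (Cconj z) = z) by (intros [a b]; apply injective_projections; simpl; ring).
(* st h is the reflection of h; st s agrees with s on the closure of D. *)
set (st := fun (s : R * R -> cC) (z : R * R) => Cconj (s (Cconj z))).
assert (Cst : forall h : R * R -> cC, contK (Y := cC) (clo D) h -> contK (Y := cC) (clo D) (st h)).
{ intros h Hh z Hz. apply cont_cC. intros eps He.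
  destruct (proj1 (cont_cC h _) (Hh _ (Csym z Hz)) eps He) as [d [Hd1 Hd2]].
  exists d. split; [exact Hd1|]. intros w Hw. unfold st. rewrite Cconj_dist. apply Hd2. rewrite Cconj_dist. exact Hw. }
assert (cf := Phi_cfunK G D (clo D) v HG HD (fun z H => H)).
assert (E : Phi A N G s v = opp (cj (Phi A N G (st s) v))).
{ apply (cfun_eq_approx (Y1 := cC) (clo D) (fun s => Phi A N G s v) (fun s => opp (cj (Phi A N G (st s) v)))).
  - exact cf.
  - destruct cf as [P [Q [C [HC HB]]]]. split; [|split].
    + intros h k Hh Hk. 
      assert (Est : Phi A N G (st (fun z => plus (h z) (k z))) v = plus (Phi A N G (st h) v) (Phi A N G (st k) v)).
      { rewrite -(P _ _ (Cst h Hh) (Cst k Hk)). apply Phi_ext. intros z.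
        apply injective_projections; unfold st; simpl; unfold plus; simpl; ring. }
      rewrite Est cj_plus. vec Y.
    + intros c h Hh.
      assert (Est : Phi A N G (st (fun z => cmul c (h z))) v = cmul (Cconj c) (Phi A N G (st h) v)).
      { rewrite -(Q (Cconj c) _ (Cst h Hh)). apply Phi_ext. intros z. unfold st. rewrite !cmul_cC.
        apply injective_projections; simpl; ring. }
      rewrite Est cj_cmul CCc. vec Y.
    + exists C. split; [exact HC|]. intros h M Hh HM Hb. rewrite nopp. eapply Rle_trans; [apply cj_norm|].
      apply HB; [apply Cst, Hh|exact HM|]. intros z Hz. rewrite norm_cC. unfold st.
      replace (Cmod (Cconj (h (Cconj z)))) with (Cmod (h (Cconj z))) by (unfold Cmod; f_equal; simpl; ring).
      rewrite -norm_cC. apply Hb, Csym, Hz.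
  - intros zeta c Nz. assert (Nz' : ~ clo D (Cconj zeta)).
    { intros H. apply Nz. rewrite -(CCc zeta). apply Csym, H. }
    assert (Rz1 : Rh zeta) by (apply HD; intros Dz; apply Nz, clo_incl, Dz).
    assert (Rz2 : Rh (Cconj zeta)) by (apply HD; intros Dz; apply Nz', clo_incl, Dz).
    assert (E2 : forall zeta (c : cC), ~ clo D zeta -> Phi A N G (ker (Y := cC) zeta c) v = cmul (c : C) (cmul c2pi (Rs A N zeta v))).
    { intros w d Nw. rewrite -(Phi_ker A N HA HN G D HG HD w v Nw).
      rewrite -(Phi_scalar A N HA HN G D HG HD d (fun z => Cmult (Cinv (Cminus w z)) (RtoC 1))).
      - apply Phi_ext. intros z. apply ker_cC.
      - intros z Hz. apply (holo_mult (fun z => z <> w)); [apply holo_pole|apply holo_const|].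
        intros E. apply Nw. rewrite -E. apply Hz. }
    rewrite (E2 zeta c Nz).
    assert (Est : Phi A N G (st (ker (Y := cC) zeta c)) v = Phi A N G (ker (Y := cC) (Cconj zeta) (Cconj c : cC)) v).
    { apply Phi_ext. intros z. unfold st. rewrite !ker_cC !Cmult_1_r Cconj_mult Cconj_inv Cconj_minus CCc. reflexivity. }
    assert (Rz3 : Rh (Cconj (Cconj zeta))) by (rewrite CCc; exact Rz1).
    rewrite Est (E2 _ _ Nz') !cj_cmul (cj_Rs _ v Rz2 Rz3) !CCc Hv.
    assert (Ec : Cconj c2pi = Copp c2pi) by (apply injective_projections; simpl; ring).
    rewrite Ec. vec Y.
  - destruct HG as [_ [[M HM] _]].
    apply (holo_approx (Y := cC) Om (clo D) s M Hs HO (pclosed_clo D) (clo_bound D M HM) HDO).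
  - intros z Hz. apply Hs, HDO, Hz. }
rewrite {2}E. rewrite (opp_opp (G := Y)). f_equal.
apply (cfun_ext (Y1 := cC) (clo D) (fun s => Phi A N G s v)).
- exact cf.
- intros z Hz. apply Hs, HDO, Hz.
- apply Cst. intros z Hz. apply Hs, HDO, Hz.
- intros z Hz. unfold st. rewrite Ssym; [symmetry; apply CCc|apply HDO, Hz].
Qed.
End Product3.

(** * Real operators defined by contour integrals *)

Section RealForm.
Context (W : CompleteNormedModule R_AbsRing).
Let Y := prodCS W.

Definition lft (L : W -> W) (y : prodCS W) : prodCS W := (L (fst y), L (snd y)).
Definition inj (w : W) : prodCS W := (w, zero).
Definition conjY (y : prodCS W) : prodCS W := (fst y, opp (snd y)).

Lemma blin_id : blin (fun w : W => w).
Proof. split; [auto|]. split; [auto|]. exists 1. split; [lra|]. intros. lra. Qed.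

Lemma prod_norm_def (y : prodCS W) : norm y = sqrt (norm (fst y) ^ 2 + norm (snd y) ^ 2).
Proof. reflexivity. Qed.

Lemma inj_pair (x y : prodCS W) : fst x = fst y -> snd x = snd y -> x = y.
Proof. apply injective_projections. Qed.

Lemma clin_lft L : blin L -> clin (lft L).
Proof.
intros HL. split; [|split].
- intros x y. apply inj_pair; apply (blin_plus L HL).
- intros c y. apply inj_pair; unfold cmul, lft; simpl.
  + change (L (plus (scal (fst c) (fst y)) (scal (snd c) (opp (snd y)))) =
            plus (scal (fst c) (L (fst y))) (scal (snd c) (opp (L (snd y))))).
    rewrite (blin_plus L HL) !(blin_scal L HL) (blin_opp L HL). reflexivity.
  + change (L (plus (scal (fst c) (snd y)) (scal (snd c) (fst y))) =
            plus (scal (fst c) (L (snd y))) (scal (snd c) (L (fst y)))).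
    rewrite (blin_plus L HL) !(blin_scal L HL). reflexivity.
- destruct HL as [_ [_ [M [HM HB]]]]. exists M. split; [exact HM|]. intros y. rewrite !prod_norm_def. simpl fst. simpl snd.
  assert (H1 := HB (fst y)). assert (H2 := HB (snd y)).
  assert (P1 := nge0 (L (fst y))). assert (P2 := nge0 (L (snd y))).
  rewrite -(sqrt_pow2 M HM) -sqrt_mult_alt; [|apply pow_le; exact HM].
  apply sqrt_le_1_alt. rewrite Rmult_plus_distr_l -!Rpow_mult_distr.
  apply Rplus_le_compat; apply pow_incr; split; assumption.
Qed.

Lemma cmul_inj_c2pi (w : W) : cmul c2pi (inj w) = ((zero, scal (2 * PI) w) : prodCS W).
Proof.
unfold c2pi. rewrite -cmul_cmul cmul_Ci cmul_RtoC. apply inj_pair.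
- change (scal (2 * PI) (opp (zero : W)) = zero). rewrite (opp_zero (G := W)). apply (scal_zero_r (V := W)).
- reflexivity.
Qed.

Lemma inj_inj x y : inj x = inj y -> x = y.
Proof. intros E. apply (f_equal fst) in E. exact E. Qed.

Lemma inj_plus x y : inj (plus x y) = plus (inj x) (inj y).
Proof. apply inj_pair; [reflexivity|]. symmetry. apply (plus_zero_l (G := W)). Qed.

Lemma inj_scal (r : R) x : inj (scal r x) = scal r (inj x).
Proof. apply inj_pair; [reflexivity|]. symmetry. apply (scal_zero_r (V := W)). Qed.

Lemma lft_inj L w : blin L -> lft L (inj w) = inj (L w).
Proof. intros HL. apply inj_pair; [reflexivity|apply (blin_zero L HL)]. Qed.

Lemma c2pi_neq : c2pi <> RtoC 0.
Proof.
intros E. apply (f_equal snd) in E. simpl in E. assert (P := PI_RGT_0). lra.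
Qed.

Lemma cmul_inv_cancel {Z : cspace} (c : C) (x y : Z) : c <> RtoC 0 -> cmul c x = cmul c y -> x = y.
Proof.
intros Hc E. apply (f_equal (fun z => cmul (Cinv c) z)) in E. rewrite !cmul_cmul !(Cinv_l c Hc) !cmul_one in E. exact E.
Qed.

Variables (a0 n0 : W -> W).
Hypotheses (Ha : blin a0) (Hn : blin n0) (Han : forall w, a0 (n0 w) = n0 (a0 w)).
Let A := lft a0.
Let N := lft n0.
Let HA : clin A := clin_lft a0 Ha.
Let HN : clin N := clin_lft n0 Hn.

Lemma lft_AN y : A (N y) = N (A y).
Proof. apply inj_pair; apply Han. Qed.

(** The resolvent set of the pencil z^2 - 2 z a0 + n0 on the complexification. *)
Definition pencil_res : R * R -> Prop := Rho A N.

Definition encloses (G : list (R -> R * R)) (D : R * R -> Prop) : Prop :=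
  bounds G D /\ (forall z, ~ D z -> pencil_res z) /\ (forall z, D z -> D (Cconj z)).

(** Intrinsic functions, restricted to a plane. *)
Definition symholo (Om : R * R -> Prop) (s : R * R -> R * R) : Prop :=
  holo (Y := cC) Om s /\ forall z, Om z -> s (Cconj z) = Cconj (s z).

(** The operator (1 / (2 pi i)) times the integral of s(z) (z^2 - 2 z a0 + n0)^{-1} dz.
    By [Phi_beta] it maps W to W, which is why only the imaginary part of the
    integral appears. *)
Definition beta (G : list (R -> R * R)) (s : R * R -> R * R) (w : W) : W :=
  scal (/ (2 * PI)) (snd (Phi A N G s (inj w))).

Lemma symholo_id Om : symholo Om (fun z => z).
Proof. split; [apply holo_id|auto]. Qed.

Lemma symholo_mult Om s t : symholo Om s -> symholo Om t -> symholo Om (fun z => Cmult (s z) (t z)).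
Proof.
intros [H1 H2] [K1 K2]. split; [apply holo_mult; assumption|].
intros z Hz. rewrite H2 // K2 // Cconj_mult //.
Qed.

Section WithCycle.
Variables (G : list (R -> R * R)) (D Om : R * R -> Prop).
Hypotheses (HG : encloses G D) (HO : copen Om) (HDO : forall z, clo D z -> Om z).

(** The integral is purely imaginary on real vectors, by [Phi_sym]. *)
Lemma Phi_beta s w : symholo Om s -> Phi A N G s (inj w) = cmul c2pi (inj (beta G s w)).
Proof.
intros [Hs Ssym]. destruct HG as [B [R D2]].
assert (E : conjY (Phi A N G s (inj w)) = opp (Phi A N G s (inj w))).
{ apply (Phi_sym A N HA HN conjY) with (D := D) (Om := Om); try assumption.
  - intros x y. apply inj_pair; [reflexivity|apply (opp_plus (G := W))].
  - intros r x. apply inj_pair; [reflexivity|symmetry; apply (scal_opp_r (V := W))].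
  - intros x. apply inj_pair; [symmetry; apply (opp_opp (G := W))|reflexivity].
  - intros x. right. rewrite !prod_norm_def. simpl fst; simpl snd. do 3 f_equal. apply nopp.
  - intros x. apply inj_pair; [reflexivity|symmetry; apply (blin_opp a0 Ha)].
  - intros x. apply inj_pair; [reflexivity|symmetry; apply (blin_opp n0 Hn)].
  - apply inj_pair; [reflexivity|apply (opp_zero (G := W))]. }
rewrite cmul_inj_c2pi. unfold beta. set (x := Phi A N G s (inj w)) in *.
assert (P := PI_RGT_0).
apply inj_pair.
- apply (f_equal fst) in E. change (fst x = opp (fst x)) in E. change (fst x = zero).
  transitivity (scal (/ 2) (plus (fst x) (fst x))).
  + transitivity (scal (/ 2 * 2) (fst x)).
    * rewrite Rinv_l; [symmetry; apply (scal_one (V := W))|lra].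
    * transitivity (scal (/ 2) (scal 2 (fst x))); [symmetry; apply (scal_assoc (V := W))|].
      f_equal. change (scal (1 + 1) (fst x) = plus (fst x) (fst x)).
      transitivity (plus (scal 1 (fst x)) (scal 1 (fst x))); [apply (scal_distr_r (V := W))|].
      f_equal; apply (scal_one (V := W)).
  + rewrite {1}E. rewrite (plus_opp_l (G := W)). apply (scal_zero_r (V := W)).
- change (snd x = scal (2 * PI) (scal (/ (2 * PI)) (snd x))).
  transitivity (scal (2 * PI * / (2 * PI)) (snd x)).
  + rewrite Rinv_r; [symmetry; apply (scal_one (V := W))|lra].
  + symmetry. apply (scal_assoc (V := W)).
Qed.

Let Cont s : symholo Om s -> contK (Y := cC) (fun z => clo D z /\ ~ D z) s.
Proof. intros [Hs _] z [Hz _]. apply Hs, HDO, Hz. Qed.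

Lemma beta_plus s x y : symholo Om s -> beta G s (plus x y) = plus (beta G s x) (beta G s y).
Proof.
intros Hs. apply inj_inj, (cmul_inv_cancel c2pi); [apply c2pi_neq|].
transitivity (Phi A N G s (inj (plus x y))); [symmetry; apply (Phi_beta s _ Hs)|].
transitivity (plus (Phi A N G s (inj x)) (Phi A N G s (inj y))).
- transitivity (Phi A N G s (plus (inj x) (inj y))); [apply f_equal, inj_plus|].
  apply (Phi_plus A N HA HN G D (proj1 HG) (proj1 (proj2 HG)) s (inj x) (inj y) (Cont s Hs)).
- rewrite (Phi_beta s x Hs) (Phi_beta s y Hs) -cmul_plus_r. apply f_equal. symmetry. apply inj_plus.
Qed.

Lemma beta_scal s (r : R) x : symholo Om s -> beta G s (scal r x) = scal r (beta G s x).
Proof.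
intros Hs. apply inj_inj, (cmul_inv_cancel c2pi); [apply c2pi_neq|].
transitivity (Phi A N G s (inj (scal r x))); [symmetry; apply (Phi_beta s _ Hs)|].
transitivity (cmul (RtoC r) (Phi A N G s (inj x))).
- transitivity (Phi A N G s (cmul (RtoC r) (inj x))).
  + apply f_equal. rewrite cmul_RtoC. apply inj_scal.
  + apply (Phi_cmul A N HA HN G D (proj1 HG) (proj1 (proj2 HG)) s (RtoC r) (inj x) (Cont s Hs)).
- rewrite (Phi_beta s x Hs). transitivity (cmul c2pi (scal r (inj (beta G s x)))); [vec Y|].
  apply f_equal. symmetry. apply inj_scal.
Qed.

Lemma beta_comm s (L : W -> W) w : symholo Om s -> blin L -> (forall x, L (a0 x) = a0 (L x)) ->
  (forall x, L (n0 x) = n0 (L x)) -> beta G s (L w) = L (beta G s w).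
Proof.
intros Hs HL L1 L2. apply inj_inj, (cmul_inv_cancel c2pi); [apply c2pi_neq|].
transitivity (Phi A N G s (inj (L w))); [symmetry; apply (Phi_beta s _ Hs)|].
transitivity (lft L (cmul c2pi (inj (beta G s w)))).
2:{ rewrite (clin_cmul (clin_lft L HL)). apply f_equal, (lft_inj L _ HL). }
transitivity (lft L (Phi A N G s (inj w))); [|apply f_equal, (Phi_beta s w Hs)].
transitivity (Phi A N G s (lft L (inj w))); [apply f_equal; symmetry; apply (lft_inj L w HL)|].
apply (Phi_comm A N HA HN G D (proj1 HG) (proj1 (proj2 HG))).
- apply clin_lft, HL.
- intros x. apply inj_pair; apply L1.
- intros x. apply inj_pair; apply L2.
- apply Cont, Hs.
Qed.

(** [Phi_mult] divided by (2 pi i)^2. *)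
Lemma beta_mult f g w : symholo Om f -> symholo Om g ->
  beta G (fun z => Cmult (f z) (g z)) w =
  minus (plus (beta G (fun z => Cmult z (f z)) (beta G g w)) (beta G f (beta G (fun z => Cmult z (g z)) w)))
        (scal 2 (a0 (beta G f (beta G g w)))).
Proof.
intros Hf Hg.
assert (Hwf := symholo_mult Om _ _ (symholo_id Om) Hf). assert (Hwg := symholo_mult Om _ _ (symholo_id Om) Hg).
assert (E := Phi_mult A N HA HN lft_AN G D Om f g (inj w) (proj1 HG) (proj1 (proj2 HG)) HO HDO (proj1 Hf) (proj1 Hg)).
assert (PC : forall s c x, symholo Om s -> Phi A N G s (cmul c x) = cmul c (Phi A N G s x)).
{ intros s c x Hs. apply (Phi_cmul A N HA HN G D (proj1 HG) (proj1 (proj2 HG)) s c x (Cont s Hs)). }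
assert (E0 := Phi_beta _ w (symholo_mult Om f g Hf Hg)).
assert (E1 := Phi_beta g w Hg). assert (E2 := Phi_beta _ w Hwg).
set (x1 := beta G g w) in *. set (x2 := beta G (fun z => Cmult z (g z)) w) in *.
assert (E3 : Phi A N G (fun z => Cmult z (f z)) (cmul c2pi (inj x1)) =
  cmul c2pi (cmul c2pi (inj (beta G (fun z => Cmult z (f z)) x1)))).
{ transitivity (cmul c2pi (Phi A N G (fun z => Cmult z (f z)) (inj x1))); [apply (PC _ _ _ Hwf)|].
  apply f_equal, (Phi_beta _ x1 Hwf). }
assert (E45 : forall x, Phi A N G f (cmul c2pi (inj x)) = cmul c2pi (cmul c2pi (inj (beta G f x)))).
{ intros x. transitivity (cmul c2pi (Phi A N G f (inj x))); [apply (PC _ _ _ Hf)|].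
  apply f_equal, (Phi_beta _ x Hf). }
assert (E4 := E45 x2). assert (E5 := E45 x1).
assert (E6 : A (cmul c2pi (cmul c2pi (inj (beta G f x1)))) = cmul c2pi (cmul c2pi (inj (a0 (beta G f x1))))).
{ transitivity (cmul c2pi (cmul c2pi (A (inj (beta G f x1))))).
  - rewrite !(clin_cmul HA). reflexivity.
  - apply f_equal, f_equal, (lft_inj a0 _ Ha). }
set (y0 := beta G (fun z => Cmult (f z) (g z)) w) in *.
set (y1 := beta G (fun z => Cmult z (f z)) x1) in *. set (y2 := beta G f x2) in *. set (y3 := beta G f x1) in *.
clearbody y0 y1 y2 y3 x1 x2.
rewrite E0 E1 E2 E3 E4 E5 E6 in E.
apply inj_inj, (cmul_inv_cancel c2pi); [apply c2pi_neq|].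
apply (cmul_inv_cancel c2pi); [apply c2pi_neq|]. rewrite E. clear E E0 E1 E2 E3 E4 E5 E6.
assert (EI : inj (minus (plus y1 y2) (scal 2 (a0 y3))) = minus (plus (inj y1) (inj y2)) (scal 2 (inj (a0 y3)))).
{ rewrite -inj_plus -inj_scal. apply inj_pair; [reflexivity|].
  symmetry. change (minus (zero : W) zero = zero). apply (minus_eq_zero (G := W)). }
rewrite EI. vec Y.
Qed.
End WithCycle.

Lemma beta_indep G1 D1 G2 D2 Om s w : encloses G1 D1 -> encloses G2 D2 -> copen Om ->
  (forall z, clo D1 z -> Om z) -> (forall z, clo D2 z -> Om z) -> holo (Y := cC) Om s ->
  beta G1 s w = beta G2 s w.
Proof.
intros [B1 [R1 _]] [B2 [R2 _]] HO O1 O2 Hs. unfold beta.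
rewrite (Phi_indep A N HA HN G1 D1 G2 D2 Om s (inj w) B1 B2 R1 R2 HO O1 O2 Hs). reflexivity.
Qed.
End RealForm.

(** * The quaternionic module *)

(** The reification procedure over R, for modules that need not be complete or complex. *)
Inductive rexp : Type :=
| RAtom (n : nat) | RZero | RAdd (a b : rexp) | RNeg (a : rexp) | RScal (r : R) (a : rexp).

Section RVec.
Context {E : NormedModule R_AbsRing}.

Fixpoint reval (env : list E) (e : rexp) : E :=
  match e with
  | RAtom n => nth n env zero
  | RZero => zero
  | RAdd a b => plus (reval env a) (reval env b)
  | RNeg a => opp (reval env a)
  | RScal r a => scal r (reval env a)
  end.

Fixpoint rcoef (n : nat) (e : rexp) : R :=
  match e with
  | RAtom m => if Nat.eqb n m then 1 else 0
  | RZero => 0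
  | RAdd a b => rcoef n a + rcoef n b
  | RNeg a => - rcoef n a
  | RScal r a => r * rcoef n a
  end.

Fixpoint rsum (env : list E) (f : nat -> R) : E :=
  match env with
  | nil => zero
  | y :: env' => plus (scal (f O) y) (rsum env' (fun n => f (S n)))
  end.

Lemma rsum_ext (env : list E) f g :
  (forall n, (n < length env)%nat -> f n = g n) -> rsum env f = rsum env g.
Proof.
revert f g; induction env as [|y env IH]; intros f g H; simpl; [reflexivity|].
rewrite (H O ltac:(simpl; lia)). f_equal. apply IH. intros n Hn. apply H. simpl; lia.
Qed.

Lemma rplus4 (a b c d : E) : plus (plus a b) (plus c d) = plus (plus a c) (plus b d).
Proof. rewrite -plus_assoc (plus_assoc b) (plus_comm b) -plus_assoc plus_assoc. reflexivity. Qed.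

Lemma rsum_plus (env : list E) f g : rsum env (fun n => f n + g n) = plus (rsum env f) (rsum env g).
Proof.
revert f g; induction env as [|y env IH]; intros f g; simpl.
- rewrite plus_zero_l. reflexivity.
- rewrite (IH (fun n => f (S n)) (fun n => g (S n))).
  rewrite (scal_distr_r (f O) (g O) y : scal (f O + g O) y = _). apply rplus4.
Qed.

Lemma rsum_scal (env : list E) (c : R) f : rsum env (fun n => c * f n) = scal c (rsum env f).
Proof.
revert f; induction env as [|y env IH]; intros f; simpl.
- rewrite scal_zero_r. reflexivity.
- rewrite (IH (fun n => f (S n))) scal_distr_l scal_assoc. reflexivity.
Qed.

Lemma rsum_zero (env : list E) : rsum env (fun _ => 0) = zero.
Proof.
induction env as [|y env IH]; simpl; [reflexivity|].
rewrite IH (scal_zero_l y : scal 0 y = _). apply plus_zero_l.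
Qed.

Lemma rsum_atom (env : list E) n : rsum env (fun m => if Nat.eqb m n then 1 else 0) = nth n env zero.
Proof.
revert n; induction env as [|y env IH]; intros [|n]; simpl; try reflexivity.
- rewrite rsum_zero (scal_one y : scal 1 y = _). apply plus_zero_r.
- rewrite (scal_zero_l y : scal 0 y = _) IH. apply plus_zero_l.
Qed.

Lemma reval_rsum (env : list E) e : reval env e = rsum env (fun n => rcoef n e).
Proof.
induction e; simpl.
- symmetry. apply rsum_atom.
- symmetry. apply rsum_zero.
- rewrite rsum_plus IHe1 IHe2. reflexivity.
- rewrite (rsum_ext env _ (fun n => -1 * rcoef n e)); [|intros; ring].
  rewrite rsum_scal IHe. symmetry. apply (scal_opp_one (rsum env (fun n => rcoef n e))).
- rewrite rsum_scal IHe. reflexivity.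
Qed.

Lemma reval_eq (env : list E) e1 e2 :
  List.Forall (fun n => rcoef n e1 = rcoef n e2) (List.seq 0 (length env)) -> reval env e1 = reval env e2.
Proof.
intros H. rewrite !reval_rsum. apply rsum_ext. intros n Hn.
apply (proj1 (List.Forall_forall _ _) H n). apply in_seq. lia.
Qed.
End RVec.

Ltac r_atoms E env e :=
  lazymatch e with
  | plus ?a ?b => let env1 := r_atoms E env a in r_atoms E env1 b
  | minus ?a ?b => let env1 := r_atoms E env a in r_atoms E env1 b
  | opp ?a => r_atoms E env a
  | scal _ ?a => r_atoms E env a
  | zero => env
  | _ => lazymatch v_lookup e env with
         | Some _ => env
         | None => constr:((e : NormedModule.sort R_AbsRing E) :: env)
         end
  end.

Ltac r_reify env e :=
  lazymatch e with
  | plus ?a ?b => let a' := r_reify env a in let b' := r_reify env b in constr:(RAdd a' b')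
  | minus ?a ?b => let a' := r_reify env a in let b' := r_reify env b in
                   constr:(RAdd a' (RNeg b'))
  | opp ?a => let a' := r_reify env a in constr:(RNeg a')
  | scal ?r ?a => let a' := r_reify env a in constr:(RScal r a')
  | zero => constr:(RZero)
  | _ => lazymatch v_lookup e env with
         | Some ?n => constr:(RAtom n)
         end
  end.

Ltac rvec_coefs E :=
  lazymatch goal with
  | |- ?a = ?b =>
    let env := r_atoms E (@nil (NormedModule.sort R_AbsRing E)) a in
    let env := r_atoms E env b in
    let a' := r_reify env a in let b' := r_reify env b in
    let H := constr:(fun H => @reval_eq E env a' b' H) in
    refine (H _); cbn [length List.seq]; repeat (apply List.Forall_cons); try apply List.Forall_nil;
    cbn [rcoef Nat.eqb]
  end.

(** Real coefficients may be given by operations of R seen as a module. *)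
Ltac rring := unfold plus, scal, opp, zero, one, mult; simpl; unfold mult; simpl; ring.
Ltac rvec E := rvec_coefs E; rring.

Section HMod.
Context {E : NormedModule R_AbsRing}.
Implicit Types (v w : hmod E) (a b : quat).

Lemma mkh_eq (x0 x1 x2 x3 y0 y1 y2 y3 : E) : x0 = y0 -> x1 = y1 -> x2 = y2 -> x3 = y3 ->
  mkh x0 x1 x2 x3 = mkh y0 y1 y2 y3.
Proof. intros -> -> -> ->. reflexivity. Qed.

Lemma hplus (x0 x1 x2 x3 y0 y1 y2 y3 : E) : plus (mkh x0 x1 x2 x3) (mkh y0 y1 y2 y3) =
  mkh (plus x0 y0) (plus x1 y1) (plus x2 y2) (plus x3 y3).
Proof. reflexivity. Qed.
Lemma hscal (r : R) (x0 x1 x2 x3 : E) : scal r (mkh x0 x1 x2 x3) =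
  mkh (scal r x0) (scal r x1) (scal r x2) (scal r x3).
Proof. reflexivity. Qed.
Lemma hopp (x0 x1 x2 x3 : E) : opp (mkh x0 x1 x2 x3) = mkh (opp x0) (opp x1) (opp x2) (opp x3).
Proof. reflexivity. Qed.
Lemma hzero : (zero : hmod E) = mkh zero zero zero zero.
Proof. reflexivity. Qed.
Lemma hminus (x0 x1 x2 x3 y0 y1 y2 y3 : E) : minus (mkh x0 x1 x2 x3) (mkh y0 y1 y2 y3) =
  mkh (minus x0 y0) (minus x1 y1) (minus x2 y2) (minus x3 y3).
Proof. reflexivity. Qed.

Lemma h_eta v : v = mkh (coord I0 v) (coord I1 v) (coord I2 v) (coord I3 v).
Proof. destruct v as [x0 [x1 [x2 x3]]]. reflexivity. Qed.
End HMod.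

Ltac hcrush E :=
  rewrite ?hplus ?hscal ?hopp ?hminus ?hzero; unfold qmul, ofR, lmul, rmul, lin4, qc; cbn [coord mkh fst snd];
  apply mkh_eq; rvec E.

Section HMod2.
Context {E : NormedModule R_AbsRing}.
Implicit Types (v w : hmod E) (a b : quat).

Lemma lmul_plus a v w : lmul a (plus v w) = plus (lmul a v) (lmul a w).
Proof. rewrite (h_eta v) (h_eta w). hcrush E. Qed.
Lemma lmul_scal a (r : R) v : lmul a (scal r v) = scal r (lmul a v).
Proof. rewrite (h_eta v). hcrush E. Qed.
Lemma lmul_plus_l a b v : lmul (plus a b) v = plus (lmul a v) (lmul b v).
Proof. destruct a as [a0 [a1 [a2 a3]]], b as [b0 [b1 [b2 b3]]]. rewrite (h_eta v). hcrush E. Qed.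
Lemma lmul_scal_l (r : R) a v : lmul (scal r a) v = scal r (lmul a v).
Proof. destruct a as [a0 [a1 [a2 a3]]]. rewrite (h_eta v). hcrush E. Qed.
Lemma lmul_lmul a b v : lmul a (lmul b v) = lmul (qmul a b) v.
Proof. destruct a as [a0 [a1 [a2 a3]]], b as [b0 [b1 [b2 b3]]]. rewrite (h_eta v). hcrush E. Qed.
Lemma lmul_ofR (r : R) v : lmul (ofR r) v = scal r v.
Proof. rewrite (h_eta v). hcrush E. Qed.
Lemma lmul_opp_l a v : lmul (opp a) v = opp (lmul a v).
Proof. destruct a as [a0 [a1 [a2 a3]]]. rewrite (h_eta v). hcrush E. Qed.
Lemma lmul_opp a v : lmul a (opp v) = opp (lmul a v).
Proof. rewrite (h_eta v). hcrush E. Qed.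
Lemma lmul_minus a v w : lmul a (minus v w) = minus (lmul a v) (lmul a w).
Proof. rewrite (h_eta v) (h_eta w). hcrush E. Qed.
Lemma rmul_ofR (r : R) v : rmul v (ofR r) = scal r v.
Proof. rewrite (h_eta v). hcrush E. Qed.
End HMod2.

(** * Bounded operators on the quaternionic module *)

Section BlinClosure.
Context {U V Z : CompleteNormedModule R_AbsRing}.

Lemma blin_comp (f : V -> Z) (g : U -> V) : blin f -> blin g -> blin (fun x => f (g x)).
Proof.
intros Hf Hg. split; [|split].
- intros x y. rewrite (blin_plus g Hg) (blin_plus f Hf) //.
- intros r x. rewrite (blin_scal g Hg) (blin_scal f Hf) //.
- destruct Hf as [_ [_ [M [HM HB]]]]. destruct Hg as [_ [_ [M' [HM' HB']]]].
  exists (M * M'). split; [apply Rmult_le_pos; assumption|]. intros x.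
  eapply Rle_trans; [apply HB|]. rewrite Rmult_assoc. apply Rmult_le_compat_l; [exact HM|apply HB'].
Qed.

Lemma blin_add (f g : U -> V) : blin f -> blin g -> blin (fun x => plus (f x) (g x)).
Proof.
intros Hf Hg. split; [|split].
- intros x y. rewrite (blin_plus g Hg) (blin_plus f Hf). apply plus4.
- intros r x. rewrite (blin_scal g Hg) (blin_scal f Hf). symmetry. apply (scal_distr_l (V := V)).
- destruct Hf as [_ [_ [M [HM HB]]]]. destruct Hg as [_ [_ [M' [HM' HB']]]].
  exists (M + M'). split; [lra|]. intros x. eapply Rle_trans; [apply ntri|].
  assert (T1 := HB x). assert (T2 := HB' x). lra.
Qed.

Lemma blin_smul (c : R) (f : U -> V) : blin f -> blin (fun x => scal c (f x)).
Proof.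
intros Hf. split; [|split].
- intros x y. rewrite (blin_plus f Hf). apply (scal_distr_l (V := V)).
- intros r x. rewrite (blin_scal f Hf).
  transitivity (scal (c * r) (f x)); [apply (scal_assoc (V := V))|]. rewrite Rmult_comm.
  symmetry. apply (scal_assoc (V := V)).
- destruct Hf as [_ [_ [M [HM HB]]]]. exists (Rabs c * M).
  split; [apply Rmult_le_pos; [apply Rabs_pos|exact HM]|]. intros x.
  eapply Rle_trans; [apply nscal|]. rewrite Rmult_assoc. apply Rmult_le_compat_l; [apply Rabs_pos|apply HB].
Qed.

Lemma blin_neg (f : U -> V) : blin f -> blin (fun x => opp (f x)).
Proof.
intros Hf. split; [|split].
- intros x y. rewrite (blin_plus f Hf). apply (opp_plus (G := V)).
- intros r x. rewrite (blin_scal f Hf). symmetry. apply (scal_opp_r (V := V)).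
- destruct Hf as [_ [_ [M [HM HB]]]]. exists M. split; [exact HM|]. intros x. rewrite nopp. apply HB.
Qed.

Lemma blin_sub (f g : U -> V) : blin f -> blin g -> blin (fun x => minus (f x) (g x)).
Proof. intros Hf Hg. apply (blin_add f (fun x => opp (g x))); [exact Hf|apply blin_neg, Hg]. Qed.

Lemma blin_zero_map : blin (fun _ : U => zero : V).
Proof.
split; [|split].
- intros x y. symmetry. apply (plus_zero_l (G := V)).
- intros r x. symmetry. apply (scal_zero_r (V := V)).
- exists 0. split; [lra|]. intros x. rewrite nzero. lra.
Qed.
End BlinClosure.

Section BlinProd.
Context {U V : CompleteNormedModule R_AbsRing}.

Lemma prod_norm_eq (y : prodC U V) : norm y = sqrt (norm (fst y) ^ 2 + norm (snd y) ^ 2).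
Proof. reflexivity. Qed.

Lemma fst_norm (y : prodC U V) : norm (fst y) <= norm y.
Proof.
rewrite prod_norm_eq -{1}(sqrt_pow2 (norm (fst y)) (nge0 _)). apply sqrt_le_1_alt.
assert (T := pow2_ge_0 (norm (snd y))). lra.
Qed.

Lemma snd_norm (y : prodC U V) : norm (snd y) <= norm y.
Proof.
rewrite prod_norm_eq -{1}(sqrt_pow2 (norm (snd y)) (nge0 _)). apply sqrt_le_1_alt.
assert (T := pow2_ge_0 (norm (fst y))). lra.
Qed.

Lemma pair_norm (y : prodC U V) : norm y <= norm (fst y) + norm (snd y).
Proof.
assert (P1 := nge0 (fst y)). assert (P2 := nge0 (snd y)).
rewrite prod_norm_eq -(sqrt_pow2 (norm (fst y) + norm (snd y))); [apply sqrt_le_1_alt; nra|lra].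
Qed.

Lemma blin_fst : blin (fun y : prodC U V => fst y).
Proof.
split; [reflexivity|]. split; [reflexivity|]. exists 1. split; [lra|]. intros x.
rewrite Rmult_1_l. apply fst_norm.
Qed.

Lemma blin_snd : blin (fun y : prodC U V => snd y).
Proof.
split; [reflexivity|]. split; [reflexivity|]. exists 1. split; [lra|]. intros x.
rewrite Rmult_1_l. apply snd_norm.
Qed.

Lemma blin_pair {Z : CompleteNormedModule R_AbsRing} (f : Z -> U) (g : Z -> V) : blin f -> blin g ->
  blin (fun x => (f x, g x) : prodC U V).
Proof.
intros Hf Hg. split; [|split].
- intros x y. apply injective_projections; [apply (blin_plus f Hf)|apply (blin_plus g Hg)].
- intros r x. apply injective_projections; [apply (blin_scal f Hf)|apply (blin_scal g Hg)].
- destruct Hf as [_ [_ [M [HM HB]]]]. destruct Hg as [_ [_ [M' [HM' HB']]]].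
  exists (M + M'). split; [lra|]. intros x. eapply Rle_trans; [apply pair_norm|]. simpl.
  assert (T1 := HB x). assert (T2 := HB' x). lra.
Qed.
End BlinProd.

Section BlinH.
Context {E : CompleteNormedModule R_AbsRing}.
Let W := hmodC E.

Lemma blin_coord (l : idx) : blin (fun v : hmodC E => coord l v : E).
Proof.
set (F1 := blin_fst (U := E) (V := prodC E (prodC E E))). set (S1 := blin_snd (U := E) (V := prodC E (prodC E E))).
set (F2 := blin_fst (U := E) (V := prodC E E)). set (S2 := blin_snd (U := E) (V := prodC E E)).
set (F3 := blin_fst (U := E) (V := E)). set (S3 := blin_snd (U := E) (V := E)).
destruct l.
- exact F1.
- exact (blin_comp _ _ F2 S1).
- exact (blin_comp _ _ F3 (blin_comp _ _ S2 S1)).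
- exact (blin_comp _ _ S3 (blin_comp _ _ S2 S1)).
Qed.

Lemma blin_mkh {Z : CompleteNormedModule R_AbsRing} (f0 f1 f2 f3 : Z -> E) : blin f0 -> blin f1 -> blin f2 -> blin f3 ->
  blin (fun x => mkh (f0 x) (f1 x) (f2 x) (f3 x) : hmodC E).
Proof.
intros H0 H1 H2 H3. exact (blin_pair _ _ H0 (blin_pair _ _ H1 (blin_pair _ _ H2 H3))).
Qed.

Lemma blin_lin4 {Z : CompleteNormedModule R_AbsRing} (a b c d : R) (f0 f1 f2 f3 : Z -> E) :
  blin f0 -> blin f1 -> blin f2 -> blin f3 -> blin (fun x => lin4 a b c d (f0 x) (f1 x) (f2 x) (f3 x) : E).
Proof.
intros H0 H1 H2 H3. unfold lin4.
apply (blin_add (fun x => plus (scal a (f0 x)) (scal b (f1 x))) (fun x => plus (scal c (f2 x)) (scal d (f3 x)))).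
- apply (blin_add (fun x => scal a (f0 x)) (fun x => scal b (f1 x))); apply blin_smul; assumption.
- apply (blin_add (fun x => scal c (f2 x)) (fun x => scal d (f3 x))); apply blin_smul; assumption.
Qed.

Lemma blin_lmul (a : quat) : blin (fun v : hmodC E => lmul a v : hmodC E).
Proof. unfold lmul. apply blin_mkh; apply blin_lin4; apply blin_coord. Qed.

Definition act4 (L : E -> E) (v : hmod E) : hmod E :=
  mkh (L (coord I0 v)) (L (coord I1 v)) (L (coord I2 v)) (L (coord I3 v)).

Lemma blin_act4 (L : E -> E) : blin L -> blin (fun v : hmodC E => act4 L v : hmodC E).
Proof. intros HL. apply blin_mkh; apply (blin_comp L); try exact HL; apply blin_coord. Qed.

Lemma act4_lmul (L : E -> E) a v : blin L -> act4 L (lmul a v) = lmul a (act4 L v).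
Proof.
intros HL. destruct a as [a0 [a1 [a2 a3]]].
unfold act4, lmul, lin4; cbn [coord mkh fst snd].
apply mkh_eq; rewrite !(blin_plus L HL) !(blin_scal L HL); reflexivity.
Qed.

Lemma act4_comm (L L' : E -> E) v : (forall x, L (L' x) = L' (L x)) -> act4 L (act4 L' v) = act4 L' (act4 L v).
Proof. intros H. unfold act4; cbn [coord mkh fst snd]. apply mkh_eq; apply H. Qed.

End BlinH.

(** * Operators with commuting components *)

Section Components.
Context {E : CompleteNormedModule R_AbsRing} (A : hmod E -> hmod E).
Hypothesis A_rl : right_linear (tot A).
Hypothesis A_bd : exists M : R, forall v, norm (A v) <= M * norm v.
Hypothesis A_comm : commuting_components A.

Definition cmp (l : idx) (x : E) : E := coord l (A (mkh x zero zero zero)).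
Definition L_ (l : idx) : hmod E -> hmod E := act4 (cmp l).

Lemma A_plus v w : A (plus v w) = plus (A v) (A w).
Proof. destruct A_rl as [_ [H _]]. apply (H v w I I). Qed.

Lemma A_rmul v a : A (rmul v a) = rmul (A v) a.
Proof. destruct A_rl as [_ [_ H]]. apply (H a v I). Qed.

Lemma A_scal (r : R) v : A (scal r v) = scal r (A v).
Proof. rewrite -(rmul_ofR r v) A_rmul rmul_ofR. reflexivity. Qed.

Lemma A_blin : blin (A : hmodC E -> hmodC E).
Proof.
split; [exact A_plus|]. split; [exact A_scal|]. destruct A_bd as [M HM].
exists (Rabs M). split; [apply Rabs_pos|]. intros x. eapply Rle_trans; [apply HM|].
apply Rmult_le_compat_r; [apply (nge0 (Y := hmodC E))|apply Rle_abs].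
Qed.

Lemma cmp_blin l : blin (cmp l).
Proof.
unfold cmp. apply (blin_comp (fun v : hmodC E => coord l v : E) (fun x => A (mkh x zero zero zero) : hmodC E)); [apply blin_coord|].
apply (blin_comp (A : hmodC E -> hmodC E) (fun x : E => mkh x zero zero zero : hmodC E)); [apply A_blin|].
apply blin_mkh; [apply blin_id|apply blin_zero_map|apply blin_zero_map|apply blin_zero_map].
Qed.

Lemma L_blin l : blin (fun v : hmodC E => L_ l v : hmodC E).
Proof. apply blin_act4, cmp_blin. Qed.

Lemma L_lmul l a v : L_ l (lmul a v) = lmul a (L_ l v).
Proof. apply act4_lmul, cmp_blin. Qed.

Lemma cmp_comm l k x : cmp l (cmp k x) = cmp k (cmp l x).
Proof. apply (A_comm l k x). Qed.

Lemma L_comm l k v : L_ l (L_ k v) = L_ k (L_ l v).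
Proof. apply act4_comm. intros x. apply cmp_comm. Qed.

Lemma A_real x : A (mkh x zero zero zero) = mkh (cmp I0 x) (cmp I1 x) (cmp I2 x) (cmp I3 x).
Proof. apply h_eta. Qed.

(** Right linearity determines A from its values on real vectors. *)
Lemma A_quatop v : A v = act (quatop (Defs.comp A)) v.
Proof.
rewrite {1}(h_eta v).
assert (D : forall x0 x1 x2 x3 : E, mkh x0 x1 x2 x3 =
  plus (plus (mkh x0 zero zero zero) (rmul (mkh x1 zero zero zero) (unit_of I1)))
       (plus (rmul (mkh x2 zero zero zero) (unit_of I2)) (rmul (mkh x3 zero zero zero) (unit_of I3)))).
{ intros. unfold unit_of. hcrush E. }
rewrite D !A_plus !A_rmul !A_real.
change (act (quatop (Defs.comp A)) v) with
  (plus (plus (L_ I0 v) (lmul (unit_of I1) (L_ I1 v))) (plus (lmul (unit_of I2) (L_ I2 v)) (lmul (unit_of I3) (L_ I3 v)))).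
unfold L_, act4, unit_of.
set (v0 := coord I0 v). set (v1 := coord I1 v). set (v2 := coord I2 v). set (v3 := coord I3 v).
rewrite ?hplus ?hscal ?hopp ?hminus ?hzero; unfold qmul, ofR, lmul, rmul, lin4, qc. cbn [coord mkh fst snd].
apply mkh_eq; rvec E.
Qed.

Lemma bar_eq v : bar A v = minus (L_ I0 v) (underl A v).
Proof.
change (bar A v) with (plus (plus (L_ I0 v) (lmul (unit_of I1) (act4 (fun x => opp (cmp I1 x)) v)))
   (plus (lmul (unit_of I2) (act4 (fun x => opp (cmp I2 x)) v)) (lmul (unit_of I3) (act4 (fun x => opp (cmp I3 x)) v)))).
change (underl A v) with (plus (L_ I1 (lmul (unit_of I1) v)) (plus (L_ I2 (lmul (unit_of I2) v)) (L_ I3 (lmul (unit_of I3) v)))).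
rewrite !L_lmul. unfold L_, act4, unit_of.
rewrite ?hplus ?hscal ?hopp ?hminus ?hzero; unfold qmul, ofR, lmul, rmul, lin4, qc. cbn [coord mkh fst snd].
rewrite ?hplus ?hscal ?hopp ?hminus ?hzero. apply mkh_eq; rvec E.
Qed.

(** A Abar *)
Definition nrm (v : hmod E) : hmod E := A (bar A v).

(** The cross terms cancel because the components commute; hence A Abar commutes
    with left multiplication by quaternions and with all components. *)
Lemma nrm_eq v : nrm v = plus (plus (L_ I0 (L_ I0 v)) (L_ I1 (L_ I1 v))) (plus (L_ I2 (L_ I2 v)) (L_ I3 (L_ I3 v))).
Proof.
unfold nrm. rewrite A_quatop bar_eq.
change (act (quatop (Defs.comp A)) ?v) with
  (plus (plus (L_ I0 v) (lmul (unit_of I1) (L_ I1 v))) (plus (lmul (unit_of I2) (L_ I2 v)) (lmul (unit_of I3) (L_ I3 v)))).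
change (underl A v) with (plus (L_ I1 (lmul (unit_of I1) v)) (plus (L_ I2 (lmul (unit_of I2) v)) (L_ I3 (lmul (unit_of I3) v)))).
assert (LP : forall l x y, L_ l (plus x y) = plus (L_ l x) (L_ l y)) by (intros; apply (blin_plus _ (L_blin l))).
assert (LM : forall l x y, L_ l (minus x y) = minus (L_ l x) (L_ l y)) by (intros; apply (blin_minus _ (L_blin l))).
rewrite !LM !LP !L_lmul.
rewrite !(L_comm I1 I0) !(L_comm I2 I0) !(L_comm I3 I0) !(L_comm I2 I1) !(L_comm I3 I1) !(L_comm I3 I2).
repeat match goal with |- context [L_ ?l (L_ ?k v)] =>
  let x := fresh "x" in set (x := L_ l (L_ k v)); rewrite (h_eta x) end.
unfold unit_of. rewrite ?hplus ?hscal ?hopp ?hminus ?hzero; unfold qmul, ofR, lmul, rmul, lin4, qc. cbn [coord mkh fst snd].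
rewrite ?hplus ?hscal ?hopp ?hminus ?hzero. cbn [coord mkh fst snd]. apply mkh_eq; rvec E.
Qed.
End Components.

Lemma blin_ext {U V : CompleteNormedModule R_AbsRing} (f g : U -> V) : (forall x, f x = g x) -> blin f -> blin g.
Proof. intros H. rewrite (functional_extensionality f g H). auto. Qed.

Lemma pinv_spec {T : NormedModule R_AbsRing} (P : pop T) w : dom (pinv P) w ->
  dom P (act (pinv P) w) /\ act P (act (pinv P) w) = w.
Proof.
intros H. apply (epsilon_spec (inhabits zero) (fun v => dom P v /\ act P v = w)).
destruct H as [v [Hv _]]. exists v. exact Hv.
Qed.

Lemma pinv_left {T : NormedModule R_AbsRing} (P : pop T) v : dom P v -> dom (pinv P) (act P v) ->
  act (pinv P) (act P v) = v.
Proof.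
intros Hv H. assert (S := pinv_spec P _ H). destruct H as [u [Hu Uu]].
rewrite -(Uu _ S). apply Uu. split; [exact Hv|reflexivity].
Qed.

Ltac rgoal := unfold plus, scal, opp, one, zero; simpl; unfold plus, scal, opp, one, zero; simpl; unfold mult; simpl;
  match goal with |- @eq _ ?a ?b => change (@eq R a b) end.

(** * The complex structures of the module *)

Section Embed.
Context {E : CompleteNormedModule R_AbsRing}.
Let W := hmodC E.

(** Left multiplication by J makes W a complex space; this map a + i b |-> a + J b
    carries the complexification onto it, for all J at once. *)
Definition embJ (J : quat) (y : prodCS W) : hmod E := plus (fst y) (lmul J (snd y)).

Definition qpt (J : quat) (c : C) : quat := slice_pt J (fst c) (snd c).

Lemma lmul_qpt J c (w : hmod E) : lmul (qpt J c) w = plus (scal (fst c) w) (scal (snd c) (lmul J w)).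
Proof. unfold qpt, slice_pt. rewrite lmul_plus_l lmul_ofR lmul_scal_l. reflexivity. Qed.

Lemma imag_sq J : imag_unit J -> qmul J J = ofR (-1).
Proof.
destruct J as [j0 [j1 [j2 j3]]]. intros [H0 H1].
change (j0 = 0) in H0. change (j1 ^ 2 + j2 ^ 2 + j3 ^ 2 = 1) in H1. subst j0.
unfold qmul, ofR, lmul, lin4, qc; cbn [coord mkh fst snd].
apply (mkh_eq (E := R_NormedModule)); rgoal; try ring. lra.
Qed.

Lemma lmul_JJ J (w : hmod E) : imag_unit J -> lmul J (lmul J w) = opp w.
Proof. intros H. rewrite lmul_lmul (imag_sq J H) lmul_ofR. apply (scal_opp_one w). Qed.

Lemma imag_opp J : imag_unit J -> imag_unit (opp J).
Proof.
destruct J as [j0 [j1 [j2 j3]]]. intros [H0 H1].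
change (j0 = 0) in H0. change (j1 ^ 2 + j2 ^ 2 + j3 ^ 2 = 1) in H1. split.
- change (- j0 = 0). lra.
- change ((- j1) ^ 2 + (- j2) ^ 2 + (- j3) ^ 2 = 1). rewrite -H1. ring.
Qed.

Lemma embJ_blin J : blin (fun y : prodCS W => embJ J y : W).
Proof.
unfold embJ.
apply (blin_add (fun y : prodC W W => fst y) (fun y : prodC W W => lmul J (snd y) : W)); [apply blin_fst|].
apply (blin_comp (fun w : W => lmul J w : W) (fun y : prodC W W => snd y)); [apply blin_lmul|apply blin_snd].
Qed.

Lemma embJ_inj J (w : hmod E) : embJ J (inj W w) = w.
Proof.
unfold embJ, inj; simpl. rewrite (blin_zero _ (blin_lmul J)). apply (plus_zero_r w).
Qed.

Lemma embJ_cmul J c y : imag_unit J -> embJ J (cmul c y) = lmul (qpt J c) (embJ J y).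
Proof.
intros HJ. rewrite lmul_qpt. unfold embJ, cmul. destruct y as [a b]. simpl.
change (plus (plus (scal (fst c) a) (scal (snd c) (opp b))) (lmul J (plus (scal (fst c) b) (scal (snd c) a))) =
  plus (scal (fst c) (plus a (lmul J b))) (scal (snd c) (lmul J (plus a (lmul J b))))).
rewrite !lmul_plus !lmul_scal (lmul_JJ J b HJ).
set (u := lmul J a). set (w := lmul J b). rvec (hmod E).
Qed.

Lemma qpt_mult J c d : imag_unit J -> qmul (qpt J c) (qpt J d) = qpt J (Cmult c d).
Proof.
destruct J as [j0 [j1 [j2 j3]]], c as [x y], d as [u v]. intros [H0 H1].
change (j0 = 0) in H0. change (j1 ^ 2 + j2 ^ 2 + j3 ^ 2 = 1) in H1. subst j0.
unfold qpt, slice_pt, qmul, ofR, lmul, lin4, qc; cbn [coord mkh fst snd].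
apply (mkh_eq (E := R_NormedModule)); rgoal; try ring.
replace (x * u - y * v) with (x * u - y * v * 1) by ring. rewrite -H1. ring.
Qed.

Lemma qpt_real J r : qpt J (RtoC r) = ofR r.
Proof.
destruct J as [j0 [j1 [j2 j3]]]. unfold qpt, slice_pt, ofR.
apply (mkh_eq (E := R_NormedModule)); rgoal; ring.
Qed.

Lemma opp_qpt J : opp J = qpt J (Copp Ci).
Proof.
destruct J as [j0 [j1 [j2 j3]]]. unfold qpt, slice_pt, ofR.
apply (mkh_eq (E := R_NormedModule)); rgoal; ring.
Qed.

Lemma qpt_opp J c : qpt (opp J) c = qpt J (Cconj c).
Proof.
destruct J as [j0 [j1 [j2 j3]]]. unfold qpt, slice_pt, ofR.
apply (mkh_eq (E := R_NormedModule)); rgoal; ring.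
Qed.

(** The element y with [embJ J y = p] and [embJ (opp J) y = m]. *)
Definition unemb (J : quat) (p m : hmod E) : prodCS W :=
  (scal (/ 2) (plus p m), scal (/ 2) (lmul J (minus m p))).

Lemma unemb_plus J p m : imag_unit J -> embJ J (unemb J p m) = p.
Proof.
intros HJ. unfold embJ, unemb; cbn [fst snd]. rewrite lmul_scal (lmul_JJ J (minus m p) HJ). rvec_coefs (hmod E); rring || (simpl; field).
Qed.
End Embed.

(** * The quadratic pencil of A *)

Section Pencil.
Context {E : CompleteNormedModule R_AbsRing} (A : hmod E -> hmod E).
Hypothesis A_rl : right_linear (tot A).
Hypothesis A_bd : exists M : R, forall v, norm (A v) <= M * norm v.
Hypothesis A_comm : commuting_components A.
Let W := hmodC E.
Let a0 := L_ A I0.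
Let n0 := nrm A.
Let Lb l : blin (fun v : hmodC E => L_ A l v : hmodC E) := L_blin A A_rl A_bd l.

Lemma L_plus l x y : L_ A l (plus x y) = plus (L_ A l x) (L_ A l y).
Proof. apply (blin_plus _ (Lb l)). Qed.

Lemma nrm_comm (L : hmod E -> hmod E) v : (forall x y, L (plus x y) = plus (L x) (L y)) ->
  (forall l x, L (L_ A l x) = L_ A l (L x)) -> L (nrm A v) = nrm A (L v).
Proof.
intros HP HL. rewrite !(nrm_eq A A_rl A_bd A_comm) !HP !HL. reflexivity.
Qed.

Lemma a0_n0 v : a0 (n0 v) = n0 (a0 v).
Proof. apply nrm_comm; [apply L_plus|]. intros l x. apply (L_comm A A_comm). Qed.

Lemma lmul_n0 q v : lmul q (n0 v) = n0 (lmul q v).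
Proof. apply nrm_comm; [apply lmul_plus|]. intros l x. symmetry. apply (L_lmul A A_rl A_bd). Qed.

Lemma lmul_a0 q v : lmul q (a0 v) = a0 (lmul q v).
Proof. symmetry. apply (L_lmul A A_rl A_bd). Qed.

Lemma underl_eq v : underl A v = plus (lmul (unit_of I1) (L_ A I1 v))
  (plus (lmul (unit_of I2) (L_ A I2 v)) (lmul (unit_of I3) (L_ A I3 v))).
Proof. rewrite -!(L_lmul A A_rl A_bd). reflexivity. Qed.

Lemma underl_blin : blin (fun v : hmodC E => underl A v : hmodC E).
Proof.
apply (blin_ext (fun v : hmodC E => plus (lmul (unit_of I1) (L_ A I1 v))
  (plus (lmul (unit_of I2) (L_ A I2 v)) (lmul (unit_of I3) (L_ A I3 v))) : hmodC E)).
- intros v. symmetry. apply underl_eq.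
- assert (T : forall l, blin (fun v : hmodC E => lmul (unit_of l) (L_ A l v) : hmodC E)).
  { intros l. apply (blin_comp (fun v : hmodC E => lmul (unit_of l) v : hmodC E) (fun v : hmodC E => L_ A l v : hmodC E)); [apply blin_lmul|apply Lb]. }
  exact (blin_add _ _ (T I1) (blin_add _ _ (T I2) (T I3))).
Qed.

Lemma bar_blin : blin (fun v : hmodC E => bar A v : hmodC E).
Proof.
apply (blin_ext (fun v : hmodC E => minus (L_ A I0 v) (underl A v) : hmodC E)).
- intros v. symmetry. apply (bar_eq A A_rl A_bd).
- apply (blin_sub (fun v : hmodC E => L_ A I0 v : hmodC E) (fun v : hmodC E => underl A v : hmodC E)); [apply Lb|apply underl_blin].
Qed.

Lemma n0_blin : blin (n0 : hmodC E -> hmodC E).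
Proof. apply (blin_comp (A : hmodC E -> hmodC E) (fun v : hmodC E => bar A v : hmodC E)); [apply (A_blin A A_rl A_bd)|apply bar_blin]. Qed.

(** p^2 - 2 p A_0 + A Abar *)
Definition QA (p : quat) (v : hmod E) : hmod E := act (Qc (Defs.comp A) p) v.

Lemma QA_eq p v : QA p v = plus (minus (lmul (qmul p p) v) (scal 2 (lmul p (a0 v)))) (n0 v).
Proof.
unfold QA. change (act (Qc (Defs.comp A) p) v) with
  (plus (minus (lmul (qmul p p) v) (scal 2 (lmul p (L_ A I0 v)))) (act (quatop (Defs.comp A)) (bar A v))).
rewrite -(A_quatop A A_rl). reflexivity.
Qed.

Lemma QA_dom p v : dom (Qc (Defs.comp A) p) v.
Proof. split; intros l; [destruct l|]; intros k; exact I. Qed.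

Lemma Qcinv_r p v : rhoS (Defs.comp A) p -> QA p (Qcinv A p v) = v.
Proof. intros [H _]. apply (pinv_spec (Qc (Defs.comp A) p) v (H v)). Qed.

Lemma Qcinv_l p v : rhoS (Defs.comp A) p -> Qcinv A p (QA p v) = v.
Proof. intros [H _]. apply pinv_left; [apply QA_dom|apply H]. Qed.

Lemma Qcinv_blin p : rhoS (Defs.comp A) p -> blin (fun v : hmodC E => Qcinv A p v : hmodC E).
Proof.
intros [H [[_ [P R]] [M HM]]]. split; [|split].
- intros x y. apply (P x y (H x) (H y)).
- intros r x. rewrite -(rmul_ofR r x) -(rmul_ofR r (Qcinv A p x)). apply (R (ofR r) x (H x)).
- exists (Rabs M). split; [apply Rabs_pos|]. intros x. eapply Rle_trans; [apply HM|].
  apply Rmult_le_compat_r; [apply (nge0 (Y := hmodC E))|apply Rle_abs].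
Qed.

Let Am := lft W a0.
Let Nm := lft W n0.

Lemma embJ_lft J (L : hmod E -> hmod E) (y : prodCS W) : (forall x z, L (plus x z) = plus (L x) (L z)) ->
  (forall q x, lmul q (L x) = L (lmul q x)) -> embJ J (lft W L y) = L (embJ J y).
Proof. intros HP HL. unfold embJ, lft; cbn [fst snd]. rewrite HL -HP. reflexivity. Qed.

Lemma embJ_Qz J z (y : prodCS W) : imag_unit J -> embJ J (Qz Am Nm z y) = QA (qpt J z) (embJ J y).
Proof.
intros HJ. rewrite QA_eq. unfold Qz.
assert (EP : forall u v : prodCS W, embJ J (plus u v) = plus (embJ J u) (embJ J v)) by (intros; apply (blin_plus _ (embJ_blin J))).
assert (EM : forall u v : prodCS W, embJ J (minus u v) = minus (embJ J u) (embJ J v)) by (intros; apply (blin_minus _ (embJ_blin J))).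
rewrite (EP (minus (cmul (Cmult z z) y) (cmul (Cmult (RtoC 2) z) (Am y))) (Nm y)).
rewrite (EM (cmul (Cmult z z) y) (cmul (Cmult (RtoC 2) z) (Am y))).
rewrite !(embJ_cmul J _ _ HJ).
rewrite (embJ_lft J a0); [|apply L_plus|apply lmul_a0].
rewrite (embJ_lft J n0); [|apply (blin_plus _ n0_blin)|apply lmul_n0].
rewrite (qpt_mult J z z HJ) -(qpt_mult J (RtoC 2) z HJ) qpt_real -lmul_lmul lmul_ofR. reflexivity.
Qed.

Lemma unemb_minus J p m : imag_unit J -> embJ (opp J) (unemb J p m : prodCS W) = m.
Proof.
intros HJ. unfold embJ, unemb; cbn [fst snd]. rewrite lmul_opp_l lmul_scal (lmul_JJ J (minus m p) HJ).
rvec_coefs (hmod E); simpl; field.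
Qed.

Lemma unemb_embJ J (y : prodCS W) : imag_unit J -> unemb J (embJ J y) (embJ (opp J) y) = y.
Proof.
intros HJ. destruct y as [a b]. unfold embJ, unemb; cbn [fst snd]. rewrite !lmul_opp_l.
apply injective_projections; cbn [fst snd].
- set (w := lmul J b). rvec_coefs (hmod E); simpl; field.
- rewrite !lmul_minus !lmul_plus ?lmul_opp (lmul_JJ J b HJ). set (w := lmul J a). rvec_coefs (hmod E); simpl; field.
Qed.

(** The complexification is the sum of W with the structure J and W with the
    structure -J, so the pencil is invertible on it as soon as it is in both. *)
Lemma pencil_res_rho J z : imag_unit J -> rhoS (Defs.comp A) (qpt J z) -> rhoS (Defs.comp A) (qpt (opp J) z) ->
  pencil_res W a0 n0 z.
Proof.
intros HJ R1 R2. assert (HJ' := imag_opp J HJ).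
exists (fun y => unemb J (Qcinv A (qpt J z) (embJ J y)) (Qcinv A (qpt (opp J) z) (embJ (opp J) y))).
split; [|split].
- intros y. rewrite -(unemb_embJ J (Qz _ _ _ _) HJ).
  rewrite (embJ_Qz J z _ HJ) (embJ_Qz (opp J) z _ HJ') (unemb_plus J _ _ HJ) (unemb_minus J _ _ HJ).
  rewrite (Qcinv_r _ _ R1) (Qcinv_r _ _ R2). apply (unemb_embJ J y HJ).
- intros y. rewrite (embJ_Qz J z _ HJ) (embJ_Qz (opp J) z _ HJ') (Qcinv_l _ _ R1) (Qcinv_l _ _ R2).
  apply (unemb_embJ J y HJ).
- assert (B1 : blin (fun y : prodC W W => Qcinv A (qpt J z) (embJ J y) : W)).
  { apply (blin_comp (fun v : W => Qcinv A (qpt J z) v : W) (fun y : prodC W W => embJ J y : W)); [apply Qcinv_blin, R1|apply embJ_blin]. }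
  assert (B2 : blin (fun y : prodC W W => Qcinv A (qpt (opp J) z) (embJ (opp J) y) : W)).
  { apply (blin_comp (fun v : W => Qcinv A (qpt (opp J) z) v : W) (fun y : prodC W W => embJ (opp J) y : W)); [apply Qcinv_blin, R2|apply embJ_blin]. }
  assert (B3 := blin_comp (fun v : W => lmul J v : W) _ (blin_lmul J) (blin_sub _ _ B2 B1)).
  exact (proj2 (proj2 (blin_pair _ _ (blin_smul (/ 2) _ (blin_add _ _ B1 B2)) (blin_smul (/ 2) _ B3)))).
Qed.

(** Both sides solve the same equation, as [embJ] intertwines the two pencils. *)
Lemma Qcinv_embJ J z (y : prodCS W) : imag_unit J -> rhoS (Defs.comp A) (qpt J z) -> pencil_res W a0 n0 z ->
  Qcinv A (qpt J z) (embJ J y) = embJ J (Rs Am Nm z y).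
Proof.
intros HJ R1 Hz. rewrite -{1}(QR Am Nm z y Hz) (embJ_Qz J z _ HJ). apply Qcinv_l, R1.
Qed.
End Pencil.

(** * Contours in the planes C_J *)

Lemma qnorm (a : quat) : norm a = sqrt (qc I0 a ^ 2 + (qc I1 a ^ 2 + (qc I2 a ^ 2 + qc I3 a ^ 2))).
Proof.
destruct a as [a0 [a1 [a2 a3]]]. unfold qc; cbn [coord fst snd].
change (sqrt (Rabs a0 ^ 2 + sqrt (Rabs a1 ^ 2 + sqrt (Rabs a2 ^ 2 + Rabs a3 ^ 2) ^ 2) ^ 2) =
  sqrt (a0 ^ 2 + (a1 ^ 2 + (a2 ^ 2 + a3 ^ 2)))).
rewrite !pow2_abs. assert (P2 := pow2_ge_0 a2). assert (P3 := pow2_ge_0 a3). assert (P1 := pow2_ge_0 a1).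
rewrite (pow2_sqrt (a2 ^ 2 + a3 ^ 2)); [|lra]. rewrite pow2_sqrt; [|lra]. reflexivity.
Qed.

Lemma norm_qpt J (z : C) : imag_unit J -> norm (qpt J z) = Cmod z.
Proof.
destruct J as [j0 [j1 [j2 j3]]], z as [x y]. intros [H0 H1].
change (j0 = 0) in H0. change (j1 ^ 2 + j2 ^ 2 + j3 ^ 2 = 1) in H1. subst j0.
rewrite qnorm. unfold Cmod. f_equal.
change ((x + y * 0) ^ 2 + ((0 + y * j1) ^ 2 + ((0 + y * j2) ^ 2 + (0 + y * j3) ^ 2)) = x ^ 2 + y ^ 2).
replace (y ^ 2) with (y ^ 2 * 1) by ring. rewrite -H1. ring.
Qed.

Lemma qpt_minus J (z w : C) : minus (qpt J z) (qpt J w) = qpt J (Cminus z w).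
Proof.
destruct J as [j0 [j1 [j2 j3]]], z as [x y], w as [u v].
apply (mkh_eq (E := R_NormedModule)); unfold minus; rgoal; ring.
Qed.

Lemma ball_qpt J (z w : C) (e : R) : imag_unit J -> Cmod (Cminus w z) < e -> ball (qpt J z) e (qpt J w).
Proof.
intros HJ H. apply (norm_compat1 (V := quat)).
assert (E : minus (qpt J w) (qpt J z) = qpt J (Cminus w z)) by apply qpt_minus.
apply Rle_lt_trans with (norm (qpt J (Cminus w z))); [right; apply f_equal, E|].
rewrite (norm_qpt J _ HJ). exact H.
Qed.

Lemma ball_plane (z w : R * R) (e : R) : ball z e w -> Cmod (Cminus w z) < 2 * e.
Proof.
intros [H1 H2]. change (Rabs (fst w - fst z) < e) in H1. change (Rabs (snd w - snd z) < e) in H2.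
eapply Rle_lt_trans; [apply Cmod_le_sum|]. simpl. unfold Rminus in *. lra.
Qed.

Lemma cl_clo (D : R * R -> Prop) z : cl D z -> clo D z.
Proof.
intros H e He. assert (He2 : 0 < e / 2) by lra. destruct (H (mkposreal _ He2)) as [w [Hw Dw]].
exists w. split; [|exact Dw]. assert (T := ball_plane z w _ Hw). simpl in T. lra.
Qed.

(** A slice function is a finite sum of products of an intrinsic function s with a
    constant q, on the right of s for left slice functions and on the left for
    right ones. *)
Record sterm := mksterm { r_fun : R * R -> R * R; r_coef : quat }.

Definition left_rep (phi : hfun) (Om : R * R -> Prop) (rs : list sterm) : Prop :=
  forall J z, imag_unit J -> Om z ->
  hval phi (qpt J z) = fold_right plus zero (map (fun r => qmul (qpt J (r_fun r z)) (r_coef r)) rs).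
Definition right_rep (phi : hfun) (Om : R * R -> Prop) (rs : list sterm) : Prop :=
  forall J z, imag_unit J -> Om z ->
  hval phi (qpt J z) = fold_right plus zero (map (fun r => qmul (r_coef r) (qpt J (r_fun r z))) rs).

Section Contour.
Context {E : CompleteNormedModule R_AbsRing} (A : hmod E -> hmod E).
Hypothesis A_rl : right_linear (tot A).
Hypothesis A_bd : exists M : R, forall v, norm (A v) <= M * norm v.
Hypothesis A_comm : commuting_components A.
Let W := hmodC E.
Let a0 := L_ A I0.
Let n0 := nrm A.

(** All data of an admissible contour that are used below, read in the plane R * R.
    The symmetry of the domain comes from its axial symmetry, as J and -J span the
    same plane. *)
Lemma admissible_encloses phi (K : contour) : admissible A phi K ->
  let D := trace (cV K) (cJ K) in
  encloses W a0 n0 (cG K) D /\ imag_unit (cJ K) /\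
  (forall z, ~ D z -> rhoS (Defs.comp A) (qpt (cJ K) z)) /\
  (forall z, clo D z -> hdom phi (qpt (cJ K) z)).
Proof.
intros [[[Vop Vax] _] [[M HM] [Hsp [Hcl [HJ [[J1 [_ Bd]] [W1 W0]]]]]]] D. set (J := cJ K) in *.
assert (Dop : copen D).
{ intros z Dz. destruct (Vop (qpt J z) Dz) as [e He]. exists e. split; [apply cond_pos|].
  intros w Hw. apply He. apply ball_qpt; assumption. }
assert (Drho : forall J', imag_unit J' -> forall z, ~ D z -> rhoS (Defs.comp A) (qpt J' z)).
{ intros J' HJ' z Nz. apply NNPP. intros N. apply Nz. apply (Vax (fst z) (snd z) J' J HJ' HJ).
  apply Hsp. exact N. }
split; [|split; [exact HJ|split; [apply (Drho J HJ)|]]].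
- split; [|split].
  + split; [|split; [|split; [exact Dop|split; [exact W1|]]]].
    * intros g Hg. destruct (proj1 (List.Forall_forall _ _) J1 g Hg) as [P [Q _]].
      split; [exact P|]. split; [exact Q|]. intros t Ht.
      destruct (proj2 (Bd (g t))) as [B1 B2]; [exists g, t; auto|].
      split; [apply cl_clo, B1|]. intros Dg. destruct (Dop _ Dg) as [e [He1 He2]].
      destruct (cl_clo _ _ B2 e He1) as [w [Hw Nw]]. apply Nw, He2, Hw.
    * exists M. intros z Dz. rewrite -(norm_qpt J z HJ). apply HM, Dz.
    * intros w Nw. apply W0. intros C. apply Nw, cl_clo, C.
  + intros z Nz. apply (pencil_res_rho A A_rl A_bd A_comm J z HJ); apply Drho; try assumption. apply imag_opp, HJ.
  + intros z Dz. change (cV K (qpt J (Cconj z))). rewrite -qpt_opp.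
    apply (Vax (fst z) (snd z) J (opp J) HJ (imag_opp J HJ)). exact Dz.
- intros z Cz. apply Hcl. intros e. destruct (Cz e (cond_pos e)) as [w [Hw Dw]].
  exists (qpt J w). split; [apply ball_qpt; assumption|exact Dw].
Qed.

Lemma hRInt_RInt (F : R -> hmod E) a b : ex_RInt (V := hmodC E) F a b -> hRInt F a b = RInt (V := hmodC E) F a b.
Proof.
intros H. unfold hRInt.
rewrite (RInt_lin (fun v : hmodC E => coord I0 v) (blin_coord I0) F a b H).
rewrite (RInt_lin (fun v : hmodC E => coord I1 v) (blin_coord I1) F a b H).
rewrite (RInt_lin (fun v : hmodC E => coord I2 v) (blin_coord I2) F a b H).
rewrite (RInt_lin (fun v : hmodC E => coord I3 v) (blin_coord I3) F a b H).
symmetry. apply h_eta.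
Qed.

Definition lsum (l : list (hmod E)) : hmod E := fold_right plus zero l.

(** The integrand M (u(z) dz). *)
Record term := mkterm { t_map : prodCS W -> hmod E; t_fun : R * R -> prodCS W }.

Lemma cint_terms (K : contour) (Gam : R * R -> Prop) (ts : list term) (F : quat -> quat -> hmod E) :
  on_cycle (cG K) Gam ->
  (forall mu, In mu ts -> blin (t_map mu : prodCS W -> hmodC E) /\ contK Gam (t_fun mu)) ->
  (forall (z c : R * R), Gam z -> F (qpt (cJ K) z) (qmul (qpt (cJ K) c) (opp (cJ K))) =
     lsum (map (fun mu : term => t_map mu (cmul (c : C) (t_fun mu z))) ts)) ->
  cint K F = lsum (map (fun mu : term => t_map mu (cyc (cG K) (t_fun mu))) ts).
Proof.
intros HG Hts HF. unfold cint. induction (cG K) as [|g G IH].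
- simpl. clear HF. induction ts as [|mu ts IH]; [reflexivity|]. simpl. unfold lsum in *. simpl.
  rewrite -IH; [|intros mu' Hmu'; apply Hts; right; exact Hmu'].
  assert (T := blin_zero _ (proj1 (Hts mu (or_introl eq_refl)))). unfold cyc; simpl.
  symmetry. rewrite (plus_zero_r (G := hmod E)). exact T.
- destruct (on_cycle_cons g G Gam HG) as [Hg [Kg HG']]. simpl. rewrite (IH HG').
  assert (Ig : is_RInt (V := hmodC E) (fun t => F (slice_pt (cJ K) (fst (g t)) (snd (g t)))
      (qmul (slice_pt (cJ K) (dx g t) (dy g t)) (opp (cJ K)))) 0 1
      (lsum (map (fun mu : term => t_map mu (gint g (t_fun mu))) ts))).
  { apply (is_RInt_ext (V := hmodC E) (fun t => lsum (map (fun mu : term => t_map mu (cmul (cvel g t) (t_fun mu (g t)))) ts))).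
    - rewrite Rmin_left; [|lra]. rewrite Rmax_right; [|lra]. intros t Ht. symmetry.
      apply (HF (g t) (cvel g t)). apply Kg. lra.
    - clear HF IH. induction ts as [|mu ts IH].
      + simpl. assert (T := is_RInt_const (V := hmodC E) 0 1 zero). rewrite (scal_zero_r (V := hmodC E)) in T. exact T.
      + simpl. apply (is_RInt_plus (V := hmodC E) (fun t => t_map mu (cmul (cvel g t) (t_fun mu (g t))))).
        * destruct (Hts mu (or_introl eq_refl)) as [B Cu].
          apply (is_RInt_lin (t_map mu : prodCS W -> hmodC E) B), (RInt_correct (V := prodCS W)).
          destruct (curve_integrable (Y := prodCS W) g Hg) as [C [_ Q]]. apply Q.
          intros t Ht. apply Cu, Kg, Ht.
        * apply IH. intros mu' Hmu'. apply Hts. right. exact Hmu'. }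
  rewrite hRInt_RInt; [|eexists; exact Ig].
  rewrite (is_RInt_unique (V := hmodC E) _ _ _ _ Ig).
  clear HF IH Ig. induction ts as [|mu ts IH]; [apply (plus_zero_l (G := hmod E))|].
  simpl. unfold lsum in *. simpl.
  rewrite cyc_cons (blin_plus _ (proj1 (Hts mu (or_introl eq_refl)))).
  rewrite -IH; [|intros mu' Hmu'; apply Hts; right; exact Hmu'].
  apply (rplus4 (E := hmod E)).
Qed.

Variables (phi : hfun) (K : contour) (Om : R * R -> Prop).
Hypotheses (HK : admissible A phi K) (HO : copen Om)
  (HDO : forall z, clo (trace (cV K) (cJ K)) z -> Om z).
Let J := cJ K.
Let G := cG K.
Let Gam (z : R * R) : Prop := clo (trace (cV K) J) z /\ ~ trace (cV K) J z.
Let Am := lft W a0.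
Let Nm := lft W n0.
Let Ha : blin (a0 : hmodC E -> hmodC E) := L_blin A A_rl A_bd I0.
Let Hn : blin (n0 : hmodC E -> hmodC E) := n0_blin A A_rl A_bd.
Let bet := beta W a0 n0 G.

Lemma contour_imag : imag_unit J.
Proof. apply (admissible_encloses phi K HK). Qed.

Lemma contour_encloses : encloses W a0 n0 G (trace (cV K) J).
Proof. apply (admissible_encloses phi K HK). Qed.

Lemma Gam_rho z : Gam z -> pencil_res W a0 n0 z.
Proof. intros [_ N]. apply contour_encloses, N. Qed.

Lemma Gam_cycle : on_cycle G Gam.
Proof. intros g Hg. destruct (proj1 (proj1 contour_encloses) g Hg) as [P [_ Q]]. split; [exact P|exact Q]. Qed.

(** The integrand B (s(z) R(z) w) dz_J, with R(z) the inverse of the pencil. *)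
Record bterm := mkbterm { b_map : hmod E -> hmod E; b_fun : R * R -> R * R; b_vec : hmod E }.

Definition bterm_at (z c : R * R) (b : bterm) : hmod E :=
  b_map b (embJ J (cmul (Cmult (Copp Ci) c) (cmul (b_fun b z : C) (Rs Am Nm z (inj W (b_vec b)))))).

Lemma bterm_blin (B : hmod E -> hmod E) : blin (B : hmodC E -> hmodC E) ->
  blin ((fun y : prodCS W => B (embJ J (cmul (Copp Ci) y))) : prodCS W -> hmodC E).
Proof.
intros Bb.
apply (blin_comp (B : hmodC E -> hmodC E) (fun y : prodCS W => embJ J (cmul (Copp Ci) y) : hmodC E)); [exact Bb|].
apply (blin_comp (fun y : prodCS W => embJ J y : hmodC E) (fun y : prodCS W => cmul (Copp Ci) y)); [apply embJ_blin|].
apply clin_blin, clin_cmul_l.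
Qed.

Lemma bterm_cont (s : R * R -> R * R) w : symholo Om s ->
  contK Gam (fun z => cmul (s z : C) (Rs Am Nm z (inj W w))).
Proof.
intros Sb z Hz. apply cont_cmul; [apply cont_cC, Sb, HDO, (proj1 Hz)|].
exact (proj1 (holo_Rz Am Nm (clin_lft W a0 Ha) (clin_lft W n0 Hn) (inj W w)) z (Gam_rho z Hz)).
Qed.

Lemma bterm_cyc (B : hmod E -> hmod E) (s : R * R -> R * R) w : blin (B : hmodC E -> hmodC E) -> symholo Om s ->
  B (embJ J (cmul (Copp Ci) (cyc G (fun z => cmul (s z : C) (Rs Am Nm z (inj W w)))))) = scal (2 * PI) (B (bet s w)).
Proof.
intros Bb Sb.
assert (T := Phi_beta W a0 n0 Ha Hn G (trace (cV K) J) Om contour_encloses HO HDO s w Sb).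
change (cyc G (fun z => cmul (s z : C) (Rs Am Nm z (inj W w))) = cmul c2pi (inj W (bet s w))) in T.
rewrite T cmul_cmul.
assert (E0 : Cmult (Copp Ci) c2pi = RtoC (2 * PI)) by (apply injective_projections; unfold c2pi; simpl; ring).
rewrite E0 (embJ_cmul J _ _ contour_imag) qpt_real lmul_ofR embJ_inj. exact (blin_scal (B : hmodC E -> hmodC E) Bb (2 * PI) (bet s w)).
Qed.

Lemma bterm_at_eq z c (b : bterm) :
  b_map b (embJ J (cmul (Copp Ci) (cmul (c : C) (cmul (b_fun b z : C) (Rs Am Nm z (inj W (b_vec b))))))) = bterm_at z c b.
Proof. unfold bterm_at. rewrite (cmul_cmul (Copp Ci) (c : C)). reflexivity. Qed.

Definition bterm_term (b : bterm) : term := mkterm (fun y : prodCS W => b_map b (embJ J (cmul (Copp Ci) y)))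
   (fun z => cmul (b_fun b z : C) (Rs Am Nm z (inj W (b_vec b)))).

Lemma cint_beta_terms (bs : list bterm) (F : quat -> quat -> hmod E) :
  (forall b, In b bs -> blin (b_map b : hmodC E -> hmodC E) /\ symholo Om (b_fun b)) ->
  (forall z c, Gam z -> F (qpt J z) (qmul (qpt J c) (opp J)) = lsum (map (bterm_at z c) bs)) ->
  cint K F = lsum (map (fun mu : term => t_map mu (cyc (cG K) (t_fun mu))) (map bterm_term bs)).
Proof.
intros Hbs HF. apply (cint_terms K Gam _ F Gam_cycle).
- intros mu Hmu. apply in_map_iff in Hmu. destruct Hmu as [b [<- Hb]].
  destruct (Hbs b Hb) as [Bb Sb]. split; [exact (bterm_blin _ Bb)|exact (bterm_cont _ (b_vec b) Sb)].
- intros z c Hz. rewrite map_map. transitivity (lsum (map (bterm_at z c) bs)); [exact (HF z c Hz)|].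
  apply (f_equal lsum), map_ext. intros b. symmetry. exact (bterm_at_eq z c b).
Qed.

(** All four calculi have integrands of this form. The factor -i of dz_J = dz (-J)
    turns the 2 pi i of [Phi_beta] into 2 pi. *)
Lemma cint_beta (bs : list bterm) (F : quat -> quat -> hmod E) :
  (forall b, In b bs -> blin (b_map b : hmodC E -> hmodC E) /\ symholo Om (b_fun b)) ->
  (forall z c, Gam z -> F (qpt J z) (qmul (qpt J c) (opp J)) = lsum (map (bterm_at z c) bs)) ->
  cint K F = scal (2 * PI) (lsum (map (fun b : bterm => b_map b (bet (b_fun b) (b_vec b))) bs)).
Proof.
intros Hbs HF. rewrite (cint_beta_terms bs F Hbs HF). rewrite map_map. clear HF. induction bs as [|b bs IH].
- symmetry. exact (scal_zero_r (V := hmodC E) (2 * PI)).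
- destruct (Hbs b (or_introl eq_refl)) as [Bb Sb]. unfold lsum in *. cbn [map fold_right] in *.
  rewrite IH; [|intros b' Hb'; apply Hbs; right; exact Hb'].
  assert (T := bterm_cyc _ _ (b_vec b) Bb Sb).
  apply (eq_trans (f_equal (fun x => plus x _) T)).
  symmetry. exact (scal_distr_l (V := hmodC E) (2 * PI) _ _).
Qed.

Variable rs : list sterm.
Hypothesis Hrs : forall r, In r rs -> symholo Om (r_fun r).

Lemma lmul_fold (f : sterm -> quat) (ls : list sterm) (v : hmod E) :
  lmul (fold_right plus zero (map f ls)) v = lsum (map (fun r => lmul (f r) v) ls).
Proof.
induction ls as [|l ls IH].
- change (lmul (zero : quat) v = zero). assert (Z : (zero : quat) = ofR 0) by reflexivity.
  rewrite Z lmul_ofR. apply (scal_zero_l (V := hmodC E)).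
- cbn [map fold_right]. rewrite lmul_plus_l IH. reflexivity.
Qed.

Lemma lsum_lin (B : hmod E -> hmod E) (f : sterm -> hmod E) (ls : list sterm) : blin (B : hmodC E -> hmodC E) ->
  B (lsum (map f ls)) = lsum (map (fun r => B (f r)) ls).
Proof.
intros HB. induction ls as [|l ls IH]; [apply (blin_zero _ HB)|].
cbn [map]. unfold lsum in *. cbn [fold_right]. rewrite (blin_plus _ HB) IH. reflexivity.
Qed.

Lemma opp_blin : blin (fun x : hmodC E => opp x : hmodC E).
Proof. exact (blin_neg (U := hmodC E) (V := hmodC E) (fun x => x) (blin_id (hmodC E))). Qed.

Let dpJ (c : R * R) : quat := qmul (qpt J c) (opp J).

Lemma lmul_dpJ c (v : hmod E) : lmul (dpJ c) v = lmul (qpt J (Cmult (Copp Ci) c)) v.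
Proof. unfold dpJ. rewrite opp_qpt (qpt_mult J c (Copp Ci) contour_imag) (Cmult_comm c). reflexivity. Qed.

Lemma embJ_2 a b d e (y : prodCS W) : Cmult a b = Cmult d e ->
  lmul (qpt J a) (lmul (qpt J b) (embJ J y)) = embJ J (cmul d (cmul e y)).
Proof. intros H. rewrite -!(embJ_cmul J _ _ contour_imag) !cmul_cmul H. reflexivity. Qed.

Lemma embJ_3 a b c d e (y : prodCS W) : Cmult (Cmult a b) c = Cmult d e ->
  lmul (qpt J a) (lmul (qpt J b) (lmul (qpt J c) (embJ J y))) = embJ J (cmul d (cmul e y)).
Proof. intros H. rewrite -!(embJ_cmul J _ _ contour_imag) !cmul_cmul H. reflexivity. Qed.

Lemma Qcinv_inj z v : Gam z -> Qcinv A (qpt J z) v = embJ J (Rs Am Nm z (inj W v)).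
Proof.
intros Hz. rewrite -{1}(embJ_inj J v). apply (Qcinv_embJ A A_rl A_bd A_comm J z _ contour_imag); [|apply Gam_rho, Hz].
apply (admissible_encloses phi K HK). apply Hz.
Qed.

Lemma Qcinv_qpt z c v : Gam z -> Qcinv A (qpt J z) (lmul (qpt J c) v) = lmul (qpt J c) (Qcinv A (qpt J z) v).
Proof.
intros Hz. rewrite (Qcinv_inj z v Hz) -{1}(embJ_inj J v) -!(embJ_cmul J _ _ contour_imag).
rewrite (Qcinv_embJ A A_rl A_bd A_comm J z _ contour_imag); [|apply (admissible_encloses phi K HK); apply Hz|apply Gam_rho, Hz].
do 1 f_equal. apply clin_cmul, (Rs_clin Am Nm (clin_lft W a0 Ha) (clin_lft W n0 Hn)), Gam_rho, Hz.
Qed.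

Lemma Qb z : Gam z -> blin (fun v : hmodC E => Qcinv A (qpt J z) v : hmodC E).
Proof. intros Hz. apply Qcinv_blin. apply (admissible_encloses phi K HK). apply Hz. Qed.

Lemma harm_L_beta v : left_rep phi Om rs ->
  harm_L K A phi v = scal (-2) (lsum (map (fun r => bet (r_fun r) (lmul (r_coef r) v)) rs)).
Proof.
intros Hrep. unfold harm_L.
rewrite (cint_beta (map (fun r => mkbterm (fun x => x) (r_fun r) (lmul (r_coef r) v)) rs)).
- rewrite map_map. cbn [b_map b_fun b_vec]. assert (P := PI_RGT_0).
  rewrite (scal_assoc (V := hmodC E)). f_equal. change (- / PI * (2 * PI) = -2). field. lra.
- intros b Hb. apply in_map_iff in Hb. destruct Hb as [r [<- Hr]]. split; [apply blin_id|apply Hrs, Hr].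
- intros z c Hz. change (qmul (qpt J c) (opp J)) with (dpJ c).
  rewrite (Hrep J z contour_imag (HDO z (proj1 Hz))) lmul_fold.
  rewrite (lsum_lin (lmul (dpJ c))); [|apply blin_lmul]. rewrite (lsum_lin _ _ _ (Qb z Hz)).
  rewrite map_map. f_equal. apply map_ext. intros r. unfold bterm_at. cbn [b_map b_fun b_vec].
  rewrite lmul_dpJ -lmul_lmul !(Qcinv_qpt z _ _ Hz) (Qcinv_inj z _ Hz). apply embJ_2. reflexivity.
Qed.

Lemma harm_R_beta v : right_rep phi Om rs ->
  harm_R K A phi v = scal (-2) (lsum (map (fun r => lmul (r_coef r) (bet (r_fun r) v)) rs)).
Proof.
intros Hrep. unfold harm_R.
rewrite (cint_beta (map (fun r => mkbterm (fun x => lmul (r_coef r) x) (r_fun r) v) rs)).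
- rewrite map_map. cbn [b_map b_fun b_vec]. assert (P := PI_RGT_0).
  rewrite (scal_assoc (V := hmodC E)). f_equal. change (- / PI * (2 * PI) = -2). field. lra.
- intros b Hb. apply in_map_iff in Hb. destruct Hb as [r [<- Hr]]. split; [apply blin_lmul|apply Hrs, Hr].
- intros z c Hz. change (qmul (qpt J c) (opp J)) with (dpJ c).
  rewrite (Hrep J z contour_imag (HDO z (proj1 Hz))) lmul_fold.
  rewrite map_map. f_equal. apply map_ext. intros r. unfold bterm_at. cbn [b_map b_fun b_vec].
  rewrite lmul_dpJ -lmul_lmul (Qcinv_inj z _ Hz). apply (f_equal (lmul (r_coef r))), embJ_2. apply Cmult_comm.
Qed.

Lemma lsum_app (xs ys : list (hmod E)) : lsum (xs ++ ys) = plus (lsum xs) (lsum ys).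
Proof.
induction xs as [|x xs IH]; [symmetry; apply (plus_zero_l (G := hmodC E))|].
simpl. unfold lsum in *. simpl. rewrite IH. apply (plus_assoc (G := hmodC E)).
Qed.

Let zs (r : sterm) (z : R * R) : R * R := Cmult z (r_fun r z).

Lemma zs_symholo r : In r rs -> symholo Om (zs r).
Proof. intros Hr. apply symholo_mult; [apply symholo_id|apply Hrs, Hr]. Qed.

Lemma two_pi_cancel (v : hmod E) : scal (/ (2 * PI)) (scal (2 * PI) v) = v.
Proof.
rewrite (scal_assoc (V := hmodC E)). assert (P := PI_RGT_0).
assert (E0 : mult (/ (2 * PI)) (2 * PI) = one) by (change (/ (2 * PI) * (2 * PI) = 1); field; lra).
rewrite E0. apply (scal_one (V := hmodC E)).
Qed.

Lemma S_L_beta v : left_rep phi Om rs ->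
  S_L K A phi v = minus (lsum (map (fun r => bet (zs r) (lmul (r_coef r) v)) rs))
                        (bar A (lsum (map (fun r => bet (r_fun r) (lmul (r_coef r) v)) rs))).
Proof.
intros Hrep. unfold S_L.
rewrite (cint_beta (map (fun r => mkbterm (fun x => x) (zs r) (lmul (r_coef r) v)) rs ++
                    map (fun r => mkbterm (fun x => opp (bar A x)) (r_fun r) (lmul (r_coef r) v)) rs)).
- rewrite two_pi_cancel map_app !map_map lsum_app. cbn [b_map b_fun b_vec]. unfold minus. f_equal.
  rewrite (lsum_lin (fun x => bar A x)); [|apply bar_blin; assumption].
  rewrite (lsum_lin (fun x => opp x)); [reflexivity|]. apply opp_blin.
- intros b Hb. apply in_app_iff in Hb. destruct Hb as [Hb|Hb]; apply in_map_iff in Hb; destruct Hb as [r [<- Hr]]; split.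
  + apply blin_id.
  + apply zs_symholo, Hr.
  + apply (blin_neg (fun x : hmodC E => bar A x : hmodC E)), bar_blin; assumption.
  + apply Hrs, Hr.
- intros z c Hz. change (qmul (qpt J c) (opp J)) with (dpJ c).
  assert (T : Qcinv A (qpt J z) (lmul (dpJ c) (lmul (hval phi (qpt J z)) v)) =
    lsum (map (fun r => lmul (qpt J (Cmult (Copp Ci) c)) (lmul (qpt J (r_fun r z)) (embJ J (Rs Am Nm z (inj W (lmul (r_coef r) v)))))) rs)).
  { rewrite (Hrep J z contour_imag (HDO z (proj1 Hz))) lmul_fold.
    rewrite (lsum_lin (lmul (dpJ c))); [|apply blin_lmul]. rewrite (lsum_lin _ _ _ (Qb z Hz)).
    f_equal. apply map_ext. intros r.
    rewrite lmul_dpJ -lmul_lmul !(Qcinv_qpt z _ _ Hz) (Qcinv_inj z _ Hz). reflexivity. }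
  unfold SLinv. rewrite T map_app !map_map lsum_app. unfold minus. f_equal.
  + rewrite (lsum_lin (lmul (qpt J z))); [|apply blin_lmul]. f_equal. apply map_ext. intros r.
    unfold bterm_at, zs. cbn [b_map b_fun b_vec]. apply embJ_3. cring.
  + rewrite (lsum_lin (fun x => bar A x)); [|apply bar_blin; assumption].
    rewrite (lsum_lin (fun x => opp x)); [|apply opp_blin]. f_equal. apply map_ext. intros r.
    unfold bterm_at. cbn [b_map b_fun b_vec]. apply f_equal, (f_equal (bar A)), embJ_2. reflexivity.
Qed.

Lemma S_R_beta v : right_rep phi Om rs ->
  S_R K A phi v = lsum (map (fun r => lmul (r_coef r) (minus (bet (zs r) v) (bet (r_fun r) (bar A v)))) rs).
Proof.
intros Hrep. unfold S_R.
rewrite (cint_beta (map (fun r => mkbterm (fun x => lmul (r_coef r) x) (zs r) v) rs ++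
                    map (fun r => mkbterm (fun x => opp (lmul (r_coef r) x)) (r_fun r) (bar A v)) rs)).
- rewrite two_pi_cancel map_app !map_map lsum_app. cbn [b_map b_fun b_vec].
  clear Hrs Hrep. induction rs as [|r rs' IH]; [apply (plus_zero_l (G := hmodC E))|].
  unfold lsum in *. cbn [map fold_right]. rewrite -IH lmul_minus. unfold minus. rewrite rplus4. reflexivity.
- intros b Hb. apply in_app_iff in Hb. destruct Hb as [Hb|Hb]; apply in_map_iff in Hb; destruct Hb as [r [<- Hr]]; split.
  + apply blin_lmul.
  + apply zs_symholo, Hr.
  + apply (blin_neg (fun x : hmodC E => lmul (r_coef r) x : hmodC E)), blin_lmul.
  + apply Hrs, Hr.
- intros z c Hz. change (qmul (qpt J c) (opp J)) with (dpJ c).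
  unfold SRinv. assert (QM := blin_minus _ (Qb z Hz) (lmul (qpt J z) v) (bar A v)). cbn beta in QM. rewrite QM. clear QM.
  rewrite (Qcinv_qpt z z v Hz) !(Qcinv_inj z _ Hz) map_app !map_map lsum_app !lmul_minus. unfold minus. f_equal.
  + rewrite (Hrep J z contour_imag (HDO z (proj1 Hz))) lmul_fold. f_equal. apply map_ext. intros r.
    unfold bterm_at, zs. cbn [b_map b_fun b_vec]. rewrite lmul_dpJ -lmul_lmul. apply (f_equal (lmul (r_coef r))).
    rewrite -(embJ_cmul J z _ contour_imag). transitivity (lmul (qpt J (r_fun r z)) (lmul (qpt J (Cmult (Copp Ci) c)) (lmul (qpt J z) (embJ J (Rs Am Nm z (inj W v)))))).
    { rewrite (embJ_cmul J z _ contour_imag). reflexivity. }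
    apply embJ_3. cring.
  + rewrite (Hrep J z contour_imag (HDO z (proj1 Hz))) lmul_fold.
    rewrite (lsum_lin (fun x => opp x)); [|apply opp_blin]. f_equal. apply map_ext. intros r.
    unfold bterm_at. cbn [b_map b_fun b_vec]. rewrite lmul_dpJ -lmul_lmul. apply f_equal, (f_equal (lmul (r_coef r))), embJ_2. cring.
Qed.
End Contour.

(** * Complex differentiability of stem functions *)

Lemma cdiff_lim {Y : cspace} (h : R * R -> Y) (z : R * R) (m : Y) :
  (forall eps, 0 < eps -> exists d, 0 < d /\ forall w, Cmod (Cminus w z) < d ->
     norm (minus (minus (h w) (h z)) (cmul (Cminus w z) m)) <= eps * Cmod (Cminus w z)) -> cdiff h z.
Proof.
intros H.
exists (fun w => if excluded_middle_informative (w = z) then m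
                 else cmul (Cinv (Cminus w z)) (minus (h w) (h z))).
split.
- intros eps He. destruct (H (eps / 4)) as [d [Hd Hb]]; [lra|]. exists d. split; [exact Hd|]. intros w Hw. cbn beta.
  destruct (excluded_middle_informative (z = z)) as [_|N]; [|contradiction].
  destruct (excluded_middle_informative (@eq (R * R) w z)) as [_|Nw]; [rewrite nminus_diag; lra|].
  assert (Nm := Cminus_neq w z Nw). assert (P := proj1 (Cmod_gt_0 _) Nm).
  assert (E : minus (cmul (Cinv (Cminus w z)) (minus (h w) (h z))) m =
    cmul (Cinv (Cminus w z)) (minus (minus (h w) (h z)) (cmul (Cminus w z) m))).
  { set (k := Cminus w z) in *. vec_coefs Y; apply injective_projections; simpl; try ring.
    - assert (T := Cinv_l k Nm). apply (f_equal fst) in T. simpl in T. lra.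
    - assert (T := Cinv_l k Nm). apply (f_equal snd) in T. simpl in T. lra. }
  rewrite E. eapply Rle_lt_trans; [apply norm_cmul|]. rewrite (Cmod_inv _ Nm).
  assert (T := Hb w Hw).
  apply Rle_lt_trans with (2 * / Cmod (Cminus w z) * (eps / 4 * Cmod (Cminus w z))).
  + apply Rmult_le_compat_l; [|exact T]. assert (T2 := Rinv_0_lt_compat _ P). lra.
  + replace (2 * / Cmod (Cminus w z) * (eps / 4 * Cmod (Cminus w z))) with (eps / 2) by (field; lra). lra.
- intros w. destruct (excluded_middle_informative (w = z)) as [->|Nw].
  + rewrite (minus_eq_zero (G := Y)). assert (E0 : Cminus z z = RtoC 0) by cring. rewrite E0 cmul_RtoC.
    symmetry. apply (scal_zero_l (V := Y)).
  + rewrite cmul_cmul (Cinv_r _ (Cminus_neq w z Nw)) cmul_one. reflexivity.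
Qed.

Lemma cdiff_comp {Y : cspace} (h : R * R -> Y) (s : R * R -> R * R) (z : R * R) :
  ccdiff s z -> cdiff h (s z) -> cdiff (fun w => h (s w)) z.
Proof.
intros [p [Hp Ep]] [q [Hq Eq]].
assert (Cs : forall eps, 0 < eps -> exists d, 0 < d /\ forall w, Cmod (Cminus w z) < d -> Cmod (Cminus (s w) (s z)) < eps).
{ intros eps He. destruct (Hp 1) as [d [Hd Hb]]; [lra|]. set (M := Cmod (p z) + 1).
  assert (HM : 0 < M) by (unfold M; assert (T := Cmod_ge_0 (p z)); lra).
  exists (Rmin d (eps / M)). split; [apply Rmin_pos; [exact Hd|apply Rdiv_lt_0_compat; assumption]|].
  intros w Hw. rewrite Ep Cmod_mult.
  assert (T1 := Hb w (Rlt_le_trans _ _ _ Hw (Rmin_l _ _))). assert (T2 := Rlt_le_trans _ _ _ Hw (Rmin_r _ _)).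
  assert (T3 := Cmod_tri_sub (p w) (p z)).
  apply Rle_lt_trans with (Cmod (Cminus w z) * M).
  - apply Rmult_le_compat_l; [apply Cmod_ge_0|]. unfold M. lra.
  - replace eps with (eps / M * M) by (field; lra). apply Rmult_lt_compat_r; assumption. }
exists (fun w => cmul (p w) (q (s w))). split.
- apply cont_cmul; [exact Hp|]. intros eps He. destruct (Hq eps He) as [d [Hd Hb]].
  destruct (Cs d Hd) as [d' [Hd' Hb']]. exists d'. split; [exact Hd'|]. intros w Hw. apply Hb, Hb', Hw.
- intros w. rewrite Eq Ep cmul_cmul. reflexivity.
Qed.

(** The Cauchy-Riemann equations: the differential is multiplication by a - i b. *)
Lemma cr_cdiff (f g : R -> R -> R) (x y a b : R) : differentiable_pt_lim f x y a b ->
  differentiable_pt_lim g x y (- b) a ->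
  cdiff (Y := cC) (fun z => (f (fst z) (snd z), g (fst z) (snd z))) (x, y).
Proof.
intros Hf Hg. apply (cdiff_lim (Y := cC) _ _ (a, - b)).
intros eps He. assert (He2 : 0 < eps / 2) by lra.
destruct (Hf (mkposreal _ He2)) as [d1 H1]. destruct (Hg (mkposreal _ He2)) as [d2 H2].
exists (Rmin d1 d2). split; [apply Rmin_pos; apply cond_pos|]. intros [u v] Hw.
change (Cmod (Cminus (u, v) (x, y))) with (Cmod (u - x, v - y)) in *.
assert (B1 := Cmod_bound_Re (u - x) (v - y)). assert (B2 := Cmod_bound_Im (u - x) (v - y)).
assert (L1 := Rlt_le_trans _ _ _ Hw (Rmin_l _ _)). assert (L2 := Rlt_le_trans _ _ _ Hw (Rmin_r _ _)).
assert (T1 := H1 u v ltac:(lra) ltac:(lra)). assert (T2 := H2 u v ltac:(lra) ltac:(lra)). cbn [pos] in T1, T2.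
assert (Mx : Rmax (Rabs (u - x)) (Rabs (v - y)) <= Cmod (u - x, v - y)) by (apply Rmax_lub; assumption).
rewrite norm_cC.
eapply Rle_trans; [apply Cmod_le_sum|].
apply Rle_trans with (eps / 2 * Cmod (u - x, v - y) + eps / 2 * Cmod (u - x, v - y)); [|right; simpl; lra].
assert (S1 := Rmult_le_compat_l _ _ _ (Rlt_le _ _ He2) Mx).
apply Rplus_le_compat.
- eapply Rle_trans; [|eapply Rle_trans; [apply T1|exact S1]]. right. f_equal. simpl.
  unfold minus, plus, opp, scal; simpl. unfold plus, opp, mult; simpl. unfold mult; simpl. ring.
- eapply Rle_trans; [|eapply Rle_trans; [apply T2|exact S1]]. right. f_equal. simpl.
  unfold minus, plus, opp, scal; simpl. unfold plus, opp, mult; simpl. unfold mult; simpl. ring.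
Qed.

Lemma coord_le (l : idx) (a : quat) : Rabs (qc l a) <= norm a.
Proof.
rewrite qnorm -(sqrt_Rsqr_abs (qc l a)). apply sqrt_le_1_alt. unfold Rsqr.
assert (P0 := pow2_ge_0 (qc I0 a)). assert (P1 := pow2_ge_0 (qc I1 a)).
assert (P2 := pow2_ge_0 (qc I2 a)). assert (P3 := pow2_ge_0 (qc I3 a)). destruct l; nra.
Qed.

Lemma qc_linear (l : idx) : is_linear (K := R_AbsRing) (U := quat) (V := R_NormedModule) (qc l).
Proof.
split.
- intros x y. destruct l; reflexivity.
- intros k x. destruct l; reflexivity.
- exists 1. split; [lra|]. intros x. change (Rabs (qc l x) <= 1 * norm x). rewrite Rmult_1_l. apply coord_le.
Qed.

Lemma qc_derive (l : idx) (f : R -> quat) (x : R) (d : quat) : is_derive f x d ->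
  is_derive (fun t => qc l (f t)) x (qc l d).
Proof.
intros H.
assert (T := filterdiff_comp' f (qc l) x (fun y => scal y d) (qc l) H (filterdiff_linear (qc l) (qc_linear l))).
unfold is_derive. eapply filterdiff_ext_lin; [exact T|]. intros y. cbn beta. destruct l; reflexivity.
Qed.

Lemma qc_continuous (l : idx) (f : R * R -> quat) (z : R * R) : continuous f z ->
  continuous (fun t => qc l (f t)) z.
Proof.
intros H. apply (continuous_comp f (qc l)); [exact H|]. apply (linear_cont (K := R_AbsRing) (U := quat) (V := R_NormedModule) (qc l)), qc_linear.
Qed.

Lemma slice_open (U : quat -> Prop) (J : quat) (z : R * R) : open U -> imag_unit J -> U (qpt J z) ->
  exists d, 0 < d /\ forall w, Cmod (Cminus w z) < d -> U (qpt J w).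
Proof.
intros HU HJ Uz. destruct (HU (qpt J z) Uz) as [e He]. exists e. split; [apply cond_pos|].
intros w Hw. apply He, ball_qpt; assumption.
Qed.

(** The stem function of the l-th intrinsic component. *)
Definition stem_comp (alpha beta : R -> R -> quat) (l : idx) (z : R * R) : R * R :=
  (qc l (alpha (fst z) (snd z)), qc l (beta (fst z) (snd z))).

Section Stem.
Variables (U : quat -> Prop) (alpha beta : R -> R -> quat).
Hypotheses (HU : slice_dom U) (Hst : stem U alpha beta).

Lemma stem_diff (f : R -> R -> R) (fu fv : R -> R -> R) (J : quat) (z : R * R) : imag_unit J -> U (qpt J z) ->
  (forall w, U (qpt J w) -> is_derive (fun x => f x (snd w)) (fst w) (fu (fst w) (snd w)) /\
     is_derive (fun y => f (fst w) y) (snd w) (fv (fst w) (snd w)) /\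
     continuous (fun w : R * R => fu (fst w) (snd w)) w) ->
  differentiable_pt_lim f (fst z) (snd z) (fu (fst z) (snd z)) (fv (fst z) (snd z)).
Proof.
intros HJ Uz H. destruct z as [x y]. apply filterdiff_differentiable_pt_lim.
destruct (H (x, y) Uz) as [_ [H2 H3]].
apply (is_derive_filterdiff f x y fu (fv x y)); [|exact H2|exact H3].
destruct (slice_open U J (x, y) (proj1 HU) HJ Uz) as [d [Hd Hb]].
assert (Hd2 : 0 < d / 2) by lra. exists (mkposreal _ Hd2). intros w Hw. apply (H w), Hb.
assert (T := ball_plane (x, y) w _ Hw). cbn [pos] in T. lra.
Qed.

Lemma stem_cdiff (l : idx) (J : quat) (z : R * R) : imag_unit J -> U (qpt J z) ->
  cdiff (Y := cC) (stem_comp alpha beta l) z.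
Proof.
intros HJ Uz. destruct Hst as [au [av [bu [bv H]]]].
assert (D1 : differentiable_pt_lim (fun u v => qc l (alpha u v)) (fst z) (snd z) (qc l (au (fst z) (snd z))) (qc l (av (fst z) (snd z)))).
{ apply (stem_diff _ (fun u v => qc l (au u v)) (fun u v => qc l (av u v)) J z HJ Uz). intros w Uw.
  destruct (H (fst w) (snd w) J HJ Uw) as [_ [_ [A1 [A2 [_ [_ [A3 _]]]]]]].
  split; [apply (qc_derive l (fun x => alpha x (snd w))), A1|].
  split; [apply (qc_derive l (fun y => alpha (fst w) y)), A2|].
  destruct w as [u v]. apply (qc_continuous l (fun w => au (fst w) (snd w))), A3. }
assert (D2 : differentiable_pt_lim (fun u v => qc l (beta u v)) (fst z) (snd z) (qc l (bu (fst z) (snd z))) (qc l (bv (fst z) (snd z)))).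
{ apply (stem_diff _ (fun u v => qc l (bu u v)) (fun u v => qc l (bv u v)) J z HJ Uz). intros w Uw.
  destruct (H (fst w) (snd w) J HJ Uw) as [_ [_ [_ [_ [A1 [A2 [_ [_ [A3 _]]]]]]]]].
  split; [apply (qc_derive l (fun x => beta x (snd w))), A1|].
  split; [apply (qc_derive l (fun y => beta (fst w) y)), A2|].
  destruct w as [u v]. apply (qc_continuous l (fun w => bu (fst w) (snd w))), A3. }
destruct (H (fst z) (snd z) J HJ Uz) as [_ [_ [_ [_ [_ [_ [_ [_ [_ [_ [E1 E2]]]]]]]]]]].
apply (f_equal (qc l)) in E1. apply (f_equal (qc l)) in E2.
assert (F1 : qc l (bv (fst z) (snd z)) = qc l (au (fst z) (snd z))).
{ assert (T : qc l (au (fst z) (snd z)) + - qc l (bv (fst z) (snd z)) = 0) by (destruct l; exact E1). lra. }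
assert (F2 : qc l (bu (fst z) (snd z)) = - qc l (av (fst z) (snd z))).
{ assert (T : qc l (av (fst z) (snd z)) + qc l (bu (fst z) (snd z)) = 0) by (destruct l; exact E2). lra. }
rewrite F1 F2 in D2. destruct z as [x y]. exact (cr_cdiff _ _ x y _ _ D1 D2).
Qed.

Lemma stem_conj (l : idx) (J : quat) (z : R * R) : imag_unit J -> U (qpt J z) ->
  stem_comp alpha beta l (Cconj z) = Cconj (stem_comp alpha beta l z).
Proof.
intros HJ Uz. destruct Hst as [au [av [bu [bv H]]]].
destruct (H (fst z) (snd z) J HJ Uz) as [E1 [E2 _]]. apply injective_projections; simpl.
- rewrite E1. reflexivity.
- rewrite E2. destruct l; reflexivity.
Qed.
End Stem.

(** * The change of variable q = 1 / z + alpha *)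

Definition omega (a : R) (z : C) : C := Cplus (Cinv z) (RtoC a).
Definition e1 : quat := unit_of I1.

Lemma e1_imag : imag_unit e1.
Proof. split; [reflexivity|]. change (1 ^ 2 + 0 ^ 2 + 0 ^ 2 = 1). ring. Qed.

Lemma qpt_zero J : qpt J (0, 0) = zero.
Proof. exact (qpt_real J 0). Qed.

Lemma qpt_eq0 J (z : C) : imag_unit J -> qpt J z = zero -> z = RtoC 0.
Proof.
intros HJ E. apply Cmod_eq_0. rewrite -(norm_qpt J z HJ) E. apply (norm_zero (V := quat)).
Qed.

Lemma qpt_inv J (z : C) : imag_unit J -> qinv (qpt J z) = qpt J (Cinv z).
Proof.
intros HJ. unfold qinv. assert (N := norm_qpt J z HJ).
assert (N2 : norm (qpt J z) ^ 2 = fst z ^ 2 + snd z ^ 2).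
{ rewrite N. unfold Cmod. rewrite pow2_sqrt; [reflexivity|]. assert (P := pow2_ge_0 (fst z)). assert (Q := pow2_ge_0 (snd z)). lra. }
change (scal (/ norm (qpt J z) ^ 2) (qconj (qpt J z)) = qpt J (Cinv z)). rewrite N2.
destruct J as [j0 [j1 [j2 j3]]], z as [x y]. destruct HJ as [H0 H1].
change (j0 = 0) in H0. subst j0. cbn [fst snd].
unfold qpt, slice_pt, qconj, ofR, qc; cbn [coord mkh fst snd].
apply (mkh_eq (E := R_NormedModule)); rgoal; unfold Rdiv; ring.
Qed.

Lemma omega_qpt J a (z : C) : imag_unit J -> plus (qinv (qpt J z)) (ofR a) = qpt J (omega a z).
Proof.
intros HJ. rewrite (qpt_inv J z HJ). destruct (Cinv z) as [x y] eqn:Ez. unfold omega. rewrite Ez.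
destruct J as [j0 [j1 [j2 j3]]]. unfold qpt, slice_pt, ofR. apply (mkh_eq (E := R_NormedModule)); rgoal; ring.
Qed.

Lemma omega_ccdiff a (z : C) : z <> RtoC 0 -> ccdiff (omega a) z.
Proof.
intros Hz. destruct (ccdiff_inv (RtoC 0) z Hz) as [q [Hq E]]. exists q. split; [exact Hq|].
intros w. rewrite -E. unfold omega. assert (E0 : forall u : C, Cminus u (RtoC 0) = u) by (intros; cring).
rewrite !E0. cring.
Qed.

Lemma omega_conj a (z : C) : omega a (Cconj z) = Cconj (omega a z).
Proof. unfold omega. rewrite -Cconj_inv. apply injective_projections; simpl; ring. Qed.

Lemma omega_large (a M : R) : exists d, 0 < d /\
  forall z : C, z <> RtoC 0 -> Cmod z < d -> M < Cmod (omega a z).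
Proof.
set (N := Rabs M + Rabs a + 1). assert (HN : 0 < N) by (unfold N; assert (T := Rabs_pos M); assert (T' := Rabs_pos a); lra).
exists (/ N). split; [apply Rinv_0_lt_compat, HN|]. intros z Nz Hz.
assert (P := proj1 (Cmod_gt_0 z) Nz).
assert (T := Cmod_tri_sub (Cinv z) (Copp (RtoC a))). rewrite Cmod_opp Cmod_R (Cmod_inv z Nz) in T.
assert (E0 : Cminus (Cinv z) (Copp (RtoC a)) = omega a z) by (unfold omega; cring). rewrite E0 in T.
assert (T2 : N < / Cmod z).
{ rewrite -(Rinv_inv N). apply Rinv_lt_contravar; [|exact Hz]. apply Rmult_lt_0_compat; [exact P|apply Rinv_0_lt_compat, HN]. }
assert (T3 := Rle_abs M). unfold N in T2. lra.
Qed.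

Section Components.
Variables (a : R) (U : quat -> Prop) (alpha beta : R -> R -> quat) (L : quat).
Hypotheses (HU : slice_dom U) (Hst : stem U alpha beta).
Hypothesis Hlim : forall eps, 0 < eps -> exists M, forall c : C, M < Cmod c ->
  U (qpt e1 c) /\ norm (minus (alpha (fst c) (snd c)) L) < eps /\ norm (beta (fst c) (snd c)) < eps.

(** The domain of f composed with z -> 1 / z + alpha. The plane spanned by e1
    represents them all, as U is axially symmetric. *)
Definition odom (z : R * R) : Prop := z = (0, 0) \/ U (qpt e1 (omega a z)).

(** The components of the transformed function; L is the value of f at infinity. *)
Definition scomp (l : idx) (z : R * R) : R * R :=
  if excluded_middle_informative (z = (0, 0)) then (qc l L, 0) else stem_comp alpha beta l (omega a z).

Lemma odom_near0 : exists d, 0 < d /\ forall z, Cmod z < d -> odom z.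
Proof.
destruct (Hlim 1) as [M HM]; [lra|]. destruct (omega_large a M) as [d [Hd Hb]].
exists d. split; [exact Hd|]. intros z Hz. destruct (excluded_middle_informative (z = (0, 0))) as [E|N]; [left; exact E|].
right. apply (HM (omega a z)), Hb; assumption.
Qed.

Lemma ccdiff_cont (s : R * R -> R * R) z : ccdiff s z -> ccont s z.
Proof.
intros [q [Hq E]]. assert (T : cdiff (Y := cC) s z).
{ exists q. split; [apply cont_cC, Hq|]. intros w. rewrite cmul_cC. apply E. }
apply cont_cC, cdiff_cont, T.
Qed.

Lemma odom_open : copen odom.
Proof.
intros z [->|Uz].
- destruct odom_near0 as [d [Hd Hb]]. exists d. split; [exact Hd|]. intros w Hw. apply Hb.
  assert (E : Cminus w (0, 0) = w) by (apply injective_projections; simpl; ring). rewrite E in Hw. exact Hw.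
- destruct (excluded_middle_informative (z = (0, 0))) as [E|N].
  + subst z. destruct odom_near0 as [d [Hd Hb]]. exists d. split; [exact Hd|]. intros w Hw. apply Hb.
    assert (E : Cminus w (0, 0) = w) by (apply injective_projections; simpl; ring). rewrite E in Hw. exact Hw.
  + destruct (slice_open U e1 _ (proj1 HU) e1_imag Uz) as [d [Hd Hb]].
    destruct (ccdiff_cont _ _ (omega_ccdiff a z N) d Hd) as [d' [Hd' Hb']].
    exists d'. split; [exact Hd'|]. intros w Hw. right. apply Hb, Hb', Hw.
Qed.

Lemma scomp_off0 l z : z <> (0, 0) -> scomp l z = stem_comp alpha beta l (omega a z).
Proof. intros N. unfold scomp. destruct (excluded_middle_informative (z = (0, 0))); [contradiction|reflexivity]. Qed.

Lemma scomp_0 l : scomp l (0, 0) = (qc l L, 0).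
Proof. unfold scomp. destruct (excluded_middle_informative ((0, 0) = (0, 0))); [reflexivity|contradiction]. Qed.

Lemma scomp_cdiff l z : odom z -> z <> (0, 0) -> cdiff (Y := cC) (scomp l) z.
Proof.
intros [E|Uz] N; [contradiction|].
assert (P : 0 < Cmod z) by (apply Cmod_gt_0; exact N).
apply (cdiff_ext_loc (Y := cC) (fun w => stem_comp alpha beta l (omega a w)) _ z (Cmod z) P).
- intros w Hw. symmetry. apply scomp_off0. intros ->. rewrite Cmod_minus_sym in Hw.
  assert (E : Cminus z (0, 0) = z) by (apply injective_projections; simpl; ring). rewrite E in Hw. lra.
- apply (cdiff_comp (Y := cC) (stem_comp alpha beta l) (omega a)); [apply omega_ccdiff, N|].
  apply (stem_cdiff U alpha beta HU Hst l e1); [apply e1_imag|exact Uz].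
Qed.

(** z tends to 0 when 1 / z + alpha tends to infinity, where the stem functions
    tend to L and to 0. *)
Lemma scomp_cont0 l : cont (Y := cC) (scomp l) (0, 0).
Proof.
intros eps He. destruct (Hlim (eps / 2)) as [M HM]; [lra|]. destruct (omega_large a M) as [d [Hd Hb]].
exists d. split; [exact Hd|]. intros w Hw. rewrite norm_cC.
assert (E : Cminus w (0, 0) = w) by (apply injective_projections; simpl; ring). rewrite E in Hw.
destruct (excluded_middle_informative (w = (0, 0))) as [->|N].
- change (Cmod (Cminus (scomp l (0, 0)) (scomp l (0, 0))) < eps). rewrite Cmod_m0. exact He.
- rewrite (scomp_off0 l w N) scomp_0. unfold stem_comp.
  destruct (HM (omega a w) (Hb w N Hw)) as [_ [H1 H2]].
  set (x := alpha (fst (omega a w)) (snd (omega a w))) in *. set (y := beta (fst (omega a w)) (snd (omega a w))) in *.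
  eapply Rle_lt_trans; [apply (Cmod_le_sum (qc l x - qc l L) (qc l y - 0))|].
  assert (T1 := coord_le l (minus x L)). assert (T2 := coord_le l y).
  assert (E1 : qc l (minus x L) = qc l x - qc l L) by (destruct l; reflexivity). rewrite E1 in T1.
  rewrite Rminus_0_r. unfold Rminus in *. lra.
Qed.

Lemma scomp_symholo l : symholo odom (scomp l).
Proof.
split; [split|].
- intros z Oz. destruct (excluded_middle_informative (z = (0, 0))) as [->|N]; [apply scomp_cont0|].
  apply cdiff_cont, scomp_cdiff; assumption.
- apply scomp_cdiff.
- intros z Oz. destruct (excluded_middle_informative (z = (0, 0))) as [->|N].
  + assert (E : Cconj (0, 0) = (0, 0)) by (apply injective_projections; simpl; ring).
    rewrite E scomp_0. apply injective_projections; simpl; ring.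
  + assert (N' : Cconj z <> (0, 0)).
    { intros E. apply N. destruct z as [x y]. apply (f_equal Cconj) in E. unfold Cconj in E. simpl in E.
      injection E. intros E1 E2. apply injective_projections; simpl; lra. }
    rewrite (scomp_off0 l _ N') (scomp_off0 l _ N) omega_conj. destruct Oz as [E|Uz]; [contradiction|].
    apply (stem_conj U alpha beta Hst l e1 _ e1_imag Uz).
Qed.
End Components.

(** * The value at infinity *)

Lemma norm_qmul (a b : quat) : norm (qmul a b) = norm a * norm b.
Proof.
destruct a as [a0 [a1 [a2 a3]]], b as [b0 [b1 [b2 b3]]].
rewrite !qnorm -sqrt_mult_alt; [|unfold qc; cbn [coord fst snd]; nra].
f_equal. unfold qmul, lmul, lin4, qc; cbn [coord mkh fst snd].
unfold plus, scal; simpl. unfold plus, mult; simpl. ring.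
Qed.

Lemma norm_imag J : imag_unit J -> norm J = 1.
Proof. intros [H0 H1]. rewrite qnorm H0 -sqrt_1 -H1. f_equal. ring. Qed.

Lemma half_sum (p m x y L : quat) (eps : R) : p = plus x y -> m = minus x y ->
  norm (minus p L) < eps -> norm (minus m L) < eps -> norm (minus x L) < eps /\ norm y < eps.
Proof.
intros Ep Em Hp Hm.
assert (E1 : minus x L = scal (/ 2) (plus (minus p L) (minus m L))).
{ rewrite Ep Em. rvec_coefs quat; simpl; field. }
assert (E2 : y = scal (/ 2) (minus (minus p L) (minus m L))).
{ rewrite Ep Em. rvec_coefs quat; simpl; field. }
assert (N : forall w : quat, norm (scal (/ 2) w) <= / 2 * norm w).
{ intros w. eapply Rle_trans; [apply (norm_scal (V := quat))|]. right. f_equal. apply Rabs_right. lra. }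
split.
- rewrite E1. eapply Rle_lt_trans; [apply N|]. eapply Rle_lt_trans; [apply Rmult_le_compat_l; [lra|apply (norm_triangle (V := quat))]|lra].
- rewrite E2. eapply Rle_lt_trans; [apply N|]. assert (O := norm_opp (V := quat) (minus m L)).
  eapply Rle_lt_trans; [apply Rmult_le_compat_l; [lra|apply (norm_triangle (V := quat) (minus p L) (opp (minus m L)))]|lra].
Qed.

(** alpha and beta are half the sum and half the difference of the values of f at
    u + J v and u - J v; [op] is multiplication by J on the left or on the right. *)
Lemma stem_lim (f : hfun) (alpha beta : R -> R -> quat) (op : quat -> quat -> quat) (L : quat) :
  slice_dom (hdom f) -> stem (hdom f) alpha beta -> lim_infty f L ->
  (forall J x, imag_unit J -> norm (op J x) = norm x) -> (forall J x, op J (opp x) = opp (op J x)) ->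
  (forall u v J, imag_unit J -> hdom f (slice_pt J u v) -> hval f (slice_pt J u v) = plus (alpha u v) (op J (beta u v))) ->
  forall eps, 0 < eps -> exists M, forall c : C, M < Cmod c ->
  hdom f (qpt e1 c) /\ norm (minus (alpha (fst c) (snd c)) L) < eps /\ norm (beta (fst c) (snd c)) < eps.
Proof.
intros HU Hst HL Hn Ho Hv eps He. destruct (HL (mkposreal _ He)) as [M HM]. exists M. intros c Hc.
assert (Nc : norm (qpt e1 c) = Cmod c) by (apply norm_qpt, e1_imag).
assert (Nc' : norm (qpt e1 (Cconj c)) = Cmod c) by (rewrite (norm_qpt _ _ e1_imag) Cmod_conj; reflexivity).
destruct (HM (qpt e1 c)) as [D1 B1]; [rewrite Nc; exact Hc|].
destruct (HM (qpt e1 (Cconj c))) as [D2 B2]; [rewrite Nc'; exact Hc|]. cbn [pos] in B1, B2.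
split; [exact D1|]. rewrite -(Hn e1 (beta (fst c) (snd c)) e1_imag).
apply (half_sum (hval f (qpt e1 c)) (hval f (qpt e1 (Cconj c)))); try assumption.
- apply Hv; [apply e1_imag|exact D1].
- destruct Hst as [au [av [bu [bv H]]]]. destruct (H (fst c) (snd c) e1 e1_imag D1) as [E1 [E2 _]].
  rewrite (Hv (fst c) (- snd c) e1 e1_imag D2) E1 E2 Ho. reflexivity.
Qed.

Lemma lim_unique (f : hfun) (L L' : quat) : lim_infty f L -> lim_infty f L' -> L = L'.
Proof.
intros H H'. assert (Z : minus L L' = zero).
{ apply (norm_eq_zero (V := quat)). apply Rle_antisym; [|apply (norm_ge_0 (V := quat))].
  apply Rnot_lt_le. intros P. assert (P2 : 0 < norm (minus L L') / 2) by lra.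
  destruct (H (mkposreal _ P2)) as [M HM]. destruct (H' (mkposreal _ P2)) as [M' HM'].
  set (q := qpt e1 (RtoC (Rmax (Rabs M) (Rabs M') + 1))).
  assert (Nq : norm q = Rmax (Rabs M) (Rabs M') + 1).
  { unfold q. rewrite (norm_qpt _ _ e1_imag) Cmod_R. apply Rabs_right.
    assert (T := Rmax_l (Rabs M) (Rabs M')). assert (T' := Rabs_pos M). lra. }
  assert (T1 := Rmax_l (Rabs M) (Rabs M')). assert (T2 := Rmax_r (Rabs M) (Rabs M')).
  assert (T3 := Rle_abs M). assert (T4 := Rle_abs M').
  destruct (HM q) as [_ B1]; [lra|]. destruct (HM' q) as [_ B2]; [lra|]. cbn [pos] in B1, B2.
  assert (E : minus L L' = plus (minus (hval f q) L') (opp (minus (hval f q) L))) by rvec quat.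
  assert (T := norm_triangle (V := quat) (minus (hval f q) L') (opp (minus (hval f q) L))).
  rewrite (norm_opp (V := quat)) in T. rewrite -E in T. lra. }
transitivity (plus (minus L L') L'); [rvec quat|]. rewrite Z. apply (plus_zero_l (G := quat)).
Qed.

Lemma val_infty_spec (f : hfun) : (exists L, lim_infty f L) -> lim_infty f (val_infty f).
Proof. intros H. apply (epsilon_spec (inhabits zero) (lim_infty f) H). Qed.

Lemma val_infty_eq (f : hfun) (L : quat) : lim_infty f L -> val_infty f = L.
Proof. intros H. apply (lim_unique f); [apply val_infty_spec; exists L|]; exact H. Qed.

(** * Slice functions as sums of intrinsic ones *)

Definition idxs : list idx := I0 :: I1 :: I2 :: I3 :: nil.

Lemma quat_left_units J (x y : quat) : plus x (qmul J y) =
  fold_right plus zero (map (fun l => qmul (qpt J (qc l x, qc l y)) (unit_of l)) idxs).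
Proof.
destruct J as [j0 [j1 [j2 j3]]], x as [x0 [x1 [x2 x3]]], y as [y0 [y1 [y2 y3]]].
unfold qpt, slice_pt, ofR, qmul, lmul, lin4, unit_of, qc; cbn [map fold_right idxs coord mkh fst snd].
apply (mkh_eq (E := R_NormedModule)); rgoal; ring.
Qed.

Lemma quat_right_units J (x y : quat) : plus x (qmul y J) =
  fold_right plus zero (map (fun l => qmul (unit_of l) (qpt J (qc l x, qc l y))) idxs).
Proof.
destruct J as [j0 [j1 [j2 j3]]], x as [x0 [x1 [x2 x3]]], y as [y0 [y1 [y2 y3]]].
unfold qpt, slice_pt, ofR, qmul, lmul, lin4, unit_of, qc; cbn [map fold_right idxs coord mkh fst snd].
apply (mkh_eq (E := R_NormedModule)); rgoal; ring.
Qed.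

Lemma qmul_zero_r (x : quat) : qmul x zero = zero.
Proof.
assert (Z : (zero : quat) = ofR 0) by reflexivity. rewrite {1}Z. destruct x as [x0 [x1 [x2 x3]]].
unfold qmul, ofR, lmul, lin4, qc; cbn [coord mkh fst snd]. apply (mkh_eq (E := R_NormedModule)); rgoal; ring.
Qed.
Lemma qmul_zero_l (x : quat) : qmul zero x = zero.
Proof.
assert (Z : (zero : quat) = ofR 0) by reflexivity. rewrite {1}Z. destruct x as [x0 [x1 [x2 x3]]].
unfold qmul, ofR, lmul, lin4, qc; cbn [coord mkh fst snd]. apply (mkh_eq (E := R_NormedModule)); rgoal; ring.
Qed.

Lemma qc_zero l : qc l zero = 0.
Proof. destruct l; reflexivity. Qed.

Lemma hval_transform_off0 a (f : hfun) J z : imag_unit J -> z <> (0, 0) ->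
  hval (transform a f) (qpt J z) = hval f (qpt J (omega a z)).
Proof.
intros HJ N. unfold transform; cbn [hval]. destruct (excluded_middle_informative (qpt J z = zero)) as [E|_].
- destruct N. apply (qpt_eq0 J z HJ E).
- rewrite (omega_qpt J a z HJ). reflexivity.
Qed.

Lemma hval_transform_0 a (f : hfun) : hval (transform a f) zero = val_infty f.
Proof. unfold transform; cbn [hval]. destruct (excluded_middle_informative _) as [_|N]; [reflexivity|contradiction]. Qed.

Lemma odom_of_hdom a (f : hfun) J z : slice_dom (hdom f) -> imag_unit J ->
  hdom (transform a f) (qpt J z) -> odom a (hdom f) z.
Proof.
intros [_ Ax] HJ [E|D]; [left; apply (qpt_eq0 J z HJ E)|right].
rewrite (omega_qpt J a z HJ) in D. apply (Ax _ _ J e1 HJ e1_imag D).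
Qed.

Lemma hdom_of_odom (f : hfun) J a z : slice_dom (hdom f) -> imag_unit J -> z <> (0, 0) ->
  odom a (hdom f) z -> hdom f (qpt J (omega a z)).
Proof. intros [_ Ax] HJ N [E|D]; [contradiction|]. apply (Ax _ _ e1 J e1_imag HJ D). Qed.

(** A slice function splits into intrinsic ones along the basis 1, e1, e2, e3. *)
Lemma left_decomposition (a : R) (f : hfun) : left_sh f -> (exists l, lim_infty f l) ->
  copen (odom a (hdom f)) /\ exists rs, (forall r, In r rs -> symholo (odom a (hdom f)) (r_fun r)) /\
  left_rep (transform a f) (odom a (hdom f)) rs.
Proof.
intros [HU [al [be [Hst Hv]]]] Hl. assert (HL := val_infty_spec f Hl).
assert (Hlim := stem_lim f al be qmul (val_infty f) HU Hst HL
  ltac:(intros J x HJ; rewrite norm_qmul (norm_imag J HJ); apply Rmult_1_l)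
  ltac:(intros J x; apply (lmul_opp (E := R_NormedModule))) Hv).
split; [apply (odom_open a (hdom f) al be (val_infty f) HU Hlim)|].
exists (map (fun l => mksterm (scomp a al be (val_infty f) l) (unit_of l)) idxs). split.
- intros r Hr. apply in_map_iff in Hr. destruct Hr as [l [<- _]]. cbn [r_fun].
  apply scomp_symholo; assumption.
- intros J z HJ Oz. rewrite map_map. cbn [r_fun r_coef].
  destruct (excluded_middle_informative (z = (0, 0))) as [->|N].
  + rewrite qpt_zero hval_transform_0.
    transitivity (plus (val_infty f) (qmul J zero)); [rewrite qmul_zero_r; symmetry; apply (plus_zero_r (G := quat))|].
    rewrite quat_left_units. apply (f_equal (fold_right plus zero)), map_ext. intros l. rewrite scomp_0 qc_zero. reflexivity.
  + rewrite (hval_transform_off0 a f J z HJ N). 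
    transitivity (plus (al (fst (omega a z)) (snd (omega a z))) (qmul J (be (fst (omega a z)) (snd (omega a z))))).
    { apply Hv; [exact HJ|]. apply hdom_of_odom; assumption. }
    rewrite quat_left_units. apply (f_equal (fold_right plus zero)), map_ext. intros l. rewrite (scomp_off0 _ _ _ _ l z N). reflexivity.
Qed.

Lemma right_decomposition (a : R) (f : hfun) : right_sh f -> (exists l, lim_infty f l) ->
  copen (odom a (hdom f)) /\ exists rs, (forall r, In r rs -> symholo (odom a (hdom f)) (r_fun r)) /\
  right_rep (transform a f) (odom a (hdom f)) rs.
Proof.
intros [HU [al [be [Hst Hv]]]] Hl. assert (HL := val_infty_spec f Hl).
assert (Hlim := stem_lim f al be (fun J x => qmul x J) (val_infty f) HU Hst HL
  ltac:(intros J x HJ; rewrite norm_qmul (norm_imag J HJ); apply Rmult_1_r)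
  ltac:(intros J x; apply (lmul_opp_l (E := R_NormedModule))) Hv).
split; [apply (odom_open a (hdom f) al be (val_infty f) HU Hlim)|].
exists (map (fun l => mksterm (scomp a al be (val_infty f) l) (unit_of l)) idxs). split.
- intros r Hr. apply in_map_iff in Hr. destruct Hr as [l [<- _]]. cbn [r_fun].
  apply scomp_symholo; assumption.
- intros J z HJ Oz. rewrite map_map. cbn [r_fun r_coef].
  destruct (excluded_middle_informative (z = (0, 0))) as [->|N].
  + rewrite qpt_zero hval_transform_0.
    transitivity (plus (val_infty f) (qmul zero J)); [rewrite qmul_zero_l; symmetry; apply (plus_zero_r (G := quat))|].
    rewrite quat_right_units. apply (f_equal (fold_right plus zero)), map_ext. intros l. rewrite scomp_0 qc_zero. reflexivity.
  + rewrite (hval_transform_off0 a f J z HJ N). 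
    transitivity (plus (al (fst (omega a z)) (snd (omega a z))) (qmul (be (fst (omega a z)) (snd (omega a z))) J)).
    { apply Hv; [exact HJ|]. apply hdom_of_odom; assumption. }
    rewrite quat_right_units. apply (f_equal (fold_right plus zero)), map_ext. intros l. rewrite (scomp_off0 _ _ _ _ l z N). reflexivity.
Qed.

Lemma real_left J (x y : quat) : is_real x -> is_real y -> plus x (qmul J y) = qpt J (qc I0 x, qc I0 y).
Proof.
intros Hx Hy. rewrite {1}Hx {1}Hy. generalize (qc I0 x) (qc I0 y). intros u v.
destruct J as [j0 [j1 [j2 j3]]]. unfold qpt, slice_pt, ofR, qmul, lmul, lin4, qc; cbn [coord mkh fst snd].
apply (mkh_eq (E := R_NormedModule)); rgoal; ring.
Qed.

(** The value at infinity is real too, as a limit of the real numbers alpha. *)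
Lemma intrinsic_component (a : R) (f : hfun) : intrinsic_sh f -> (exists l, lim_infty f l) ->
  copen (odom a (hdom f)) /\ exists s, symholo (odom a (hdom f)) s /\
  forall J z, imag_unit J -> odom a (hdom f) z -> hval (transform a f) (qpt J z) = qpt J (s z).
Proof.
intros [HU [al [be [Hst Hv]]]] Hl. assert (HL := val_infty_spec f Hl).
assert (Hlim := stem_lim f al be qmul (val_infty f) HU Hst HL
  ltac:(intros J x HJ; rewrite norm_qmul (norm_imag J HJ); apply Rmult_1_l)
  ltac:(intros J x; apply (lmul_opp (E := R_NormedModule))) (fun u v J HJ D => proj2 (proj2 (Hv u v J HJ D)))).
split; [apply (odom_open a (hdom f) al be (val_infty f) HU Hlim)|].
exists (scomp a al be (val_infty f) I0). split; [apply scomp_symholo; assumption|].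
intros J z HJ Oz. destruct (excluded_middle_informative (z = (0, 0))) as [->|N].
- rewrite qpt_zero hval_transform_0 scomp_0. change (val_infty f = qpt J (RtoC (qc I0 (val_infty f)))). rewrite qpt_real.
  assert (Z : forall l, l <> I0 -> qc l (val_infty f) = 0).
  { intros l Nl. apply Rabs_eq_0. apply Rle_antisym; [|apply Rabs_pos]. apply Rnot_lt_le. intros P.
    destruct (Hlim _ P) as [M HM]. 
    set (c := RtoC (Rabs M + 1)). assert (Hc : M < Cmod c).
    { unfold c. rewrite Cmod_R. assert (T := Rle_abs M). assert (T2 := Rle_abs (Rabs M + 1)). lra. }
    destruct (HM c Hc) as [D [B _]]. destruct (Hv _ _ e1 e1_imag D) as [Rx _].
    assert (T := coord_le l (minus (al (fst c) (snd c)) (val_infty f))).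
    assert (E : qc l (minus (al (fst c) (snd c)) (val_infty f)) = - qc l (val_infty f)).
    { rewrite Rx. destruct l; [contradiction| | |]; unfold minus; rgoal; unfold qc; ring. }
    rewrite E Rabs_Ropp in T. lra. }
  rewrite {1}(h_eta (val_infty f)). unfold ofR. apply (mkh_eq (E := R_NormedModule)).
  + reflexivity.
  + apply (Z I1). discriminate.
  + apply (Z I2). discriminate.
  + apply (Z I3). discriminate.
- rewrite (hval_transform_off0 a f J z HJ N) (scomp_off0 _ _ _ _ I0 z N).
  assert (D := hdom_of_odom f J a z HU HJ N Oz). destruct (Hv _ _ J HJ D) as [Rx [Ry E]].
  rewrite -(real_left J _ _ Rx Ry). exact E.
Qed.

(** * Limits of sums and products *)

Lemma transform_op a (f g H : hfun) (op : quat -> quat -> quat) : val_infty H = op (val_infty f) (val_infty g) ->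
  (forall q, hval H q = op (hval f q) (hval g q)) ->
  forall p, hval (transform a H) p = op (hval (transform a f) p) (hval (transform a g) p).
Proof.
intros E0 E p. unfold transform; cbn [hval]. destruct (excluded_middle_informative (p = zero)); [exact E0|apply E].
Qed.

Lemma lim_add (f g : hfun) L M : lim_infty f L -> lim_infty g M -> lim_infty (fadd f g) (plus L M).
Proof.
intros Hf Hg eps. assert (He : 0 < eps / 2) by (assert (T := cond_pos eps); lra).
destruct (Hf (mkposreal _ He)) as [R1 H1]. destruct (Hg (mkposreal _ He)) as [R2 H2].
exists (Rmax R1 R2). intros q Hq. assert (T1 := Rmax_l R1 R2). assert (T2 := Rmax_r R1 R2).
destruct (H1 q ltac:(lra)) as [D1 B1]. destruct (H2 q ltac:(lra)) as [D2 B2]. cbn [pos] in B1, B2.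
split; [split; assumption|]. cbn [fadd hval].
assert (E : minus (plus (hval f q) (hval g q)) (plus L M) = plus (minus (hval f q) L) (minus (hval g q) M)) by rvec quat.
rewrite E. eapply Rle_lt_trans; [apply (norm_triangle (V := quat))|]. lra.
Qed.

Lemma lim_mul (f g : hfun) L M : lim_infty f L -> lim_infty g M -> lim_infty (fmul f g) (qmul L M).
Proof.
intros Hf Hg eps. set (K := norm L + norm M + 1).
assert (P1 := norm_ge_0 (V := quat) L). assert (P2 := norm_ge_0 (V := quat) M).
assert (HK : 0 < K) by (unfold K; lra).
assert (He : 0 < Rmin 1 (eps / (2 * K))).
{ apply Rmin_pos; [lra|]. apply Rdiv_lt_0_compat; [apply cond_pos|lra]. }
destruct (Hf (mkposreal _ He)) as [R1 H1]. destruct (Hg (mkposreal _ He)) as [R2 H2].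
exists (Rmax R1 R2). intros q Hq. assert (T1 := Rmax_l R1 R2). assert (T2 := Rmax_r R1 R2).
destruct (H1 q ltac:(lra)) as [D1 B1]. destruct (H2 q ltac:(lra)) as [D2 B2]. cbn [pos] in B1, B2.
split; [split; assumption|]. cbn [fmul hval].
set (x := hval f q) in *. set (y := hval g q) in *.
assert (E : minus (qmul x y) (qmul L M) = plus (qmul (minus x L) y) (qmul L (minus y M))).
{ destruct x as [x0 [x1 [x2 x3]]], y as [y0 [y1 [y2 y3]]], L as [l0 [l1 [l2 l3]]], M as [m0 [m1 [m2 m3]]].
  unfold qmul, lmul, lin4, qc; cbn [coord mkh fst snd].
  apply (mkh_eq (E := R_NormedModule)); unfold minus; rgoal; ring. }
rewrite E. eapply Rle_lt_trans; [apply (norm_triangle (V := quat))|]. rewrite !norm_qmul.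
assert (Q1 := Rmin_l 1 (eps / (2 * K))). assert (Q2 := Rmin_r 1 (eps / (2 * K))).
assert (Ny : norm y < K).
{ assert (Ey : y = plus (minus y M) M) by rvec quat. rewrite Ey.
  eapply Rle_lt_trans; [apply (norm_triangle (V := quat))|]. unfold K. lra. }
assert (Py := norm_ge_0 (V := quat) y). assert (Px := norm_ge_0 (V := quat) (minus x L)).
assert (Pz := norm_ge_0 (V := quat) (minus y M)).
assert (S1 : norm (minus x L) * norm y <= eps / (2 * K) * norm y) by (apply Rmult_le_compat_r; lra).
assert (S2 : norm L * norm (minus y M) <= norm L * (eps / (2 * K))) by (apply Rmult_le_compat_l; lra).
assert (HE : 0 < eps / (2 * K)) by (apply Rdiv_lt_0_compat; [apply cond_pos|lra]).
assert (S3 : eps / (2 * K) * norm y < eps / (2 * K) * K) by (apply Rmult_lt_compat_l; assumption).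
assert (S4 : eps / (2 * K) * norm L <= eps / (2 * K) * K) by (apply Rmult_le_compat_l; [lra|unfold K; lra]).
assert (S5 : eps / (2 * K) * K = eps / 2) by (field; lra). lra.
Qed.

(** * The algebra of the product rule *)

Section ProductCore.
Context {E : CompleteNormedModule R_AbsRing} (A : hmod E -> hmod E).
Hypothesis A_rl : right_linear (tot A).
Hypothesis A_bd : exists M : R, forall v, norm (A v) <= M * norm v.
Hypothesis A_comm : commuting_components A.
Hypothesis A_inj : forall v, A v = zero -> v = zero.

Lemma bar_plus x y : bar A (plus x y) = plus (bar A x) (bar A y).
Proof. apply (blin_plus _ (bar_blin A A_rl A_bd)). Qed.
Lemma bar_scal (r : R) x : bar A (scal r x) = scal r (bar A x).
Proof. apply (blin_scal _ (bar_blin A A_rl A_bd)). Qed.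
Lemma underl_plus x y : underl A (plus x y) = plus (underl A x) (underl A y).
Proof. apply (blin_plus _ (underl_blin A A_rl A_bd)). Qed.
Lemma underl_scal (r : R) x : underl A (scal r x) = scal r (underl A x).
Proof. apply (blin_scal _ (underl_blin A A_rl A_bd)). Qed.
Lemma nrm_plus x y : nrm A (plus x y) = plus (nrm A x) (nrm A y).
Proof. apply (blin_plus _ (n0_blin A A_rl A_bd)). Qed.
Lemma nrm_scal (r : R) x : nrm A (scal r x) = scal r (nrm A x).
Proof. apply (blin_scal _ (n0_blin A A_rl A_bd)). Qed.
Lemma nrm_opp x : nrm A (opp x) = opp (nrm A x).
Proof. apply (blin_opp _ (n0_blin A A_rl A_bd)). Qed.

Lemma underl_L l v : underl A (L_ A l v) = L_ A l (underl A v).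
Proof.
rewrite !(underl_eq A A_rl A_bd) !(L_plus A A_rl A_bd) !(L_lmul A A_rl A_bd).
rewrite !(L_comm A A_comm _ l). reflexivity.
Qed.

Lemma bar_L l v : bar A (L_ A l v) = L_ A l (bar A v).
Proof.
rewrite !(bar_eq A A_rl A_bd) underl_L (L_comm A A_comm I0 l).
symmetry. apply (blin_minus _ (L_blin A A_rl A_bd l)).
Qed.

Lemma bar_nrm v : bar A (nrm A v) = nrm A (bar A v).
Proof. apply (nrm_comm A A_rl A_bd A_comm); [apply bar_plus|apply bar_L]. Qed.

Lemma underl_nrm v : underl A (nrm A v) = nrm A (underl A v).
Proof. apply (nrm_comm A A_rl A_bd A_comm); [apply underl_plus|apply underl_L]. Qed.

Lemma mkh_real_zero (x : E) : mkh x zero zero zero = zero -> x = zero.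
Proof. intros H. apply (f_equal (coord I0)) in H. exact H. Qed.

Lemma L_real l x : L_ A l (mkh x zero zero zero) = mkh (cmp A l x) zero zero zero.
Proof.
unfold L_, act4; cbn [coord mkh fst snd]. assert (Z := blin_zero _ (cmp_blin A A_rl A_bd l)). rewrite !Z. reflexivity.
Qed.

(** A Abar acts componentwise, so it suffices to consider real x. Then A Abar x = 0
    gives Abar x = 0, whose components are those of A x up to sign. *)
Lemma nrm_inj v : nrm A v = zero -> v = zero.
Proof.
assert (R0 : forall x, nrm A (mkh x zero zero zero) = zero -> x = zero).
{ intros x H. assert (H1 := A_inj _ H). rewrite (bar_eq A A_rl A_bd) (underl_eq A A_rl A_bd) !L_real in H1.
  assert (Z : forall l, cmp A l x = zero).
  { intros l.
    set (x0 := cmp A I0 x) in H1. set (x1 := cmp A I1 x) in H1. set (x2 := cmp A I2 x) in H1. set (x3 := cmp A I3 x) in H1.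
    assert (H2 : mkh x0 (opp x1) (opp x2) (opp x3) = (zero : hmod E)).
    { rewrite -H1. unfold unit_of. hcrush E. }
    destruct l.
    - exact (f_equal (coord I0) H2).
    - assert (H3 := f_equal (coord I1) H2). change (opp x1 = zero) in H3. change (x1 = zero).
      rewrite -(opp_opp x1) H3. apply (opp_zero (G := E)).
    - assert (H3 := f_equal (coord I2) H2). change (opp x2 = zero) in H3. change (x2 = zero).
      rewrite -(opp_opp x2) H3. apply (opp_zero (G := E)).
    - assert (H3 := f_equal (coord I3) H2). change (opp x3 = zero) in H3. change (x3 = zero).
      rewrite -(opp_opp x3) H3. apply (opp_zero (G := E)). }
  apply mkh_real_zero, A_inj. rewrite (A_real A) !Z. reflexivity. }
assert (C0 : forall l, nrm A (mkh (coord l v) zero zero zero) = mkh (coord l (nrm A v)) zero zero zero).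
{ intros l. rewrite !(nrm_eq A A_rl A_bd A_comm) !L_real. destruct l; unfold L_, act4; cbn [coord mkh fst snd]; hcrush E. }
intros H. rewrite (h_eta v). assert (Z : forall l, coord l v = zero).
{ intros l. apply R0. rewrite C0 H. destruct l; reflexivity. }
rewrite !Z. reflexivity.
Qed.

Lemma pinv_nrm x : dom (pinv (tot (fun v => A (bar A v)))) (nrm A x) /\
  act (pinv (tot (fun v => A (bar A v)))) (nrm A x) = x.
Proof.
assert (D : dom (pinv (tot (fun v => A (bar A v)))) (nrm A x)).
{ exists x. split; [split; [exact I|reflexivity]|]. intros y [_ Hy]. change (nrm A y = nrm A x) in Hy.
  assert (Z : minus y x = zero).
  { apply nrm_inj. unfold minus. rewrite nrm_plus nrm_opp Hy. apply (plus_opp_r (G := hmod E)). }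
  transitivity (plus (minus y x) x); [rewrite Z; symmetry; apply (plus_zero_l (G := hmod E))|].
  rvec (hmod E). }
split; [exact D|]. apply (pinv_left (tot (fun v => A (bar A v))) x I D).
Qed.

(** The product rule, given the integrals: zf, bf, zg, bg stand for the integrals of
    z f R, f R, z g R, g R, where one of f, g is intrinsic and for it Abar may stand
    on either side. Everything is in the image of A Abar, which commutes with zf and
    bf; the third summand of the right-hand side turns the two terms
    bf Abar bg contributed by F DG and DF G into bf (Abar + A_) bg = bf A_0 bg. *)
Lemma product_core (zf bf zg bg F G DF DG DFG : hmod E -> hmod E) :
  (forall x y, zf (plus x y) = plus (zf x) (zf y)) -> (forall (r : R) x, zf (scal r x) = scal r (zf x)) ->
  (forall x y, bf (plus x y) = plus (bf x) (bf y)) -> (forall (r : R) x, bf (scal r x) = scal r (bf x)) ->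
  (forall x, zf (nrm A x) = nrm A (zf x)) -> (forall x, bf (nrm A x) = nrm A (bf x)) ->
  (forall v, F v = minus (zf v) (bf (bar A v))) ->
  (forall v, G v = minus (zg v) (bar A (bg v))) ->
  (forall v, DF v = nrm A (scal (-2) (bf v))) ->
  (forall v, DG v = nrm A (scal (-2) (bg v))) ->
  (forall v, DFG v = nrm A (scal (-2) (minus (plus (zf (bg v)) (bf (zg v))) (scal 2 (bf (L_ A I0 (bg v))))))) ->
  peq (tot DFG) (product_rhs A F G DF DG).
Proof.
intros zfP zfS bfP bfS zfN bfN HF HG HDF HDG HDFG.
assert (T : forall v, DF (underl A (DG v)) = nrm A (nrm A (scal 4 (bf (underl A (bg v)))))).
{ intros v. rewrite HDF HDG underl_nrm bfN underl_scal bfS -nrm_scal. do 2 apply f_equal.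
  rewrite (scal_assoc (V := hmodC E)). apply (f_equal (fun r : R => scal r (bf (underl A (bg v))))).
  change (-2 * -2 = 4). ring. }
split.
- intros v. split; [|intros _; exact I]. intros _. split; [split; exact I|]. split; [exact I|].
  change (dom (pinv (tot (fun v => A (bar A v)))) (DF (underl A (DG v)))). rewrite T. apply pinv_nrm.
- intros v _. change (DFG v = plus (plus (F (DG v)) (DF (G v)))
    (act (pinv (tot (fun v => A (bar A v)))) (DF (underl A (DG v))))).
  assert (bfO : forall x, bf (opp x) = opp (bf x)).
  { intros x. rewrite -(scal_opp_one (V := hmodC E) x) bfS. apply (scal_opp_one (V := hmodC E)). }
  assert (bfM : bf (minus (zg v) (bar A (bg v))) = minus (bf (zg v)) (bf (bar A (bg v)))).
  { unfold minus. rewrite bfP bfO. reflexivity. }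
  assert (E0 : L_ A I0 (bg v) = plus (bar A (bg v)) (underl A (bg v))).
  { rewrite (bar_eq A A_rl A_bd). set (x := L_ A I0 (bg v)). set (y := underl A (bg v)). rvec (hmod E). }
  rewrite T (proj2 (pinv_nrm _)) HF HDF HDFG HDG HG bar_nrm zfN bfN bfM bar_scal zfS bfS.
  rewrite E0 (bfP (bar A (bg v)) (underl A (bg v))).
  unfold minus. rewrite -!nrm_opp -!nrm_plus. apply (f_equal (nrm A)).
  set (x1 := zf (bg v)). set (x2 := bf (zg v)). set (x3 := bf (bar A (bg v))). set (x4 := bf (underl A (bg v))).
  rvec (hmod E).
Qed.
End ProductCore.

Lemma copen_and (P Q : R * R -> Prop) : copen P -> copen Q -> copen (fun z => P z /\ Q z).
Proof.
intros HP HQ z [Pz Qz]. destruct (HP z Pz) as [d [Hd Hb]]. destruct (HQ z Qz) as [e [He Hc]].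
exists (Rmin d e). split; [apply Rmin_pos; assumption|]. intros w Hw. split.
- apply Hb. eapply Rlt_le_trans; [exact Hw|apply Rmin_l].
- apply Hc. eapply Rlt_le_trans; [exact Hw|apply Rmin_r].
Qed.

Lemma symholo_mono (Om Om' : R * R -> Prop) s : (forall z, Om' z -> Om z) -> symholo Om s -> symholo Om' s.
Proof. intros H [H1 H2]. split; [apply (holo_mono Om Om'); assumption|]. intros z Hz. apply H2, H, Hz. Qed.

(** * The calculi as sums of contour integrals *)

Section Sums.
Context {E : CompleteNormedModule R_AbsRing} (A : hmod E -> hmod E).
Hypothesis A_rl : right_linear (tot A).
Hypothesis A_bd : exists M : R, forall v, norm (A v) <= M * norm v.
Hypothesis A_comm : commuting_components A.
Let Lb := L_blin A A_rl A_bd I0.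
Let Nb := n0_blin A A_rl A_bd.
Let Han := a0_n0 A A_rl A_bd A_comm.

Definition rcalc (G : list (R -> R * R)) (s : R * R -> R * R) (v : hmod E) : hmod E :=
  beta (hmodC E) (L_ A I0) (nrm A) G s v.
Definition zid (s : R * R -> R * R) (z : R * R) : R * R := Cmult z (s z).

Definition left_sum G (rs : list sterm) (v : hmod E) : hmod E :=
  lsum (map (fun r => rcalc G (r_fun r) (lmul (r_coef r) v)) rs).
Definition right_sum G (rs : list sterm) (v : hmod E) : hmod E :=
  lsum (map (fun r => lmul (r_coef r) (rcalc G (r_fun r) v)) rs).
Definition ztimes (rs : list sterm) : list sterm := map (fun r => mksterm (zid (r_fun r)) (r_coef r)) rs.

Section Cycle.
Variables (G : list (R -> R * R)) (D Om : R * R -> Prop).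
Hypotheses (HG : encloses (hmodC E) (L_ A I0) (nrm A) G D) (HO : copen Om) (HDO : forall z, clo D z -> Om z).

Lemma zid_symholo s : symholo Om s -> symholo Om (zid s).
Proof. apply symholo_mult, symholo_id. Qed.

Lemma rcalc_plus s x y : symholo Om s -> rcalc G s (plus x y) = plus (rcalc G s x) (rcalc G s y).
Proof. intros Hs. apply (beta_plus (hmodC E) (L_ A I0) (nrm A) Lb Nb G D Om HG HO HDO s x y Hs). Qed.

Lemma rcalc_scal s (r : R) x : symholo Om s -> rcalc G s (scal r x) = scal r (rcalc G s x).
Proof. intros Hs. apply (beta_scal (hmodC E) (L_ A I0) (nrm A) Lb Nb G D Om HG HO HDO s r x Hs). Qed.

Lemma rcalc_comm s (L : hmod E -> hmod E) x : symholo Om s -> blin (L : hmodC E -> hmodC E) ->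
  (forall v, L (L_ A I0 v) = L_ A I0 (L v)) -> (forall v, L (nrm A v) = nrm A (L v)) ->
  rcalc G s (L x) = L (rcalc G s x).
Proof. intros Hs HL H1 H2. apply (beta_comm (hmodC E) (L_ A I0) (nrm A) Lb Nb G D Om HG HO HDO s L x Hs HL H1 H2). Qed.

Lemma rcalc_bar s x : symholo Om s -> rcalc G s (bar A x) = bar A (rcalc G s x).
Proof.
intros Hs. apply (rcalc_comm s (bar A) x Hs (bar_blin A A_rl A_bd)).
- intros v. apply (bar_L A A_rl A_bd A_comm).
- intros v. apply (bar_nrm A A_rl A_bd A_comm).
Qed.

Lemma rcalc_nrm s x : symholo Om s -> rcalc G s (nrm A x) = nrm A (rcalc G s x).
Proof. intros Hs. apply (rcalc_comm s (nrm A) x Hs Nb); [intros v; symmetry; apply Han|reflexivity]. Qed.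

Lemma rcalc_L0 s x : symholo Om s -> rcalc G s (L_ A I0 x) = L_ A I0 (rcalc G s x).
Proof. intros Hs. apply (rcalc_comm s (L_ A I0) x Hs Lb); [reflexivity|exact Han]. Qed.

Lemma rcalc_mult s t x : symholo Om s -> symholo Om t ->
  rcalc G (fun z => Cmult (s z) (t z)) x =
  minus (plus (rcalc G (zid s) (rcalc G t x)) (rcalc G s (rcalc G (zid t) x))) (scal 2 (rcalc G s (L_ A I0 (rcalc G t x)))).
Proof.
intros Hs Ht. rewrite (rcalc_L0 s _ Hs).
apply (beta_mult (hmodC E) (L_ A I0) (nrm A) Lb Nb Han G D Om HG HO HDO s t x Hs Ht).
Qed.

Lemma lsum_three {I : Type} (z1 b1 b2 : hmod E -> hmod E) (x y : I -> hmod E) (l : list I) :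
  (forall u v, z1 (plus u v) = plus (z1 u) (z1 v)) -> z1 zero = zero ->
  (forall u v, b1 (plus u v) = plus (b1 u) (b1 v)) -> b1 zero = zero ->
  (forall u v, b2 (plus u v) = plus (b2 u) (b2 v)) -> b2 zero = zero ->
  lsum (map (fun i => minus (plus (z1 (x i)) (b1 (y i))) (scal 2 (b2 (x i)))) l) =
  minus (plus (z1 (lsum (map x l))) (b1 (lsum (map y l)))) (scal 2 (b2 (lsum (map x l)))).
Proof.
intros P1 Z1 P2 Z2 P3 Z3. induction l as [|i l IH].
- unfold lsum; cbn [map fold_right]. rewrite Z1 Z2 Z3. rvec (hmod E).
- unfold lsum in *; cbn [map fold_right]. rewrite IH P1 P2 P3. rvec (hmod E).
Qed.

Lemma lsum_plus {I : Type} (f1 f2 f : I -> hmod E) (l : list I) : (forall i, In i l -> f i = plus (f1 i) (f2 i)) ->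
  lsum (map f l) = plus (lsum (map f1 l)) (lsum (map f2 l)).
Proof.
intros H. induction l as [|i l IH].
- unfold lsum; cbn [map fold_right]. symmetry. apply (plus_zero_l (G := hmodC E)).
- unfold lsum in *; cbn [map fold_right]. rewrite IH; [|intros j Hj; apply H; right; exact Hj].
  rewrite (H i (or_introl eq_refl)). apply rplus4.
Qed.

Lemma lsum_map {I : Type} (B : hmod E -> hmod E) (f1 f : I -> hmod E) (l : list I) : blin (B : hmodC E -> hmodC E) ->
  (forall i, In i l -> f i = B (f1 i)) -> lsum (map f l) = B (lsum (map f1 l)).
Proof.
intros HB H. induction l as [|i l IH].
- unfold lsum; cbn [map fold_right]. symmetry. apply (blin_zero _ HB).
- unfold lsum in *; cbn [map fold_right]. rewrite IH; [|intros j Hj; apply H; right; exact Hj].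
  rewrite (H i (or_introl eq_refl)). symmetry. apply (blin_plus _ HB).
Qed.

Variable rs : list sterm.
Hypothesis Hrs : forall r, In r rs -> symholo Om (r_fun r).

Lemma ztimes_symholo r : In r (ztimes rs) -> symholo Om (r_fun r).
Proof. intros H. apply in_map_iff in H. destruct H as [t [<- Ht]]. apply zid_symholo, Hrs, Ht. Qed.

Lemma right_sum_plus x y : right_sum G rs (plus x y) = plus (right_sum G rs x) (right_sum G rs y).
Proof.
apply (lsum_plus (fun r => lmul (r_coef r) (rcalc G (r_fun r) x)) (fun r => lmul (r_coef r) (rcalc G (r_fun r) y))
  (fun r => lmul (r_coef r) (rcalc G (r_fun r) (plus x y)))).
intros r Hr. rewrite (rcalc_plus _ _ _ (Hrs r Hr)) lmul_plus. reflexivity.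
Qed.

Lemma right_sum_scal (k : R) x : right_sum G rs (scal k x) = scal k (right_sum G rs x).
Proof.
apply (lsum_map (scal k) (fun r => lmul (r_coef r) (rcalc G (r_fun r) x)) (fun r => lmul (r_coef r) (rcalc G (r_fun r) (scal k x)))).
- apply (blin_smul (U := hmodC E) (V := hmodC E) k (fun x => x) (blin_id (hmodC E))).
- intros r Hr. rewrite (rcalc_scal _ _ _ (Hrs r Hr)) lmul_scal. reflexivity.
Qed.

Lemma right_sum_nrm x : right_sum G rs (nrm A x) = nrm A (right_sum G rs x).
Proof.
apply (lsum_map (nrm A) (fun r => lmul (r_coef r) (rcalc G (r_fun r) x)) (fun r => lmul (r_coef r) (rcalc G (r_fun r) (nrm A x))) rs Nb).
intros r Hr. rewrite (rcalc_nrm _ _ (Hrs r Hr)). apply (lmul_n0 A A_rl A_bd A_comm).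
Qed.
End Cycle.
End Sums.

Section Final.
Context {E : CompleteNormedModule R_AbsRing} (A : hmod E -> hmod E).
Hypothesis A_rl : right_linear (tot A).
Hypothesis A_bd : exists M : R, forall v, norm (A v) <= M * norm v.
Hypothesis A_comm : commuting_components A.
Let Lb := L_blin A A_rl A_bd I0.
Let Nb := n0_blin A A_rl A_bd.

Lemma left_sum_ztimes G rs v :
  left_sum A G (ztimes rs) v = lsum (map (fun r => rcalc A G (zid (r_fun r)) (lmul (r_coef r) v)) rs).
Proof. apply (f_equal lsum), map_map. Qed.

Lemma right_sum_ztimes G rs v :
  right_sum A G (ztimes rs) v = lsum (map (fun r => lmul (r_coef r) (rcalc A G (zid (r_fun r)) v)) rs).
Proof. apply (f_equal lsum), map_map. Qed.

(** The operators in the theorem come with unrelated contours, in different planes;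
    they are all moved to a common cycle G. *)
Section Moved.
Variables (G : list (R -> R * R)) (D Om : R * R -> Prop) (phi : hfun) (K : contour) (rs : list sterm).
Hypotheses (HG : encloses (hmodC E) (L_ A I0) (nrm A) G D) (HO : copen Om) (HDO : forall z, clo D z -> Om z).
Hypotheses (HK : admissible A phi K) (HKO : forall z, clo (trace (cV K) (cJ K)) z -> Om z)
  (Hrs : forall r, In r rs -> symholo Om (r_fun r)).

Lemma rcalc_indep s v : symholo Om s -> rcalc A (cG K) s v = rcalc A G s v.
Proof.
intros Hs. apply (beta_indep (hmodC E) (L_ A I0) (nrm A) Lb Nb (cG K) (trace (cV K) (cJ K)) G D Om s v); try assumption.
- apply (admissible_encloses A A_rl A_bd A_comm phi K HK).
- apply Hs.
Qed.

Lemma left_sum_indep ts v : (forall r, In r ts -> symholo Om (r_fun r)) -> left_sum A (cG K) ts v = left_sum A G ts v.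
Proof. intros H. apply (f_equal lsum), map_ext_in. intros r Hr. apply rcalc_indep, H, Hr. Qed.

Lemma right_sum_indep ts v : (forall r, In r ts -> symholo Om (r_fun r)) -> right_sum A (cG K) ts v = right_sum A G ts v.
Proof. intros H. apply (f_equal lsum), map_ext_in. intros r Hr. rewrite (rcalc_indep _ _ (H r Hr)). reflexivity. Qed.

Lemma harm_L_sum v : left_rep phi Om rs -> A (bar A (harm_L K A phi v)) = nrm A (scal (-2) (left_sum A G rs v)).
Proof.
intros H. rewrite (harm_L_beta A A_rl A_bd A_comm phi K Om HK HO HKO rs Hrs v H).
change (nrm A (scal (-2) (left_sum A (cG K) rs v)) = nrm A (scal (-2) (left_sum A G rs v))).
rewrite (left_sum_indep rs v Hrs). reflexivity.
Qed.

Lemma harm_R_sum v : right_rep phi Om rs -> A (bar A (harm_R K A phi v)) = nrm A (scal (-2) (right_sum A G rs v)).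
Proof.
intros H. rewrite (harm_R_beta A A_rl A_bd A_comm phi K Om HK HO HKO rs Hrs v H).
change (nrm A (scal (-2) (right_sum A (cG K) rs v)) = nrm A (scal (-2) (right_sum A G rs v))).
rewrite (right_sum_indep rs v Hrs). reflexivity.
Qed.

Lemma S_L_sum v : left_rep phi Om rs ->
  S_L K A phi v = minus (left_sum A G (ztimes rs) v) (bar A (left_sum A G rs v)).
Proof.
intros H. rewrite (S_L_beta A A_rl A_bd A_comm phi K Om HK HO HKO rs Hrs v H).
rewrite -(left_sum_indep rs v Hrs) -(left_sum_indep (ztimes rs) v (ztimes_symholo Om rs Hrs)).
rewrite left_sum_ztimes. reflexivity.
Qed.

Lemma S_R_sum v : right_rep phi Om rs ->
  S_R K A phi v = minus (right_sum A G (ztimes rs) v) (right_sum A G rs (bar A v)).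
Proof.
intros H. rewrite (S_R_beta A A_rl A_bd A_comm phi K Om HK HO HKO rs Hrs v H).
rewrite -(right_sum_indep rs (bar A v) Hrs) -(right_sum_indep (ztimes rs) v (ztimes_symholo Om rs Hrs)).
rewrite right_sum_ztimes. unfold right_sum.
transitivity (plus (lsum (map (fun r => lmul (r_coef r) (rcalc A (cG K) (zid (r_fun r)) v)) rs))
  (lsum (map (fun r => opp (lmul (r_coef r) (rcalc A (cG K) (r_fun r) (bar A v)))) rs))).
- apply (lsum_plus _ (fun r => opp (lmul (r_coef r) (rcalc A (cG K) (r_fun r) (bar A v))))).
  intros r _. rewrite lmul_minus. reflexivity.
- unfold minus. apply f_equal. apply (lsum_map opp (fun r => lmul (r_coef r) (rcalc A (cG K) (r_fun r) (bar A v)))).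
  + apply opp_blin.
  + reflexivity.
Qed.
End Moved.
End Final.

(** * Linearity *)

Definition qsum (l : list quat) : quat := fold_right plus zero l.

Lemma qsum_app (xs ys : list quat) : qsum (xs ++ ys) = plus (qsum xs) (qsum ys).
Proof. apply (lsum_app (E := R_CompleteNormedModule)). Qed.

Lemma qmul_plus_l (x y z : quat) : qmul (plus x y) z = plus (qmul x z) (qmul y z).
Proof. apply (lmul_plus_l (E := R_NormedModule)). Qed.
Lemma qmul_plus_r (x y z : quat) : qmul x (plus y z) = plus (qmul x y) (qmul x z).
Proof. apply (lmul_plus (E := R_NormedModule)). Qed.
Lemma qmul_assoc (x y z : quat) : qmul x (qmul y z) = qmul (qmul x y) z.
Proof. apply (lmul_lmul (E := R_NormedModule)). Qed.

Lemma qsum_mul_r {I : Type} (f : I -> quat) (l : list I) (q : quat) :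
  qmul (qsum (map f l)) q = qsum (map (fun i => qmul (f i) q) l).
Proof.
induction l as [|i l IH]; [apply qmul_zero_l|]. unfold qsum in *; cbn [map fold_right].
rewrite qmul_plus_l IH. reflexivity.
Qed.

Lemma qsum_mul_l {I : Type} (f : I -> quat) (l : list I) (q : quat) :
  qmul q (qsum (map f l)) = qsum (map (fun i => qmul q (f i)) l).
Proof.
induction l as [|i l IH]; [apply qmul_zero_r|]. unfold qsum in *; cbn [map fold_right].
rewrite qmul_plus_r IH. reflexivity.
Qed.

Lemma lim_const (q : quat) : lim_infty (mkhfun (fun _ => True) (fun _ => q)) q.
Proof.
intros eps. exists 0. intros x _. split; [exact I|]. cbn [hval].
rewrite (minus_eq_zero (G := quat)). assert (T := norm_zero (V := quat)). rewrite T. apply cond_pos.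
Qed.

Lemma lim_rscal (f : hfun) (q L : quat) : lim_infty f L -> lim_infty (frscal f q) (qmul L q).
Proof.
intros H eps. destruct (lim_mul _ _ _ _ H (lim_const q) eps) as [M HM]. exists M. intros x Hx.
destruct (HM x Hx) as [[D _] B]. split; [exact D|exact B].
Qed.

Lemma lim_lscal (f : hfun) (q L : quat) : lim_infty f L -> lim_infty (flscal q f) (qmul q L).
Proof.
intros H eps. destruct (lim_mul _ _ _ _ (lim_const q) H eps) as [M HM]. exists M. intros x Hx.
destruct (HM x Hx) as [[_ D] B]. split; [exact D|exact B].
Qed.

Definition scaled_r (q : quat) (r : sterm) : sterm := mksterm (r_fun r) (qmul (r_coef r) q).
Definition scaled_l (q : quat) (r : sterm) : sterm := mksterm (r_fun r) (qmul q (r_coef r)).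
Definition times (s : R * R -> R * R) (r : sterm) : sterm := mksterm (fun z => Cmult (s z) (r_fun r z)) (r_coef r).
Definition times_r (s : R * R -> R * R) (r : sterm) : sterm := mksterm (fun z => Cmult (r_fun r z) (s z)) (r_coef r).

Section Final.
Context {E : CompleteNormedModule R_AbsRing} (A : hmod E -> hmod E).
Hypothesis A_rl : right_linear (tot A).
Hypothesis A_bd : exists M : R, forall v, norm (A v) <= M * norm v.
Hypothesis A_comm : commuting_components A.
Variable a : R.

Lemma admissible_odom (f H : hfun) K : (forall q, hdom H q -> hdom f q) -> slice_dom (hdom f) ->
  admissible A (transform a H) K -> forall z, clo (trace (cV K) (cJ K)) z -> odom a (hdom f) z.
Proof.
intros Hsub Hf HK z Hz. destruct (admissible_encloses A A_rl A_bd A_comm _ K HK) as [_ [HJ [_ Hd]]].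
apply (odom_of_hdom a f (cJ K) z Hf HJ). destruct (Hd z Hz) as [E0|D]; [left; exact E0|right; apply Hsub, D].
Qed.

Lemma nrm_comb x y : nrm A (scal (-2) (plus x y)) = plus (nrm A (scal (-2) x)) (nrm A (scal (-2) y)).
Proof. rewrite (scal_distr_l (V := hmodC E)). apply (nrm_plus A A_rl A_bd). Qed.

Lemma left_sum_app G r1 r2 v : left_sum A G (r1 ++ r2) v = plus (left_sum A G r1 v) (left_sum A G r2 v).
Proof. exact (eq_trans (f_equal lsum (map_app _ r1 r2)) (lsum_app _ _)). Qed.

Lemma right_sum_app G r1 r2 v : right_sum A G (r1 ++ r2) v = plus (right_sum A G r1 v) (right_sum A G r2 v).
Proof. exact (eq_trans (f_equal lsum (map_app _ r1 r2)) (lsum_app _ _)). Qed.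

Lemma left_sum_scaled G q rs v : left_sum A G (map (scaled_r q) rs) v = left_sum A G rs (lmul q v).
Proof.
transitivity (lsum (map (fun r => rcalc A G (r_fun r) (lmul (qmul (r_coef r) q) v)) rs)).
- exact (f_equal lsum (map_map (scaled_r q) _ rs)).
- apply (f_equal lsum), map_ext. intros r. apply f_equal. symmetry. apply lmul_lmul.
Qed.

Lemma right_sum_scaled G q rs v : right_sum A G (map (scaled_l q) rs) v = lmul q (right_sum A G rs v).
Proof.
transitivity (lsum (map (fun r => lmul (qmul q (r_coef r)) (rcalc A G (r_fun r) v)) rs)).
- exact (f_equal lsum (map_map (scaled_l q) _ rs)).
- apply (lsum_map (lmul q) (fun r => lmul (r_coef r) (rcalc A G (r_fun r) v))); [apply blin_lmul|].
  intros r _. symmetry. apply lmul_lmul.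
Qed.

Lemma linear_left (f g : hfun) (q : quat) (Kf Kg KH : contour) :
  let H := fadd (frscal f q) g in
  left_sh f -> (exists l, lim_infty f l) -> left_sh g -> (exists l, lim_infty g l) ->
  admissible A (transform a f) Kf -> admissible A (transform a g) Kg -> admissible A (transform a H) KH ->
  forall v, A (bar A (harm_L KH A (transform a H) v)) =
    plus (A (bar A (harm_L Kf A (transform a f) (lmul q v)))) (A (bar A (harm_L Kg A (transform a g) v))).
Proof.
intros H Lf If Lg Ig Af Ag AH v.
destruct (left_decomposition a f Lf If) as [Of [rf [Sf Rf]]]. destruct (left_decomposition a g Lg Ig) as [Og [rg [Sg Rg]]].
destruct (admissible_encloses A A_rl A_bd A_comm _ KH AH) as [HG _].
assert (Hf : forall z, clo (trace (cV KH) (cJ KH)) z -> odom a (hdom f) z).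
{ apply (admissible_odom f H KH); [intros x D; apply D|apply Lf|exact AH]. }
assert (Hg : forall z, clo (trace (cV KH) (cJ KH)) z -> odom a (hdom g) z).
{ apply (admissible_odom g H KH); [intros x D; apply D|apply Lg|exact AH]. }
set (G := cG KH) in *. set (D := trace (cV KH) (cJ KH)) in *.
rewrite (harm_L_sum A A_rl A_bd A_comm G D _ _ Kf rf HG Of Hf Af (admissible_odom f f Kf (fun _ d => d) (proj1 Lf) Af) Sf (lmul q v) Rf).
rewrite (harm_L_sum A A_rl A_bd A_comm G D _ _ Kg rg HG Og Hg Ag (admissible_odom g g Kg (fun _ d => d) (proj1 Lg) Ag) Sg v Rg).
set (Om := fun z => odom a (hdom f) z /\ odom a (hdom g) z).
assert (HD : forall z, clo D z -> Om z) by (intros z Hz; split; [apply Hf, Hz|apply Hg, Hz]).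
rewrite (harm_L_sum A A_rl A_bd A_comm G D Om (transform a H) KH (map (scaled_r q) rf ++ rg) HG (copen_and _ _ Of Og) HD AH HD).
- rewrite -nrm_comb. apply f_equal, f_equal. rewrite left_sum_app left_sum_scaled. reflexivity.
- intros r Hr. apply in_app_iff in Hr. destruct Hr as [Hr|Hr].
  + apply in_map_iff in Hr. destruct Hr as [t [<- Ht]]. apply (symholo_mono (odom a (hdom f))); [intros z [Z _]; exact Z|exact (Sf t Ht)].
  + apply (symholo_mono (odom a (hdom g))); [intros z [_ Z]; exact Z|exact (Sg r Hr)].
- intros J z HJ [Oz1 Oz2].
  assert (Vf := val_infty_spec f If). assert (Vg := val_infty_spec g Ig).
  rewrite (transform_op a (frscal f q) g H plus).
  + rewrite (transform_op a f f (frscal f q) (fun x _ => qmul x q)); [|apply val_infty_eq, lim_rscal, Vf|reflexivity].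
    rewrite (Rf J z HJ Oz1) (Rg J z HJ Oz2) map_app. fold (qsum (map (fun r => qmul (qpt J (r_fun r z)) (r_coef r)) rf)).
    rewrite qsum_mul_r. transitivity (qsum (map (fun r => qmul (qpt J (r_fun r z)) (r_coef r)) (map (scaled_r q) rf) ++
      map (fun r => qmul (qpt J (r_fun r z)) (r_coef r)) rg)); [|reflexivity].
    rewrite qsum_app map_map. apply (f_equal (fun x => plus x _)). apply (f_equal qsum), map_ext. intros r.
    symmetry. apply qmul_assoc.
  + rewrite (val_infty_eq (frscal f q) (qmul (val_infty f) q) (lim_rscal _ _ _ Vf)).
    apply val_infty_eq, lim_add; [apply lim_rscal, Vf|exact Vg].
  + reflexivity.
Qed.

Lemma linear_right (f g : hfun) (q : quat) (Kf Kg KH : contour) :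
  let H := fadd (flscal q f) g in
  right_sh f -> (exists l, lim_infty f l) -> right_sh g -> (exists l, lim_infty g l) ->
  admissible A (transform a f) Kf -> admissible A (transform a g) Kg -> admissible A (transform a H) KH ->
  forall v, A (bar A (harm_R KH A (transform a H) v)) =
    plus (lmul q (A (bar A (harm_R Kf A (transform a f) v)))) (A (bar A (harm_R Kg A (transform a g) v))).
Proof.
intros H Lf If Lg Ig Af Ag AH v.
destruct (right_decomposition a f Lf If) as [Of [rf [Sf Rf]]]. destruct (right_decomposition a g Lg Ig) as [Og [rg [Sg Rg]]].
destruct (admissible_encloses A A_rl A_bd A_comm _ KH AH) as [HG _].
assert (Hf : forall z, clo (trace (cV KH) (cJ KH)) z -> odom a (hdom f) z).
{ apply (admissible_odom f H KH); [intros x D; apply D|apply Lf|exact AH]. }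
assert (Hg : forall z, clo (trace (cV KH) (cJ KH)) z -> odom a (hdom g) z).
{ apply (admissible_odom g H KH); [intros x D; apply D|apply Lg|exact AH]. }
set (G := cG KH) in *. set (D := trace (cV KH) (cJ KH)) in *.
rewrite (harm_R_sum A A_rl A_bd A_comm G D _ _ Kf rf HG Of Hf Af (admissible_odom f f Kf (fun _ d => d) (proj1 Lf) Af) Sf v Rf).
rewrite (harm_R_sum A A_rl A_bd A_comm G D _ _ Kg rg HG Og Hg Ag (admissible_odom g g Kg (fun _ d => d) (proj1 Lg) Ag) Sg v Rg).
set (Om := fun z => odom a (hdom f) z /\ odom a (hdom g) z).
assert (HD : forall z, clo D z -> Om z) by (intros z Hz; split; [apply Hf, Hz|apply Hg, Hz]).
rewrite (harm_R_sum A A_rl A_bd A_comm G D Om (transform a H) KH (map (scaled_l q) rf ++ rg) HG (copen_and _ _ Of Og) HD AH HD).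
- rewrite (lmul_n0 A A_rl A_bd A_comm) lmul_scal -nrm_comb. apply f_equal, f_equal. rewrite right_sum_app right_sum_scaled. reflexivity.
- intros r Hr. apply in_app_iff in Hr. destruct Hr as [Hr|Hr].
  + apply in_map_iff in Hr. destruct Hr as [t [<- Ht]]. apply (symholo_mono (odom a (hdom f))); [intros z [Z _]; exact Z|exact (Sf t Ht)].
  + apply (symholo_mono (odom a (hdom g))); [intros z [_ Z]; exact Z|exact (Sg r Hr)].
- intros J z HJ [Oz1 Oz2].
  assert (Vf := val_infty_spec f If). assert (Vg := val_infty_spec g Ig).
  rewrite (transform_op a (flscal q f) g H plus).
  + rewrite (transform_op a f f (flscal q f) (fun x _ => qmul q x)); [|apply val_infty_eq, lim_lscal, Vf|reflexivity].
    rewrite (Rf J z HJ Oz1) (Rg J z HJ Oz2) map_app. fold (qsum (map (fun r => qmul (r_coef r) (qpt J (r_fun r z))) rf)).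
    rewrite qsum_mul_l. transitivity (qsum (map (fun r => qmul (r_coef r) (qpt J (r_fun r z))) (map (scaled_l q) rf) ++
      map (fun r => qmul (r_coef r) (qpt J (r_fun r z))) rg)); [|reflexivity].
    rewrite qsum_app map_map. apply (f_equal (fun x => plus x _)). apply (f_equal qsum), map_ext. intros r.
    apply qmul_assoc.
  + rewrite (val_infty_eq (flscal q f) (qmul q (val_infty f)) (lim_lscal _ _ _ Vf)).
    apply val_infty_eq, lim_add; [apply lim_lscal, Vf|exact Vg].
  + reflexivity.
Qed.
End Final.

(** * Products with an intrinsic function *)

Lemma qmul_1_r (x : quat) : qmul x (ofR 1) = x.
Proof.
destruct x as [x0 [x1 [x2 x3]]]. unfold qmul, ofR, lmul, lin4, qc; cbn [coord mkh fst snd].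
apply (mkh_eq (E := R_NormedModule)); rgoal; ring.
Qed.
Lemma qmul_1_l (x : quat) : qmul (ofR 1) x = x.
Proof.
destruct x as [x0 [x1 [x2 x3]]]. unfold qmul, ofR, lmul, lin4, qc; cbn [coord mkh fst snd].
apply (mkh_eq (E := R_NormedModule)); rgoal; ring.
Qed.

Definition single (s : R * R -> R * R) : list sterm := mksterm s (ofR 1) :: nil.

Lemma single_left_rep phi Om s : (forall J z, imag_unit J -> Om z -> hval phi (qpt J z) = qpt J (s z)) ->
  left_rep phi Om (single s).
Proof.
intros H J z HJ Oz. rewrite (H J z HJ Oz). cbn [single map fold_right r_fun r_coef].
rewrite qmul_1_r. symmetry. apply (plus_zero_r (G := quat)).
Qed.

Lemma single_right_rep phi Om s : (forall J z, imag_unit J -> Om z -> hval phi (qpt J z) = qpt J (s z)) ->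
  right_rep phi Om (single s).
Proof.
intros H J z HJ Oz. rewrite (H J z HJ Oz). cbn [single map fold_right r_fun r_coef].
rewrite qmul_1_l. symmetry. apply (plus_zero_r (G := quat)).
Qed.

Lemma single_symholo Om s : symholo Om s -> forall r, In r (single s) -> symholo Om (r_fun r).
Proof. intros H r [<-|[]]. exact H. Qed.

Section Final.
Context {E : CompleteNormedModule R_AbsRing} (A : hmod E -> hmod E).
Hypothesis A_rl : right_linear (tot A).
Hypothesis A_bd : exists M : R, forall v, norm (A v) <= M * norm v.
Hypothesis A_comm : commuting_components A.

Lemma lmul_1 (v : hmod E) : lmul (ofR 1) v = v.
Proof. rewrite lmul_ofR. apply (scal_one (V := hmodC E)). Qed.

Lemma left_sum_single G s v : left_sum A G (single s) v = rcalc A G s v.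
Proof.
transitivity (plus (rcalc A G s (lmul (ofR 1) v)) zero); [reflexivity|].
rewrite lmul_1. apply (plus_zero_r (G := hmodC E)).
Qed.

Lemma right_sum_single G s v : right_sum A G (single s) v = rcalc A G s v.
Proof.
transitivity (plus (lmul (ofR 1) (rcalc A G s v)) zero); [reflexivity|].
rewrite lmul_1. apply (plus_zero_r (G := hmodC E)).
Qed.

Section Cycle.
Variables (G : list (R -> R * R)) (D Om : R * R -> Prop).
Hypotheses (HG : encloses (hmodC E) (L_ A I0) (nrm A) G D) (HO : copen Om) (HDO : forall z, clo D z -> Om z).

Lemma rcalc_zero s : symholo Om s -> rcalc A G s zero = zero.
Proof.
intros Hs. assert (Z : (zero : hmod E) = scal 0 zero) by (symmetry; apply (scal_zero_r (V := hmodC E))).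
rewrite {1}Z (rcalc_scal A A_rl A_bd G D Om HG HO HDO s 0 zero Hs). apply (scal_zero_l (V := hmodC E)).
Qed.

(** [beta_mult] for s and each of the components of the other factor. *)
Lemma left_sum_times s rs v : symholo Om s -> (forall r, In r rs -> symholo Om (r_fun r)) ->
  left_sum A G (map (times s) rs) v =
  minus (plus (rcalc A G (zid s) (left_sum A G rs v)) (rcalc A G s (left_sum A G (ztimes rs) v)))
        (scal 2 (rcalc A G s (L_ A I0 (left_sum A G rs v)))).
Proof.
intros Hs Hrs. assert (Hzs := zid_symholo Om s Hs).
transitivity (lsum (map (fun r => minus (plus (rcalc A G (zid s) (rcalc A G (r_fun r) (lmul (r_coef r) v)))
   (rcalc A G s (rcalc A G (zid (r_fun r)) (lmul (r_coef r) v))))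
   (scal 2 (rcalc A G s (L_ A I0 (rcalc A G (r_fun r) (lmul (r_coef r) v)))))) rs)).
- transitivity (lsum (map (fun r => rcalc A G (fun z => Cmult (s z) (r_fun r z)) (lmul (r_coef r) v)) rs)).
  + exact (f_equal lsum (map_map (times s) _ rs)).
  + apply (f_equal lsum), map_ext_in. intros r Hr.
    apply (rcalc_mult A A_rl A_bd A_comm G D Om HG HO HDO s (r_fun r) _ Hs (Hrs r Hr)).
- rewrite left_sum_ztimes.
  apply (lsum_three (rcalc A G (zid s)) (rcalc A G s) (fun x => rcalc A G s (L_ A I0 x))
    (fun r => rcalc A G (r_fun r) (lmul (r_coef r) v)) (fun r => rcalc A G (zid (r_fun r)) (lmul (r_coef r) v)) rs).
  + intros x y. apply (rcalc_plus A A_rl A_bd G D Om HG HO HDO _ x y Hzs).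
  + apply (rcalc_zero _ Hzs).
  + intros x y. apply (rcalc_plus A A_rl A_bd G D Om HG HO HDO _ x y Hs).
  + apply (rcalc_zero _ Hs).
  + intros x y. rewrite (L_plus A A_rl A_bd). apply (rcalc_plus A A_rl A_bd G D Om HG HO HDO _ _ _ Hs).
  + rewrite (blin_zero _ (L_blin A A_rl A_bd I0)). apply (rcalc_zero _ Hs).
Qed.

Lemma right_sum_times s rs v : symholo Om s -> (forall r, In r rs -> symholo Om (r_fun r)) ->
  right_sum A G (map (times_r s) rs) v =
  minus (plus (right_sum A G (ztimes rs) (rcalc A G s v)) (right_sum A G rs (rcalc A G (zid s) v)))
        (scal 2 (right_sum A G rs (L_ A I0 (rcalc A G s v)))).
Proof.
intros Hs Hrs. set (x := rcalc A G s v). set (y := rcalc A G (zid s) v).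
transitivity (lsum (map (fun r => minus (plus (lmul (r_coef r) (rcalc A G (zid (r_fun r)) x)) (lmul (r_coef r) (rcalc A G (r_fun r) y)))
   (scal 2 (lmul (r_coef r) (rcalc A G (r_fun r) (L_ A I0 x))))) rs)).
- transitivity (lsum (map (fun r => lmul (r_coef r) (rcalc A G (fun z => Cmult (r_fun r z) (s z)) v)) rs)).
  + exact (f_equal lsum (map_map (times_r s) _ rs)).
  + apply (f_equal lsum), map_ext_in. intros r Hr.
    rewrite (rcalc_mult A A_rl A_bd A_comm G D Om HG HO HDO (r_fun r) s v (Hrs r Hr) Hs).
    rewrite lmul_minus lmul_plus lmul_scal. reflexivity.
- rewrite right_sum_ztimes.
  rewrite (lsum_plus (fun r => plus (lmul (r_coef r) (rcalc A G (zid (r_fun r)) x)) (lmul (r_coef r) (rcalc A G (r_fun r) y)))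
    (fun r => opp (scal 2 (lmul (r_coef r) (rcalc A G (r_fun r) (L_ A I0 x)))))
    (fun r => minus (plus (lmul (r_coef r) (rcalc A G (zid (r_fun r)) x)) (lmul (r_coef r) (rcalc A G (r_fun r) y)))
     (scal 2 (lmul (r_coef r) (rcalc A G (r_fun r) (L_ A I0 x))))) rs); [|reflexivity].
  unfold minus. apply (f_equal2 plus).
  + apply (lsum_plus (fun r => lmul (r_coef r) (rcalc A G (zid (r_fun r)) x)) (fun r => lmul (r_coef r) (rcalc A G (r_fun r) y))).
    reflexivity.
  + apply (lsum_map (fun w => opp (scal 2 w)) (fun r => lmul (r_coef r) (rcalc A G (r_fun r) (L_ A I0 x)))).
    * apply (blin_neg (U := hmodC E) (V := hmodC E) (fun w => scal 2 w)).
      apply (blin_smul (U := hmodC E) (V := hmodC E) 2 (fun w => w) (blin_id (hmodC E))).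
    * reflexivity.
Qed.
End Cycle.
End Final.

(** * The product rule *)

Section Products.
Context {E : CompleteNormedModule R_AbsRing} (A : hmod E -> hmod E).
Hypothesis A_rl : right_linear (tot A).
Hypothesis A_bd : exists M : R, forall v, norm (A v) <= M * norm v.
Hypothesis A_comm : commuting_components A.
Hypothesis A_inj : forall v, A v = zero -> v = zero.
Variable a : R.

Lemma product_left (f g : hfun) (F Gg DF DG DFG : hmod E -> hmod E) (KF KG KDF KDG KH : contour) :
  let H := fmul f g in
  intrinsic_sh f -> (exists l, lim_infty f l) -> left_sh g -> (exists l, lim_infty g l) ->
  admissible A (transform a f) KF -> (forall v, F v = S_L KF A (transform a f) v) ->
  admissible A (transform a g) KG -> (forall v, Gg v = S_L KG A (transform a g) v) ->
  admissible A (transform a f) KDF -> (forall v, DF v = A (bar A (harm_L KDF A (transform a f) v))) ->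
  admissible A (transform a g) KDG -> (forall v, DG v = A (bar A (harm_L KDG A (transform a g) v))) ->
  admissible A (transform a H) KH -> (forall v, DFG v = A (bar A (harm_L KH A (transform a H) v))) ->
  peq (tot DFG) (product_rhs A F Gg DF DG).
Proof.
intros H Lf If Lg Ig AF EF AG EG ADF EDF ADG EDG AH EH.
destruct (intrinsic_component a f Lf If) as [Of [s [Ss Rs]]]. destruct (left_decomposition a g Lg Ig) as [Og [rg [Sg Rg]]].
destruct (admissible_encloses A A_rl A_bd A_comm _ KH AH) as [HG _].
assert (Hf : forall z, clo (trace (cV KH) (cJ KH)) z -> odom a (hdom f) z).
{ apply (admissible_odom A A_rl A_bd A_comm a f H KH); [intros x D; apply D|apply Lf|exact AH]. }
assert (Hg : forall z, clo (trace (cV KH) (cJ KH)) z -> odom a (hdom g) z).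
{ apply (admissible_odom A A_rl A_bd A_comm a g H KH); [intros x D; apply D|apply Lg|exact AH]. }
set (G := cG KH) in *. set (D := trace (cV KH) (cJ KH)) in *.
assert (Df := fun K => admissible_odom A A_rl A_bd A_comm a f f K (fun _ d => d) (proj1 Lf)).
assert (Dg := fun K => admissible_odom A A_rl A_bd A_comm a g g K (fun _ d => d) (proj1 Lg)).
assert (Sf := single_symholo _ s Ss). assert (Rf := single_left_rep _ _ s Rs).
set (Om := fun z => odom a (hdom f) z /\ odom a (hdom g) z).
assert (HD : forall z, clo D z -> Om z) by (intros z Hz; split; [apply Hf, Hz|apply Hg, Hz]).
assert (HO := copen_and _ _ Of Og).
assert (Ss' : symholo Om s) by (apply (symholo_mono (odom a (hdom f))); [intros z [Z _]; exact Z|exact Ss]).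
assert (Sg' : forall r, In r rg -> symholo Om (r_fun r)).
{ intros r Hr. apply (symholo_mono (odom a (hdom g))); [intros z [_ Z]; exact Z|exact (Sg r Hr)]. }
apply (product_core A A_rl A_bd A_comm A_inj (rcalc A G (zid s)) (rcalc A G s) (left_sum A G (ztimes rg)) (left_sum A G rg)).
- intros x y. apply (rcalc_plus A A_rl A_bd G D Om HG HO HD _ x y (zid_symholo Om s Ss')).
- intros r x. apply (rcalc_scal A A_rl A_bd G D Om HG HO HD _ r x (zid_symholo Om s Ss')).
- intros x y. apply (rcalc_plus A A_rl A_bd G D Om HG HO HD _ x y Ss').
- intros r x. apply (rcalc_scal A A_rl A_bd G D Om HG HO HD _ r x Ss').
- intros x. apply (rcalc_nrm A A_rl A_bd A_comm G D Om HG HO HD _ x (zid_symholo Om s Ss')).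
- intros x. apply (rcalc_nrm A A_rl A_bd A_comm G D Om HG HO HD _ x Ss').
- intros v. rewrite EF (S_L_sum A A_rl A_bd A_comm G D _ _ KF (single s) HG Of Hf AF (Df KF AF) Sf v Rf).
  change (ztimes (single s)) with (single (zid s)). rewrite !left_sum_single.
  rewrite (rcalc_bar A A_rl A_bd A_comm G D Om HG HO HD s v Ss'). reflexivity.
- intros v. rewrite EG. apply (S_L_sum A A_rl A_bd A_comm G D _ _ KG rg HG Og Hg AG (Dg KG AG) Sg v Rg).
- intros v. rewrite EDF (harm_L_sum A A_rl A_bd A_comm G D _ _ KDF (single s) HG Of Hf ADF (Df KDF ADF) Sf v Rf).
  rewrite left_sum_single. reflexivity.
- intros v. rewrite EDG. apply (harm_L_sum A A_rl A_bd A_comm G D _ _ KDG rg HG Og Hg ADG (Dg KDG ADG) Sg v Rg).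
- intros v. rewrite EH.
  rewrite (harm_L_sum A A_rl A_bd A_comm G D Om (transform a H) KH (map (times s) rg) HG HO HD AH HD).
  + rewrite (left_sum_times A A_rl A_bd A_comm G D Om HG HO HD s rg v Ss' Sg'). reflexivity.
  + intros r Hr. apply in_map_iff in Hr. destruct Hr as [t [<- Ht]]. apply symholo_mult; [exact Ss'|exact (Sg' t Ht)].
  + intros J z HJ [Oz1 Oz2]. rewrite (transform_op a f g H qmul).
    * rewrite (Rs J z HJ Oz1) (Rg J z HJ Oz2).
      transitivity (qsum (map (fun r => qmul (qpt J (s z)) (qmul (qpt J (r_fun r z)) (r_coef r))) rg)); [apply (qsum_mul_l _ rg)|].
      rewrite map_map. apply (f_equal qsum), map_ext. intros r. rewrite qmul_assoc (qpt_mult J _ _ HJ). reflexivity.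
    * apply val_infty_eq, lim_mul; apply val_infty_spec; assumption.
    * reflexivity.
Qed.

Lemma product_right (f g : hfun) (F Gg DF DG DFG : hmod E -> hmod E) (KF KG KDF KDG KH : contour) :
  let H := fmul f g in
  right_sh f -> (exists l, lim_infty f l) -> intrinsic_sh g -> (exists l, lim_infty g l) ->
  admissible A (transform a f) KF -> (forall v, F v = S_R KF A (transform a f) v) ->
  admissible A (transform a g) KG -> (forall v, Gg v = S_R KG A (transform a g) v) ->
  admissible A (transform a f) KDF -> (forall v, DF v = A (bar A (harm_R KDF A (transform a f) v))) ->
  admissible A (transform a g) KDG -> (forall v, DG v = A (bar A (harm_R KDG A (transform a g) v))) ->
  admissible A (transform a H) KH -> (forall v, DFG v = A (bar A (harm_R KH A (transform a H) v))) ->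
  peq (tot DFG) (product_rhs A F Gg DF DG).
Proof.
intros H Lf If Lg Ig AF EF AG EG ADF EDF ADG EDG AH EH.
destruct (right_decomposition a f Lf If) as [Of [rf [Sf Rf]]]. destruct (intrinsic_component a g Lg Ig) as [Og [s [Ss Rs]]].
destruct (admissible_encloses A A_rl A_bd A_comm _ KH AH) as [HG _].
assert (Hf : forall z, clo (trace (cV KH) (cJ KH)) z -> odom a (hdom f) z).
{ apply (admissible_odom A A_rl A_bd A_comm a f H KH); [intros x D; apply D|apply Lf|exact AH]. }
assert (Hg : forall z, clo (trace (cV KH) (cJ KH)) z -> odom a (hdom g) z).
{ apply (admissible_odom A A_rl A_bd A_comm a g H KH); [intros x D; apply D|apply Lg|exact AH]. }
set (G := cG KH) in *. set (D := trace (cV KH) (cJ KH)) in *.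
assert (Df := fun K => admissible_odom A A_rl A_bd A_comm a f f K (fun _ d => d) (proj1 Lf)).
assert (Dg := fun K => admissible_odom A A_rl A_bd A_comm a g g K (fun _ d => d) (proj1 Lg)).
assert (Sg := single_symholo _ s Ss). assert (Rg := single_right_rep _ _ s Rs).
set (Om := fun z => odom a (hdom f) z /\ odom a (hdom g) z).
assert (HD : forall z, clo D z -> Om z) by (intros z Hz; split; [apply Hf, Hz|apply Hg, Hz]).
assert (HO := copen_and _ _ Of Og).
assert (Ss' : symholo Om s) by (apply (symholo_mono (odom a (hdom g))); [intros z [_ Z]; exact Z|exact Ss]).
assert (Sf' : forall r, In r rf -> symholo Om (r_fun r)).
{ intros r Hr. apply (symholo_mono (odom a (hdom f))); [intros z [Z _]; exact Z|exact (Sf r Hr)]. }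
assert (Sz' := ztimes_symholo Om rf Sf').
apply (product_core A A_rl A_bd A_comm A_inj (right_sum A G (ztimes rf)) (right_sum A G rf) (rcalc A G (zid s)) (rcalc A G s)).
- intros x y. apply (right_sum_plus A A_rl A_bd G D Om HG HO HD _ Sz').
- intros r x. apply (right_sum_scal A A_rl A_bd G D Om HG HO HD _ Sz').
- intros x y. apply (right_sum_plus A A_rl A_bd G D Om HG HO HD _ Sf').
- intros r x. apply (right_sum_scal A A_rl A_bd G D Om HG HO HD _ Sf').
- intros x. apply (right_sum_nrm A A_rl A_bd A_comm G D Om HG HO HD _ Sz').
- intros x. apply (right_sum_nrm A A_rl A_bd A_comm G D Om HG HO HD _ Sf').
- intros v. rewrite EF. apply (S_R_sum A A_rl A_bd A_comm G D _ _ KF rf HG Of Hf AF (Df KF AF) Sf v Rf).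
- intros v. rewrite EG (S_R_sum A A_rl A_bd A_comm G D _ _ KG (single s) HG Og Hg AG (Dg KG AG) Sg v Rg).
  change (ztimes (single s)) with (single (zid s)). rewrite !right_sum_single.
  rewrite (rcalc_bar A A_rl A_bd A_comm G D Om HG HO HD s v Ss'). reflexivity.
- intros v. rewrite EDF. apply (harm_R_sum A A_rl A_bd A_comm G D _ _ KDF rf HG Of Hf ADF (Df KDF ADF) Sf v Rf).
- intros v. rewrite EDG (harm_R_sum A A_rl A_bd A_comm G D _ _ KDG (single s) HG Og Hg ADG (Dg KDG ADG) Sg v Rg).
  rewrite right_sum_single. reflexivity.
- intros v. rewrite EH.
  rewrite (harm_R_sum A A_rl A_bd A_comm G D Om (transform a H) KH (map (times_r s) rf) HG HO HD AH HD).
  + rewrite (right_sum_times A A_rl A_bd A_comm G D Om HG HO HD s rf v Ss' Sf'). reflexivity.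
  + intros r Hr. apply in_map_iff in Hr. destruct Hr as [t [<- Ht]]. apply symholo_mult; [exact (Sf' t Ht)|exact Ss'].
  + intros J z HJ [Oz1 Oz2]. rewrite (transform_op a f g H qmul).
    * rewrite (Rf J z HJ Oz1) (Rs J z HJ Oz2).
      transitivity (qsum (map (fun r => qmul (qmul (r_coef r) (qpt J (r_fun r z))) (qpt J (s z))) rf)); [apply (qsum_mul_r _ rf)|].
      rewrite map_map. apply (f_equal qsum), map_ext. intros r. rewrite -qmul_assoc (qpt_mult J _ _ HJ). reflexivity.
    * apply val_infty_eq, lim_mul; apply val_infty_spec; assumption.
    * reflexivity.
Qed.
End Products.

(** T - alpha recovers v from its image. *)
Lemma resolvent_inj {E : NormedModule R_AbsRing} (T : idx -> pop E) (alpha : R) : in_B (resolvent T alpha) ->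
  forall v, act (resolvent T alpha) v = zero -> v = zero.
Proof.
intros [HD [[D0 [_ HR]] _]] v Hv.
set (P := padd (quatop T) (tot (fun v => opp (scal alpha v)))) in *.
assert (Z : act (resolvent T alpha) zero = zero).
{ assert (Z0 : (zero : hmod E) = rmul zero (ofR 0)) by (rewrite rmul_ofR; symmetry; apply (scal_zero_l (V := hmod E))).
  rewrite {1}Z0 (proj2 (HR (ofR 0) zero (HD zero))) rmul_ofR. apply (scal_zero_l (V := hmod E)). }
transitivity (act P (act (pinv P) v)); [symmetry; apply (pinv_spec P v (HD v))|].
transitivity (act P (act (pinv P) zero)); [|apply (pinv_spec P zero (HD zero))].
apply (f_equal (act P)). exact (eq_trans Hv (eq_sym Z)).
Qed.

Theorem theorem3p13 :
  forall (XR : CompleteNormedModule R_AbsRing) (T : idx -> pop XR) (alpha : R),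
    KC T ->
    (forall l, real_spectrum (T l)) ->
    (exists l, zero_op (T l)) ->
    rhoS T (ofR alpha) ->
    in_B (resolvent T alpha) ->
    commuting_components (act (resolvent T alpha)) ->
    (forall (f g : hfun) (a : quat) (DF DG DH : hmod XR -> hmod XR),
       SHL T f -> SHL T g ->
       is_harm_L T alpha f DF -> is_harm_L T alpha g DG ->
       is_harm_L T alpha (fadd (frscal f a) g) DH ->
       forall v, DH v = plus (DF (lmul a v)) (DG v)) /\
    (forall (f g : hfun) (a : quat) (DF DG DH : hmod XR -> hmod XR),
       SHR T f -> SHR T g ->
       is_harm_R T alpha f DF -> is_harm_R T alpha g DG ->
       is_harm_R T alpha (fadd (flscal a f) g) DH ->
       forall v, DH v = plus (lmul a (DF v)) (DG v)) /\
    (forall (f g : hfun) (F G DF DG DFG : hmod XR -> hmod XR),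
       SHN T f -> SHL T g ->
       is_S_L T alpha f F -> is_S_L T alpha g G ->
       is_harm_L T alpha f DF -> is_harm_L T alpha g DG ->
       is_harm_L T alpha (fmul f g) DFG ->
       peq (tot DFG) (product_rhs (act (resolvent T alpha)) F G DF DG)) /\
    (forall (f g : hfun) (F G DF DG DFG : hmod XR -> hmod XR),
       SHR T f -> SHN T g ->
       is_S_R T alpha f F -> is_S_R T alpha g G ->
       is_harm_R T alpha f DF -> is_harm_R T alpha g DG ->
       is_harm_R T alpha (fmul f g) DFG ->
       peq (tot DFG) (product_rhs (act (resolvent T alpha)) F G DF DG)).
Proof.
intros XR T alpha _ _ _ _ HB HC. assert (Inj := resolvent_inj T alpha HB).
destruct HB as [HD [[_ [HP HR]] HM]]. set (A := act (resolvent T alpha)) in *.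
assert (A_rl : right_linear (tot A)).
{ split; [exact I|]. split.
  - intros v w _ _. split; [exact I|]. apply (HP v w (HD v) (HD w)).
  - intros q v _. split; [exact I|]. apply (HR q v (HD v)). }
split; [|split; [|split]].
- intros f g a DF DG DH [Lf [_ [_ If]]] [Lg [_ [_ Ig]]] [Kf [Af Ef]] [Kg [Ag Eg]] [Kh [Ah Eh]] v.
  rewrite Ef Eg Eh. apply (linear_left A A_rl HM HC alpha f g a Kf Kg Kh Lf If Lg Ig Af Ag Ah v).
- intros f g a DF DG DH [Lf [_ [_ If]]] [Lg [_ [_ Ig]]] [Kf [Af Ef]] [Kg [Ag Eg]] [Kh [Ah Eh]] v.
  rewrite Ef Eg Eh. apply (linear_right A A_rl HM HC alpha f g a Kf Kg Kh Lf If Lg Ig Af Ag Ah v).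
- intros f g F G DF DG DFG [Lf [_ [_ If]]] [Lg [_ [_ Ig]]] [K1 [A1 E1]] [K2 [A2 E2]] [K3 [A3 E3]] [K4 [A4 E4]] [K5 [A5 E5]].
  apply (product_left A A_rl HM HC Inj alpha f g F G DF DG DFG K1 K2 K3 K4 K5 Lf If Lg Ig A1 E1 A2 E2 A3 E3 A4 E4 A5 E5).
- intros f g F G DF DG DFG [Lf [_ [_ If]]] [Lg [_ [_ Ig]]] [K1 [A1 E1]] [K2 [A2 E2]] [K3 [A3 E3]] [K4 [A4 E4]] [K5 [A5 E5]].
  apply (product_right A A_rl HM HC Inj alpha f g F G DF DG DFG K1 K2 K3 K4 K5 Lf If Lg Ig A1 E1 A2 E2 A3 E3 A4 E4 A5 E5).
Qed.
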